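(* Let $n\le 6$ and let $\mathcal{A}$, $\mathcal{A}'$ be two $2$-arrangements of $n$ planes in $\mathbb{R}^4$, with complements $X$ and $X'$, such that the pair $(\mathcal{A},\mathcal{A}')$ is not Mazurovskiĭ's pair $(\mathcal{K},\mathcal{L})$ (up to order, isotopy and mirror images). Then $H^*(X)\cong H^*(X')$ (as graded rings, integer coefficients) if and only if $X$ and $X'$ are homotopy equivalent.
   Context: A $2$-arrangement in $\mathbb{R}^4$ is a finite collection $\mathcal{A}=\{H_1,\dots,H_n\}$ of $2$-dimensional linear subspaces of $\mathbb{R}^4$ that are pairwise transverse ($H_i\cap H_j=\{0\}$ for $i\ne j$); its complement is $X=\mathbb{R}^4\setminus\bigcup_i H_i$ and its link is $L=\mathbb{S}^3\cap\bigcup_i H_i$. The linking numbers $l_{i,j}=\pm1$ of $\mathcal{A}$ are those of the (oriented) link $L$: if $H_i=\{\alpha_i=\alpha_i'=0\}$ with linear forms $\alpha_i,\alpha_i'$, then $l_{i,j}=\operatorname{sgn}\det(\alpha_i,\alpha'_i,\alpha_j,\alpha'_j)$. Two $2$-arrangements are isotopic if they are joined by a continuous path of $2$-arrangements; the mirror image of $\mathcal{A}$ is its image under an orientation-reversing linear automorphism of $\mathbb{R}^4$. For a permutation $\tau\in S_n$ (written $\tau_1\cdots\tau_n$), $\mathcal{A}(\tau)$ is the horizontal arrangement in $\mathbb{R}^4=\mathbb{C}^2$ with defining polynomial $\prod_{i=1}^n\bigl(z-\tfrac{i+\tau_i}{2}w-\tfrac{i-\tau_i}{2}\bar w\bigr)$;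 i.e., writing $z=x+\sqrt{-1}\,y$, $w=u+\sqrt{-1}\,v$, its planes are $H_i=\{x=i\,u,\ y=\tau_i v\}$. Mazurovskiĭ's pair consists of $\mathcal{K}=\mathcal{A}(341256)$ and the $2$-arrangement $\mathcal{L}$ of $6$ planes which is isotopic neither to $\mathcal{K}$ nor to its mirror image, but whose planes can be ordered and oriented so that it has the same linking numbers as $\mathcal{K}$ (such an $\mathcal{L}$ exists, and is unique up to isotopy and mirror image). *)

(* Defs.v *)
From HB Require Import structures.
From mathcomp Require Import all_boot all_order all_algebra perm.
From mathcomp Require Import generic_quotient ring_quotient.
From mathcomp Require Import all_classical all_reals topology normedtype.
From mathcomp Require Import zify ring.

Set Implicit Arguments.
Unset Strict Implicit.
Unset Printing Implicit Defensive.

Import Order.TTheory GRing.Theory Num.Theory.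
Import numFieldNormedType.Exports.
Local Open Scope classical_set_scope.
Local Open Scope ring_scope.

Section SingularSimplices.
Variable R : realType.

Definition std_simplex (n : nat) : set 'rV[R]_n.+1 :=
  [set t | (forall i, 0 <= t 0 i) /\ \sum_i t 0 i = 1].
Arguments std_simplex n : clear implicits.

(* Affine extension of the map f between the vertices. *)
Definition push_coord (p q : nat) (f : 'I_p.+1 -> 'I_q.+1) (t : 'rV[R]_p.+1) :
  'rV[R]_q.+1 := \row_j \sum_(i | f i == j) t 0 i.

Lemma push_coord_subproof (p q : nat) (f : 'I_p.+1 -> 'I_q.+1)
  (t : std_simplex p) : push_coord f (val t) \in std_simplex q.
Proof.
case: t => t /= /set_mem[t0 t1]; apply/mem_set; split.
  by move=> j; rewrite mxE sumr_ge0.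
rewrite -[RHS]t1 [RHS](partition_big f xpredT) //=.
by apply: eq_bigr => j _; rewrite mxE.
Qed.

Definition simplex_map (p q : nat) (f : 'I_p.+1 -> 'I_q.+1)
    (t : std_simplex p) : std_simplex q :=
  exist _ (push_coord f (val t)) (push_coord_subproof f t).

Lemma simplex_map_comp (p q r : nat) (f : 'I_p.+1 -> 'I_q.+1)
    (g : 'I_q.+1 -> 'I_r.+1) (t : std_simplex p) :
  simplex_map g (simplex_map f t) = simplex_map (g \o f) t.
Proof.
apply: val_inj; apply/rowP => k; rewrite !mxE /=.
rewrite [RHS](partition_big f (fun j => g j == k)) //=.
apply: eq_bigr => j /eqP gj; rewrite mxE; apply: eq_bigl => i.
by case: (f i =P j) => [->|]; rewrite ?andbF ?andbT ?gj ?eqxx.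
Qed.

Lemma push_coord_continuous (p q : nat) (f : 'I_p.+1 -> 'I_q.+1) :
  continuous (push_coord f).
Proof.
move=> t V [W nW WV].
have nf (ij : 'I_1 * 'I_q.+1) :
    nbhs t [set u | W ij.1 ij.2 (push_coord f u ij.1 ij.2)].
  case: ij => i j; move: (nW i j).
  suff /(_ (W i j)) : (fun u => push_coord f u i j) @ t --> push_coord f t i j.
    exact.
  rewrite mxE; under eq_fun do rewrite mxE.
  have FF : Filter (nbhs t) by exact: nbhs_filter.
  exact: (@cvg_big _ _ _ _ _ add_continuous _ (nbhs t) _ _ _ FF
    (fun k _ => @coord_continuous R 1 p.+1 0 k t)).
have FF : Filter (nbhs t) by exact: nbhs_filter.
refine (filterS _ (filter_forall FF nf)) => u Wu; apply: WV => i j.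
exact: (Wu (i, j)).
Qed.

Lemma simplex_map_continuous (p q : nat) (f : 'I_p.+1 -> 'I_q.+1) :
  continuous (simplex_map f).
Proof.
apply: continuous_comp_initial => t.
apply: (@continuous_comp _ _ _ (@set_val _ (std_simplex p)) (push_coord f)).
  exact: initial_continuous.
exact: push_coord_continuous.
Qed.

HB.instance Definition _ (p q : nat) (f : 'I_p.+1 -> 'I_q.+1) :=
  isContinuous.Build _ _ (simplex_map f) (@simplex_map_continuous p q f).

Definition sing (X : topologicalType) (n : nat) :=
  continuousType (std_simplex n) X.

Definition sing_map (X : topologicalType) (p q : nat)
    (f : 'I_p.+1 -> 'I_q.+1) (s : sing X q) : sing X p :=
  [the continuousType _ _ of s \o simplex_map f].

Lemma sing_map_comp (X : topologicalType) (p q r : nat)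
    (f : 'I_p.+1 -> 'I_q.+1) (g : 'I_q.+1 -> 'I_r.+1) (s : sing X r) :
  sing_map f (sing_map g s) = sing_map (g \o f) s.
Proof. by apply/continuousEP => t /=; rewrite simplex_map_comp. Qed.

Lemma eq_sing_map (X : topologicalType) (p q : nat)
    (f g : 'I_p.+1 -> 'I_q.+1) (s : sing X q) :
  f =1 g -> sing_map f s = sing_map g s.
Proof. by move=> /funext ->. Qed.

End SingularSimplices.

Section SingularCohomology.
Variables (R : realType) (X : topologicalType).

Definition cochain (n : nat) := sing R X n -> int.
HB.instance Definition _ n := GRing.Zmodule.on (cochain n).
HB.instance Definition _ n := Choice.on (cochain n).

Definition coboundary (n : nat) (c : cochain n) : cochain n.+1 :=
  fun s => \sum_(i < n.+2) (-1) ^+ i * c (sing_map (lift i) s).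

Lemma coboundaryB (n : nat) : {morph @coboundary n : a b / a - b}.
Proof.
move=> a b; apply/funext => s.
transitivity (coboundary a s - coboundary b s); last by [].
by rewrite /coboundary -sumrB; apply: eq_bigr => i _; rewrite -mulrBr.
Qed.

Definition is_cocycle (n : nat) : {pred cochain n} :=
  fun c => coboundary c == 0.

Lemma is_cocycleP (n : nat) (c : cochain n) :
  reflect (coboundary c = 0) (c \in @is_cocycle n).
Proof. exact: eqP. Qed.

Lemma is_cocycle_zmod_closed (n : nat) : zmod_closed (@is_cocycle n).
Proof.
split=> [|a b].
  by apply/is_cocycleP; rewrite -(subrr (0 : cochain n)) coboundaryB subrr.
move=> /is_cocycleP a0 /is_cocycleP b0; apply/is_cocycleP.
by rewrite coboundaryB a0 b0 subrr.
Qed.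

HB.instance Definition _ (n : nat) :=
  GRing.isZmodClosed.Build (cochain n) (@is_cocycle n)
    (is_cocycle_zmod_closed n).

Record cocycle (n : nat) :=
  Cocycle { cocycle_val : cochain n; _ : cocycle_val \in @is_cocycle n }.
HB.instance Definition _ n := [isSub for @cocycle_val n].
HB.instance Definition _ n := [Choice of cocycle n by <:].
HB.instance Definition _ n := [SubChoice_isSubZmodule of cocycle n by <:].

Definition in_coboundary (n : nat) : cochain n -> Prop :=
  if n is m.+1 then fun c => exists b : cochain m, c = coboundary b
  else fun c => c = 0.

Lemma in_coboundary0 (n : nat) : @in_coboundary n 0.
Proof.
case: n => //= n; exists 0.
by rewrite -(subrr (0 : cochain n)) coboundaryB subrr.
Qed.

Lemma in_coboundaryB (n : nat) (a b : cochain n) :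
  in_coboundary a -> in_coboundary b -> in_coboundary (a - b).
Proof.
case: n a b => /= [|n] a b; first by move=> -> ->; rewrite subrr.
by move=> [c ->] [d ->]; exists (c - d); rewrite coboundaryB.
Qed.

Lemma in_coboundaryD (n : nat) (a b : cochain n) :
  in_coboundary a -> in_coboundary b -> in_coboundary (a + b).
Proof.
move=> Ba Bb; rewrite -[b]opprK -(sub0r b).
exact: in_coboundaryB Ba (in_coboundaryB (in_coboundary0 n) Bb).
Qed.

Definition is_coboundary (n : nat) : {pred cocycle n} :=
  fun c => `[< in_coboundary (val c) >].

Lemma is_coboundaryP (n : nat) (c : cocycle n) :
  reflect (in_coboundary (val c)) (c \in @is_coboundary n).
Proof. exact: asboolP. Qed.

Lemma is_coboundary_zmod_closed (n : nat) : zmod_closed (@is_coboundary n).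
Proof.
split=> [|a b].
  by apply/is_coboundaryP; rewrite raddf0; exact: in_coboundary0.
move=> /is_coboundaryP Ba /is_coboundaryP Bb; apply/is_coboundaryP.
by rewrite raddfB; exact: in_coboundaryB.
Qed.

HB.instance Definition _ (n : nat) :=
  GRing.isZmodClosed.Build (cocycle n) (@is_coboundary n)
    (is_coboundary_zmod_closed n).

Definition cohomology (n : nat) := Quotient.quot (@is_coboundary n).
HB.instance Definition _ n := GRing.Zmodule.on (cohomology n).

(* Alexander--Whitney formula: the front p-face of s times its back q-face.
   It is used for n = p + q; keeping n free avoids casts between the types
   cochain (p + q.+1) and cochain (p + q).+1 in the Leibniz rule. *)
Definition cup_cochain (p q n : nat) (a : cochain p) (b : cochain q) :
    cochain n :=
  fun s => a (sing_map (fun i : 'I_p.+1 => inord i) s) *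
           b (sing_map (fun j : 'I_q.+1 => inord (p + j)) s).
Arguments cup_cochain {p q} n a b.

Lemma coboundary_cup (p q n : nat) (a : cochain p) (b : cochain q) s :
  n = (p + q)%N ->
  coboundary (cup_cochain n a b) s =
  cup_cochain n.+1 (coboundary a) b s +
  (-1) ^+ p * cup_cochain n.+1 a (coboundary b) s.
Proof.
move=> en.
pose sm m (g : nat -> nat) := sing_map (fun i : 'I_m.+1 => inord (g i)) s.
pose A i := a (sm p (bump i)).
pose B i := b (sm q (fun j => bump i (p + j))).
have -> : coboundary (cup_cochain n a b) s =
    \sum_(0 <= i < n.+2) (-1) ^+ i * (A i * B i).
  rewrite big_mkord /coboundary; apply: eq_bigr => i _.
  rewrite /cup_cochain !sing_map_comp; congr (_ * (a _ * b _));
  apply: eq_sing_map => j /=; apply: val_inj => /=; rewrite !inordK //;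
  rewrite /bump; have := ltn_ord i; have := ltn_ord j; lia.
have -> : cup_cochain n.+1 (coboundary a) b s =
    \sum_(0 <= i < p.+2) (-1) ^+ i * (A i * B 0%N).
  rewrite big_mkord /cup_cochain /coboundary big_distrl /=.
  apply: eq_bigr => i _; rewrite -mulrA sing_map_comp; congr (_ * (a _ * b _));
  apply: eq_sing_map => j /=; apply: val_inj => /=; rewrite !inordK //;
  rewrite /= /bump; have := ltn_ord i; have := ltn_ord j; lia.
have -> : cup_cochain n.+1 a (coboundary b) s =
    \sum_(0 <= i < q.+2) (-1) ^+ i * (A p.+1 * B (p + i)%N).
  rewrite big_mkord /cup_cochain /coboundary big_distrr /=.
  apply: eq_bigr => i _; rewrite mulrCA sing_map_comp; congr (_ * (a _ * b _));
  apply: eq_sing_map => j /=; apply: val_inj => /=; rewrite !inordK //;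
  rewrite /= /bump; have := ltn_ord i; have := ltn_ord j; lia.
have A' i : (p < i)%N -> A i = A p.+1.
  move=> pi; congr a; apply: eq_sing_map => j; congr inord.
  by rewrite /bump; have := ltn_ord j; lia.
have B' i : (i <= p)%N -> B i = B 0%N.
  move=> ip; congr b; apply: eq_sing_map => j; congr inord.
  by rewrite /bump; lia.
have ltpn : (p.+1 <= n.+2)%N by lia.
rewrite (big_cat_nat (leq0n _) ltpn) /=.
rewrite [X in _ = X + _]big_nat_recr //= -addrA; congr (_ + _).
  by apply: eq_big_nat => i /andP[_ ip]; rewrite (B' i).
have -> : \sum_(p.+1 <= i < n.+2) (-1) ^+ i * (A i * B i) =
    \sum_(0 <= i < q.+1) (-1) ^+ (i + p.+1) * (A (i + p.+1)%N * B (i + p.+1)%N).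
  rewrite -[in LHS](add0n p.+1) big_addn (_ : n.+2 - p.+1 = q.+1)%N //; lia.
rewrite [in RHS]big_nat_recl //= addn0 (B' p) // mulrDr exprS !mulN1r.
rewrite expr0 mul1r mulNr addrA addNr add0r big_distrr /=.
apply: eq_big_nat => i _; rewrite A' ?leq_addl // mulrA -exprD.
have -> : (i + p.+1 = p + i.+1)%N by lia.
by [].
Qed.

Lemma cup_is_cocycle (p q : nat) (a : cocycle p) (b : cocycle q) :
  cup_cochain (p + q) (val a) (val b) \in @is_cocycle (p + q).
Proof.
have /is_cocycleP a0 := valP a; have /is_cocycleP b0 := valP b.
apply/is_cocycleP/funext => s /=.
by rewrite coboundary_cup // /cup_cochain a0 b0 mul0r !mulr0 addr0.
Qed.

Definition cup_cocycle (p q : nat) (a : cocycle p) (b : cocycle q) :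
  cocycle (p + q) := Cocycle (cup_is_cocycle a b).

Definition cup (p q : nat) (x : cohomology p) (y : cohomology q) :
    cohomology (p + q) :=
  \pi_(cohomology (p + q))%qT (cup_cocycle (repr x) (repr y)).

Lemma cup_coboundaryl (p q : nat) (a : cochain p) (b : cochain q) :
  in_coboundary a -> coboundary b = 0 ->
  in_coboundary (cup_cochain (p + q) a b).
Proof.
case: p a => [|p] a /=.
  move=> -> _; rewrite (_ : cup_cochain _ _ _ = 0); last first.
    by apply/funext => s; exact: mul0r.
  exact: in_coboundary0.
move=> [c ->] b0; exists (cup_cochain (p + q) c b); apply/funext => s.
rewrite coboundary_cup // /cup_cochain b0.
by rewrite [X in _ * (_ * X)](_ : _ = 0) // !mulr0 addr0.
Qed.

Lemma cup_coboundaryr (p q : nat) (a : cochain p) (b : cochain q) :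
  coboundary a = 0 -> in_coboundary b ->
  in_coboundary (cup_cochain (p + q) a b).
Proof.
case: q b => [|q] b /= a0.
  move=> ->; rewrite (_ : cup_cochain _ _ _ = 0); last first.
    by apply/funext => s; exact: mulr0.
  exact: in_coboundary0.
move=> [c ->]; rewrite addnS.
exists (fun s => (-1) ^+ p * cup_cochain (p + q) a c s).
apply/funext => s.
transitivity ((-1) ^+ p * coboundary (cup_cochain (p + q) a c) s); last first.
  rewrite /coboundary big_distrr; apply: eq_bigr => i _ /=.
  by rewrite mulrCA.
rewrite coboundary_cup // mulrDr mulrA -exprD addnn -mul2n exprM sqrrN !expr1n.
rewrite mul1r [X in _ * X + _](_ : _ = 0) ?mulr0 ?add0r //.
by rewrite /cup_cochain a0 mul0r.
Qed.

Lemma pi_cohomologyP (n : nat) (a b : cocycle n) :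
  \pi_(cohomology n)%qT a = \pi_(cohomology n)%qT b <->
  in_coboundary (val a - val b).
Proof.
split=> [/eqP|ab]; last apply/eqP; rewrite -Quotient.idealrBE.
  by move/is_coboundaryP; rewrite raddfB.
by apply/is_coboundaryP; rewrite raddfB.
Qed.

Lemma cup_pi (p q : nat) (a : cocycle p) (b : cocycle q) :
  cup (\pi_(cohomology p)%qT a) (\pi_(cohomology q)%qT b) =
  \pi_(cohomology (p + q))%qT (cup_cocycle a b).
Proof.
have ra : in_coboundary (val (repr (\pi_(cohomology p)%qT a)) - val a).
  by apply/pi_cohomologyP; rewrite reprK.
have rb : in_coboundary (val (repr (\pi_(cohomology q)%qT b)) - val b).
  by apply/pi_cohomologyP; rewrite reprK.
rewrite /cup; move: (repr _) (repr _) ra rb => b' a' ra rb.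
apply/pi_cohomologyP => /=.
have /is_cocycleP a0 := valP a; have /is_cocycleP b0 := valP b'.
rewrite (_ : _ - _ = cup_cochain (p + q) (val a' - val a) (val b') +
                     cup_cochain (p + q) (val a) (val b' - val b)).
  by apply: in_coboundaryD; [exact: cup_coboundaryl|exact: cup_coboundaryr].
apply/funext => s; rewrite /cup_cochain.
transitivity (val a' (sing_map (fun i => inord i) s) *
    val b' (sing_map (fun j : 'I_q.+1 => inord (p + j)) s) -
    val a (sing_map (fun i => inord i) s) *
    val b (sing_map (fun j : 'I_q.+1 => inord (p + j)) s)) => //.
transitivity ((val a' (sing_map (fun i => inord i) s) -
    val a (sing_map (fun i => inord i) s)) *
    val b' (sing_map (fun j : 'I_q.+1 => inord (p + j)) s) +
    val a (sing_map (fun i => inord i) s) *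
    (val b' (sing_map (fun j : 'I_q.+1 => inord (p + j)) s) -
    val b (sing_map (fun j : 'I_q.+1 => inord (p + j)) s))) => //.
by rewrite mulrBl mulrBr addrA subrK.
Qed.

Lemma one_is_cocycle : (fun=> 1) \in @is_cocycle 0.
Proof.
apply/is_cocycleP/funext => s; rewrite /coboundary !big_ord_recl big_ord0 /=.
by rewrite expr0 expr1 !mulr1 addr0 subrr.
Qed.

Definition cohomology_one : cohomology 0 :=
  \pi_(cohomology 0)%qT (Cocycle one_is_cocycle).

End SingularCohomology.

Definition graded_ring_iso (R : realType) (X Y : topologicalType) : Prop :=
  exists phi : forall n, {additive cohomology R X n -> cohomology R Y n},
    [/\ forall n, bijective (phi n),
        phi 0%N (cohomology_one R X) = cohomology_one R Y
      & forall p q (x : cohomology R X p) (y : cohomology R X q),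
          phi (p + q)%N (cup x y) = cup (phi p x) (phi q y)].

Section HomotopyEquivalence.
Variable R : realType.

Definition homotopic (X Y : topologicalType) (f g : X -> Y) : Prop :=
  exists F : X * R -> Y,
    [/\ {within [set: X] `*` `[0, 1], continuous F},
        forall x, F (x, 0) = f x & forall x, F (x, 1) = g x].

Definition homotopy_equivalent (X Y : topologicalType) : Prop :=
  exists (f : X -> Y) (g : Y -> X),
    [/\ continuous f, continuous g,
        homotopic (g \o f) idfun & homotopic (f \o g) idfun].

End HomotopyEquivalence.

Section TwoArrangements.
Variable R : realType.

Definition subsp := {vspace 'rV[R]_4}.

Definition two_arrangement (n : nat) (H : 'I_n -> subsp) : Prop :=
  (forall i, \dim (H i) = 2) /\
  (forall i j, i != j -> (H i :&: H j = 0)%VS).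

Definition complement (n : nat) (H : 'I_n -> subsp) : topologicalType :=
  set_type [set x : 'rV[R]_4 | forall i, x \notin H i].

(* The common zero set of two linear forms, given as the rows of a. *)
Definition zero_locus (a : 'M[R]_(2, 4)) : subsp :=
  lker (linfun (mulmxr a^T : 'rV[R]_4 -> 'rV[R]_2)).

Definition row_span (a : 'M[R]_(2, 4)) : subsp :=
  limg (linfun (mulmxr a : 'rV[R]_2 -> 'rV[R]_4)).

Lemma mem_zero_locus (a : 'M[R]_(2, 4)) (x : 'rV[R]_4) :
  (x \in zero_locus a) = (x *m a^T == 0).
Proof. by rewrite memv_ker lfunE. Qed.

Lemma mem_row_span (a : 'M[R]_(2, 4)) (x : 'rV[R]_4) :
  reflect (exists u : 'rV[R]_2, x = u *m a) (x \in row_span a).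
Proof.
apply: (iffP memv_imgP) => [[u _ ->]|[u ->]]; exists u; rewrite ?lfunE //.
exact: memvf.
Qed.

(* The open sets of the Grassmannian of planes in R^4, that is the quotient
   topology of the (open) set of 2 x 4 matrices of rank 2. *)
Definition grassmannian_open (U : set subsp) : Prop :=
  open [set a : 'M[R]_(2, 4) | row_free a /\ U (row_span a)].

Definition plane_path (P : R -> subsp) : Prop :=
  forall U, grassmannian_open U ->
    open (P @^-1` U : set (subspace `[0 : R, 1]%classic)).

(* Arrangements are collections, so the endpoints are compared up to a
   bijection of the indices; this also allows m and n to be distinct
   variables. *)
Definition isotopic (m n : nat) (H : 'I_m -> subsp) (H' : 'I_n -> subsp) :
    Prop :=
  exists (sigma : 'I_m -> 'I_n) (P : R -> 'I_m -> subsp),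
    [/\ bijective sigma,
        forall i, plane_path (P^~ i),
        forall t, 0 <= t <= 1 -> two_arrangement (P t),
        P 0 =1 H & P 1 =1 H' \o sigma].

Definition image_arrangement (n : nat) (g : 'M[R]_4) (H : 'I_n -> subsp) :
    'I_n -> subsp :=
  fun i => (linfun (mulmxr g : 'rV[R]_4 -> 'rV[R]_4) @: H i)%VS.

Definition isotopic_to_mirror (m n : nat) (H : 'I_m -> subsp)
    (H' : 'I_n -> subsp) : Prop :=
  exists g : 'M[R]_4, \det g < 0 /\ isotopic H (image_arrangement g H').

(* The order of the two forms defining each plane is a choice of
   (co)orientation. *)
Definition linking_number (n : nat) (a : 'I_n -> 'M[R]_(2, 4)) (i j : 'I_n) :
    R := Num.sg (\det (col_mx (a i) (a j) : 'M[R]_4)).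

Definition same_linking_numbers (n : nat) (H H' : 'I_n -> subsp) : Prop :=
  exists (sigma : 'S_n) (a a' : 'I_n -> 'M[R]_(2, 4)),
    [/\ forall i, H i = zero_locus (a i),
        forall i, H' i = zero_locus (a' i)
      & forall i j, i != j ->
          linking_number a (sigma i) (sigma j) = linking_number a' i j].

(* Coordinates (x, y, u, v); the plane i is x = i u, y = tau_i v, where both
   i and tau_i are counted from 1 in the mathematical notation. *)
Definition horizontal_forms (n : nat) (tau : 'S_n) (i : 'I_n) :
    'M[R]_(2, 4) :=
  \matrix_(r, k) (if r == 0 then [:: 1; 0; - i.+1%:R; 0]`_k
                  else [:: 0; 1; 0; - (tau i).+1%:R]`_k).

Definition horizontal_arrangement (n : nat) (tau : 'S_n) : 'I_n -> subsp :=
  fun i => zero_locus (horizontal_forms tau i).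

Lemma mem_horizontal_arrangement (n : nat) (tau : 'S_n) (i : 'I_n)
    (x y u v : R) :
  (\row_k [:: x; y; u; v]`_k \in horizontal_arrangement tau i) =
  (x == i.+1%:R * u) && (y == (tau i).+1%:R * v).
Proof.
rewrite mem_zero_locus; apply/eqP/andP => [/rowP xyuv|[/eqP -> /eqP ->]].
  have := xyuv 0; have := xyuv 1; rewrite !mxE.
  rewrite !big_ord_recl !big_ord0 !mxE /= => h1 h0.
  by split; rewrite -subr_eq0; [rewrite -[0]h0|rewrite -[0]h1]; apply/eqP; ring.
apply/rowP => r; rewrite !mxE !big_ord_recl !big_ord0 !mxE /=.
by case: ifP => _; ring.
Qed.

Lemma two_arrangement_horizontal (n : nat) (tau : 'S_n) :
  two_arrangement (horizontal_arrangement tau).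
Proof.
have coord (x : 'rV[R]_4) : exists a b c d, x = \row_k [:: a; b; c; d]`_k.
  exists (x 0 0), (x 0 1), (x 0 2), (x 0 3); apply/rowP => -[[|[|[|[|//]]]] ?];
  by rewrite !mxE /=; congr (x _ _); apply: val_inj.
split=> [i|i j ij].
  pose h := linfun (mulmxr (horizontal_forms tau i)^T : 'rV[R]_4 -> 'rV[R]_2).
  have : limg h = fullv.
    apply/eqP; rewrite eqEsubv subvf; apply/subvP => y _; apply/memv_imgP.
    exists (\row_k [:: y 0 0; y 0 1; 0; 0]`_k); first exact: memvf.
    rewrite lfunE /=; apply/rowP => r.
    rewrite !mxE !big_ord_recl !big_ord0 !mxE /=.
    case: r => [[|[|//]] ?] /=; rewrite ?eqxx /=.
      by rewrite (_ : Ordinal _ = 0); [ring|exact: val_inj].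
    by rewrite (_ : Ordinal _ = 1); [ring|exact: val_inj].
  move=> lh; have := limg_ker_dim h fullv.
  rewrite lh capfv !dimvf /dim /= /horizontal_arrangement /zero_locus -/h.
  by move: (\dim _) => d; lia.
apply/eqP; rewrite -subv0; apply/subvP => x; rewrite memv_cap memv0.
have [a [b [c [d ->]]]] := coord x.
rewrite !mem_horizontal_arrangement.
move=> /andP[/andP[/eqP a1 /eqP b1] /andP[/eqP a2 /eqP b2]].
have c0 : c = 0.
  apply/eqP; move: a2; rewrite a1 => /eqP; rewrite -subr_eq0 -mulrBl mulf_eq0.
  by rewrite subr_eq0 eqr_nat eqSS (inj_eq val_inj) (negbTE ij).
have d0 : d = 0.
  apply/eqP; move: b2; rewrite b1 => /eqP; rewrite -subr_eq0 -mulrBl mulf_eq0.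
  rewrite subr_eq0 eqr_nat eqSS (inj_eq val_inj) (inj_eq perm_inj).
  by rewrite (negbTE ij).
rewrite a1 b1 c0 d0 !mulr0; apply/eqP/rowP => -[[|[|[|[|//]]]] ?];
by rewrite !mxE.
Qed.

(* 341256 in one-line notation, that is the product of the transpositions
   (1 3) and (2 4); the indices below are counted from 0. *)
Definition perm_K : 'S_6 :=
  (tperm (inord 0) (inord 2) * tperm (inord 1) (inord 3))%g.

Lemma perm_KE (i : 'I_6) : (perm_K i).+1 = nth 0 [:: 3; 4; 1; 2; 5; 6]%N i.
Proof.
rewrite permM !permE /=.
by case: i => [[|[|[|[|[|[|//]]]]]] ?];
  rewrite /= -?val_eqE /= ?inordK //= -?val_eqE /= ?inordK.
Qed.

Definition mazurovskii_K : 'I_6 -> subsp := horizontal_arrangement perm_K.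

(* The defining property of L, which determines it up to isotopy and mirror
   image. *)
Definition is_mazurovskii_L (L : 'I_6 -> subsp) : Prop :=
  [/\ two_arrangement L,
      ~ isotopic L mazurovskii_K,
      ~ isotopic_to_mirror L mazurovskii_K
    & same_linking_numbers L mazurovskii_K].

Definition equivalent_to_K (n : nat) (H : 'I_n -> subsp) : Prop :=
  isotopic H mazurovskii_K \/ isotopic_to_mirror H mazurovskii_K.

Definition equivalent_to_L (n : nat) (H : 'I_n -> subsp) : Prop :=
  exists2 L, is_mazurovskii_L L & isotopic H L \/ isotopic_to_mirror H L.

Definition mazurovskii_pair (m n : nat) (H : 'I_m -> subsp)
    (H' : 'I_n -> subsp) : Prop :=
  (equivalent_to_K H /\ equivalent_to_L H') \/
  (equivalent_to_L H /\ equivalent_to_K H').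

End TwoArrangements.

(* Main.v *)
(* For the nontrivial implication, write the planes as zero sets of pairs of linear forms. H^1 of the
   complement is free on the classes e_i of the arguments of these forms, as one sees on meridian loops. When the
   third form is a combination of the other two, the arguments satisfy a Steinberg relation; with the values
   of products on tori around the planes it determines which products of degree one classes are divisible by 3
   from the linking numbers. The number of triples (x, y, z) in H^1 / 3 with both xy and xz divisible by 3
   is thus an invariant of the ring, and it separates the equivalence classes of linking numbers for n <= 6.
   Two arrangements of one class are joined by an isotopy, up to order and mirror images, except for the class
   of K, which splits into K and L. Sending one plane to infinity makes the others points of M_2(R) whose
   differences have determinants of given signs; the matrix of these determinants is a Gram matrix for a
   form of signature (2, 2), and the spaces of such matrices are shown to be connected. *)
From HB Require Import structures.
Require Import Defs.
From mathcomp Require Import all_boot all_order all_algebra perm.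
From mathcomp Require Import generic_quotient ring_quotient.
From mathcomp Require Import all_classical all_reals topology normedtype.
From mathcomp Require Import realfun exp trigo.
From mathcomp Require Import zify ring lra.
From mathcomp Require Import derive.
From Stdlib Require NArith.
Set Implicit Arguments.
Unset Strict Implicit.
Unset Printing Implicit Defensive.
Import Order.TTheory GRing.Theory Num.Theory.
Import numFieldNormedType.Exports.
Local Open Scope classical_set_scope.
Local Open Scope ring_scope.

(** H^2 is never computed. The invariant only asks when a product is divisible by 3, and this is
    caught from two sides: tori give necessary conditions and the Steinberg relations show that they
    suffice. The prime has to be odd, since anticommutativity leaves squares as possible 2-torsion.
    Maps to the circle are real functions that are continuous modulo integers, so no covering space
    is needed. The harder half is connectedness. Six planes are six isotropic vectors for the wedge
    pairing on bivectors, of signature (3, 3); their fifteen determinants fill a symmetric matrix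
    with zero diagonal, whose determinant [fpol] is to stay negative. With fixed signs [fpol] is
    concave in suitable entries, so an entry can be pushed far out as soon as its derivative under
    scaling is nonpositive. Euler's identity at a vertex, or a limit on the boundary, shows that
    some entry can be pushed. In the class of K alone this may fail, and the points where it fails
    are joined to each other by lowering entries instead. The Gram matrix forgets an orientation of
    the points; an odd symmetry of the signs, an explicit path or a mirror image recovers it. *)

Lemma cts_pair (T U V : topologicalType) (f : T -> U) (g : T -> V) :
 continuous f -> continuous g -> continuous (fun x => (f x, g x)).
by move=> cf cg x; apply: cvg_pair; [exact: cf|exact: cg]. Qed.

Lemma cts_within (T U V : topologicalType) (A : set U)
  (F : U -> V) (k : T -> U) :
 {within A, continuous F} -> continuous k -> (forall t, A (k t)) ->
 continuous (F \o k).
move=> /subspace_continuousP cF ck kA t V' /(cF _ (kA t)).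
rewrite /within /= => FV.
have h : nbhs t (fun t' => A (k t') -> V' (F (k t'))) := ck t _ FV.
by apply: filterS h => t'; apply; exact: kA.
Qed.

(** * Functoriality of singular cohomology *)

Section Pullback.
Variables (R : realType) (X Y : topologicalType) (f : X -> Y).
Hypothesis cf : continuous f.

Lemma push_sing_cts n (s : sing R X n) : continuous (f \o s).
by move=> t; apply: continuous_comp; [exact: cts_fun|exact: cf]. Qed.

Definition push_sing n (s : sing R X n) : sing R Y n :=
 HB.pack_for (sing R Y n) (f \o s)
  (isContinuous.Build _ _ (f \o s) (@push_sing_cts n s)).

Lemma push_sing_map p q (h : 'I_p.+1 -> 'I_q.+1) (s : sing R X q) :
 push_sing (sing_map h s) = sing_map h (push_sing s).
exact/continuousEP. Qed.

Definition pull_cochain n (c : cochain R Y n) : cochain R X n :=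
 fun s => c (push_sing s).

Lemma coboundary_pull n (c : cochain R Y n) :
 coboundary (pull_cochain c) = pull_cochain (coboundary c).
apply/funext => s; apply: eq_bigr => i _.
by rewrite /pull_cochain push_sing_map.
Qed.

Lemma pull_is_cocycle n (c : cocycle R Y n) :
 pull_cochain (val c) \in @is_cocycle R X n.
have /is_cocycleP c0 := valP c.
by apply/is_cocycleP; rewrite coboundary_pull c0; apply/funext.
Qed.

Definition pull_cocycle n (c : cocycle R Y n) : cocycle R X n :=
 Cocycle (pull_is_cocycle c).

Lemma pull_in_coboundary n (c : cochain R Y n) :
 in_coboundary c -> in_coboundary (pull_cochain c).
case: n c => [|n] c /=; first by move=> ->; apply/funext.
by move=> [b ->]; exists (pull_cochain b); rewrite coboundary_pull.
Qed.

Definition pull n (x : cohomology R Y n) : cohomology R X n :=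
 \pi_(cohomology R X n)%qT (pull_cocycle (repr x)).

Lemma pull_pi n (c : cocycle R Y n) :
 pull (\pi_(cohomology R Y n)%qT c) =
 \pi_(cohomology R X n)%qT (pull_cocycle c).
apply/pi_cohomologyP; apply: (@pull_in_coboundary n (val _ - val c)).
by apply/pi_cohomologyP; rewrite reprK.
Qed.

Lemma pull_zmod n : zmod_morphism (@pull n).
move=> x y; elim/quotW: x => a; elim/quotW: y => b.
have piB Z k (u v : cocycle R Z k) :
  \pi_(cohomology R Z k)%qT u - \pi_(cohomology R Z k)%qT v =
  \pi_(cohomology R Z k)%qT (u - v) by rewrite !piE.
rewrite piB !pull_pi piB; apply/pi_cohomologyP.
rewrite (_ : _ - _ = 0); first exact: in_coboundary0.
by apply/funext => s; exact: subrr.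
Qed.

HB.instance Definition _ n :=
 GRing.isZmodMorphism.Build (cohomology R Y n) (cohomology R X n) (@pull n)
  (@pull_zmod n).

Lemma pull_cup p q (x : cohomology R Y p) (y : cohomology R Y q) :
 pull (cup x y) = cup (pull x) (pull y).
elim/quotW: x => a; elim/quotW: y => b; rewrite cup_pi (pull_pi a) (pull_pi b) cup_pi.
etransitivity; first exact: (pull_pi (cup_cocycle a b)).
congr (\pi_(_)%qT _); apply: val_inj; apply/funext => s /=.
by rewrite /pull_cochain /cup_cochain /= !push_sing_map.
Qed.

Lemma pull_one : pull (cohomology_one R Y) = cohomology_one R X.
etransitivity; first exact: pull_pi.
by congr (\pi_(_)%qT _); apply: val_inj. Qed.

End Pullback.

(** * Homotopy invariance by the prism operator *)

Section Prism.
Variables (R : realType) (X Y : topologicalType) (F : X * R -> Y).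
Hypothesis cF : {within [set: X] `*` `[0, 1], continuous F}.

(** [e] marks the vertices that lie on the top of the prism; the weight is then the height, an
    affine function of barycentric coordinates. *)
Definition weight (m : nat) (e : 'I_m.+1 -> bool) (t : @std_simplex R m) : R :=
 \sum_(i | e i) val t 0 i.

Lemma weight_itv m (e : 'I_m.+1 -> bool) t : 0 <= weight e t <= 1.
have /set_mem[t0 t1] := valP t; rewrite sumr_ge0 //= -t1 /weight.
by rewrite [leRHS](bigID e) /= lerDl sumr_ge0.
Qed.

Lemma weight_cts m (e : 'I_m.+1 -> bool) : continuous (@weight m e).
move=> t.
have FF : Filter (nbhs t) by exact: nbhs_filter.
apply: (@cvg_big _ _ _ _ _ add_continuous _ (nbhs t) _ _ _ FF) => k _.
apply: (@continuous_comp _ _ _ (@set_val _ (@std_simplex R m))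
 (fun u : 'rV[R]_m.+1 => u 0 k)); first exact: initial_continuous.
exact: coord_continuous.
Qed.

Definition prism_fun n m (s : sing R X n) (u : 'I_m.+1 -> 'I_n.+1)
  (e : 'I_m.+1 -> bool) (t : @std_simplex R m) : Y :=
 F (s (simplex_map u t), weight e t).

Lemma prism_fun_cts n m (s : sing R X n) (u : 'I_m.+1 -> 'I_n.+1)
 (e : 'I_m.+1 -> bool) : continuous (prism_fun s u e).
apply: (cts_within (k := fun t => (s (simplex_map u t), weight e t)) cF).
 apply: cts_pair; last exact: weight_cts. move=> t; apply: (@continuous_comp _ _ _ (simplex_map u) s).
  exact: simplex_map_continuous.
 exact: cts_fun.
by move=> t; split=> //=; rewrite in_itv /= weight_itv.
Qed.

Definition prism n m (s : sing R X n) (u : 'I_m.+1 -> 'I_n.+1)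
  (e : 'I_m.+1 -> bool) : sing R Y m :=
 HB.pack_for (sing R Y m) (prism_fun s u e)
  (isContinuous.Build _ _ (prism_fun s u e) (@prism_fun_cts n m s u e)).

Lemma weight_comp m k (e : 'I_m.+1 -> bool) (h : 'I_k.+1 -> 'I_m.+1) t :
 weight e (simplex_map h t) = weight (e \o h) t.
rewrite /weight [RHS](partition_big h e) //=; apply: eq_bigr => j ej.
rewrite !mxE; apply: eq_bigl => i /=.
by case: eqP => [->|]; rewrite ?ej ?andbF.
Qed.

Lemma sing_map_prism n m k (s : sing R X n) (u : 'I_m.+1 -> 'I_n.+1)
  (e : 'I_m.+1 -> bool) (h : 'I_k.+1 -> 'I_m.+1) :
 sing_map h (prism s u e) = prism s (u \o h) (e \o h).
apply/continuousEP => t /=.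
by rewrite /prism_fun weight_comp simplex_map_comp.
Qed.

Lemma prism_sing_map n p m (s : sing R X n) (d : 'I_p.+1 -> 'I_n.+1)
  (u : 'I_m.+1 -> 'I_p.+1) (e : 'I_m.+1 -> bool) :
 prism (sing_map d s) u e = prism s (d \o u) e.
by apply/continuousEP => t /=; rewrite /prism_fun /= simplex_map_comp.
Qed.

Lemma eq_prism n m (s : sing R X n) (u u' : 'I_m.+1 -> 'I_n.+1)
 (e e' : 'I_m.+1 -> bool) : u =1 u' -> e =1 e' -> prism s u e = prism s u' e'.
by move=> /funext -> /funext ->. Qed.

(* The nat-indexed version of [prism]: the degeneracies and faces of the prism
  decomposition are then given by [unbump] and [bump] on nat. *)
Definition nprism n m (s : sing R X n) (u : nat -> nat) (e : nat -> bool) :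
 sing R Y m := prism s (fun i : 'I_m.+1 => inord (u i)) (fun i => e i).

Definition prism_op n (c : cochain R Y n.+1) : cochain R X n := fun s =>
 \sum_(0 <= i < n.+1) (-1) ^+ i * c (nprism n.+1 s (unbump i) (fun j => i < j)%N).

Lemma prism_op_coboundary n (c : cochain R Y n) (s : sing R X n) :
 (if n is n'.+1 return cochain R Y n -> sing R X n -> int
  then fun c s => coboundary (@prism_op n' c) s else fun _ _ => 0) c s +
 prism_op (coboundary c) s =
 c (prism s id xpredT) - c (prism s id xpred0).
(* [A i k] is the value on the k-th face of the i-th simplex of the prism. Consecutive simplices
   share a face, [A i i.+1] being [A i.+1 i.+1], so the diagonal terms telescope to the two ends;
   the faces with k < i or i.+1 < k cancel against the coboundary of [prism_op], which exists only
   in positive degree. *)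
pose A i k := c (nprism n s (unbump i \o bump k) (fun j => i < bump k j)%N).
have -> : prism_op (coboundary c) s =
  \sum_(0 <= i < n.+1) \sum_(0 <= k < n.+2) (-1) ^+ (i + k) * A i k.
 apply: eq_big_nat => i /andP[_ ni]; rewrite big_mkord /coboundary big_distrr /=.
 apply: eq_bigr => k _; rewrite mulrA -exprD; congr (_ * c _).
 rewrite /nprism sing_map_prism; apply: eq_prism => j //=.
have Ad i : A i i = c (nprism n s id (fun j => i <= j)%N).
 congr c; apply: eq_prism => j /=.
  by congr inord; rewrite /unbump /bump; lia.
 by rewrite /bump; lia.
have AdS i : A i i.+1 = c (nprism n s id (fun j => i < j)%N).
 congr c; apply: eq_prism => j /=.
  by congr inord; rewrite /unbump /bump; lia.
 by rewrite /bump; lia.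
have AT : c (nprism n s id (fun j => 0 <= j)%N) = c (prism s id xpredT).
 by congr c; apply: eq_prism => j //=; rewrite inord_val.
have AF : c (nprism n s id (fun j => n < j)%N) = c (prism s id xpred0).
 by congr c; apply: eq_prism => j /=; rewrite ?inord_val // ltnNge -ltnS ltn_ord.
have tele : \sum_(0 <= i < n.+1) (A i i - A i i.+1) =
  c (prism s id xpredT) - c (prism s id xpred0).
 rewrite -AT -AF. pose B i := c (nprism n s id (fun j => i <= j)%N).
 transitivity (\sum_(0 <= i < n.+1) (B i - B i.+1)).
  by apply: eq_bigr => i _; rewrite Ad AdS.
 have -> : \sum_(0 <= i < n.+1) (B i - B i.+1) =
   - \sum_(0 <= i < n.+1) (B i.+1 - B i).
  by rewrite -sumrN; apply: eq_bigr => i _; rewrite opprB.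
 by rewrite telescope_sumr // opprB.
have split_row i : (i < n.+1)%N ->
  \sum_(0 <= k < n.+2) (-1) ^+ (i + k) * A i k =
  (\sum_(0 <= k < i) (-1) ^+ (i + k) * A i k +
   \sum_(i.+2 <= k < n.+2) (-1) ^+ (i + k) * A i k) + (A i i - A i i.+1).
 move=> ni; rewrite (@big_cat_nat _ _ _ i) //=; last by lia. rewrite [X in _ + X = _]big_ltn; last by lia.
 rewrite [X in _ + (_ + X) = _]big_ltn; last by lia.
 have -> : (-1 : int) ^+ (i + i) = 1 by rewrite addnn -mul2n exprM sqrrN !expr1n.
 have -> : (-1 : int) ^+ (i + i.+1) = -1.
  by rewrite addnS addnn -mul2n exprS exprM sqrrN !expr1n mulr1.
 by rewrite mul1r mulN1r addrA addrAC -!addrA; congr (_ + _); ring.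
rewrite (eq_big_nat _ _ (F2 := fun i => (\sum_(0 <= k < i) (-1) ^+ (i + k) * A i k +
   \sum_(i.+2 <= k < n.+2) (-1) ^+ (i + k) * A i k) + (A i i - A i i.+1)));
 last by move=> i /andP[_]; exact: split_row.
rewrite big_split /= tele addrA.
transitivity (0 + (c (prism s id xpredT) - c (prism s id xpred0)));
 last by rewrite add0r.
congr (_ + _).
case: n c s @A {Ad AdS AT AF tele split_row} => [|n] c s A.
 by rewrite big_nat1 !big_geq // !addr0.
pose B i k := c (nprism n.+1 s (bump k \o unbump i) (fun j => i < j)%N).
have -> : coboundary (prism_op c) s =
  \sum_(0 <= k < n.+2) \sum_(0 <= i < n.+1) (-1) ^+ (k + i) * B i k.
 rewrite big_mkord; apply: eq_bigr => k _; rewrite /prism_op big_distrr /=.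
 apply: eq_big_nat => i /andP[_ ni]; rewrite mulrA -exprD; congr (_ * c _).
 rewrite /nprism prism_sing_map; apply: eq_prism => j //=. apply: val_inj; rewrite /= !inordK //.
  by rewrite /bump /unbump; have := ltn_ord j; have := ltn_ord k; lia.
 by rewrite /unbump; have := ltn_ord j; lia.
have Alow i k : (k <= i)%N -> A i.+1 k = B i k.
 move=> ki; congr c; apply: eq_prism => j /=.
  by congr inord; rewrite /unbump /bump; lia.
 by rewrite /bump; lia.
have Ahigh i k : (i < k)%N -> A i k.+1 = B i k.
 move=> ki; congr c; apply: eq_prism => j /=.
  by congr inord; rewrite /unbump /bump; lia.
 by rewrite /bump; lia.
rewrite exchange_big /= big_split /= [X in _ + (X + _)]big_nat_recl //= [X in _ + (X + _ + _)]big_geq // add0r.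
rewrite [X in _ + (_ + X)]big_nat_recr //= [X in _ + (_ + (_ + X))]big_geq // addr0.
rewrite -!big_split /= big1_seq // => i /andP[_]; rewrite mem_index_iota => /andP[_ ni].
rewrite (@big_cat_nat _ _ _ i.+1) //=; last by lia.
rewrite addrACA -big_split /= big1_seq ?add0r; last first.
 move=> k /andP[_]; rewrite mem_index_iota => /andP[_ ki]. by rewrite Alow // addSn exprS mulN1r mulNr addnC subrr.
rewrite [X in _ + X]big_add1 /= -big_split /= big1_seq //.
move=> k /andP[_]; rewrite mem_index_iota => /andP[ik _].
by rewrite Ahigh // addnS exprS mulN1r mulNr addnC subrr.
Qed.

End Prism.

Lemma homotopic_pull (R : realType) (X Y : topologicalType) (f g : X -> Y)
  (cf : continuous f) (cg : continuous g) n (x : cohomology R Y n) :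
 homotopic R f g -> pull cf x = pull cg x.
move=> [F [cF F0 F1]]; elim/quotW: x => a; rewrite !pull_pi.
have sumT (t : @std_simplex R n) : weight xpredT t = 1.
 by have /set_mem[_ t1] := valP t.
have simplex_map_id (t : @std_simplex R n) : simplex_map id t = t.
 apply: val_inj; apply/rowP => j; rewrite !mxE. by rewrite (big_pred1 j) // => i; rewrite eq_sym.
have pT (s : sing R X n) : prism cF s id xpredT = push_sing cg s.
 by apply/continuousEP => t /=; rewrite /prism_fun (sumT t) F1 simplex_map_id.
have p0 (s : sing R X n) : prism cF s id xpred0 = push_sing cf s.
 apply/continuousEP => t /=; rewrite /prism_fun simplex_map_id. by rewrite /weight big_pred0_eq F0.
apply/esym/pi_cohomologyP.
have /is_cocycleP a0 := valP a.
have key (s : sing R X n) : val (pull_cocycle cg a) s - val (pull_cocycle cf a) s =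
  (if n is n'.+1 return cochain R Y n -> sing R X n -> int
  then fun c s => coboundary (@prism_op R X Y F cF n' c) s else fun _ _ => 0)
   (val a) s.
 have := prism_op_coboundary cF (val a) s; rewrite a0 pT p0 => <-.
 by rewrite [X in _ + X]big1 ?addr0 // => i _; rewrite mulr0.
case: n a a0 key {sumT simplex_map_id pT p0} => [|n] a a0 key.
 by apply/funext => s; exact: key.
by exists (prism_op cF (val a)); apply/funext => s; exact: key.
Qed.

Lemma heq_ring_iso (R : realType) (X Y : topologicalType) :
 homotopy_equivalent R X Y -> graded_ring_iso R X Y.
move=> [f [g [cf cg gf fg]]].
exists (fun n => pull cg (n := n)); split.
- have comp (T U : topologicalType) (h : T -> U) (k : U -> T)
   (ch : continuous h) (ck : continuous k) n (z : cohomology R T n) :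
   homotopic R (k \o h) idfun -> pull ch (pull ck z) = z.
  have cid : continuous (@idfun T) by move=> x; exact: cvg_id. have ckh : continuous (k \o h).
   by move=> x; apply: continuous_comp; [exact: ch|exact: ck].
  move=> kh; transitivity (pull cid z).
   rewrite -(homotopic_pull ckh cid z kh).
   elim/quotW: z => a; rewrite (pull_pi ck a) (pull_pi ch) (pull_pi ckh); congr (\pi_(_)%qT _).
   apply: val_inj; apply/funext => s; apply: (f_equal (val a)). exact/continuousEP.
  elim/quotW: z => a; rewrite pull_pi; congr (\pi_(_)%qT _).
  apply: val_inj; apply/funext => s; apply: (f_equal (val a)). exact/continuousEP.
 by move=> n; exists (fun x => pull cf x) => x; exact: comp.
- exact: pull_one.
- by move=> p q x y; exact: pull_cup.
Qed.

(** * Symmetry and transitivity of the two equivalence relations *)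

Section Equivalences.
Variable R : realType.

Lemma graded_ring_iso_sym (X Y : topologicalType) :
 graded_ring_iso R X Y -> graded_ring_iso R Y X.
move=> [phi [bij one cupE]].
(* The default 0 of [xget] is never reached, since [phi n] is onto. *)
pose psi n : cohomology R Y n -> cohomology R X n :=
 fun y => xget 0 [set x | phi n x = y].
have phiK n y : phi n (psi n y) = y.
 by rewrite /psi; case: xgetP => //; case: (bij n) => k _ kK /(_ (k y)) [].
have inj n : injective (phi n) by apply: bij_inj.
have psi_add n : zmod_morphism (@psi n).
 by move=> a b; apply: (inj n); rewrite raddfB !phiK.
pose psiA n : {additive cohomology R Y n -> cohomology R X n} :=
 HB.pack (@psi n) (GRing.isZmodMorphism.Build _ _ (@psi n) (psi_add n)).
exists psiA; split => /=.
- by move=> n; exists (phi n) => x /=; [exact: phiK|apply: (inj n); rewrite phiK].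
- by apply: (inj 0%N); rewrite phiK one.
- by move=> p q x y; apply: (inj (p + q)%N); rewrite cupE !phiK.
Qed.

Definition clip (t : R) : R := Num.max 0 (Num.min 1 t).

Lemma clamp_itv t : `[0, 1]%classic (clip t).
by rewrite /clip /= in_itv /= le_max lexx /= ge_max ler01 ge_min lexx. Qed.

Lemma clamp_id t : 0 <= t <= 1 -> clip t = t.
by rewrite /clip => /andP[t0 t1]; rewrite min_r // max_r. Qed.

Lemma clamp_le0 t : t <= 0 -> clip t = 0.
by rewrite /clip => t0; rewrite min_r ?max_l // (le_trans t0). Qed.

Lemma clamp_ge1 t : 1 <= t -> clip t = 1.
by rewrite /clip => t0; rewrite min_l ?max_r. Qed.

Lemma clamp_cts : continuous clip.
move=> t; apply: continuous_max; first exact: cvg_cst.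
by apply: continuous_min; [exact: cvg_cst|exact: cvg_id].
Qed.

(* Clamping the time gives a homotopy continuous on all of [X * R]. *)
Lemma homotopicP (X Y : topologicalType) (f g : X -> Y) :
 homotopic R f g <-> exists F : X * R -> Y,
  [/\ continuous F, forall x (t : R), t <= 0 -> F (x, t) = f x
   & forall x (t : R), 1 <= t -> F (x, t) = g x].
split=> [[F [cF F0 F1]]|[F [cF F0 F1]]]; last first.
 exists F; split; [exact: continuous_subspaceT|by move=> x; rewrite F0|]. by move=> x; rewrite F1.
exists (fun xt => F (xt.1, clip xt.2)); split=> [|x t t0|x t t1] /=.
- apply: (cts_within (k := fun xt : X * R => (xt.1, clip xt.2)) cF).
  apply: cts_pair => // x; first exact: cvg_fst. by apply: continuous_comp; [exact: cvg_snd|exact: clamp_cts].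
 by move=> xt; split => //; exact: clamp_itv.
- by rewrite clamp_le0.
- by rewrite clamp_ge1.
Qed.

Lemma homotopic_trans (X Y : topologicalType) (f g h : X -> Y) :
 homotopic R f g -> homotopic R g h -> homotopic R f h.
move=> /homotopicP[F [cF F0 F1]] /homotopicP[G [cG G0 G1]]; apply/homotopicP.
(* With the factor 4 in place of 2 both halves are constantly g around the junction t = 1/2: F rests
   from time 1 on and G rests up to time 0. *)
pose H (xt : X * R) := if xt.2 <= 2^-1 then F (xt.1, 4 * xt.2)
            else G (xt.1, 4 * xt.2 - 3).
have cm (a b : R) : continuous (fun xt : X * R => (xt.1, a * xt.2 - b)).
 apply: cts_pair => x; first exact: cvg_fst. apply: (@continuous_comp _ _ _ snd (fun t : R => a * t - b)).
  exact: cvg_snd.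
 apply: cvgB; last exact: cvg_cst. by apply: cvgM; [exact: cvg_cst|exact: cvg_id].
exists H; split=> [xt|x t t0|x t t1].
- suff cH : {within [set: X * R], continuous H}.
  by apply: (cts_within (k := idfun) cH) => // y; exact: cvg_id.
 have snd_closed (S : set R) : closed S -> closed [set xt : X * R | S xt.2].
  by move=> cS; apply: closed_comp => // y _; exact: cvg_snd.
 rewrite (_ : setT = [set xt : X * R | xt.2 <= 2^-1] `|`
           [set xt : X * R | 2^-1 <= xt.2]); last first.
  by apply/esym/seteqP; split=> // y _; have [|/ltW] := leP y.2 2^-1; [left|right].
 apply: withinU_continuous.
 + exact: (snd_closed [set t : R | t <= 2^-1] (@closed_le R _)).
 + exact: (snd_closed [set t : R | 2^-1 <= t] (@closed_ge R _)).
 + apply: (@subspace_eq_continuous _ _ _ (fun xt : X * R => F (xt.1, 4 * xt.2 - 0)) H).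
   by move=> y /set_mem /= y2; rewrite /H y2 subr0.
  apply: continuous_subspaceT => y. by apply: (@continuous_comp _ _ _ (fun xt : X * R => (xt.1, 4 * xt.2 - 0)) F);
   [exact: cm|exact: cF].
 + apply: (@subspace_eq_continuous _ _ _ (fun xt : X * R => G (xt.1, 4 * xt.2 - 3)) H).
   move=> y /set_mem /= y2; rewrite /H; case: leP => // y2'. rewrite G0; last by lra. by rewrite F1 //; lra.
  apply: continuous_subspaceT => y. by apply: (@continuous_comp _ _ _ (fun xt : X * R => (xt.1, 4 * xt.2 - 3)) G);
   [exact: cm|exact: cG].
- by rewrite /H (le_trans t0) ?invr_ge0 // F0 // mulr_ge0_le0.
- rewrite /H leNgt (lt_le_trans _ t1) ?invf_lt1 ?ltr1n //= G1 //; lra.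
Qed.

Lemma homotopic_comp (X Y Z W : topologicalType) (h : X -> Y) (k : Z -> W)
  (f g : Y -> Z) : continuous h -> continuous k -> homotopic R f g ->
 homotopic R (k \o f \o h) (k \o g \o h).
move=> ch ck /homotopicP[F [cF F0 F1]]; apply/homotopicP.
exists (fun xt => k (F (h xt.1, xt.2))); split=> [xt|x t t0|x t t1] /=.
- apply: (@continuous_comp _ _ _ (fun xt => F (h xt.1, xt.2)) k); last exact: ck.
 apply: (@continuous_comp _ _ _ (fun xt : X * R => (h xt.1, xt.2)) F); last exact: cF.
 apply: cts_pair => y; last exact: cvg_snd. by apply: (@continuous_comp _ _ _ fst h); [exact: cvg_fst|exact: ch].
- by rewrite F0.
- by rewrite F1.
Qed.

Lemma homotopy_eq_refl (X : topologicalType) :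
 homotopy_equivalent R X X.
have h : homotopic R (@idfun X) idfun.
 by apply/homotopicP; exists fst; split=> // x; exact: cvg_fst.
by exists idfun, idfun; split=> // x; exact: cvg_id.
Qed.

Lemma homotopy_eq_sym (X Y : topologicalType) :
 homotopy_equivalent R X Y -> homotopy_equivalent R Y X.
by move=> [f [g [cf cg gf fg]]]; exists g, f. Qed.

Lemma homotopy_eq_trans (X Y Z : topologicalType) :
 homotopy_equivalent R X Y -> homotopy_equivalent R Y Z ->
 homotopy_equivalent R X Z.
move=> [f [g [cf cg gf fg]]] [f' [g' [cf' cg' gf' fg']]].
exists (f' \o f), (g \o g'); split.
- by move=> x; apply: continuous_comp; [exact: cf|exact: cf'].
- by move=> x; apply: continuous_comp; [exact: cg'|exact: cg].
- exact: homotopic_trans (homotopic_comp cf cg gf') gf.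
- exact: homotopic_trans (homotopic_comp cg' cf' fg) fg'.
Qed.

End Equivalences.

(** * Continuity of real and matrix valued functions *)

Section Real.
Variables (R : realType) (T : topologicalType).
Implicit Types f g : T -> R.

Lemma ctsC (c : R) : continuous (fun _ : T => c).
by move=> x; exact: cvg_cst. Qed.

Lemma ctsD f g : continuous f -> continuous g -> continuous (fun x => f x + g x).
by move=> cf cg x; apply: cvgD; [exact: cf|exact: cg]. Qed.

Lemma ctsN f : continuous f -> continuous (fun x => - f x).
by move=> cf x; apply: cvgN; exact: cf. Qed.

Lemma ctsB f g : continuous f -> continuous g -> continuous (fun x => f x - g x).
by move=> cf cg; apply: ctsD => //; exact: ctsN. Qed.

Lemma ctsM f g : continuous f -> continuous g -> continuous (fun x => f x * g x).
by move=> cf cg x; apply: cvgM; [exact: cf|exact: cg]. Qed.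

Lemma ctsV f : (forall x, f x != 0) -> continuous f -> continuous (fun x => (f x)^-1).
by move=> f0 cf x; apply: cvgV; [exact: f0|exact: cf]. Qed.

Lemma cts_sum (I : Type) (r : seq I) (P : pred I) (F : I -> T -> R) :
 (forall i, continuous (F i)) -> continuous (fun x => \sum_(i <- r | P i) F i x).
by move=> cF x; apply: (@cvg_big _ _ _ _ _ add_continuous) => i _; exact: cF.
Qed.

Lemma cts_prod (I : Type) (r : seq I) (P : pred I) (F : I -> T -> R) :
 (forall i, continuous (F i)) -> continuous (fun x => \prod_(i <- r | P i) F i x).
by move=> cF x; apply: (@cvg_big _ _ _ _ _ mul_continuous) => i _; exact: cF.
Qed.

Lemma cts_min f g : continuous f -> continuous g ->
 continuous (fun x => Num.min (f x) (g x)).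
by move=> cf cg x; apply: continuous_min; [exact: cf|exact: cg]. Qed.

Lemma cts_norm f : continuous f -> continuous (fun x => `|f x|).
by move=> cf x; apply: cvg_norm; exact: cf. Qed.

Lemma ctsO (U V : topologicalType) (f : T -> U) (h : U -> V) :
 continuous f -> continuous h -> continuous (fun x => h (f x)).
by move=> cf ch x; apply: continuous_comp; [exact: cf|exact: ch]. Qed.

Lemma mx_cts m n (f : T -> 'M[R]_(m, n)) :
 (forall i j, continuous (fun x => f x i j)) -> continuous f.
move=> cf t V [W nW WV].
have nf (ij : 'I_m * 'I_n) : nbhs t [set u | W ij.1 ij.2 (f u ij.1 ij.2)].
 by case: ij => i j; exact: (cf i j t _ (nW i j)).
have FF : Filter (nbhs t) := nbhs_filter t.
refine (filterS _ (filter_forall FF nf)) => u Wu; apply: WV => i j.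
exact: (Wu (i, j)).
Qed.

Lemma cts_coord m n (f : T -> 'M[R]_(m, n)) i j :
 continuous f -> continuous (fun x => f x i j).
move=> cf; apply: (ctsO (h := fun M : 'M[R]_(m, n) => M i j) cf).
exact: coord_continuous.
Qed.

Lemma cts_det n (M : T -> 'M[R]_n) :
 (forall i j, continuous (fun x => M x i j)) -> continuous (fun x => \det (M x)).
move=> cM; apply: cts_sum => s; apply: ctsM; first exact: ctsC.
by apply: cts_prod => i; exact: cM.
Qed.

Lemma cts_mulmx m n p (M : T -> 'M[R]_(m, n)) (N : T -> 'M[R]_(n, p)) :
 (forall i j, continuous (fun x => M x i j)) ->
 (forall i j, continuous (fun x => N x i j)) ->
 forall i j, continuous (fun x => (M x *m N x) i j).
move=> cM cN i j.
have -> : (fun x => (M x *m N x) i j) = (fun x => \sum_k M x i k * N x k j).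
 by apply/funext => x; rewrite mxE.
by apply: cts_sum => k; apply: ctsM; [exact: cM|exact: cN].
Qed.

End Real.

Lemma ctsE (R : realType) (T : topologicalType) (f g : T -> R) :
 f =1 g -> continuous g -> continuous f.
by move=> /funext ->. Qed.

Lemma cts_id (T : topologicalType) : continuous (fun x : T => x).
by move=> x; exact: cvg_id. Qed.

Ltac cts := repeat match goal with
 | |- continuous (fun=> _) => exact (@ctsC _ _ _)
 | |- continuous (fun y => y) => exact (@cts_id _)
 | |- continuous (fun y => (@?f y) - (@?g y)) => refine (@ctsB _ _ f g _ _)
 | |- continuous (fun y => (@?f y) + (@?g y)) => refine (@ctsD _ _ f g _ _)
 | |- continuous (fun y => (@?f y) * (@?g y)) => refine (@ctsM _ _ f g _ _)
 | |- continuous (fun y => - (@?f y)) => refine (@ctsN _ _ f _)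
 | _ => assumption
 end.
Ltac cts_mx := apply: ctsE => [?|]; [rewrite !mxE; reflexivity|].

Lemma cts_block (R : realType) (T : topologicalType) m1 m2 n1 n2
  (A : T -> 'M[R]_(m1, n1)) (B : T -> 'M[R]_(m1, n2))
  (C : T -> 'M[R]_(m2, n1)) (D : T -> 'M[R]_(m2, n2)) :
 (forall i j, continuous (fun x => A x i j)) ->
 (forall i j, continuous (fun x => B x i j)) ->
 (forall i j, continuous (fun x => C x i j)) ->
 (forall i j, continuous (fun x => D x i j)) ->
 forall i j, continuous (fun x => block_mx (A x) (B x) (C x) (D x) i j).
move=> cA cB cC cD i j.
case: (split_ordP i) => i' ->; case: (split_ordP j) => j' ->.
- by apply: ctsE (cA i' j') => x; rewrite block_mxEul.
- by apply: ctsE (cB i' j') => x; rewrite block_mxEur.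
- by apply: ctsE (cC i' j') => x; rewrite block_mxEdl.
- by apply: ctsE (cD i' j') => x; rewrite block_mxEdr.
Qed.

(** * Induction along the interval, and paths in spaces of matrix families *)

Section RealLine.
Variable R : realType.

(** The hypothesis makes the set where [P] holds open and closed in [0, 1]. This turns local
    deformation statements into global ones without choosing a subdivision. *)
Lemma itv_const (P : R -> Prop) :
 (forall t, 0 <= t <= 1 -> exists2 e, 0 < e &
   forall s, 0 <= s <= 1 -> `|s - t| < e -> (P s <-> P t)) ->
 P 0 -> P 1.
move=> loc P0; pose A := `[0 : R, 1]%classic; pose B := A `&` [set t | P t].
have AE t : A t <-> 0 <= t <= 1 by rewrite /A /= in_itv.
pose N (Q : R -> Prop) := [set s : R | exists t e, `|s - t| < e /\
 forall u, 0 <= u <= 1 -> `|u - t| < e -> Q u].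
have oN Q : open (N Q).
 rewrite openE => s [t [e [ste Qt]]]; apply/nbhs_ballP. exists (e - `|s - t|) => /= [|u]; first by rewrite subr_gt0.
 rewrite /ball /= => su; exists t, e; split=> //. have := ler_distD s u t; rewrite (distrC u s); lra.
suff BA : B = A by have [] : B 1 by rewrite BA; apply/AE; rewrite ler01 lexx.
have NP t : 0 <= t <= 1 -> P t -> N P t.
 move=> t01 Pt; have [e e0 ePt] := loc t t01; exists t, e.
 by rewrite subrr normr0; split=> // u u01 ut; apply/(ePt _ u01 ut).
have NnP t : 0 <= t <= 1 -> ~ P t -> N (fun t => ~ P t) t.
 move=> t01 Pt; have [e e0 ePt] := loc t t01; exists t, e.
 by rewrite subrr normr0; split=> // u u01 ut /(ePt _ u01 ut).
apply: (@segment_connected R 0 1).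
- by exists 0; split=> //; apply/AE; rewrite ler01 lexx.
- exists (N P); first exact: oN.
 apply/seteqP; split=> t [/AE t01 Pt]; split; try exact/AE.
  exact: NP.
 by case: Pt => t' [e [tt' Pe]]; exact: Pe.
- exists (~` N (fun t => ~ P t)); first exact: open_closedC.
 apply/seteqP; split=> t [/AE t01 Pt]; split; try exact/AE.
  by case=> t' [e [tt' Pe]]; exact: (Pe t).
 by apply: contrapT => /(NnP _ t01).
Qed.

Lemma cts_near (f : R -> R) (t e : R) : continuous f -> 0 < e ->
 exists2 d, 0 < d & forall s, `|s - t| < d -> `|f s - f t| < e.
move=> cf e0; have /cvgrPdist_lt/(_ _ e0)/nbhs_ballP[d /= d0 H] := cf t.
by exists d => // s st; rewrite distrC; apply: H; rewrite /ball /= distrC.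
Qed.

Definition mxpath (T : Type) m n (g : R -> T -> 'M[R]_(m, n)) :=
 forall i r k, continuous (fun t => g t i r k).

(** Paths run over all of R and stay in [A] at every time, so continuity is never relative to an
    interval; [pconn_itv] obtains such a path by clamping time. *)
Definition pconn (T : Type) m n (A : (T -> 'M[R]_(m, n)) -> Prop)
  (x y : T -> 'M[R]_(m, n)) : Prop :=
 exists g : R -> T -> 'M[R]_(m, n),
  [/\ mxpath g, forall t, A (g t), g 0 = x & g 1 = y].

Lemma mxpath_comp (T : Type) m n (g : R -> T -> 'M[R]_(m, n)) (h : R -> R) :
 mxpath g -> continuous h -> mxpath (fun t => g (h t)).
by move=> cg ch i r k; apply: ctsO ch (cg i r k). Qed.

Lemma pconn_itv (T : Type) m n (A : (T -> 'M[R]_(m, n)) -> Prop)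
  (g : R -> T -> 'M[R]_(m, n)) :
 mxpath g -> (forall t, 0 <= t <= 1 -> A (g t)) -> pconn A (g 0) (g 1).
move=> cg Ag; exists (fun t => g (clip t)); split.
- exact: mxpath_comp cg (@clamp_cts R).
- by move=> t; apply: Ag; have := clamp_itv t; rewrite /= in_itv.
- by rewrite clamp_le0.
- by rewrite clamp_ge1.
Qed.

Lemma pconn_refl (T : Type) m n (A : (T -> 'M[R]_(m, n)) -> Prop) x :
 A x -> pconn A x x.
by move=> Ax; exists (fun=> x); split=> // i r k; exact: ctsC. Qed.

Lemma pconn_sym (T : Type) m n (A : (T -> 'M[R]_(m, n)) -> Prop) x y :
 pconn A x y -> pconn A y x.
move=> [g [cg Ag g0 g1]]; exists (fun t => g (1 - t)); split=> //.
- by apply: (mxpath_comp (h := fun t => 1 - t)) => //; cts.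
- by rewrite subr0.
- by rewrite subrr.
Qed.

Lemma pconnT (T : Type) m n (A : (T -> 'M[R]_(m, n)) -> Prop) x y z :
 pconn A x y -> pconn A y z -> pconn A x z.
move=> [g [cg Ag g0 g1]] [h [ch Ah h0 h1]].
pose u (t : R) := clip (2 * t); pose v (t : R) := clip (2 * t - 1).
have cu : continuous u by apply: ctsO (@clamp_cts R); apply: ctsM; cts.
have cv : continuous v by apply: ctsO (@clamp_cts R); cts.
(* At each time one of the two paths rests at [y], so this single formula is their concatenation and
   its continuity needs no gluing. *)
exists (fun t i => g (u t) i + h (v t) i - y i); split.
- move=> i r k.
 rewrite (_ : (fun _ => _) = fun t => g (u t) i r k + h (v t) i r k - y i r k).
  apply: ctsB; last exact: ctsC. by apply: ctsD; [exact: mxpath_comp cg cu _ _ _|exact: mxpath_comp ch cv _ _ _].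
 by apply/funext => t; rewrite !mxE.
- move=> t; have [t2|t2] := leP t 2^-1.
  rewrite (_ : (fun i => _) = g (u t)) //; apply/funext => i. by rewrite /v clamp_le0 ?h0 ?addrK //; lra.
 rewrite (_ : (fun i => _) = h (v t)) //; apply/funext => i.
 by rewrite /u clamp_ge1 ?g1 1?addrAC ?subrr ?add0r //; lra.
- apply/funext => i; rewrite /u /v !clamp_le0 ?g0 ?h0 ?addrK //; lra.
- apply/funext => i; rewrite /u /v !clamp_ge1 ?g1 ?h1 1?addrAC ?subrr ?add0r //; lra.
Qed.

End RealLine.

(** * Matrices of positive determinant form a connected space *)

Section GLconnected.
Variable R : realType.

Definition gl_conn n (M N : 'M[R]_n) : Prop :=
 pconn (fun g : unit -> 'M[R]_n => \det (g tt) != 0) (fun=> M) (fun=> N).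

Lemma gl_conn_path n (g : R -> 'M[R]_n) :
 (forall i j, continuous (fun t => g t i j)) ->
 (forall t, 0 <= t <= 1 -> \det (g t) != 0) -> gl_conn (g 0) (g 1).
by move=> cg dg; apply: (pconn_itv (g := fun t (_ : unit) => g t)). Qed.

Lemma gl_conn_refl n (M : 'M[R]_n) : \det M != 0 -> gl_conn M M.
exact: pconn_refl. Qed.

Lemma gl_conn_mul n (M N M' N' : 'M[R]_n) :
 gl_conn M N -> gl_conn M' N' -> gl_conn (M *m M') (N *m N').
move=> [g [cg dg g0 g1]] [h [ch dh h0 h1]].
exists (fun t u => g t u *m h t u); split.
- by move=> i r k; apply: cts_mulmx => ? ?; [exact: cg|exact: ch].
- by move=> t; rewrite det_mulmx mulf_neq0.
- by rewrite g0 h0.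
- by rewrite g1 h1.
Qed.

Lemma gl_conn_mull n (P M N : 'M[R]_n) :
 \det P != 0 -> gl_conn M N -> gl_conn (P *m M) (P *m N).
by move=> P0 MN; apply: gl_conn_mul => //; exact: gl_conn_refl. Qed.

Lemma gl_conn_mulr n (P M N : 'M[R]_n) :
 \det P != 0 -> gl_conn M N -> gl_conn (M *m P) (N *m P).
by move=> P0 MN; apply: gl_conn_mul => //; exact: gl_conn_refl. Qed.

Lemma gl_conn_dblock m n (C : 'M[R]_(n, m)) :
 gl_conn 1%:M (block_mx 1%:M 0 C 1%:M : 'M[R]_(m + n)).
pose g (t : R) : 'M[R]_(m + n) := block_mx 1%:M 0 (t *: C) 1%:M.
have -> : 1%:M = g 0 by rewrite /g scale0r -scalar_mx_block.
have -> : block_mx 1%:M 0 C 1%:M = g 1 by rewrite /g scale1r.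
apply: gl_conn_path => [i j|t _]; last by rewrite det_lblock !det1 mulr1 oner_neq0.
apply: cts_block => i' j'; [exact: ctsC|exact: ctsC| |exact: ctsC].
by cts_mx; cts.
Qed.

Lemma gl_conn_ublock m n (B : 'M[R]_(m, n)) :
 gl_conn 1%:M (block_mx 1%:M B 0 1%:M : 'M[R]_(m + n)).
pose g (t : R) : 'M[R]_(m + n) := block_mx 1%:M (t *: B) 0 1%:M.
have -> : 1%:M = g 0 by rewrite /g scale0r -scalar_mx_block.
have -> : block_mx 1%:M B 0 1%:M = g 1 by rewrite /g scale1r.
apply: gl_conn_path => [i j|t _]; last by rewrite det_ublock !det1 mulr1 oner_neq0.
apply: cts_block => i' j'; [exact: ctsC| |exact: ctsC|exact: ctsC].
by cts_mx; cts.
Qed.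

Lemma gl_conn_neq0 n (M N : 'M[R]_n) : gl_conn M N -> \det M != 0.
by move=> [g [_ dg g0 _]]; have := dg 0; rewrite g0. Qed.

Lemma gl_conn_sym n (M N : 'M[R]_n) : gl_conn M N -> gl_conn N M.
exact: pconn_sym. Qed.

Lemma gl_conn_trans n (M N P : 'M[R]_n) : gl_conn M N -> gl_conn N P -> gl_conn M P.
exact: pconnT. Qed.

Lemma gl_conn_lblock_diag m n (N N' : 'M[R]_n) : gl_conn N N' ->
 gl_conn (block_mx 1%:M 0 0 N : 'M[R]_(m + n)) (block_mx 1%:M 0 0 N').
move=> [g [cg dg g0 g1]].
exists (fun t u => block_mx 1%:M 0 0 (g t u)); split=> [u i j|t||].
- by apply: cts_block => i' j'; [exact: ctsC|exact: ctsC|exact: ctsC|exact: cg].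
- by rewrite det_ublock det1 mul1r.
- by rewrite g0.
- by rewrite g1.
Qed.

(* Whitehead's lemma: diag(d, d^-1) is a product of transvections. *)
Lemma gl_conn_whitehead n (u : 'rV[R]_n) (v : 'cV[R]_n) (d : R) :
 u *m v = 1%:M -> d != 0 ->
 gl_conn 1%:M
  (block_mx d%:M 0 0 (1%:M + (d^-1 - 1) *: (v *m u)) : 'M[R]_(1 + n)).
move=> uv d0.
pose L (c : R) : 'M[R]_(1 + n) := block_mx 1%:M 0 (c *: v) 1%:M.
pose U (c : R) : 'M[R]_(1 + n) := block_mx 1%:M (c *: u) 0 1%:M.
pose W (c : R) : 'M[R]_(1 + n) :=
 block_mx 0 (c *: u) (- c^-1 *: v) (1%:M - v *m u).
have WE c : c != 0 -> U c *m L (- c^-1) *m U c = W c.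
 move=> c0; rewrite /U /L /W !mulmx_block !mulmx0 !mul0mx !mulmx1 !mul1mx. have e : c *: u *m (- c^-1 *: v) = - 1%:M.
  by rewrite -scalemxAl -scalemxAr uv scalerA mulrN mulfV // scaleN1r.
 rewrite e subrr mul0mx !add0r !addr0; congr block_mx. rewrite -scalemxAl -scalemxAr scalerA mulNr mulVf // scaleN1r.
 by rewrite addrC.
have -> : block_mx d%:M 0 0 (1%:M + (d^-1 - 1) *: (v *m u)) =
  U d *m L (- d^-1) *m U d *m (U (-1) *m L (- (-1)^-1) *m U (-1)).
 rewrite !WE ?oppr_eq0 ?oner_eq0 // /W mulmx_block !mul0mx !add0r invrN invr1 opprK scale1r scaleN1r.
 have vuvu : v *m u *m (v *m u) = v *m u by rewrite mulmxA -(mulmxA v) uv mulmx1. congr block_mx.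
 - by rewrite -scalemxAl uv scalemx1.
 - by rewrite mulmxBr mulmx1 -scalemxAl mulmxA uv mul1mx subrr.
 - by rewrite mulmx0 add0r mulmxBl mul1mx -mulmxA uv mulmx1 subrr.
 rewrite mulmxN -scalemxAl scaleNr opprK mulmxBr mulmx1 mulmxBl mul1mx vuvu subrr subr0.
 by rewrite scalerBl scale1r addrCA addrA.
have ul := @gl_conn_ublock 1 n; have dl := @gl_conn_dblock 1 n.
rewrite -[1%:M in X in gl_conn X _]
 (_ : 1%:M *m 1%:M *m 1%:M *m (1%:M *m 1%:M *m 1%:M) = _); last by rewrite !mulmx1.
by do !apply: gl_conn_mul; first [exact: ul|exact: dl].
Qed.

(** Gaussian elimination by block transvections, each joined to 1. A nonzero corner is produced
    first if necessary; Whitehead's lemma then moves the determinant of the Schur complement into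
    the corner. *)
Lemma gl_conn_normal n (M : 'M[R]_n.+1) : \det M != 0 ->
 gl_conn M (block_mx (\det M)%:M 0 0 1%:M : 'M[R]_(1 + n)).
elim: n M => [|n IHn] M M0.
 suff -> : block_mx (\det M)%:M 0 0 1%:M = M :> 'M[R]_(1 + 0).
  exact: gl_conn_refl.
 rewrite det_mx11; apply/matrixP => i j. case: (split_ordP (i : 'I_(1 + 0))) => [i' ->|[]//].
 case: (split_ordP (j : 'I_(1 + 0))) => [j' ->|[]//].
 by rewrite block_mxEul mxE !ord1 mulr1n; congr (M _ _); exact: val_inj.
have l0 : lshift n.+1 (0 : 'I_1) = 0 :> 'I_(1 + n.+1) by exact: val_inj.
pose E1 (c : 'rV[R]_n.+1) : 'M[R]_(1 + n.+1) := block_mx 1%:M c 0 1%:M.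
pose E2 (c : 'cV[R]_n.+1) : 'M[R]_(1 + n.+1) := block_mx 1%:M 0 c 1%:M.
have dE1 c : \det (E1 c) = 1 by rewrite det_ublock !det1 mulr1.
have dE2 c : \det (E2 c) = 1 by rewrite det_lblock !det1 mulr1.
have mE1l (c : 'rV[R]_n.+1) (N P : 'M[R]_(1 + n.+1)) : gl_conn (E1 c *m N) P -> gl_conn N P.
 move=> h; have N0 := gl_conn_neq0 h; rewrite det_mulmx dE1 mul1r in N0.
 by apply: gl_conn_trans h; rewrite -[N in X in gl_conn X _]mul1mx;
  apply: gl_conn_mulr => //; exact: gl_conn_ublock.
have mE1r (c : 'rV[R]_n.+1) (N P : 'M[R]_(1 + n.+1)) : gl_conn (N *m E1 c) P -> gl_conn N P.
 move=> h; have N0 := gl_conn_neq0 h; rewrite det_mulmx dE1 mulr1 in N0.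
 by apply: gl_conn_trans h; rewrite -[N in X in gl_conn X _]mulmx1;
  apply: gl_conn_mull => //; exact: gl_conn_ublock.
have mE2l (c : 'cV[R]_n.+1) (N P : 'M[R]_(1 + n.+1)) : gl_conn (E2 c *m N) P -> gl_conn N P.
 move=> h; have N0 := gl_conn_neq0 h; rewrite det_mulmx dE2 mul1r in N0.
 by apply: gl_conn_trans h; rewrite -[N in X in gl_conn X _]mul1mx;
  apply: gl_conn_mulr => //; exact: gl_conn_dblock.
suff main (N : 'M[R]_(1 + n.+1)) : \det N != 0 -> N 0 0 != 0 ->
  gl_conn N (block_mx (\det N)%:M 0 0 1%:M : 'M[R]_(1 + n.+1)).
 have [m0|m0] := eqVneq (M 0 0) 0; last exact: main.
 have [i Mi] : exists i : 'I_n.+1, (M : 'M_(1 + n.+1)) (rshift 1 i) 0 != 0.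
  apply: contrapT => /forallNP Mi; move/eqP: M0; apply. rewrite (expand_det_col M 0) big1 // => i _.
  have [j ->|j ->] := split_ordP (i : 'I_(1 + n.+1)).
   by rewrite ord1 l0 m0 mul0r.
  by have /negP := Mi j; rewrite negbK => /eqP ->; rewrite mul0r.
 have dM : \det M = \det (E1 (delta_mx 0 i) *m (M : 'M_(1 + n.+1))).
  by rewrite det_mulmx dE1 mul1r.
 rewrite [in X in gl_conn _ X]dM; apply: (mE1l (delta_mx 0 i)). apply: main; first by rewrite -dM.
 have corner (N : 'M[R]_(1 + n.+1)) :
   (E1 (delta_mx 0 i) *m N) 0 0 = N 0 0 + N (rshift 1 i) 0.
  by rewrite -[N in LHS]submxK mulmx_block !mul1mx -l0 block_mxEul mxE -rowE !mxE.
 by rewrite corner m0 add0r.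
move=> N0 n0.
pose a := N 0 0; pose ur := ursubmx N; pose dl := dlsubmx N.
have ulE : ulsubmx N = a%:M.
 rewrite [LHS]mx11_scalar !mxE; congr (N _ _)%:M; exact: val_inj.
pose S := drsubmx N - a^-1 *: (dl *m ur).
have NE : E2 (- a^-1 *: dl) *m N *m E1 (- a^-1 *: ur) = block_mx a%:M 0 0 S.
 rewrite -[N in LHS]submxK ulE -/ur -/dl /E1 /E2 !mulmx_block.
 rewrite !mulmx0 !mul0mx !mulmx1 !mul1mx !addr0 mul_mx_scalar mul_scalar_mx !scalerA mulrN mulfV // !scaleN1r.
 by rewrite !addNr mul0mx add0r -scalemxAl scaleNr addrC.
have dN : \det N = a * \det S.
 have := congr1 determinant NE; rewrite !det_mulmx dE1 dE2 mul1r mulr1 => ->. by rewrite det_ublock det_scalar1.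
have S0 : \det S != 0 by move: N0; rewrite dN mulf_eq0 negb_or => /andP[].
apply: (mE2l (- a^-1 *: dl)); apply: (mE1r (- a^-1 *: ur)); rewrite NE.
have split_a (P : 'M[R]_n.+1) : block_mx a%:M 0 0 P =
  block_mx a%:M 0 0 1%:M *m block_mx 1%:M 0 0 P :> 'M[R]_(1 + n.+1).
 by rewrite mulmx_block !mulmx0 !mul0mx !mulmx1 !mul1mx !addr0 !add0r.
have da0 : \det (block_mx a%:M 0 0 1%:M : 'M[R]_(1 + n.+1)) != 0.
 by rewrite det_ublock det1 mulr1 det_scalar1.
have -> : block_mx (\det N)%:M 0 0 1%:M =
  block_mx a%:M 0 0 1%:M *m block_mx (\det S)%:M 0 0 1%:M :> 'M[R]_(1 + n.+1).
 by rewrite mulmx_block !mulmx0 !mul0mx !mulmx1 !addr0 add0r -scalar_mxM dN.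
rewrite split_a; apply: gl_conn_mull => //.
apply: gl_conn_trans (gl_conn_lblock_diag 1 (IHn S S0)) _.
set s := \det S; pose u : 'rV[R]_(1 + n) := row_mx 1%:M 0.
pose v : 'cV[R]_(1 + n) := col_mx 1%:M 0.
have uv : u *m v = 1%:M by rewrite mul_row_col mulmx1 mulmx0 addr0.
pose D : 'M[R]_(1 + n) := block_mx s%:M 0 0 1%:M.
have -> : block_mx s%:M 0 0 1%:M =
  block_mx s%:M 0 0 (1%:M + (s^-1 - 1) *: (v *m u)) *m block_mx 1%:M 0 0 D
   :> 'M[R]_(1 + n.+1).
 rewrite mulmx_block !mulmx0 !mul0mx !mulmx1 !addr0 add0r; congr block_mx.
 rewrite mul_col_row mul1mx mulmx0 !mul0mx scale_block_mx !scaler0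
  (scalar_mx_block 1 n 1) add_block_mx !addr0 mulmx_block.
 rewrite !mulmx0 !mul0mx !mulmx1 !addr0 add0r.
 by rewrite -[X in X + _]scale1r -scalerDl addrC subrK scalemx1 -scalar_mxM mulVf.
rewrite -[block_mx 1%:M 0 0 D in X in gl_conn X _]mul1mx.
have dD : \det (block_mx 1%:M 0 0 D : 'M[R]_(1 + n.+1)) = s.
 by rewrite (@det_ublock _ 1 n.+1) det1 mul1r (@det_ublock _ 1 n) det1 mulr1 det_scalar1.
apply: gl_conn_mulr; first exact: (eq_ind_r (fun x => x != 0) S0 dD).
exact: gl_conn_whitehead.
Qed.

Lemma gl_conn_pos n (M : 'M[R]_n.+1) : 0 < \det M -> gl_conn M 1%:M.
move=> M0; apply: gl_conn_trans (gl_conn_normal (lt0r_neq0 M0)) _.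
have -> : 1%:M = block_mx 1%:M 0 0 1%:M :> 'M[R]_(1 + n).
 by rewrite -scalar_mx_block.
set d := \det M in M0 *.
pose g (t : R) : 'M[R]_(1 + n) := block_mx ((1 - t) * d + t)%:M 0 0 1%:M.
have -> : block_mx d%:M 0 0 1%:M = g 0 by rewrite /g subr0 mul1r addr0.
have -> : block_mx 1%:M 0 0 1%:M = g 1 by rewrite /g subrr mul0r add0r.
apply: gl_conn_path => [i j|t /andP[t0 t1]].
 apply: cts_block => i' j'; [|exact: ctsC|exact: ctsC|exact: ctsC].
 cts_mx.
 by case: eqP => _; [rewrite /GRing.natmul /=; cts|exact: ctsC].
rewrite (@det_ublock _ 1 n) det1 mulr1 det_scalar1 gt_eqF //.
have [->|tn0] := eqVneq t 0; first by rewrite subr0 mul1r addr0.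
by rewrite ltr_wpDl ?mulr_ge0 ?subr_ge0 ?(ltW M0) // lt_neqAle eq_sym tn0.
Qed.

End GLconnected.

(** * The sum of the absolute values of the entries as a norm *)

Section Entrywise.
Variable R : realType.

Definition nm m n (M : 'M[R]_(m, n)) : R := \sum_i \sum_j `|M i j|.

Lemma nm_ge0 m n (M : 'M[R]_(m, n)) : 0 <= nm M.
by apply: sumr_ge0 => i _; apply: sumr_ge0 => j _. Qed.

Lemma nm_entry m n (M : 'M[R]_(m, n)) i j : `|M i j| <= nm M.
rewrite /nm (bigD1 i) //= (bigD1 j) //= -addrA lerDl addr_ge0 //.
 exact: sumr_ge0.
by apply: sumr_ge0 => k _; apply: sumr_ge0.
Qed.

Lemma nm_eq0 m n (M : 'M[R]_(m, n)) : (nm M == 0) = (M == 0).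
apply/eqP/eqP => [M0|->]; last first.
 by rewrite /nm big1 // => i _; rewrite big1 // => j _; rewrite mxE normr0.
apply/matrixP => i j; rewrite mxE; apply/eqP; rewrite -normr_le0 -M0.
exact: nm_entry.
Qed.

Lemma nm0 m n : nm (0 : 'M[R]_(m, n)) = 0.
by apply/eqP; rewrite nm_eq0. Qed.

Lemma nm_gt0 m n (M : 'M[R]_(m, n)) : M != 0 -> 0 < nm M.
by move=> M0; rewrite lt_neqAle eq_sym nm_eq0 M0 nm_ge0. Qed.

Lemma nmD m n (M N : 'M[R]_(m, n)) : nm (M + N) <= nm M + nm N.
rewrite /nm -big_split /=; apply: ler_sum => i _.
rewrite -big_split /=; apply: ler_sum => j _.
by rewrite mxE ler_normD.
Qed.

Lemma nmN m n (M : 'M[R]_(m, n)) : nm (- M) = nm M.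
by apply: eq_bigr => i _; apply: eq_bigr => j _; rewrite mxE normrN. Qed.

Lemma nmB m n (M N : 'M[R]_(m, n)) : nm (M - N) <= nm M + nm N.
by rewrite -(nmN N); exact: nmD. Qed.

Lemma nmBr m n (M N : 'M[R]_(m, n)) : nm M - nm (N - M) <= nm N.
by rewrite lerBlDr -{1}[M](subKr N) nmB. Qed.

Lemma nmZ m n (c : R) (M : 'M[R]_(m, n)) : nm (c *: M) = `|c| * nm M.
rewrite /nm mulr_sumr; apply: eq_bigr => i _.
by rewrite mulr_sumr; apply: eq_bigr => j _; rewrite mxE normrM.
Qed.

Lemma nmM m n p (M : 'M[R]_(m, n)) (N : 'M[R]_(n, p)) : nm (M *m N) <= nm M * nm N.
have row_le k : \sum_j `|N k j| <= nm N.
 by rewrite [leRHS](bigD1 k) //= lerDl; apply: sumr_ge0 => i _; apply: sumr_ge0.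
rewrite {1 2}/nm mulr_suml; apply: ler_sum => i _.
apply: (@le_trans _ _ (\sum_j \sum_k `|M i k| * `|N k j|)).
 apply: ler_sum => j _; rewrite mxE; apply: le_trans (ler_norm_sum _ _ _) _.
 by apply: ler_sum => k _; rewrite normrM.
rewrite exchange_big mulr_suml /=; apply: ler_sum => k _.
by rewrite -mulr_sumr ler_wpM2l.
Qed.

Lemma nm_tr m n (M : 'M[R]_(m, n)) : nm M^T = nm M.
rewrite /nm exchange_big; apply: eq_bigr => i _; apply: eq_bigr => j _.
by rewrite mxE.
Qed.

Lemma nm_row m1 m2 n (A : 'M[R]_(n, m1)) (B : 'M[R]_(n, m2)) :
 nm (row_mx A B) = nm A + nm B.
rewrite /nm -big_split /=; apply: eq_bigr => i _.
by rewrite big_split_ord /=; congr (_ + _); apply: eq_bigr => j _;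
 rewrite ?row_mxEl ?row_mxEr.
Qed.

Lemma cts_nm (T : topologicalType) m n (M : T -> 'M[R]_(m, n)) :
 (forall i j, continuous (fun x => M x i j)) -> continuous (fun x => nm (M x)).
by move=> cM; apply: cts_sum => i; apply: cts_sum => j; exact: cts_norm.
Qed.

End Entrywise.

Notation forms R n := ('I_n -> 'M[R]_(2, 4)).

(** * A small move of the planes keeps the homotopy type of the complement *)

Section Configurations.
Variable R : realType.

Definition cross (a b : 'M[R]_(2, 4)) : R := \det (col_mx a b : 'M[R]_4).

Definition is_cfg n (a : forms R n) : Prop :=
 forall i j, i != j -> cross (a i) (a j) != 0.

Definition conn n (a b : forms R n) : Prop := pconn (@is_cfg n) a b.

Definition loci n (a : forms R n) : 'I_n -> subsp R :=
 fun i => zero_locus (a i).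

Definition heq n (a b : forms R n) : Prop :=
 homotopy_equivalent R (complement (loci a)) (complement (loci b)).

Definition avoids n (a : forms R n) (x : 'rV[R]_4) : Prop :=
 forall i, x *m (a i)^T != 0.

Lemma complementE n (a : forms R n) (x : 'rV[R]_4) :
 x \in [set x : 'rV[R]_4 | forall i, x \notin loci a i] <-> avoids a x.
by rewrite inE /=; split=> H i; move: (H i); rewrite mem_zero_locus. Qed.

Lemma avoids_val n (a : forms R n) (x : complement (loci a)) :
 avoids a (val x).
by apply/complementE; exact: valP. Qed.

Definition to_compl n (a : forms R n) (x : 'rV[R]_4)
  (ax : avoids a x) : complement (loci a) :=
 exist _ x (proj2 (complementE a x) ax).

Lemma to_compl_cts n (a : forms R n) (T : topologicalType)
  (u : T -> 'rV[R]_4) (au : forall t, avoids a (u t)) :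
 (forall k, continuous (fun t => u t 0 k)) ->
 continuous (fun t => to_compl (au t)).
move=> cu; apply: continuous_comp_initial.
by apply: mx_cts => i k; rewrite ord1.
Qed.

Lemma val_cts n (a : forms R n) k :
 continuous (fun x : complement (loci a) => (val x : 'rV[R]_4) 0 k).
by apply: (cts_coord (f := val : complement (loci a) -> 'rV[R]_4)) => x;
 exact: initial_continuous.
Qed.

(** The criterion behind the homotopy equivalences of this development: both composites are joined
    to the identity by straight segments that avoid the planes. *)
Lemma heq_straight n (a b : forms R n) (f g : 'rV[R]_4 -> 'rV[R]_4) :
 (forall x, avoids a x -> avoids b (f x)) ->
 (forall x, avoids b x -> avoids a (g x)) ->
 (forall k, continuous (fun x : complement (loci a) => f (val x) 0 k)) ->
 (forall k, continuous (fun x : complement (loci b) => g (val x) 0 k)) ->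
 (forall x s, avoids a x -> 0 <= s <= 1 -> avoids a (x + s *: (g (f x) - x))) ->
 (forall x s, avoids b x -> 0 <= s <= 1 -> avoids b (x + s *: (f (g x) - x))) ->
 heq a b.
move=> ab ba cf cg gfh fgh.
pose F (x : complement (loci a)) := to_compl (ab _ (avoids_val x)).
pose G (x : complement (loci b)) := to_compl (ba _ (avoids_val x)).
have cF : continuous F.
 exact: (@to_compl_cts n b (complement (loci a)) (fun x => f (val x)) (fun x => ab _ (avoids_val x)) cf).
have cG : continuous G.
 exact: (@to_compl_cts n a (complement (loci b)) (fun x => g (val x)) (fun x => ba _ (avoids_val x)) cg).
have clamp (t : R) : 0 <= 1 - clip t <= 1.
 by have := clamp_itv t; rewrite /= in_itv /= => /andP[]; lra.
suff H (c : forms R n) (K : complement (loci c) -> complement (loci c)) :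
  continuous K ->
  (forall x s, 0 <= s <= 1 -> avoids c (val x + s *: (val (K x) - val x))) ->
  homotopic R K idfun.
 exists F, G; split=> //; apply: H.
 - by move=> x; apply: continuous_comp; [exact: cF|exact: cG].
 - by move=> x s s01; apply: gfh => //; exact: avoids_val.
 - by move=> x; apply: continuous_comp; [exact: cG|exact: cF].
 - by move=> x s s01; apply: fgh => //; exact: avoids_val.
move=> cK Kc.
pose h (xt : complement (loci c) * R) : 'rV[R]_4 :=
 val xt.1 + (1 - clip xt.2) *: (val (K xt.1) - val xt.1).
have hc xt : avoids c (h xt) by exact: Kc.
have cv k : continuous (fun xt : complement (loci c) * R => (val xt.1 : 'rV[R]_4) 0 k).
 apply: (ctsO (f := fst) (h := fun x : complement (loci c) => (val x : 'rV[R]_4) 0 k)).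
  by move=> x; exact: cvg_fst.
 exact: val_cts.
have cKv k : continuous (fun xt : complement (loci c) * R => (val (K xt.1) : 'rV[R]_4) 0 k).
 apply: (ctsO (f := fun xt : complement (loci c) * R => K xt.1)
  (h := fun x : complement (loci c) => (val x : 'rV[R]_4) 0 k)).
  by apply: (ctsO (f := fst) (h := K)) => // x; exact: cvg_fst.
 exact: val_cts.
have cc : continuous (fun xt : complement (loci c) * R => clip xt.2).
 apply: (ctsO (f := snd) (h := @clip R)); last exact: clamp_cts. by move=> x; exact: cvg_snd.
exists (fun xt => to_compl (hc xt)); split.
- apply: continuous_subspaceT; apply: to_compl_cts => k.
 apply: (ctsE (g := fun xt : complement (loci c) * R => (val xt.1 : 'rV[R]_4) 0 k + (1 - clip xt.2) *
   ((val (K xt.1) : 'rV[R]_4) 0 k - (val xt.1 : 'rV[R]_4) 0 k))).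
  by move=> xt; rewrite /h !mxE.
 by apply: ctsD => //; apply: ctsM; apply: ctsB => //; exact: ctsC.
- move=> x; apply: val_inj => /=; rewrite /h /=.
 by rewrite clamp_le0 // subr0 scale1r addrC subrK.
- move=> x; apply: val_inj => /=; rewrite /h /=.
 by rewrite clamp_ge1 // subrr scale0r addr0.
Qed.

Lemma heq_refl n (a : forms R n) : heq a a.
exact: homotopy_eq_refl. Qed.

Lemma heqC n (a b : forms R n) : heq a b -> heq b a.
exact: homotopy_eq_sym. Qed.

Lemma heqT n (a b c : forms R n) :
 heq a b -> heq b c -> heq a c.
exact: homotopy_eq_trans. Qed.

Lemma avoids_near (b : 'M[R]_(2, 4)) (x z : 'rV[R]_4) (d r al : R) :
 x != 0 -> nm b <= al -> r * nm x <= nm (x *m b^T) ->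
 nm (z - x) <= d * nm x -> d * al < r -> z *m b^T != 0.
move=> x0 bal rx zx dr; rewrite -nm_eq0 gt_eqF //.
have nx := nm_gt0 x0.
have h1 : nm (z *m b^T - x *m b^T) <= d * nm x * al.
 rewrite -mulmxBl; apply: le_trans (nmM _ _) _. by rewrite nm_tr ler_pM ?nm_ge0.
have h2 := nmBr (x *m b^T) (z *m b^T).
have h3 : d * nm x * al < r * nm x by rewrite mulrAC ltr_pM2r.
lra.
Qed.

Section Move.
Variables (n : nat) (a : forms R n) (i : 'I_n) (A1 : 'M[R]_(2, 4)).
Variables (r al d : R) (M G : 'M[R]_4).
Let A0 := a i.
Hypotheses (r0 : 0 < r) (al0 : forall j, nm (a j) <= al) (al1 : nm A1 <= al).
Hypothesis sep : forall j (x : 'rV[R]_4), j != i -> nm (x *m A0^T) <= 2 * r * nm x ->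
 2 * r * nm x <= nm (x *m (a j)^T).
Hypotheses (MG : M *m G = 1%:M) (GM : G *m M = 1%:M).
Hypotheses (MA : M *m A1^T = A0^T) (GA : G *m A0^T = A1^T).
Hypotheses (dM : forall x : 'rV[R]_4, nm (x *m M - x) <= d * nm x)
      (dG : forall x : 'rV[R]_4, nm (x *m G - x) <= d * nm x)
      (dA : forall x : 'rV[R]_4, nm (x *m A1^T - x *m A0^T) <= r / 4 * nm x).
Hypotheses (d_ge0 : 0 <= d) (d_lt1 : d < 1) (d_small : 3 * d * al < r / 4)
 (d_small' : d * (al + r) <= r / 2).

(** A cut-off that depends only on the direction of x: 1 on the cone of relative width r around the
    plane of [A0], and 0 outside the cone of width 2 r. *)
Definition bump_fun (x : 'rV[R]_4) : R :=
 clip (2 - nm (x *m A0^T) / (r * nm x)).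

(** Used with T = [M], which carries the plane of [A0] into that of [A1], and with T = [G], which
    goes back; the cut-off leaves the other planes alone. *)
Definition push (T : 'M[R]_4) (x : 'rV[R]_4) : 'rV[R]_4 :=
 x + bump_fun x *: (x *m T - x).

Let b : forms R n := fun j => if j == i then A1 else a j.

Lemma bump_fun_itv x : 0 <= bump_fun x <= 1.
by have := clamp_itv (2 - nm (x *m A0^T) / (r * nm x)); rewrite /= in_itv. Qed.

Lemma push_in T x : x != 0 -> nm (x *m A0^T) <= r * nm x -> push T x = x *m T.
move=> x0 h; rewrite /push /bump_fun clamp_ge1 ?scale1r ?[RHS](addrC, subrK) //.
 by rewrite addrC subrK.
have : nm (x *m A0^T) / (r * nm x) <= 1.
 by rewrite ler_pdivrMr ?mul1r // mulr_gt0 ?nm_gt0.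
lra.
Qed.

Lemma push_out T x : x != 0 -> 2 * r * nm x <= nm (x *m A0^T) -> push T x = x.
move=> x0 h; rewrite /push /bump_fun clamp_le0 ?scale0r ?addr0 //.
have : 2 <= nm (x *m A0^T) / (r * nm x).
 by rewrite ler_pdivlMr ?mulrA // mulr_gt0 ?nm_gt0.
lra.
Qed.

Lemma push_near T x : (forall x : 'rV[R]_4, nm (x *m T - x) <= d * nm x) ->
 nm (push T x - x) <= d * nm x.
move=> dT; rewrite /push addrAC subrr add0r nmZ.
have /andP[c0 c1] := bump_fun_itv x.
rewrite ger0_norm //; apply: le_trans (dT x).
by rewrite ler_piMl // nm_ge0.
Qed.

Lemma push_cts T (m : nat) (c : forms R m) k :
 (0 < m)%N -> continuous (fun x : complement (loci c) => push T (val x) 0 k).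
move=> m0.
have v0 (x : complement (loci c)) : (val x : 'rV[R]_4) != 0.
 apply: contraNneq (avoids_val x (Ordinal m0)) => ->. by rewrite mul0mx.
have cv i' j : continuous (fun x : complement (loci c) => (val x : 'rV[R]_4) i' j).
 by rewrite (ord1 i'); exact: val_cts.
have cvT p (N : 'M[R]_(4, p)) i' j :
  continuous (fun x : complement (loci c) => ((val x : 'rV[R]_4) *m N) i' j).
 by apply: cts_mulmx => // ? ?; exact: ctsC.
apply: (ctsE (g := fun x : complement (loci c) => (val x : 'rV[R]_4) 0 k +
  bump_fun (val x) * (((val x : 'rV[R]_4) *m T) 0 k - (val x : 'rV[R]_4) 0 k))).
 by move=> x; rewrite /push !mxE.
apply: ctsD => //; apply: ctsM; last exact: ctsB.
apply: (ctsO (h := @clip R)); last exact: clamp_cts.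
apply: ctsB; first exact: ctsC.
apply: ctsM; first by apply: cts_nm => ? ?; exact: cvT.
apply: ctsV => [x|]; first by rewrite mulf_neq0 ?gt_eqF ?nm_gt0.
by apply: ctsM; [exact: ctsC|apply: cts_nm].
Qed.

Lemma push2_near x (T U : 'M[R]_4) :
 (forall x : 'rV[R]_4, nm (x *m T - x) <= d * nm x) ->
 (forall x : 'rV[R]_4, nm (x *m U - x) <= d * nm x) ->
 nm (push U (push T x) - x) <= 3 * d * nm x.
move=> dT dU; have h1 := push_near x dT; have h2 := push_near (push T x) dU.
have h3 : nm (push T x) <= 2 * nm x.
 have := nmD x (push T x - x); rewrite addrC subrK => h. have : d * nm x <= nm x by rewrite ler_piMl ?nm_ge0 // ltW.
 lra.
have h4 : d * nm (push T x) <= d * (2 * nm x) by rewrite ler_wpM2l.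
have := nmD (push U (push T x) - push T x) (push T x - x).
rewrite addrA subrK; lra.
Qed.

(** Starting in the cone of half width, the first push does not leave the cone where the cut-off is
    1, so two inverse linear maps cancel. *)
Lemma push2_id x (T U : 'M[R]_4) : x != 0 -> T *m U = 1%:M ->
 (forall x : 'rV[R]_4, nm (x *m T - x) <= d * nm x) ->
 nm (x *m A0^T) <= r / 2 * nm x -> push U (push T x) = x.
move=> x0 TU dT h; have nx := nm_gt0 x0; have rp := r0.
have h0 : nm (x *m A0^T) <= r * nm x.
 have hr : r / 2 <= r by lra. exact: le_trans h (ler_wpM2r (nm_ge0 x) hr).
have xT0 : x *m T != 0.
 apply: contraTneq x0 => xT; have := dT x; rewrite xT sub0r nmN => h1. have : d * nm x < nm x by rewrite gtr_pMl.
 lra.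
rewrite (push_in T x0 h0) push_in //; first by rewrite -mulmxA TU mulmx1.
have h1 := nmBr (x *m T) x.
have h2 : nm (x *m T *m A0^T - x *m A0^T) <= d * nm x * al.
 rewrite -mulmxBl; apply: le_trans (nmM _ _) _. by rewrite nm_tr ler_pM ?nm_ge0 // al0.
have h3 := nmD (x *m T *m A0^T - x *m A0^T) (x *m A0^T).
rewrite subrK in h3.
have h4 := nmBr x (x *m T); have h5 := dT x.
have h6 : d * nm x * al + r * (d * nm x) <= r / 2 * nm x.
 have -> : d * nm x * al + r * (d * nm x) = d * (al + r) * nm x by ring. by rewrite ler_wpM2r // nm_ge0.
have h7 : r * (nm x - d * nm x) <= r * nm (x *m T).
 by rewrite ler_pM2l //; lra.
lra.
Qed.

Definition update : forms R n := fun j => if j == i then A1 else a j.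

Lemma updateE j : j != i -> update j = a j.
by rewrite /update => /negbTE ->. Qed.

Lemma update_same : update i = A1.
by rewrite /update eqxx. Qed.

Lemma dal : 0 <= d * al.
by rewrite mulr_ge0 // (le_trans _ al1) ?nm_ge0. Qed.

Lemma avoids_far (f : 'rV[R]_4 -> 'rV[R]_4) x j : x != 0 -> j != i ->
 x *m (a j)^T != 0 ->
 nm (f x - x) <= 3 * d * nm x ->
 (2 * r * nm x <= nm (x *m A0^T) -> f x = x) -> f x *m (a j)^T != 0.
move=> x0 ji xj fx far; have [h|/ltW h] := leP (nm (x *m A0^T)) (2 * r * nm x).
 by apply: (avoids_near x0 (al0 j) (sep ji h) fx); have := dal; have := d_small; have := r0; lra.
by rewrite far.
Qed.

Lemma near_A1 (x : 'rV[R]_4) (q : R) : q * nm x <= nm (x *m A0^T) ->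
 (q - r / 4) * nm x <= nm (x *m A1^T).
move=> h; have h1 := nmBr (x *m A0^T) (x *m A1^T); have h2 := dA x.
have -> : (q - r / 4) * nm x = q * nm x - r / 4 * nm x by ring.
lra.
Qed.

(** [push M] and [push G] are not inverse to each other where the cut-off varies. There the points
    are far from all planes compared with the displacement, so the straight segments of
    [heq_straight] are still harmless. *)
Lemma heq_move : (0 < n)%N -> heq a update.
move=> n0; have dal0 := dal; have rp := r0; have ds := d_small; have dp := d_ge0.
have x0P (c : forms R n) x : avoids c x -> x != 0.
 move=> /(_ (Ordinal n0)); apply: contraNneq => ->; by rewrite mul0mx.
have d3 (x : 'rV[R]_4) : d * nm x <= 3 * d * nm x.
 rewrite ler_wpM2r ?nm_ge0 //; lra.
have seg x (y : 'rV[R]_4) (s e : R) : 0 <= s <= 1 -> nm (y - x) <= e ->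
  nm (x + s *: (y - x) - x) <= e.
 move=> /andP[s0 s1] yx; rewrite addrAC subrr add0r nmZ ger0_norm //.
 by apply: le_trans yx; rewrite ler_piMl // nm_ge0.
apply: (@heq_straight n a update (push M) (push G)).
- move=> x ax j; have x0 := x0P a x ax.
 have [->|ji] := eqVneq j i; rewrite ?update_same ?updateE //.
  have [h|/ltW h] := leP (nm (x *m A0^T)) (r * nm x).
   by rewrite push_in // -mulmxA MA; exact: ax.
  by apply: (avoids_near x0 al1 (near_A1 h) (push_near x dM)); lra.
 apply: (avoids_far x0 ji (ax j) (le_trans (push_near x dM) (d3 x))). exact: push_out.
- move=> x ax j; have x0 := x0P update x ax; have := ax j.
 have [->|ji] := eqVneq j i; rewrite ?update_same ?updateE // => axj.
  have [h|/ltW h] := leP (nm (x *m A0^T)) (r * nm x).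
   by rewrite push_in // -mulmxA GA.
  by apply: (avoids_near x0 (al0 i) h (push_near x dG)); lra.
 apply: (avoids_far x0 ji axj (le_trans (push_near x dG) (d3 x))). exact: push_out.
- by move=> k; exact: push_cts.
- by move=> k; exact: push_cts.
- move=> x s ax s01 j; have x0 := x0P a x ax.
 have h2 := push2_near x dM dG. have [->|ji] := eqVneq j i.
  have [h|/ltW h] := leP (nm (x *m A0^T)) (r / 2 * nm x).
   by rewrite push2_id // subrr scaler0 addr0; exact: ax.
  by apply: (avoids_near x0 (al0 i) h (seg _ _ _ _ s01 h2)); lra.
 apply: (avoids_far (f := fun x => x + s *: (push G (push M x) - x)) x0 ji (ax j)).
  exact: seg.
 by move=> h; rewrite !push_out // subrr scaler0 addr0.
- move=> x s ax s01 j; have x0 := x0P update x ax; have := ax j.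
 have h2 := push2_near x dG dM. have [->|ji] := eqVneq j i; rewrite ?update_same ?updateE // => axj.
  have [h|/ltW h] := leP (nm (x *m A0^T)) (r / 2 * nm x).
   by rewrite push2_id // subrr scaler0 addr0.
  by apply: (avoids_near x0 al1 (near_A1 h) (seg _ _ _ _ s01 h2)); lra.
 apply: (avoids_far (f := fun x => x + s *: (push M (push G x) - x)) x0 ji axj).
  exact: seg.
 by move=> h; rewrite !push_out // subrr scaler0 addr0.
Qed.

End Move.

Lemma cross_row (a b : 'M[R]_(2, 4)) :
 cross a b = \det (row_mx a^T b^T : 'M[R]_4).
rewrite /cross -(det_tr (col_mx a b : 'M[R]_4)).
exact: (congr1 (fun N : 'M[R]_4 => \det N) (tr_col_mx a b)). Qed.

Lemma nm_mulmx_row (A B : 'M[R]_(4, 2)) (x : 'rV[R]_4) :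
 nm (x *m (row_mx A B : 'M[R]_4)) = nm (x *m A) + nm (x *m B).
by rewrite -nm_row -mul_mx_row. Qed.

(** Transversality made quantitative: two forms of a configuration form an invertible 4 by 4 matrix,
    so they cannot both be small at x; finitely many inverses have a common bound. *)
Lemma cfg_lower_bound n (a : forms R n) : is_cfg a ->
 exists2 L, 0 < L & forall i j (x : 'rV[R]_4), i != j ->
  nm x <= L * (nm (x *m (a i)^T) + nm (x *m (a j)^T)).
move=> ca; pose C i j : 'M[R]_4 := row_mx (a i)^T (a j)^T.
pose L := 1 + \sum_i \sum_j nm (invmx (C i j)).
have s0 : 0 <= \sum_i \sum_j nm (invmx (C i j)).
 by apply: sumr_ge0 => i _; apply: sumr_ge0 => j _; exact: nm_ge0.
exists L => [|i j x ij]; first by rewrite /L; lra.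
have Cu : C i j \in unitmx by rewrite unitmxE unitfE -cross_row ca.
have -> : nm (x *m (a i)^T) + nm (x *m (a j)^T) = nm (x *m C i j).
 by rewrite /C nm_mulmx_row.
rewrite -{1}(mulmxK Cu x) mulrC; apply: le_trans (nmM _ _) _.
rewrite ler_wpM2l ?nm_ge0 // /L (bigD1 i) //= (bigD1 j) //=.
have h1 : 0 <= \sum_(k | k != j) nm (invmx (C i k)).
 by apply: sumr_ge0 => k _; exact: nm_ge0.
have h2 : 0 <= \sum_(k | k != i) \sum_l nm (invmx (C k l)).
 by apply: sumr_ge0 => k _; apply: sumr_ge0 => l _; exact: nm_ge0.
lra.
Qed.

(** The radius is uniform over all [c] near [a], because [heq_near] replaces the forms one by one
    and passes through mixtures of two configurations. *)
Lemma heq_near_one n (a : forms R n) : is_cfg a -> (1 < n)%N ->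
 exists2 e, 0 < e & forall c, (forall j, nm (c j - a j) <= e) ->
  forall i A1, nm (A1 - a i) <= e -> heq c (update c i A1).
move=> ca n1; have [L0 L00 aL] := cfg_lower_bound ca.
(* [L0] is the bound for [a], and its double plus 1 serves for all nearby [c]. Cones of width of
   order 1 / (8 L) around distinct planes are disjoint. The constant 1000 in [e] is generous: a
   displacement of order e L has to be small against r / al. *)
pose L := 2 * L0 + 1; pose al := 1 + \sum_j nm (a j); pose r := (8 * L)^-1.
have L1 : 1 <= L by rewrite /L; lra.
have s0 : 0 <= \sum_j nm (a j) by apply: sumr_ge0 => j _; exact: nm_ge0.
have al_ge1 : 1 <= al by rewrite /al; lra.
have r0 : 0 < r by rewrite /r invr_gt0; lra.
have rL : r * L = 8^-1 by rewrite /r; field; lra.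
have r8 : r <= 8^-1 by rewrite -rL ler_peMr // ltW.
pose e := r / (1000 * L * (al + r + 1)).
have den0 : 0 < 1000 * L * (al + r + 1) by rewrite !mulr_gt0 //; lra.
have e0 : 0 < e by rewrite /e divr_gt0.
have eE : e * L * (al + r + 1) = r / 1000.
 by rewrite /e; field; rewrite !lt0r_neq0 //; lra.
have eL : e * L <= r / 1000.
 rewrite -eE -[leLHS]mulr1; apply: ler_wpM2l; last by lra. by rewrite mulr_ge0 ?(ltW e0) //; lra.
have er : e <= r / 1000.
 by apply: le_trans eL; rewrite ler_peMr // ltW.
have LE : L = 2 * L0 + 1 by [].
have alE : al = 1 + \sum_j nm (a j) by [].
have L_gt0 : 0 < L by lra.
have eLge0 : 0 <= e * L by rewrite mulr_ge0 // ltW.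
have eL4 : 2 * (e * L) <= 2^-1 by lra.
have dl1 : e * L <= 8^-1 by lra.
have L0e : L0 * e <= 8^-1.
 by apply: le_trans dl1; rewrite mulrC ler_pM2l // LE; lra.
have e1 : e <= 1 by lra.
clearbody L al r e.
exists e => // c ce i A1 A1e.
have cL k j (x : 'rV[R]_4) : k != j ->
  nm x <= L * (nm (x *m (c k)^T) + nm (x *m (c j)^T)).
 move=> kj; have h := aL _ _ x kj. have close l : nm (x *m (a l)^T) <= nm (x *m (c l)^T) + e * nm x.
  have h1 := nmBr (x *m (a l)^T) (x *m (c l)^T). have h2 : nm (x *m (c l)^T - x *m (a l)^T) <= e * nm x.
   rewrite -mulmxBr -linearB /= mulrC; apply: le_trans (nmM _ _) _. by rewrite ler_wpM2l ?nm_ge0 // nm_tr.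
  clear - h1 h2; lra.
 have hk := close k; have hj := close j. set u := nm (x *m (c k)^T) in hk *; set v := nm (x *m (c j)^T) in hj *.
 have h3 : L0 * (nm (x *m (a k)^T) + nm (x *m (a j)^T)) <= L0 * (u + v + 2 * (e * nm x)).
  by rewrite ler_pM2l //; clear - hk hj; lra.
 have h4 : L0 * (e * nm x) <= 8^-1 * nm x.
  rewrite mulrA ler_wpM2r ?nm_ge0 //.
 have uv0 : 0 <= u + v by rewrite addr_ge0 ?nm_ge0. have uv1 : 0 <= L0 * (u + v) by rewrite mulr_ge0 ?(ltW L00).
 have -> : L * (u + v) = 2 * (L0 * (u + v)) + (u + v) by rewrite LE; ring. clear - h h3 h4 uv1 uv0; lra.
have cal j : nm (c j) <= al.
 have h := nmD (c j - a j) (a j); rewrite subrK in h. have := ce j; have : nm (a j) <= \sum_j nm (a j).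
  by rewrite (bigD1 j) //= lerDl; apply: sumr_ge0 => l _; exact: nm_ge0.
 rewrite alE; clear - h e1; lra.
have A1al : nm A1 <= al.
 have h := nmD (A1 - a i) (a i); rewrite subrK in h. have : nm (a i) <= \sum_j nm (a j).
  by rewrite (bigD1 i) //= lerDl; apply: sumr_ge0 => l _; exact: nm_ge0.
 rewrite alE; clear - h e1 A1e; lra.
have D2e : nm (A1 - c i) <= 2 * e.
 have := nmB (A1 - a i) (c i - a i); rewrite opprB addrA subrK => h. have := ce i; clear - h A1e; lra.
have [j ij] : exists j : 'I_n, i != j.
 have [i0|i0] := eqVneq (val i) 0%N.
  by exists (Ordinal n1); rewrite -val_eqE /= i0.
 by exists (Ordinal (ltn_trans (ltn0Sn 0) n1)); rewrite -val_eqE.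
pose C : 'M[R]_4 := row_mx (c i)^T (c j)^T.
have nC (x : 'rV[R]_4) : nm x <= L * nm (x *m C).
 by rewrite nm_mulmx_row; exact: cL.
have kerP (N : 'M[R]_4) : (forall x : 'rV[R]_4, x *m N = 0 -> x = 0) -> N \in unitmx.
 move=> N0; rewrite -row_free_unit -kermx_eq0; apply/eqP/row_matrixP => k.
 by rewrite row0; apply: N0; rewrite -row_mul mulmx_ker row0.
have Cu : C \in unitmx.
 apply: kerP => x xC; apply/eqP; rewrite -nm_eq0 eq_le nm_ge0 andbT.
 by apply: le_trans (nC x) _; rewrite xC nm0 mulr0.
(* A section of the form [c i] bounded by L. With D = A1 - c i the map G = 1 + D^T K takes (c i)^T
   to A1^T and is as close to 1 as e L. *)
pose K : 'M[R]_(2, 4) := @usubmx R 2 2 4 (invmx C).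
have KA : K *m (c i)^T = 1%:M.
 have : K *m row_mx (c i)^T (c j)^T = row_mx 1%:M 0 :> 'M[R]_(2, 2 + 2).
  transitivity (usubmx (invmx C *m C : 'M[R]_(2 + 2, 4))).
   exact: (@mul_usub_mx _ 2 2 4 4 (invmx C) C).
  by rewrite mulVmx // (scalar_mx_block 2 2 1) /block_mx col_mxKu.
 by rewrite mul_mx_row => /eq_row_mx[].
have nK (x : 'rV[R]_2) : nm (x *m K) <= L * nm x.
 have -> : x *m K = row_mx x 0 *m invmx C.
  by rewrite -[invmx C in RHS](@vsubmxK _ 2 2) mul_row_col mul0mx addr0.
 apply: le_trans (nC _) _; rewrite mulmxKV //. have -> : nm (row_mx x 0 : 'rV[R]_4) = nm x.
  by apply: etrans (@nm_row R 2 2 1 x 0) _; rewrite nm0 addr0.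
 by [].
pose D := A1 - c i; pose G : 'M[R]_4 := 1%:M + D^T *m K.
have dG0 (x : 'rV[R]_4) : nm (x *m G - x) <= 2 * (e * L) * nm x.
 rewrite mulmxDr mulmx1 addrAC subrr add0r mulmxA; apply: le_trans (nK _) _.
 have h1 : nm (x *m D^T) <= nm x * (2 * e).
  by apply: le_trans (nmM _ _) _; rewrite ler_wpM2l ?nm_ge0 // nm_tr.
 have -> : 2 * (e * L) * nm x = L * (nm x * (2 * e)) by ring. by rewrite ler_pM2l //.
have Gu : G \in unitmx.
 apply: kerP => x xG; apply/eqP; rewrite -nm_eq0 eq_le nm_ge0 andbT. have := dG0 x; rewrite xG sub0r nmN => h.
 have : 2 * (e * L) * nm x <= 2^-1 * nm x.
  rewrite ler_wpM2r ?nm_ge0 //.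
 clear - h; lra.
have dGe (x : 'rV[R]_4) : nm (x *m G - x) <= 4 * (e * L) * nm x.
 apply: le_trans (dG0 x) _; rewrite ler_wpM2r ?nm_ge0 //. have : 0 <= e * L by []. clear - r0; lra.
have dM (x : 'rV[R]_4) : nm (x *m invmx G - x) <= 4 * (e * L) * nm x.
 set y := x *m invmx G. have xE : x = y *m G by rewrite /y mulmxKV. have h := dG0 y; rewrite -xE -nmN opprB in h.
 have h1 := nmD (y - x) x; rewrite subrK in h1.
 have h2 : 2 * (e * L) * nm y <= 2^-1 * nm y by rewrite ler_wpM2r ?nm_ge0 //.
 have h3 : nm y <= 2 * nm x by (clear - h h1 h2; lra). have h4 : 2 * (e * L) * nm y <= 2 * (e * L) * (2 * nm x).
  by rewrite ler_wpM2l // mulr_ge0.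
 have -> : 4 * (e * L) * nm x = 2 * (e * L) * (2 * nm x) by ring. clear - h h4; lra.
have d0 : 0 <= 4 * (e * L) by rewrite mulr_ge0.
have dal1 : 4 * (e * L) * (al + r) <= r / 250.
 have -> : r / 250 = 4 * (e * L) * (al + r + 1) by rewrite -mulrA eE; field.
 by rewrite ler_wpM2l //; clear - r0; lra.
have dal2 : 4 * (e * L) * al <= r / 250.
 by apply: le_trans dal1; rewrite ler_wpM2l //; clear - r0; lra.
apply: (@heq_move n c i A1 r al (4 * (e * L)) (invmx G) G) => //.
- move=> l x li h; have := cL _ _ x li.
 set u := nm (x *m (c l)^T); set v := nm (x *m (c i)^T) in h * => h1.
 have h2 : L * (u + v) <= L * (u + 2 * r * nm x) by rewrite ler_pM2l //; clear - h; lra.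
 have h3 : L * (u + 2 * r * nm x) = L * u + 4^-1 * nm x.
  have -> : L * (u + 2 * r * nm x) = L * u + 2 * (r * L) * nm x by ring. by rewrite rL; congr (_ + _ * _); field.
 have h4 : r * nm x <= r * (L * u + 4^-1 * nm x).
  by rewrite ler_pM2l //; clear - h1 h2 h3; lra.
 have h5 : r * (L * u + 4^-1 * nm x) = 8^-1 * u + 4^-1 * (r * nm x).
  by rewrite -rL; ring.
 have u0 : 0 <= u := nm_ge0 _. clear - u0 h4 h5; lra.
- by rewrite mulVmx.
- by rewrite mulmxV.
- have GA : G *m (c i)^T = A1^T.
  rewrite mulmxDl mul1mx -mulmxA KA mulmx1 /D linearB /=. by rewrite addrC subrK.
 by rewrite -GA mulmxA mulVmx // mul1mx.
- by rewrite mulmxDl mul1mx -mulmxA KA mulmx1 /D linearB /= addrC subrK.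
- move=> x; rewrite -mulmxBr -linearB /= mulrC; apply: le_trans (nmM _ _) _.
 rewrite ler_wpM2l ?nm_ge0 // nm_tr; apply: le_trans D2e _; clear - er r0; lra.
- clear - dl1; lra.
- clear - dal2 r0; lra.
- clear - dal1 r0; lra.
- exact: ltn_trans n1.
Qed.

Lemma heq_near n (a : forms R n) : is_cfg a -> (1 < n)%N ->
 exists2 e, 0 < e & forall c, (forall j, nm (c j - a j) <= e) -> heq a c.
move=> ca n1; have [e e0 H] := heq_near_one ca n1; exists e => // c ce.
pose m k : forms R n := fun j => if (j < k)%N then c j else a j.
have mk k j : nm (m k j - a j) <= e.
 rewrite /m; case: ifP => _ //; rewrite subrr. by apply: le_trans (ltW e0); rewrite le_eqVlt nm_eq0 eqxx.
suff Hk k : (k <= n)%N -> heq a (m k).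
 have := Hk n (leqnn n); rewrite (_ : m n = c) //. by apply/funext => j; rewrite /m ltn_ord.
elim: k => [|k IH] kn.
 by rewrite (_ : m 0%N = a) //; exact: heq_refl.
apply: heqT (IH (ltnW kn)) _.
have -> : m k.+1 = update (m k) (Ordinal kn) (c (Ordinal kn)).
 apply/funext => j; rewrite /update /m ltnS leq_eqVlt -val_eqE /=.
 by case: eqP => //= jk; congr (c _); apply: val_inj.
exact: H.
Qed.

Lemma mxpath_near n (g : R -> forms R n) t e : mxpath g -> 0 < e ->
 exists2 d, 0 < d & forall s, `|s - t| < d -> forall j, nm (g s j - g t j) <= e.
move=> cg e0; pose F s := \sum_j nm (g s j - g t j).
have cF : continuous F.
 apply: cts_sum => j; apply: cts_nm => r k. cts_mx.
 by apply: ctsB; [exact: cg|exact: ctsC].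
have [d d0 H] := cts_near t cF e0; exists d => // s /H + j.
have -> : F t = 0.
 by rewrite /F big1 // => k _; apply/eqP; rewrite nm_eq0 subrr.
rewrite subr0 => /ltW Fs; apply: le_trans (le_trans (ler_norm _) Fs).
by rewrite /F (bigD1 j) //= lerDl; apply: sumr_ge0 => k _; exact: nm_ge0.
Qed.

Lemma conn_heq n (a b : forms R n) : (1 < n)%N ->
 conn a b -> heq a b.
move=> n1 [g [cg ag g0 g1]]; rewrite -g1.
apply: (@itv_const R (fun t => heq a (g t))); last first.
 by rewrite g0; exact: heq_refl.
move=> t _; have [e e0 H] := heq_near (ag t) n1.
have [d d0 H'] := mxpath_near t cg e0; exists d; first exact: d0.
move=> s _ sd; have h := H _ (H' _ sd).
split=> h'; first exact: heqT h' (heqC h).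
exact: heqT h' h.
Qed.

End Configurations.

(** * Changes of coordinates and the chart with one plane at infinity *)

Section Plane.
Variable R : realType.
Implicit Types n : nat.

Lemma cross_mul (P P' : 'M[R]_2) (a b : 'M[R]_(2, 4)) :
 cross (P *m a) (P' *m b) = \det P * \det P' * cross a b.
rewrite /cross -(@det_ublock _ 2 2 P 0 P').
apply: etrans (det_mulmx (block_mx P 0 0 P' : 'M[R]_4) (col_mx a b)); congr (\det _).
by apply: etrans (esym (mul_block_col P 0 0 P' a b)); rewrite !mul0mx addr0 add0r.
Qed.

Lemma cross_mulr (g : 'M[R]_4) (a b : 'M[R]_(2, 4)) :
 cross (a *m g) (b *m g) = cross a b * \det g.
by rewrite /cross -det_mulmx -mul_col_mx. Qed.

Lemma cross_sym (a b : 'M[R]_(2, 4)) : cross a b = cross b a.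
have e : col_mx b a = block_mx 0 1%:M 1%:M 0 *m col_mx a b :> 'M[R]_(2 + 2, 4).
 by rewrite mul_block_col !mul0mx !mul1mx addr0 add0r.
have d : \det (block_mx 0 1%:M 1%:M 0 : 'M[R]_(2 + 2)) = 1.
 rewrite (_ : block_mx 0 1%:M 1%:M 0 =
  block_mx 1%:M 1%:M 0 1%:M *m block_mx 1%:M 0 (- 1%:M) 1%:M *m
  block_mx 1%:M 1%:M 0 1%:M *m block_mx (- 1%:M) 0 0 1%:M); last first.
  rewrite !mulmx_block !mulmx0 !mul0mx !mulmx1 !mul1mx !addr0 !add0r.
  by rewrite !mulmxN !mulmx1 !opprK !subrr oppr0 add0r addNr.
 rewrite !det_mulmx !det_ublock det_lblock !det1 !mulr1 !mul1r. by rewrite -scaleN1r detZ det1 mulr1 sqrrN expr1n.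
apply: esym; apply: etrans (congr1 (fun M : 'M[R]_(2 + 2, 4) => \det (M : 'M_4)) e) _.
rewrite -[RHS]mul1r -[X in _ = X * _]d.
exact: (det_mulmx (@block_mx R 2 2 2 2 0 1%:M 1%:M 0) (@col_mx R 2 2 4 a b)).
Qed.

(** Isotopy of the labelled planes rather than of their forms: at the end each pair of forms may be
    replaced by another basis, of either orientation. *)
Definition eqv n (a b : forms R n) : Prop :=
 exists P : 'I_n -> 'M[R]_2, (forall i, \det (P i) != 0) /\
  conn a (fun i => P i *m b i).

Lemma conn_mul n (P : 'I_n -> 'M[R]_2) (a b : forms R n) :
 (forall i, \det (P i) != 0) -> conn a b ->
 conn (fun i => P i *m a i) (fun i => P i *m b i).
move=> dP [g [cg gc g0 g1]]; exists (fun t i => P i *m g t i); split.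
- by move=> i r k; apply: cts_mulmx => ? ?; [exact: ctsC|exact: cg].
- by move=> t i j ij; rewrite cross_mul !mulf_neq0 // gc.
- by rewrite g0.
- by rewrite g1.
Qed.

Lemma conn_eqv n (a b : forms R n) : conn a b -> eqv a b.
move=> ab; exists (fun=> 1%:M); split=> [i|]; first by rewrite det1 oner_neq0.
by under eq_fun do rewrite mul1mx.
Qed.

Lemma eqv_mul n (P : 'I_n -> 'M[R]_2) (a : forms R n) :
 (forall i, \det (P i) != 0) -> is_cfg a -> eqv a (fun i => P i *m a i).
move=> dP ca; exists (fun i => invmx (P i)); split=> [i|].
 by rewrite det_inv invr_eq0.
rewrite (_ : (fun i => _) = a); first exact: pconn_refl.
by apply/funext => i; rewrite mulKmx // unitmxE unitfE.
Qed.

Lemma eqv_trans n (a b c : forms R n) : eqv a b -> eqv b c -> eqv a c.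
move=> [P [dP ab]] [P' [dP' bc]]; exists (fun i => P i *m P' i); split=> [i|].
 by rewrite det_mulmx mulf_neq0.
apply: pconnT ab _; have := conn_mul dP bc.
by rewrite (_ : (fun i => P i *m P' i *m c i) = fun i => P i *m (P' i *m c i)) //;
 apply/funext => i; rewrite mulmxA.
Qed.

Lemma eqv_sym n (a b : forms R n) : eqv a b -> eqv b a.
move=> [P [dP ab]]; exists (fun i => invmx (P i)); split=> [i|].
 by rewrite det_inv invr_eq0.
have dP' i : \det (invmx (P i)) != 0 by rewrite det_inv invr_eq0.
have := conn_mul dP' (pconn_sym ab); rewrite (_ : (fun i => _ *m (_ *m b i)) = b) //.
by apply/funext => i; rewrite mulKmx // unitmxE unitfE.
Qed.

Lemma eqv_refl n (a : forms R n) : is_cfg a -> eqv a a.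
by move=> ca; apply: conn_eqv; exact: pconn_refl. Qed.

Lemma conn_gl n (a : forms R n) (g : 'M[R]_4) : is_cfg a ->
 0 < \det g -> conn a (fun i => a i *m g).
move=> ca /gl_conn_pos/pconn_sym[h [ch dh h0 h1]].
exists (fun t i => a i *m h t tt); split.
- by move=> i r k; apply: cts_mulmx => ? ?; [exact: ctsC|exact: ch].
- by move=> t i j ij; rewrite cross_mulr mulf_neq0 // ca.
- by apply/funext => i; rewrite h0 mulmx1.
- by rewrite h1.
Qed.

Lemma conn_sub m n (s : 'I_m -> 'I_n) (a b : forms R n) :
 injective s -> conn a b -> conn (a \o s) (b \o s).
move=> sI [g [cg gc g0 g1]]; exists (fun t i => g t (s i)); split.
- by move=> i r k; exact: cg.
- by move=> t i j ij; rewrite gc // (inj_eq sI).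
- by rewrite g0.
- by rewrite g1.
Qed.

Lemma eqv_sub m n (s : 'I_m -> 'I_n) (a b : forms R n) :
 injective s -> eqv a b -> eqv (a \o s) (b \o s).
move=> sI [P [dP ab]]; exists (P \o s); split=> [i|]; first exact: dP.
have := conn_sub sI ab; exact.
Qed.

Lemma zero_locus_mul (P : 'M[R]_2) (a : 'M[R]_(2, 4)) : \det P != 0 ->
 zero_locus (P *m a) = zero_locus a.
move=> dP; apply/vspaceP => x; rewrite !mem_zero_locus trmx_mul mulmxA.
have Pu : P^T \in unitmx by rewrite unitmx_tr unitmxE unitfE.
apply/eqP/eqP => [h|->]; last by rewrite mul0mx.
by rewrite -[x *m a^T](mulmxK Pu) h mul0mx.
Qed.

Lemma eqv_heq n (a b : forms R n) : (1 < n)%N ->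
 eqv a b -> heq a b.
move=> n1 [P [dP ab]]; have := conn_heq n1 ab.
have e : loci (fun i => P i *m b i) = loci b.
 by apply/funext => i; exact: zero_locus_mul.
by rewrite /heq e.
Qed.

Lemma locally_sign (f : R -> R) : continuous f -> (forall t, f t != 0) ->
 Num.sg (f 0) = Num.sg (f 1).
move=> cf f0; apply: (@itv_const R (fun t => Num.sg (f 0) = Num.sg (f t))) => // t _.
have ft : 0 < `|f t| by rewrite normr_gt0.
have [d d0 H] := cts_near t cf ft; exists d => // s _ /H h.
suff -> : Num.sg (f s) = Num.sg (f t) by [].
move: h; have [p|p|p] := ltgtP (f t) 0; last by move: (f0 t); rewrite p eqxx.
 by rewrite (ltr0_norm p) ltr_distl => /andP[_ h]; rewrite !ltr0_sg //; lra.
by rewrite (gtr0_norm p) ltr_distl => /andP[h _]; rewrite !gtr0_sg //; lra.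
Qed.

Lemma conn_sg n (a b : forms R n) i j : i != j -> conn a b ->
 Num.sg (cross (a i) (a j)) = Num.sg (cross (b i) (b j)).
move=> ij [g [cg gc <- <-]].
apply: (locally_sign (f := fun t => cross (g t i) (g t j))) => [|t]; last exact: gc.
apply: cts_det => r k.
have [r' ->|r' ->] := split_ordP (r : 'I_(2 + 2)).
 by apply: (ctsE (g := fun t => g t i r' k)) => [t|]; [rewrite (@col_mxEu _ 2 2 4)|exact: cg].
by apply: (ctsE (g := fun t => g t j r' k)) => [t|]; [rewrite (@col_mxEd _ 2 2 4)|exact: cg].
Qed.

Definition at_infinity : 'M[R]_(2, 4) := @row_mx R 2 2 2 0 1%:M.
Definition graph_form (X : 'M[R]_2) : 'M[R]_(2, 4) := @row_mx R 2 2 2 1%:M X.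

(** Planes transverse to the one at infinity are graphs, that is, points of M_2(R); by [cross_graph]
    two of them are compared through the determinant of their difference. *)
Definition chart n (x : 'I_n -> 'M[R]_2) : forms R n.+1 :=
 fun i => oapp (fun j => graph_form (x j)) at_infinity (unlift ord0 i).

Lemma chart0 n (x : 'I_n -> 'M[R]_2) : chart x ord0 = at_infinity.
by rewrite /chart unlift_none. Qed.

Lemma chartS n (x : 'I_n -> 'M[R]_2) j : chart x (lift ord0 j) = graph_form (x j).
by rewrite /chart liftK. Qed.

Lemma cross_inf_form (P Q : 'M[R]_2) :
 cross at_infinity (@row_mx R 2 2 2 P Q) = \det P.
rewrite cross_sym /cross /at_infinity (_ : col_mx _ _ = block_mx P Q 0 1%:M :> 'M[R]_(2 + 2)); last by [].
by rewrite (@det_ublock _ 2 2) det1 mulr1.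
Qed.

Lemma cross_graph (X Y : 'M[R]_2) :
 cross (graph_form X) (graph_form Y) = \det (Y - X).
rewrite /cross /graph_form.
have e : block_mx 1%:M 0 (- 1%:M) 1%:M *m block_mx 1%:M X 1%:M Y =
  block_mx 1%:M X 0 (Y - X) :> 'M[R]_(2 + 2).
 rewrite (@mulmx_block _ 2 2 2 2 2 2) !mul0mx !mul1mx ?mulmx1 !addr0.
 by rewrite !mulNmx !mul1mx addNr [- X + _]addrC.
have := congr1 (fun M : 'M[R]_(2 + 2) => \det M) e.
by rewrite det_mulmx (@det_lblock _ 2 2) (@det_ublock _ 2 2) !det1 !mul1r.
Qed.

Definition is_pts n (x : 'I_n -> 'M[R]_2) : Prop :=
 forall i j, i != j -> \det (x i - x j) != 0.

Definition pts_conn n (x y : 'I_n -> 'M[R]_2) : Prop := pconn (@is_pts n) x y.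

Lemma det2N (X : 'M[R]_2) : \det (- X) = \det X.
by rewrite -scaleN1r detZ sqrrN expr1n mul1r. Qed.

Lemma is_cfg_chart n (x : 'I_n -> 'M[R]_2) : is_pts x -> is_cfg (chart x).
move=> px i j; case: (unliftP ord0 i) => [i'|] ->; case: (unliftP ord0 j) => [j'|] ->.
- rewrite (inj_eq lift_inj) !chartS cross_graph -det2N opprB => /px.
 by [].
- by rewrite chartS chart0 cross_sym cross_inf_form det1 oner_neq0.
- by rewrite chartS chart0 cross_inf_form det1 oner_neq0.
- by rewrite eqxx.
Qed.

Lemma pts_conn_chart n (x y : 'I_n -> 'M[R]_2) :
 pts_conn x y -> conn (chart x) (chart y).
move=> [g [cg gp g0 g1]]; exists (fun t => chart (g t)); split.
- move=> i r k; case: (unliftP ord0 i) => [i'|] ->; last first.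
  by apply: (ctsE (g := fun=> at_infinity r k)) => [t|]; [rewrite chart0|exact: ctsC].
 have [k' ->|k' ->] := split_ordP (k : 'I_(2 + 2)).
  apply: (ctsE (g := fun t => (1%:M : 'M[R]_2) r k')) => [t|]; last exact: ctsC.
  by rewrite chartS /graph_form (@row_mxEl R 2 2 2).
 apply: (ctsE (g := fun t => g t i' r k')) => [t|]; last exact: cg.
 by rewrite chartS /graph_form (@row_mxEr R 2 2 2).
- by move=> t; exact: is_cfg_chart.
- by rewrite g0.
- by rewrite g1.
Qed.

(** The inverse of [C] has positive determinant, hence is joined to 1, and it takes the plane 0 to
    infinity. The left blocks of the other forms then have positive determinants and are contracted
    to 1, each on its own. *)
Lemma chart_normal n (a : forms R n.+1) : (0 < n)%N -> is_cfg a ->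
 (forall j, 0 < cross (a ord0) (a (lift ord0 j))) ->
 exists2 x : 'I_n -> 'M[R]_2, is_pts x & conn a (chart x).
move=> n0 ca a0; pose j0 := lift ord0 (Ordinal n0) : 'I_n.+1.
pose C : 'M[R]_4 := @col_mx R 2 2 4 (a j0) (a ord0).
have dC : 0 < \det C by rewrite -/(cross _ _) cross_sym a0.
have Cu : C \in unitmx by rewrite unitmxE unitfE lt0r_neq0.
have dg : 0 < \det (invmx C) by rewrite det_inv invr_gt0.
have h1 := conn_gl ca dg.
have ainf : a ord0 *m invmx C = at_infinity.
 have : @dsubmx R 2 2 4 (C *m invmx C) = at_infinity.
  by rewrite mulmxV // (scalar_mx_block 2 2 1) /block_mx col_mxKd.
 by rewrite -(@mul_dsub_mx _ 2 2 4 4) /C col_mxKd.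
pose P j : 'M[R]_2 := @lsubmx R 2 2 2 (a (lift ord0 j) *m invmx C).
pose Q j : 'M[R]_2 := @rsubmx R 2 2 2 (a (lift ord0 j) *m invmx C).
have PQ j : a (lift ord0 j) *m invmx C = @row_mx R 2 2 2 (P j) (Q j).
 by rewrite /P /Q (@hsubmxK _ 2 2 2).
have dP j : 0 < \det (P j).
 by rewrite -(cross_inf_form (P j) (Q j)) -PQ -ainf cross_mulr mulr_gt0.
have Pu j : P j \in unitmx by rewrite unitmxE unitfE lt0r_neq0.
pose x j := invmx (P j) *m Q j.
have gP j : gl_conn 1%:M (invmx (P j)).
 by apply/gl_conn_sym/gl_conn_pos; rewrite det_inv invr_gt0.
have /choice[h hP] : forall j, exists h : R -> unit -> 'M[R]_2,
  [/\ mxpath h, forall t, \det (h t tt) != 0, h 0 = (fun=> 1%:M) &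
   h 1 = (fun=> invmx (P j))].
 by move=> j; have [h [? ? ? ?]] := gP j; exists h.
pose Z t i := oapp (fun j => h j t tt) 1%:M (unlift ord0 i).
have h2 : conn (fun i => a i *m invmx C) (chart x).
 exists (fun t i => Z t i *m (a i *m invmx C)); split.
 - move=> i r k; apply: cts_mulmx => r' k'; last exact: ctsC.
  rewrite /Z; case: (unlift ord0 i) => [i'|] /=; last exact: ctsC. by have [ch _ _ _] := hP i'; exact: ch.
 - move=> t i j ij; rewrite cross_mul !mulf_neq0 //.
  + rewrite /Z; case: (unliftP ord0 i) => [i'|] _ /=; last by rewrite det1 oner_neq0.
   by have [_ dh _ _] := hP i'; exact: dh.
  + rewrite /Z; case: (unliftP ord0 j) => [i'|] _ /=; last by rewrite det1 oner_neq0.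
   by have [_ dh _ _] := hP i'; exact: dh.
  + by rewrite cross_mulr mulf_neq0 ?ca // lt0r_neq0.
 - apply/funext => i; rewrite /Z; case: (unliftP ord0 i) => [i'|] _ /=; rewrite ?mul1mx //.
  by have [_ _ -> _] := hP i'; rewrite mul1mx.
 - apply/funext => i; rewrite /Z; case: (unliftP ord0 i) => [i'|] -> /=.
   have [_ _ _ ->] := hP i'; rewrite PQ chartS /graph_form. by rewrite (@mul_mx_row _ 2 2 2 2) mulVmx.
  by rewrite mul1mx ainf chart0.
exists x; last exact: pconnT h1 h2.
move=> i j ij; have [g [_ gc _ g1]] := h2.
have := gc 1 (lift ord0 j) (lift ord0 i); rewrite g1 !chartS cross_graph.
by apply; rewrite (inj_eq lift_inj) eq_sym.
Qed.

End Plane.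

(** * Points in two classes: negative determinants inside, positive across *)

Section TwoClasses.
Variable R : realType.

Lemma det2E (X : 'M[R]_2) : \det X = X 0 0 * X 1 1 - X 0 1 * X 1 0.
rewrite (expand_det_row _ ord0) !big_ord_recl big_ord0 /cofactor !det_mx11 !mxE.
have l1 : lift ord0 ord0 = 1 :> 'I_2 by exact: val_inj.
have l0 : lift 1 ord0 = 0 :> 'I_2 by exact: val_inj.
by rewrite !ord1 l1 l0 /= expr0 expr1; ring.
Qed.

(** The bilinear form with [polar X X] equal to 2 det X. *)
Definition polar (X Y : 'M[R]_2) : R :=
 X 0 0 * Y 1 1 + Y 0 0 * X 1 1 - X 0 1 * Y 1 0 - Y 0 1 * X 1 0.

Lemma det_lin (s : R) (X Y : 'M[R]_2) :
 \det (s *: X + Y) = s ^+ 2 * \det X + s * polar X Y + \det Y.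
by rewrite !det2E !mxE /polar; ring. Qed.

Variable n : nat.
Implicit Types (x y : 'I_n -> 'M[R]_2) (p : pred 'I_n).

Definition class_pts p y : Prop :=
 forall i j, i != j -> p i = p j -> \det (y i - y j) != 0.

Definition shift p (s : R) (u : 'M[R]_2) y : 'I_n -> 'M[R]_2 :=
 fun i => if p i then s *: u + y i else y i.

Lemma bounded01 (f : R -> R) : continuous f -> exists B, forall t, 0 <= t <= 1 -> f t <= B.
move=> cf; have [|c _ cmax] := @EVT_max R f 0 1 ler01.
 by apply: continuous_subspaceT => t; exact: cf.
by exists (f c) => t t01; apply: cmax; rewrite in_itv.
Qed.

Lemma shift_det p s u y i j :
 \det (shift p s u y i - shift p s u y j) =
 (if p i == p j then 0 else s ^+ 2 * \det u + s * polar u (if p i then y i - y j else y j - y i)) +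
 \det (y i - y j).
rewrite /shift; case: (p i) (p j) => -[] /=.
- by rewrite add0r; congr (\det _); rewrite opprD addrACA subrr add0r.
- by rewrite -addrA det_lin.
- by rewrite -det2N opprB -addrA det_lin -(det2N (y i - y j)) opprB.
- by rewrite add0r.
Qed.

(** Once one class is moved far away in a direction of nonzero determinant, the term s^2 det u
    dominates every determinant across the classes. Only the conditions inside the classes remain,
    and compactness of the time interval gives one s for the whole path. *)
Lemma shift_conn p u u' y y' : gl_conn u u' -> pconn (class_pts p) y y' ->
 exists B, forall s, B <= s -> pts_conn (shift p s u y) (shift p s u' y').
move=> [g [cg dg g0 g1]] [h [ch dh h0 h1]].
pose w t i j := if p i then h t i - h t j else h t j - h t i.
pose f t := \sum_i \sum_j
 (`|polar (g t tt) (w t i j)| + `|\det (h t i - h t j)|) / `|\det (g t tt)|.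
have cw i j r k : continuous (fun t => w t i j r k).
 by rewrite /w; case: (p i); apply: (ctsE (g := fun t => h t _ r k - h t _ r k)) => [t|];
  rewrite ?mxE //; apply: ctsB; exact: ch.
have cf : continuous f.
 apply: cts_sum => i; apply: cts_sum => j. apply: ctsM.
  apply: ctsD; apply: cts_norm; last first.
   apply: cts_det => r k; cts_mx.
   by apply: ctsB; exact: ch.
  by rewrite /polar; apply: ctsB; [apply: ctsB; [apply: ctsD|]|]; apply: ctsM;
   first [exact: cg|exact: cw].
 apply: ctsV => [t|]; first by rewrite normr_eq0 dg. by apply: cts_norm; apply: cts_det => r k; exact: cg.
have [B HB] := bounded01 cf.
exists (`|B| + 1) => s sB.
have -> : shift p s u y = (fun t => shift p s (g t tt) (h t)) 0 by rewrite /= g0 h0.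
have -> : shift p s u' y' = (fun t => shift p s (g t tt) (h t)) 1 by rewrite /= g1 h1.
apply: (pconn_itv (g := fun t => shift p s (g t tt) (h t))) => [i r k|t t01 i j ij].
 rewrite /shift; case: (p i); last exact: ch.
 cts_mx.
 by apply: ctsD; [apply: ctsM; [exact: ctsC|exact: cg]|exact: ch].
rewrite shift_det; case: (p i =P p j) => [pij|_]; first by rewrite add0r dh.
have fij : (`|polar (g t tt) (w t i j)| + `|\det (h t i - h t j)|) / `|\det (g t tt)| <= B.
 apply: le_trans (HB t t01); rewrite /f (bigD1 i) //= (bigD1 j) //= -addrA.
 by rewrite lerDl addr_ge0 // sumr_ge0 // => k _; rewrite ?sumr_ge0 // => *;
  rewrite divr_ge0 ?addr_ge0.
move: fij; rewrite -/(w t i j) ler_pdivrMr ?normr_gt0 ?dg //.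
have d0 : 0 < `|\det (g t tt)| by rewrite normr_gt0 dg.
move: (polar _ _) (\det (h t i - h t j)) (\det (g t tt)) d0 => P D G d0 PD.
apply/eqP => e.
have : s ^+ 2 * `|G| <= s * `|P| + `|D|.
 have -> : s ^+ 2 * `|G| = `|- (s * P) - D|.
  rewrite (_ : - (s * P) - D = s ^+ 2 * G); last by move: e; lra. by rewrite normrM ger0_norm ?sqr_ge0.
 apply: le_trans (ler_normB _ _) _; rewrite normrN normrM lerD2r.
 by rewrite ger0_norm //; have := normr_ge0 B; move: sB; clear; lra.
apply/negP; rewrite -ltNge.
have B0 := normr_ge0 B; have BB := ler_norm B.
have s1 : 1 <= s by move: sB B0; clear; lra.
have : s * `|P| + `|D| <= s * (`|P| + `|D|).
 rewrite mulrDr lerD2l ler_peMl //.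
have : s * (`|P| + `|D|) <= s * (B * `|G|) by rewrite ler_pM2l //; move: s1; clear; lra.
have : s * (B * `|G|) < s * (s * `|G|).
 by rewrite ltr_pM2l ?ltr_pM2r //; move: s1 sB BB; clear; lra.
by rewrite expr2; move=> h1' h2' h3'; move: h1' h2' h3'; rewrite -mulrA; clear; lra.
Qed.

Definition two_class p x : Prop := forall i j, i != j ->
 if p i == p j then \det (x i - x j) < 0 else 0 < \det (x i - x j).

Lemma shift_start p x : two_class p x -> exists2 u, 0 < \det u &
 forall s, 0 <= s -> pts_conn x (shift p s u x).
move=> px.
have H u : (forall i j, p i -> ~~ p j -> 0 < polar u (x i - x j)) -> 0 < \det u ->
  forall s, 0 <= s -> pts_conn x (shift p s u x).
 move=> Hu du s s0. have -> : x = (fun t => shift p (t * s) u x) 0.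
  by apply/funext => i; rewrite /shift mul0r scale0r add0r if_same.
 rewrite [X in pts_conn _ (shift _ _ _ X)](_ : _ = x); last first.
  by apply/funext => i; rewrite /shift mul0r scale0r add0r if_same.
 have -> : shift p s u x = (fun t => shift p (t * s) u x) 1 by rewrite /= mul1r.
 apply: (pconn_itv (g := fun t => shift p (t * s) u x)) => [i r k|t /andP[t0 t1] i j ij].
  rewrite /shift; case: (p i); last exact: ctsC.
  cts_mx. by cts.
 rewrite shift_det; have := px _ _ ij; case: (p i =P p j) => [pij|pij] d.
  by rewrite add0r; apply: ltr0_neq0.
 apply: lt0r_neq0; apply: ltr_wpDl => //; apply: addr_ge0.
  by rewrite mulr_ge0 ?sqr_ge0 // ltW.
 apply: mulr_ge0; first exact: mulr_ge0.
 have pjE : p j = ~~ p i by move: pij; case: (p i); case: (p j) => // /(_ erefl).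
 by case: ifP => pi; apply: ltW; apply: Hu; rewrite ?pjE pi.
have [i0 pi0|/= nI] := pickP p; last first.
 exists 1%:M; first by rewrite det1 ltr01. by apply: H => [i j|]; rewrite ?nI // det1 ltr01.
have [j0 pj0|/= nJ] := pickP (predC p); last first.
 exists 1%:M; first by rewrite det1 ltr01. by apply: H => [i j _|]; [move: (nJ j) => /= ->|rewrite det1 ltr01].
rewrite /= in pj0.
have ij0 : i0 != j0 by apply: contraNneq pj0 => <-.
have du : 0 < \det (x i0 - x j0) by have := px _ _ ij0; rewrite pi0 (negbTE pj0).
(* The difference of one point from each class is a good direction: the identity below writes the
   polar form as a sum of two positive and two nonnegative terms. *)
exists (x i0 - x j0) => //; apply: H => // i j pi pj.
have -> : polar (x i0 - x j0) (x i - x j) =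
  \det (x i - x j0) + \det (x i0 - x j) - \det (x i - x i0) - \det (x j - x j0).
 by rewrite !det2E /polar !mxE; ring.
have ge k l : p k = p l -> \det (x k - x l) <= 0.
 move=> kl; have [->|kl'] := eqVneq k l; first by rewrite subrr det0. by have := px _ _ kl'; rewrite kl eqxx => /ltW.
have lt k l : p k -> ~~ p l -> 0 < \det (x k - x l).
 move=> pk pl; have kl : k != l by apply: contraNneq pl => <-. by have := px _ _ kl; rewrite pk (negbTE pl).
have h1 := lt _ _ pi pj0; have h2 := lt _ _ pi0 pj.
have h3 : \det (x i - x i0) <= 0 by apply: ge; rewrite pi pi0.
have h4 : \det (x j - x j0) <= 0 by apply: ge; rewrite (negbTE pj) (negbTE pj0).
by move: h1 h2 h3 h4; clear; lra.
Qed.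

(** The traceless symmetric matrices, a plane on which det is negative definite. *)
Definition refl2 (c d : R) : 'M[R]_2 := \matrix_(i, j)
 (if i == 0 then if j == 0 then c else d else if j == 0 then d else - c).

Lemma det_refl2 c d : \det (refl2 c d) = - (c ^+ 2 + d ^+ 2).
by rewrite det2E !mxE /=; ring. Qed.

Lemma refl2B c d c' d' : refl2 c d - refl2 c' d' = refl2 (c - c') (d - d').
apply/matrixP => i j; rewrite !mxE; case: (i == 0); case: (j == 0) => //.
by rewrite opprB opprK addrC.
Qed.

Lemma class_seg p (g : R -> 'I_n -> 'M[R]_2) : mxpath g ->
 (forall t i j, 0 <= t <= 1 -> i != j -> p i = p j -> \det (g t i - g t j) != 0) ->
 pconn (class_pts p) (g 0) (g 1).
by move=> cg Hg; apply: pconn_itv => // t t01 i j; exact: Hg. Qed.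

Lemma refl2_neq0 c d : (c != 0) || (d != 0) -> \det (refl2 c d) != 0.
move=> cd; rewrite det_refl2 oppr_eq0 paddr_eq0 ?sqr_ge0 // !sqrf_eq0.
by rewrite negb_and.
Qed.

Lemma refl2_path (c d : R -> 'I_n -> R) :
 (forall i, continuous (c^~ i)) -> (forall i, continuous (d^~ i)) ->
 mxpath (fun t i => refl2 (c t i) (d t i)).
move=> cc cd i r k; apply: (ctsE (g := fun t =>
 if r == 0 then if k == 0 then c t i else d t i else if k == 0 then d t i else - c t i)). by move=> t; rewrite mxE.
by case: (r == 0); case: (k == 0) => //; try exact: cc; try exact: cd; apply: ctsN; exact: cc.
Qed.

Definition std_line (i : 'I_n) : 'M[R]_2 := refl2 i%:R 0.

(** Split M_2 into the positive part (a, a') and the negative part (b, b') of det. Inside a class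
    the negative part dominates, so the positive part can be shrunk away; what remains are distinct
    points of a plane, which can be brought to standard position on a line. *)
Lemma class_std p x : two_class p x -> pconn (class_pts p) x std_line.
move=> px.
pose a i := (x i 0 0 + x i 1 1) / 2; pose a' i := (x i 0 1 - x i 1 0) / 2.
pose b i := (x i 0 0 - x i 1 1) / 2; pose b' i := (x i 0 1 + x i 1 0) / 2.
have dx i j : \det (x i - x j) =
  (a i - a j) ^+ 2 + (a' i - a' j) ^+ 2 - (b i - b j) ^+ 2 - (b' i - b' j) ^+ 2.
 by rewrite det2E !mxE /a /a' /b /b'; field.
have px' i j : i != j -> p i = p j ->
  (a i - a j) ^+ 2 + (a' i - a' j) ^+ 2 < (b i - b j) ^+ 2 + (b' i - b' j) ^+ 2.
 by move=> ij pij; have := px _ _ ij; rewrite pij eqxx dx; lra.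
have bij i j : i != j -> p i = p j -> (b i - b j != 0) || (b' i - b' j != 0).
 move=> ij pij; rewrite -negb_and; apply/negP => /andP[/eqP e1 /eqP e2].
 have := px' _ _ ij pij; rewrite e1 e2 expr0n addr0. by rewrite ltNge addr_ge0 ?sqr_ge0.
have s1 : pconn (class_pts p) x (fun i => refl2 (b i) (b' i)).
 pose g t i := x i - t *: (x i - refl2 (b i) (b' i)).
 have -> : x = g 0 by apply/funext => i; rewrite /g scale0r subr0.
 rewrite [X in pconn _ _ X](_ : _ = g 1); last first.
  by apply/funext => i; rewrite /g scale1r opprB addrC subrK.
 apply: class_seg => [i r k|t i j t01 ij pij].
  apply: (ctsE (g := fun t : R => x i r k - t * (x i r k - refl2 (b i) (b' i) r k))).
   by move=> t; rewrite !mxE.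
  by cts.
 have -> : \det (g t i - g t j) = (1 - t) ^+ 2 * ((a i - a j) ^+ 2 + (a' i - a' j) ^+ 2) -
   ((b i - b j) ^+ 2 + (b' i - b' j) ^+ 2).
  by rewrite det2E /g !mxE /= /a /a' /b /b'; field.
 apply: ltr0_neq0; rewrite subr_lt0; apply: le_lt_trans (px' _ _ ij pij).
 case/andP: t01 => t0 t1; rewrite ler_piMl ?addr_ge0 ?sqr_ge0 //. by rewrite exprn_ile1 ?subr_ge0 // lerBlDr lerDl.
(* [K] exceeds the slope between any two of the points. On the straight way to the line of slope K,
   two points could only meet if their slope were K; a pair with equal b is kept apart by the first
   coordinate. *)
pose K := \sum_i \sum_j `|(b' i - b' j) / (b i - b j)| + 1.
have K1 : 1 <= K by rewrite /K lerDr sumr_ge0 // => i _; rewrite sumr_ge0.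
have Kij i j : (b' i - b' j) / (b i - b j) < K.
 apply: le_lt_trans (ler_norm _) _; apply: (@le_lt_trans _ _ (K - 1)); last by lra.
 rewrite /K addrK (bigD1 i) //= (bigD1 j) //= -addrA lerDl addr_ge0 //.
  by rewrite sumr_ge0.
 by rewrite sumr_ge0 // => k _; rewrite sumr_ge0.
have cN (i j : 'I_n) : i != j -> (i%:R - j%:R : R) != 0.
 by move=> ij; rewrite subr_eq0 eqr_nat.
have s2 : pconn (class_pts p) (fun i => refl2 (b i) (b' i))
  (fun i : 'I_n => refl2 i%:R (K * i%:R)).
 pose g (t : R) (i : 'I_n) := refl2 ((1 - t) * b i + t * i%:R) ((1 - t) * b' i + t * (K * i%:R)).
 rewrite [X in pconn _ X _](_ : _ = g 0); last first.
  by apply/funext => i; rewrite /g subr0 !mul1r !mul0r !addr0.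
 rewrite [X in pconn _ _ X](_ : _ = g 1); last first.
  by apply/funext => i; rewrite /g subrr !mul1r !mul0r !add0r.
 apply: class_seg => [|t i j t01 ij pij].
  by apply: refl2_path => i; cts.
 rewrite /g refl2B; apply: refl2_neq0; rewrite -negb_and; apply/negP => /andP[/eqP e1 /eqP e2].
 have {}e1 : (1 - t) * (b i - b j) = - (t * (i%:R - j%:R)) by move: e1; lra.
 have {}e2 : (1 - t) * (b' i - b' j) = - (t * K * (i%:R - j%:R)) by move: e2; lra. have [t0|t0] := eqVneq t 0.
  have /orP[] := bij _ _ ij pij => /eqP; apply.
   by move: e1; rewrite t0 !mul0r; lra.
  by move: e2; rewrite t0 !mul0r; lra.
 have m0 : (1 - t) * (b i - b j) != 0 by rewrite e1 oppr_eq0 mulf_neq0 ?cN.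
 have [n1 n2] : 1 - t != 0 /\ b i - b j != 0 by apply/andP; rewrite -negb_or -mulf_eq0.
 have := Kij i j; suff -> : (b' i - b' j) / (b i - b j) = K by rewrite ltxx.
 apply: (mulIf n2); rewrite divfK //; apply: (mulfI n1). by rewrite e2 mulrCA e1; ring.
have s3 : pconn (class_pts p) (fun i : 'I_n => refl2 i%:R (K * i%:R)) std_line.
 pose g (t : R) (i : 'I_n) := refl2 i%:R ((1 - t) * (K * i%:R)). rewrite [X in pconn _ X _](_ : _ = g 0); last first.
  by apply/funext => i; rewrite /g subr0 !mul1r.
 rewrite [X in pconn _ _ X](_ : _ = g 1); last first.
  by apply/funext => i; rewrite /g subrr mul0r.
 apply: class_seg => [|t i j t01 ij pij].
  by apply: refl2_path => i; cts.
 by rewrite /g refl2B; apply: refl2_neq0; rewrite cN.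
exact: pconnT s1 (pconnT s2 s3).
Qed.

Theorem two_class_conn p x y : two_class p x -> two_class p y -> pts_conn x y.
move=> px py.
have H z : two_class p z -> exists B, forall s, B <= s -> 0 <= s ->
  pts_conn z (shift p s 1%:M std_line).
 move=> pz; have [u du zu] := shift_start pz. have [B HB] := shift_conn (gl_conn_pos du) (class_std pz).
 by exists B => s sB s0; apply: pconnT (zu s s0) (HB s sB).
have [B HB] := H _ px; have [B' HB'] := H _ py.
pose s := `|B| + `|B'|.
have h1 := ler_norm B; have h2 := ler_norm B'; have h3 := normr_ge0 B.
have h4 := normr_ge0 B'.
apply: pconnT (HB s _ _) (pconn_sym (HB' s _ _)); rewrite /s;
 move: h1 h2 h3 h4; clear; lra.
Qed.

End TwoClasses.

(** * Determinants that unfold to polynomials *)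

Section Laplace.
Variable R : comPzRingType.

(** Laplace expansion on functions of natural numbers: for a numeral n it simplifies to an explicit
    polynomial that [ring] and [field] can handle. *)
Fixpoint ddet (n : nat) (M : nat -> nat -> R) : R :=
 if n is m.+1 then
  foldr (fun j acc => (if odd j then - (M 0 j * ddet m (fun i k => M i.+1 (bump j k)))
   else M 0 j * ddet m (fun i k => M i.+1 (bump j k))) + acc)%R 0 (iota 0 n)
 else 1.

Lemma det_ddet n (M : nat -> nat -> R) : \det (\matrix_(i < n, j < n) M i j) = ddet n M.
elim: n M => [|n IH] M; first by rewrite det_mx00.
pose F j := if odd j then - (M 0 j * ddet n (fun i k => M i.+1 (bump j k)))%R
 else (M 0 j * ddet n (fun i k => M i.+1 (bump j k)))%R.
transitivity (\sum_(0 <= j < n.+1) F j)%R; last by rewrite unlock.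
rewrite (expand_det_row _ ord0) big_mkord; apply: eq_bigr => j _.
rewrite /cofactor mxE add0n -signr_odd /F -IH.
have -> : row' ord0 (col' j (\matrix_(i < n.+1, k < n.+1) M i k)) =
  \matrix_(i < n, k < n) M i.+1 (bump j k) :> 'M_n.
 by apply/matrixP => i k; rewrite !mxE.
by case: (odd j); rewrite ?expr1 ?expr0 ?mulN1r ?mul1r ?mulrN.
Qed.

End Laplace.

(** * Symmetric matrices up to congruence *)

Section Congruence.
Variable R : realType.

Lemma row_complete n (v : 'rV[R]_n.+1) : v != 0 ->
 exists2 Z : 'M[R]_n.+1, Z \in unitmx & row 0 Z = v.
move=> v0; have r1 : \rank v = 1%N by apply/eqP; rewrite rank_rV v0.
have := mulmx_ebase v; rewrite r1; set c := col_ebase v; set Z := row_ebase v => e.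
have cu : c \in unitmx by exact: col_ebase_unit.
exists (c 0 0 *: Z).
 by rewrite unitmxZ ?row_ebase_unit // -det_mx11 -unitmxE.
rewrite -[in RHS]e [c]mx11_scalar mul_scalar_mx -scalemxAl; apply/rowP => j.
rewrite !mxE; congr (_ * _); rewrite (bigD1 0) //= big1 ?addr0 => [|i i0].
 by rewrite mxE /= mul1r.
by rewrite mxE /= eq_sym (_ : (i == 0 :> nat) = false) ?mul0r //; apply: negbTE.
Qed.

Lemma sym_nonzero_value n (G : 'M[R]_n) : G^T = G -> G != 0 ->
 exists v : 'rV[R]_n, (v *m G *m v^T) 0 0 != 0.
move=> sG; apply: contraNP => /forallNP H; apply/eqP/matrixP => i j.
have Q0 (v : 'rV[R]_n) : (v *m G *m v^T) 0 0 = 0 by apply/eqP; move: (H v) => /negP; rewrite negbK.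
have E k l : ((delta_mx 0 k : 'rV[R]_n) *m G *m (delta_mx 0 l : 'rV[R]_n)^T) 0 0 = G k l.
 by rewrite -rowE trmx_delta -colE !mxE.
have eD (A B : 'M[R]_1) : (A + B) 0 0 = A 0 0 + B 0 0 by rewrite mxE.
have := Q0 (delta_mx 0 i + delta_mx 0 j).
rewrite linearD /= !mulmxDl !mulmxDr !eD !E.
have := Q0 (delta_mx 0 i); rewrite E => ->; have := Q0 (delta_mx 0 j); rewrite E => ->.
have -> : G j i = G i j by rewrite -[in LHS]sG mxE.
by move=> h; rewrite [RHS]mxE; move: h; clear; lra.
Qed.

Lemma schur_complement n (c : R) (r : 'rV[R]_n) (H : 'M[R]_n) : c != 0 ->
 let Z := block_mx 1%:M 0 (c^-1 *: r^T) 1%:M in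
 block_mx c%:M r r^T H = Z *m block_mx c%:M 0 0 (H - c^-1 *: (r^T *m r)) *m Z^T.
move=> c0 Z; rewrite /Z tr_block_mx !mulmx_block !trmx1 !trmx0.
rewrite !(mulmx0, mul0mx, mulmx1, mul1mx, addr0, add0r) linearZ /= trmxK
 mul_mx_scalar mul_scalar_mx !scalerA mulfV // !scale1r -scalemxAr.
by rewrite addrC subrK.
Qed.

Lemma congruent_diag n (G : 'M[R]_n) : G^T = G ->
 exists (Z : 'M[R]_n) (d : 'rV[R]_n), Z \in unitmx /\ G = Z *m diag_mx d *m Z^T.
elim: n G => [|n IH] G sG.
 by exists 1%:M, 0; split; [exact: unitmx1|apply/matrixP => -[]].
have [->|G0] := eqVneq G 0.
 exists 1%:M, 0; split; first exact: unitmx1.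
 by rewrite (_ : diag_mx 0 = 0) ?mulmx0 ?mul0mx //; apply/matrixP => i j; rewrite !mxE mul0rn.
have [v vG] := sym_nonzero_value sG G0.
have v0 : v != 0 by apply: contraNneq vG => ->; rewrite !mul0mx mxE.
have [Z Zu Zv] := row_complete v0.
pose G1 := Z *m G *m Z^T.
have G1s : G1^T = G1 by rewrite /G1 !trmx_mul trmxK sG mulmxA.
have G100 : G1 0 0 != 0.
 rewrite (_ : G1 0 0 = (v *m G *m v^T) 0 0) // -Zv -row_mul !mxE. by apply: eq_bigr => k _; rewrite !mxE.
pose h := @ulsubmx _ 1 n 1 n G1; pose r := @ursubmx _ 1 n 1 n G1.
have l0 : lshift n (0 : 'I_1) = 0 by exact: val_inj.
have h0 : h 0 0 != 0 by rewrite /h mxE mxE l0.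
have rT : @dlsubmx _ 1 n 1 n G1 = r^T by rewrite /r trmx_ursub G1s.
have eG1 : G1 = block_mx (h 0 0)%:M r r^T (@drsubmx _ 1 n 1 n G1).
 by rewrite -rT -mx11_scalar (@submxK _ 1 n 1 n).
have := schur_complement r (@drsubmx _ 1 n 1 n G1) h0; rewrite -eG1 /=.
set Z1 := block_mx _ _ _ _; set H := _ - _ => eG.
have Hs : H^T = H.
 rewrite /H linearB /= linearZ /= trmx_mul trmxK; congr (_ - _). by rewrite -[in RHS]G1s trmx_drsub.
have [Z2 [d [Z2u e2]]] := IH _ Hs.
have Z1u : Z1 \in unitmx by rewrite unitmxE det_lblock !det1 mulr1 unitr1.
pose Z3 := block_mx 1%:M 0 0 Z2 : 'M[R]_(1 + n).
have Z3u : Z3 \in unitmx by rewrite unitmxE det_ublock det1 mul1r -unitmxE.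
exists (invmx Z *m Z1 *m Z3), (row_mx (h 0 0)%:M d); split.
 by rewrite !unitmx_mul unitmx_inv Zu Z1u Z3u.
have -> : G = invmx Z *m G1 *m (invmx Z)^T.
 by rewrite /G1 trmx_inv !mulmxA mulVmx // mul1mx mulmxK // unitmx_tr.
rewrite eG !trmx_mul !mulmxA; congr (_ *m _); rewrite -!mulmxA; congr (_ *m _).
congr (_ *m _); rewrite !mulmxA; congr (_ *m _).
rewrite (@diag_mx_row _ _ _ (h 0 0)%:M d) /Z3 (@tr_block_mx _ 1 n 1 n) !(@mulmx_block _ 1 n 1 n 1 n) !trmx1 !trmx0 !mulmx1 !mul1mx !mul0mx
 !mulmx0 !addr0 !add0r !mul0mx -e2; congr block_mx.
by apply/matrixP => i j; rewrite !ord1 !mxE.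
Qed.

(** A continuous Gram-Schmidt process. Near [t0] the corner keeps its sign, so its absolute value
    has a continuous nonzero square root, and the Schur complement is again equal to a diagonal of
    signs at [t0]. *)
Lemma local_factor n (e : 'rV[R]_n) (H : R -> 'M[R]_n) (t0 : R) :
 (forall j, e 0 j = 1 \/ e 0 j = -1) ->
 (forall i j, continuous (fun t => H t i j)) -> (forall t, (H t)^T = H t) ->
 H t0 = diag_mx e ->
 exists (d : R) (X : R -> 'M[R]_n), [/\ 0 < d, forall i j, continuous (fun t => X t i j),
  X t0 = 1%:M & forall t, `|t - t0| < d -> H t = X t *m diag_mx e *m (X t)^T].
elim: n e H => [|n IH] e H e1 cH sH H0.
 exists 1, (fun=> 1%:M); split=> //; first by move=> []. by move=> t _; apply/matrixP => -[].
have e00 : e 0 0 * e 0 0 = 1 by case: (e1 0) => ->; rewrite ?mulrNN mulr1.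
have [d1 d10 near1] := cts_near t0 (cH 0 0) (ltr01 : (0 : R) < 1).
(* Time is clamped to an interval around [t0] on which the corner does not vanish. The Schur
   complement is then continuous for all times, as the induction hypothesis requires. *)
pose c t := t0 - d1 / 2 + clip ((t - t0 + d1 / 2) / d1) * d1.
have cc : continuous c.
 rewrite /c; apply: ctsD; first exact: ctsC. apply: ctsM; last exact: ctsC. by apply: ctsO (@clamp_cts R); cts.
have cnear t : `|c t - t0| < d1.
 have := clamp_itv ((t - t0 + d1 / 2) / d1); rewrite /= in_itv /= => /andP[h1 h2].
 rewrite /c; move: (clip _) h1 h2 => u h1 h2. have : u * d1 <= d1 by rewrite ler_piMl // ltW.
 have : 0 <= u * d1 by rewrite mulr_ge0 // ltW. by rewrite ltr_norml; move: d10; clear; lra.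
have cid t : `|t - t0| < d1 / 2 -> c t = t.
 move=> h; rewrite /c clamp_id; first by rewrite divfK ?lt0r_neq0 //; lra.
 move: h; rewrite ltr_norml => /andP[h1 h2].
 by apply/andP; split; [apply: divr_ge0|rewrite ler_pdivrMr // mul1r]; lra.
pose H1 t := H (c t); pose h t := @ulsubmx _ 1 n 1 n (H1 t).
pose r t := @ursubmx _ 1 n 1 n (H1 t).
have ct0 : c t0 = t0 by apply: cid; rewrite subrr normr0 divr_gt0.
have l0 : lshift n (0 : 'I_1) = 0 by exact: val_inj.
have hE t : h t 0 0 = H (c t) 0 0 by rewrite !mxE l0.
have hp t : 0 < e 0 0 * h t 0 0.
 have := near1 _ (cnear t); rewrite hE H0 !mxE eqxx mulr1n.
 by case: (e1 0) => ->; rewrite ltr_norml => /andP[? ?]; lra.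
have h0 t : h t 0 0 != 0 by apply: contraTneq (hp t) => ->; rewrite mulr0 ltxx.
have rT t : @dlsubmx _ 1 n 1 n (H1 t) = (r t)^T by rewrite /r trmx_ursub /H1 sH.
have eH1 t : H1 t = block_mx (h t 0 0)%:M (r t) (r t)^T (@drsubmx _ 1 n 1 n (H1 t)).
 by rewrite -rT -mx11_scalar (@submxK _ 1 n 1 n).
pose H' t := @drsubmx _ 1 n 1 n (H1 t) - (h t 0 0)^-1 *: ((r t)^T *m r t).
have cH1 i j : continuous (fun t => H1 t i j) by exact: ctsO cc (cH i j).
have ch : continuous (fun t => h t 0 0).
 by apply: (ctsE (g := fun t => H1 t 0 0)) => [t|//]; rewrite hE.
have chV : continuous (fun t => (h t 0 0)^-1) by exact: ctsV.
have cr j : continuous (fun t => r t 0 j).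
 by apply: (ctsE (g := fun t : R => H1 t (@lshift 1 n 0) (@rshift 1 n j))) => [t|//]; rewrite !mxE.
have cH' i j : continuous (fun t => H' t i j).
 apply: (ctsE (g := fun t => H1 t (rshift 1 i) (rshift 1 j) -
   (h t 0 0)^-1 * (r t 0 i * r t 0 j))) => [t|].
  by rewrite !mxE big_ord1 !mxE.
 by apply: ctsB => //; apply: ctsM => //; exact: ctsM.
have r0 : r t0 = 0.
 by rewrite /r /H1 ct0 H0; apply/rowP => j; rewrite !mxE -val_eqE /= mulr0n.
have e1' j : (@rsubmx _ 1 1 n e) 0 j = 1 \/ (@rsubmx _ 1 1 n e) 0 j = -1.
 by rewrite mxE; exact: e1.
have sH' t : (H' t)^T = H' t.
 rewrite /H' linearB /= linearZ /= trmx_mul trmxK; congr (_ - _). by rewrite trmx_drsub /H1 sH.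
have H'0 : H' t0 = diag_mx (@rsubmx _ 1 1 n e).
 rewrite /H' r0 mulmx0 scaler0 subr0 /H1 ct0 H0; apply/matrixP => i j. by rewrite !mxE -!val_eqE /= eqn_add2l.
have [d2 [X' [d20 cX' X'0 eX']]] := IH _ _ e1' cH' sH' H'0.
pose b t := Num.sqrt (e 0 0 * h t 0 0).
have cb : continuous b.
 by apply: ctsO; [apply: ctsM => //; exact: ctsC|exact: sqrt_continuous].
pose X t : 'M[R]_(1 + n) := block_mx (b t)%:M 0 ((h t 0 0)^-1 *: (b t *: (r t)^T)) (X' t).
exists (Num.min (d1 / 2) d2), X; split.
- by rewrite lt_min d20 divr_gt0.
- move=> i j; apply: (@cts_block R R 1 n 1 n (fun t => (b t)%:M) (fun=> 0)
  (fun t => (h t 0 0)^-1 *: (b t *: (r t)^T)) X') => // k l.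
 + apply: (ctsE (g := b)) => [t|//]; by rewrite !ord1 mxE eqxx mulr1n.
 + exact: ctsC.
 + apply: (ctsE (g := fun t => (h t 0 0)^-1 * (b t * r t 0 k))) => [t|].
   by rewrite !mxE !ord1.
  by apply: ctsM => //; exact: ctsM.
- rewrite /X r0 linear0 !scaler0 X'0 /b hE ct0 H0 !mxE eqxx mulr1n e00 sqrtr1.
 by rewrite -scalar_mx_block.
- move=> t; rewrite lt_min => /andP[tn1 tn2].
 rewrite -[in LHS](cid t tn1) -/(H1 t) eH1 (schur_complement _ _ (h0 t)) -/(H' t) (eX' t tn2).
 have -> : diag_mx e = @block_mx R 1 n 1 n (e 0 0)%:M 0 0 (diag_mx (@rsubmx _ 1 1 n e)).
  have el : diag_mx (@lsubmx _ 1 1 n e) = (e 0 0)%:M.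
   by apply/matrixP => i j; rewrite !ord1 !mxE l0.
  by rewrite -[in LHS](@hsubmxK _ 1 1 n e) (diag_mx_row (@lsubmx _ 1 1 n e) _) el.
 have b2 : b t * b t * e 0 0 = h t 0 0.
  rewrite -expr2 sqr_sqrtr ?ltW // mulrAC e00 mul1r //.
 rewrite /X !(@tr_block_mx _ 1 n 1 n) !(@mulmx_block _ 1 n 1 n 1 n) !trmx1 !trmx0 !mulmx1 !mul1mx !mul0mx
  !mulmx0 !addr0 !add0r !mul0mx !tr_scalar_mx.
 rewrite !linearZ /= !trmxK -b2 -!scalar_mxM !mul_scalar_mx !mul_mx_scalar addr0 -?scalemxAl -?scalemxAr !scalerA.
 by congr (@block_mx R 1 n 1 n _%:M (_ *: _) (_ *: _) (_ *: _ + _)); ring.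
Qed.

End Congruence.

(** * Isometries of the determinant form on 2 by 2 matrices *)

Section Orthogonal.
Variable R : realType.
Implicit Types (P : 'M[R]_2) (T Y : 'M[R]_4) (v w : 'rV[R]_4).

(* The determinant on M_2 is a form of signature (2, 2); pt takes it to
  v_0^2 + v_1^2 - v_2^2 - v_3^2. *)
Definition i4 (k : nat) : 'I_4 := inord k.

Definition pt v : 'M[R]_2 := \matrix_(i, j)
 (if i == 0 then if j == 0 then v 0 (i4 0) + v 0 (i4 2) else v 0 (i4 3) - v 0 (i4 1)
  else if j == 0 then v 0 (i4 3) + v 0 (i4 1) else v 0 (i4 0) - v 0 (i4 2)).

Lemma pt_linear : linear pt.
move=> c v w; apply/matrixP => i j; rewrite !mxE.
by case: (i == 0); case: (j == 0); ring.
Qed.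
HB.instance Definition _ := GRing.isLinear.Build R 'rV[R]_4 'M[R]_2 _ pt pt_linear.

Definition unpt (X : 'M[R]_2) : 'rV[R]_4 := \row_k
 nth 0 [:: (X 0 0 + X 1 1) / 2; (X 1 0 - X 0 1) / 2; (X 0 0 - X 1 1) / 2;
      (X 1 0 + X 0 1) / 2] k.

Lemma mx2E (X : 'M[R]_2) (Y : 'M[R]_2) : X 0 0 = Y 0 0 -> X 0 1 = Y 0 1 ->
 X 1 0 = Y 1 0 -> X 1 1 = Y 1 1 -> X = Y.
move=> h1 h2 h3 h4; apply/matrixP => i j.
have E (k : 'I_2) : k = 0 \/ k = 1.
 by case: k => [[|[|//]] h]; [left|right]; exact: val_inj.
by case: (E i) => ->; case: (E j) => ->.
Qed.

Lemma unptK : cancel unpt pt.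
by move=> X; apply: mx2E; rewrite !mxE /= !inordK //=; field. Qed.

Lemma row4P v w : (forall k, (k < 4)%N -> v 0 (i4 k) = w 0 (i4 k)) -> v = w.
by move=> h; apply/rowP => k; have := h k (ltn_ord k); rewrite /i4 inord_val. Qed.

Lemma ptK : cancel pt unpt.
by move=> v; apply: row4P => -[|[|[|[|//]]]] _; rewrite !mxE /= inordK //=; field.
Qed.

Definition sgnQ : 'rV[R]_4 := \row_j (if (j < 2)%N then 1 else -1).
Definition formQ : 'M[R]_4 := diag_mx sgnQ.
Definition bform v w : R := (v *m formQ *m w^T) 0 0.

Lemma bformE v w : bform v w = v 0 (i4 0) * w 0 (i4 0) + v 0 (i4 1) * w 0 (i4 1)
 - v 0 (i4 2) * w 0 (i4 2) - v 0 (i4 3) * w 0 (i4 3).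
transitivity (\sum_(0 <= k < 4) v 0 (i4 k) * (if (k < 2)%N then 1 else -1) * w 0 (i4 k)).
 rewrite big_mkord /bform mxE; apply: eq_bigr => k _. by rewrite /i4 inord_val mul_mx_diag !mxE.
by rewrite !big_nat_recr //= big_geq //; ring.
Qed.

Lemma det_pt v : \det (pt v) = bform v v.
by rewrite det2E bformE !mxE /=; ring. Qed.

Lemma polar_pt v w : polar (pt v) (pt w) = 2 * bform v w.
by rewrite bformE /polar !mxE /=; ring. Qed.

Lemma gramE Y k l : (Y *m formQ *m Y^T) k l = bform (row k Y) (row l Y).
by rewrite /bform tr_row -row_mul !mxE; apply: eq_bigr => i _; rewrite !mxE.
Qed.

Definition lmul_mx P : 'M[R]_4 := \matrix_i unpt (P *m pt (delta_mx 0 i)).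
Definition rmul_mx P : 'M[R]_4 := \matrix_i unpt (pt (delta_mx 0 i) *m P).

Lemma pt_mulmx v T : pt (v *m T) = \sum_i v 0 i *: pt (row i T).
by rewrite mulmx_sum_row linear_sum; apply: eq_bigr => i _; rewrite linearZ. Qed.

Lemma pt_delta v : pt v = \sum_i v 0 i *: pt (delta_mx 0 i).
by rewrite -[in LHS](mulmx1 v) pt_mulmx; apply: eq_bigr => i _; rewrite row1. Qed.

Lemma pt_lmul P v : pt (v *m lmul_mx P) = P *m pt v.
rewrite pt_mulmx [in RHS]pt_delta mulmx_sumr; apply: eq_bigr => i _.
by rewrite rowK unptK scalemxAr.
Qed.

Lemma pt_rmul P v : pt (v *m rmul_mx P) = pt v *m P.
rewrite pt_mulmx [in RHS]pt_delta mulmx_suml; apply: eq_bigr => i _.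
by rewrite rowK unptK scalemxAl.
Qed.

Lemma det4E T : \det T = ddet 4 (fun i j => T (i4 i) (i4 j)).
rewrite -det_ddet; congr (\det _); apply/matrixP => i j.
by rewrite mxE /i4 !inord_val.
Qed.

Lemma mul2E (X Y : 'M[R]_2) i j : (X *m Y) i j = X i 0 * Y 0 j + X i 1 * Y 1 j.
rewrite mxE !big_ord_recl big_ord0 addr0 (_ : lift ord0 ord0 = 1) //; exact: val_inj.
Qed.

Lemma delta4 k i : (k < 4)%N -> (i < 4)%N ->
 (delta_mx 0 (i4 k) : 'rV[R]_4) 0 (i4 i) = (k == i)%:R.
by move=> hk hi; rewrite mxE eqxx -val_eqE /= !inordK // eq_sym. Qed.

Definition mx2 (a b c d : R) : 'M[R]_2 := \matrix_(i, j)
 (if i == 0 then if j == 0 then a else b else if j == 0 then c else d).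

Definition pt_basis k : 'M[R]_2 :=
 nth 0 [:: mx2 1 0 0 1; mx2 0 (-1) 1 0; mx2 1 0 0 (-1); mx2 0 1 1 0] k.

Lemma pt_deltaE k : (k < 4)%N -> pt (delta_mx 0 (i4 k)) = pt_basis k.
case: k => [|[|[|[|//]]]] _; apply: mx2E; rewrite !mxE /= -!val_eqE /= !inordK //=; ring.
Qed.

Lemma mulmx4E (f : 'M[R]_2 -> 'M[R]_2) k j : (k < 4)%N -> (j < 4)%N ->
 (\matrix_i unpt (f (pt (delta_mx 0 i))) : 'M[R]_4) (i4 k) (i4 j) =
 unpt (f (pt_basis k)) 0 (i4 j).
by move=> hk hj; rewrite mxE pt_deltaE. Qed.

Lemma unptE (X : 'M[R]_2) k : (k < 4)%N -> unpt X 0 (i4 k) =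
 nth 0 [:: (X 0 0 + X 1 1) / 2; (X 1 0 - X 0 1) / 2; (X 0 0 - X 1 1) / 2;
      (X 1 0 + X 0 1) / 2] k.
by move=> hk; rewrite mxE inordK. Qed.

Lemma det_lmul P : \det (lmul_mx P) = \det P ^+ 2.
rewrite det4E /ddet /= !(mulmx4E (mulmx P)) // !unptE //= !mul2E /pt_basis /= !mxE /= det2E.
by field.
Qed.

Lemma det_rmul P : \det (rmul_mx P) = \det P ^+ 2.
rewrite det4E /ddet /= !(mulmx4E (mulmxr P)) // !unptE //= !mul2E /pt_basis /= !mxE /= det2E.
by field.
Qed.

Lemma pt_mx T : (forall k, (k < 4)%N -> pt (row (i4 k) T) = pt (delta_mx 0 (i4 k))) ->
 T = 1%:M.
move=> h; apply/row_matrixP => i; have := h i (ltn_ord i); rewrite /i4 inord_val row1.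
exact: (can_inj ptK).
Qed.

Definition preserves T : Prop :=
 forall v w, polar (pt (v *m T)) (pt (w *m T)) = polar (pt v) (pt w).

Lemma polar_mul P (X X' : 'M[R]_2) P' : polar (P *m X *m P') (P *m X' *m P') =
 \det P * \det P' * polar X X'.
by rewrite /polar !mul2E !det2E; ring. Qed.

Lemma pt_conj T P P' v :
 pt (v *m (T *m lmul_mx P *m rmul_mx P')) = P *m pt (v *m T) *m P'.
by rewrite (mulmxA v) pt_rmul (mulmxA v) pt_lmul. Qed.

Lemma det_conj T P P' :
 \det (T *m lmul_mx P *m rmul_mx P') = \det T * (\det P * \det P') ^+ 2.
by rewrite 2!det_mulmx det_lmul det_rmul -mulrA -exprMn. Qed.

Lemma preserves_mul T P P' : preserves T -> \det P * \det P' = 1 ->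
 preserves (T *m lmul_mx P *m rmul_mx P').
by move=> hT e v w; rewrite !pt_conj polar_mul e mul1r hT.
Qed.

Lemma nilpotent_conj (N : 'M[R]_2) : N != 0 -> N 0 0 + N 1 1 = 0 -> \det N = 0 ->
 exists g, \det g != 0 /\ g *m N = mx2 0 1 0 0 *m g.
move=> N0 tN dN; rewrite det2E in dN.
have e : N 1 1 = - N 0 0 by move: tN; lra.
rewrite e in dN.
have [b0|b0] := eqVneq (N 0 1) 0.
 have a0 : N 0 0 = 0.
  by apply/eqP; rewrite -sqrf_eq0 -oppr_eq0; apply/eqP; move: dN; rewrite b0; lra.
 have c0 : N 1 0 != 0.
  apply: contraNneq N0 => c0; apply/eqP/mx2E; rewrite !mxE //. by rewrite e a0 oppr0.
 exists (mx2 0 1 (N 1 0) 0); split; first by rewrite det2E !mxE /=; move: c0; rewrite mul0r mul1r sub0r oppr_eq0.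
 by apply: mx2E; rewrite !mul2E !mxE /= ?e ?a0 ?b0; ring.
exists (mx2 1 0 (N 0 0) (N 0 1)); split; first by rewrite det2E !mxE /= mul1r mul0r subr0.
apply: mx2E; rewrite !mul2E !mxE /= ?e; try ring.
by move: dN; lra.
Qed.

Lemma polarE12 X : polar X (mx2 0 1 0 0) = - X 1 0.
by rewrite /polar !mxE /=; ring. Qed.

Lemma polarE21 X : polar X (mx2 0 0 1 0) = - X 0 1.
by rewrite /polar !mxE /=; ring. Qed.

Lemma polar_diag (X : 'M[R]_2) : X 1 1 = - X 0 0 -> X 1 0 = 0 -> X 0 1 = 0 -> polar X X = -2 ->
 X 0 0 ^+ 2 = 1.
by move=> h1 h2 h3; rewrite /polar h1 h2 h3; lra. Qed.

(** [T] is composed with maps X -> P X P' until it fixes 1, then also the nilpotent E12, then also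
    E21. The remaining basis vector, orthogonal to these, can only be multiplied by 1 or -1, and the
    determinant of [T] excludes -1. *)
Lemma isometry_normal T : preserves T -> \det T = 1 ->
 exists P P', \det P * \det P' = 1 /\ forall v, pt (v *m T) = P *m pt v *m P'.
move=> hT dT; pose e k : 'rV[R]_4 := delta_mx 0 (i4 k).
have pe0 : pt (e 0) = 1%:M by apply: mx2E; rewrite !mxE /= -?val_eqE /= ?inordK //=; ring.
have pe2 : pt (e 2) = mx2 1 0 0 (-1) by apply: mx2E; rewrite !mxE /= -?val_eqE /= ?inordK //=; ring.
have p1 : polar (1%:M : 'M[R]_2) 1%:M = 2 by rewrite /polar !mxE /=; ring.
pose E12 := unpt (mx2 0 1 0 0); pose E21 := unpt (mx2 0 0 1 0).
have e1E : e 1 = E21 - E12.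
 by apply: (can_inj ptK); rewrite linearB /= !unptK; apply: mx2E; rewrite !mxE /= -?val_eqE /= ?inordK //=; ring.
have e3E : e 3 = E21 + E12.
 by apply: (can_inj ptK); rewrite linearD /= !unptK; apply: mx2E; rewrite !mxE /= -?val_eqE /= ?inordK //=; ring.
have detP X : polar X X = 2 * \det X by rewrite /polar det2E; ring.
pose A := pt (e 0 *m T).
have dA : \det A = 1.
 by apply: (mulfI (_ : 2 != 0 :> R)); rewrite ?pnatr_eq0 // -detP hT pe0 p1 mulr1.
have Au : A \in unitmx by rewrite unitmxE dA unitr1.
pose T1 := T *m lmul_mx (invmx A) *m rmul_mx 1%:M.
have h1 : preserves T1 by apply: preserves_mul => //; rewrite det_inv dA invr1 det1 mulr1.
have T1e0 : pt (e 0 *m T1) = 1%:M.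
 by rewrite pt_conj mulmx1 mulVmx.
pose N := pt (E12 *m T1).
have tr2 X : polar X 1%:M = X 0 0 + X 1 1 by rewrite /polar !mxE /=; ring.
have tN : N 0 0 + N 1 1 = 0.
 by rewrite -tr2 -T1e0 h1 pe0 tr2 unptK !mxE /= addr0.
have dN : \det N = 0.
 apply: (mulfI (_ : 2 != 0 :> R)); rewrite ?pnatr_eq0 // -detP h1 unptK. by rewrite detP det2E !mxE /=; ring.
have N0 : N != 0.
 apply/eqP => N0; have := h1 E12 E21; rewrite -/N N0 !unptK /polar !mxE /=. by lra.
(* The image of E12 is orthogonal to 1 and isotropic, so its trace and determinant vanish;
   conjugation brings it back to E12 and keeps 1 fixed. *)
have [g [dg gN]] := nilpotent_conj N0 tN dN.
have gu : g \in unitmx by rewrite unitmxE unitfE.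
pose T2 := T1 *m lmul_mx g *m rmul_mx (invmx g).
have h2 : preserves T2 by apply: preserves_mul => //; rewrite det_inv divff.
have T2E v : pt (v *m T2) = g *m pt (v *m T1) *m invmx g.
 exact: pt_conj.
have T2e0 : pt (e 0 *m T2) = 1%:M by rewrite T2E T1e0 mulmx1 mulmxV.
have T2N : pt (E12 *m T2) = mx2 0 1 0 0 by rewrite T2E -/N gN mulmxK.
pose F := pt (E21 *m T2).
have F10 : F 1 0 = 1.
 have := h2 E12 E21; rewrite -/F T2N !unptK /polar !mxE /=; lra.
have tF : F 1 1 = - F 0 0.
 have : polar F 1%:M = 0 by rewrite -T2e0 h2 pe0 tr2 unptK !mxE /= addr0.
 by rewrite tr2 addrC => /eqP; rewrite addr_eq0 => /eqP.
have dF : F 0 1 = - F 0 0 ^+ 2.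
 have : \det F = 0.
  apply: (mulfI (_ : 2 != 0 :> R)); rewrite ?pnatr_eq0 // -detP h2 unptK. by rewrite detP det2E !mxE /=; ring.
 by rewrite det2E F10 tF; lra.
(* Conjugation by this unipotent matrix fixes 1 and E12 and turns F into E21. *)
pose h := mx2 1 (- F 0 0) 0 1; pose h' := mx2 1 (F 0 0) 0 1.
have hh' : h *m h' = 1%:M by apply: mx2E; rewrite !mul2E !mxE /=; ring.
have dh : \det h = 1 by rewrite det2E !mxE /=; ring.
have dh' : \det h' = 1 by rewrite det2E !mxE /=; ring.
pose T3 := T2 *m lmul_mx h *m rmul_mx h'.
have h3 : preserves T3 by apply: preserves_mul => //; rewrite dh dh' mulr1.
have T3E v : pt (v *m T3) = h *m pt (v *m T2) *m h'.
 exact: pt_conj.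
have T3e0 : pt (e 0 *m T3) = 1%:M by rewrite T3E T2e0 mulmx1 hh'.
have T3N : pt (E12 *m T3) = mx2 0 1 0 0.
 by rewrite T3E T2N; apply: mx2E; rewrite !mul2E !mxE /=; ring.
have T3F : pt (E21 *m T3) = mx2 0 0 1 0.
 rewrite T3E -/F /h /h'; clearbody F; apply: mx2E; rewrite !mul2E !mxE /= ?F10 ?tF ?dF; ring.
pose Z := pt (e 2 *m T3).
have Z11 : Z 1 1 = - Z 0 0.
 have : polar Z 1%:M = 0 by rewrite -T3e0 h3 pe0 pe2 tr2 !mxE /= subrr.
 by rewrite tr2 addrC => /eqP; rewrite addr_eq0 => /eqP.
have Z10 : Z 1 0 = 0.
 have : polar Z (mx2 0 1 0 0) = 0 by rewrite -T3N h3 unptK pe2 /polar !mxE /=; ring.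
 by rewrite polarE12 => /eqP; rewrite oppr_eq0 => /eqP.
have Z01 : Z 0 1 = 0.
 have : polar Z (mx2 0 0 1 0) = 0 by rewrite -T3F h3 unptK pe2 /polar !mxE /=; ring.
 by rewrite polarE21 => /eqP; rewrite oppr_eq0 => /eqP.
have Z00 : Z 0 0 ^+ 2 = 1.
 apply: polar_diag => //; by rewrite h3 pe2 /polar !mxE /=; ring.
have dT3 : \det T3 = 1.
 rewrite !det_conj dT dh dh' !det_inv dA det1. by rewrite invr1 !mulr1 divff // !expr1n !mulr1.
have rowT k : row (i4 k) T3 = e k *m T3 by rewrite rowE.
have R0 : row (i4 0) T3 = e 0 by rewrite rowT; apply: (can_inj ptK); rewrite T3e0 pe0.
have R1 : row (i4 1) T3 = e 1.
 by rewrite rowT; apply: (can_inj ptK); rewrite e1E mulmxBl !linearB /= T3N T3F !unptK.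
have R3 : row (i4 3) T3 = e 3.
 by rewrite rowT; apply: (can_inj ptK); rewrite e3E mulmxDl !linearD /= T3N T3F !unptK.
have R2 : row (i4 2) T3 = Z 0 0 *: e 2.
 rewrite rowT; apply: (can_inj ptK); rewrite linearZ /= pe2 -/Z.
 by apply: mx2E; rewrite ?Z11 ?Z01 ?Z10 !mxE /=; ring.
have ent k i : T3 (i4 k) (i4 i) = row (i4 k) T3 0 (i4 i) by rewrite [in RHS]mxE.
have scE i : (Z 0 0 *: e 2) 0 (i4 i) = Z 0 0 * e 2 0 (i4 i) by rewrite [LHS]mxE.
have z1 : Z 0 0 = 1.
 move: dT3; rewrite det4E /ddet /= !ent R0 R1 R2 R3 !scE /e !delta4 //=. by clear; move: (Z 0 0) => z; lra.
have T31 : T3 = 1%:M.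
 apply: pt_mx => -[|[|[|[|//]]]] _; rewrite ?R0 ?R1 ?R2 ?R3 ?z1 ?scale1r //.
have fin v : pt v = h *m (g *m (invmx A *m pt (v *m T)) *m invmx g) *m h'.
 by rewrite -[in LHS](mulmx1 v) -T31 T3E T2E pt_conj mulmx1.
exists (A *m invmx g *m h'), (h *m g); split.
- by rewrite !det_mulmx dA dh dh' det_inv !mul1r !mulr1 mulVf.
- move=> v; rewrite [in RHS]fin; have h'h : h' *m h = 1%:M by exact: mulmx1C.
 rewrite !mulmxA -(mulmxA _ h' h) h'h mulmx1 mulmxKV //.
 by rewrite -(mulmxA _ h' h) h'h mulmx1 mulmxKV // mulmxV // mul1mx.
Qed.

End Orthogonal.

(** * Gram matrices of five points with one of them at the origin *)

Section Gram.
Variable R : realType.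
Implicit Types (Y G : 'M[R]_4).

(** Four rows give five points, the last one being 0; with the plane at infinity this describes six
    planes. *)
Definition pts4 Y : 'I_5 -> 'M[R]_2 :=
 fun k => oapp (fun j => pt (row j Y)) 0 (unlift ord_max k).

Definition gram Y : 'M[R]_4 := Y *m formQ R *m Y^T.

Definition gext G (k l : 'I_5) : R :=
 oapp (fun i => oapp (G i) 0 (unlift ord_max l)) 0 (unlift ord_max k).

Definition gdist G k l : R := gext G k k + gext G l l - gext G k l - gext G l k.

Lemma bformBB (v w : 'rV[R]_4) :
 bform (v - w) (v - w) = bform v v + bform w w - bform v w - bform w v.
by rewrite !bformE !mxE; ring. Qed.

Lemma bform0l (v : 'rV[R]_4) : bform 0 v = 0.
by rewrite !bformE !mxE; ring. Qed.

Lemma bform0r (v : 'rV[R]_4) : bform v 0 = 0.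
by rewrite !bformE !mxE; ring. Qed.

Lemma det_pts4 Y k l : \det (pts4 Y k - pts4 Y l) = gdist (gram Y) k l.
pose w k : 'rV[R]_4 := oapp (fun j => row j Y) 0 (unlift ord_max k).
have E k' : pts4 Y k' = pt (w k').
 by rewrite /pts4 /w; case: (unlift _ _) => //=; rewrite linear0.
have W k' l' : gext (gram Y) k' l' = bform (w k') (w l').
 rewrite /gext /w; case: (unlift _ k') => [i|] /=; last by rewrite bform0l.
 by case: (unlift _ l') => [j|] /=; [exact: gramE|rewrite bform0r].
by rewrite !E -linearB det_pt bformBB /gdist !W.
Qed.

(** A positive determinant leaves the signatures (4, 0), (2, 2) and (0, 4), and values of both signs
    leave (2, 2), the signature of det on M_2. *)
Definition good_gram G : Prop :=
 [/\ G^T = G, 0 < \det G, forall k l, k != l -> gdist G k l != 0,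
   exists k l, 0 < gdist G k l & exists k l, gdist G k l < 0].

Definition gvec (k : 'I_5) : 'rV[R]_4 := oapp (fun j => delta_mx 0 j) 0 (unlift ord_max k).

Lemma gdistE G k l : gdist G k l = ((gvec k - gvec l) *m G *m (gvec k - gvec l)^T) 0 0.
have eD (A B : 'M[R]_1) : (A + B) 0 0 = A 0 0 + B 0 0 by rewrite mxE.
have eN (A : 'M[R]_1) : (- A) 0 0 = - A 0 0 by rewrite mxE.
have W k' l' : gext G k' l' = (gvec k' *m G *m (gvec l')^T) 0 0.
 rewrite /gext /gvec; case: (unlift _ k') => [i|] /=; last by rewrite !mul0mx mxE.
 case: (unlift _ l') => [j|] /=; last by rewrite trmx0 mulmx0 mxE. by rewrite -rowE trmx_delta -colE !mxE.
rewrite /gdist !W [in RHS]linearB /= !mulmxBl !mulmxBr !(eD, eN); lra.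
Qed.

Lemma det_formQ : \det (formQ R) = 1.
rewrite det_diag; transitivity (\prod_(0 <= k < 4) (if (k < 2)%N then 1 else -1 : R)).
 by rewrite big_mkord; apply: eq_bigr => i _; rewrite mxE.
by rewrite !big_nat_recr //= big_geq // !mul1r mulrNN mul1r.
Qed.

Lemma det_gram Y : \det (gram Y) = \det Y ^+ 2.
by rewrite !det_mulmx det_tr det_formQ mulr1. Qed.

(** The product 1 forces an even number of entries -1; as both signs occur, there are two of
    each. *)
Lemma signs_perm (e : 'I_4 -> R) : (forall i, e i = 1 \/ e i = -1) ->
 \prod_i e i = 1 -> (exists i, e i = 1) -> (exists i, e i = -1) ->
 exists2 f : 'I_4 -> 'I_4, injective f & forall j, e (f j) = sgnQ R 0 j.
move=> e1 pe [i0 ei0] [i2 ei2].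
have ne : (1 : R) != -1 by rewrite -subr_eq0 opprK -[1 + 1]/(2%:R) pnatr_eq0.
have card3 (i : 'I_4) : #|predC1 i| = 3%N by rewrite cardC1 card_ord.
have other (i : 'I_4) (c : R) : (c = 1 \/ c = -1) -> e i = c -> exists2 j, j != i & e j = c.
 move=> hc ei; have [[j /andP[ji ej]]|H] := pselect (exists j, (j != i) && (e j == c)).
  by exists j => //; apply/eqP.
 exfalso; have ej j : j != i -> e j = - c.
  move=> ji; have : e j != c.
   by apply/negP => ejc; apply: H; exists j; rewrite ji ejc.
  by case: (e1 j) => ->; case: hc => ->; rewrite ?opprK ?eqxx.
 move: pe; rewrite (bigD1 i) //= ei (eq_bigr (fun=> - c)) => [|j ji]; last exact: ej.
 rewrite prodr_const (_ : #|_| = 3%N) ?card3 //.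
 by case: hc => ->; move=> h; move: ne; rewrite -[X in X != _]h !exprS expr0 ?opprK ?mulr1 ?mul1r
  ?mulrNN ?mulr1 ?mul1r ?mulN1r ?opprK ?eqxx.
have [i1 i10 ei1] := other i0 1 (or_introl erefl) ei0.
have [i3 i32 ei3] := other i2 (-1) (or_intror erefl) ei2.
have d i j : e i = 1 -> e j = -1 -> i == j = false.
 by move=> hi hj; apply: contraNF ne => /eqP ij; apply/eqP; rewrite -hj -ij hi.
pose s := [:: i0; i1; i2; i3].
have us : uniq s.
 rewrite /= !inE (eq_sym i0 i1) (negbTE i10) (eq_sym i2 i3) (negbTE i32).
 by rewrite (d i0 i2) ?(d i0 i3) ?(d i1 i2) ?(d i1 i3).
exists (fun j => nth i0 s j).
 by move=> j k /eqP; rewrite nth_uniq // => /eqP/val_inj.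
by case=> [[|[|[|[|//]]]] hj]; rewrite /= mxE.
Qed.

Lemma good_gram_factor G : good_gram G -> exists Y, gram Y = G.
move=> [sG dG _ [k1 [l1 p1]] [k2 [l2 p2]]].
have [Z [d [Zu eG]]] := congruent_diag sG.
have dZ : \det Z != 0 by rewrite -unitfE -unitmxE.
have dE : \det G = \det Z ^+ 2 * \prod_i d 0 i.
 by rewrite eG !det_mulmx det_tr det_diag mulrAC.
have dp : 0 < \prod_i d 0 i.
 by move: dG; rewrite dE pmulr_rgt0 // exprn_even_gt0.
have d0 i : d 0 i != 0.
 by apply/negP => /eqP di; move: dp; rewrite (bigD1 i) //= di mul0r ltxx.
pose e (i : 'I_4) : R := Num.sg (d 0 i).
have e1 i : e i = 1 \/ e i = -1.
 have := d0 i; rewrite /e; have [h|h|->] := ltgtP (d 0 i) 0.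
 - by right; rewrite ltr0_sg.
 - by left; rewrite gtr0_sg.
 - by [].
have val k l : gdist G k l = \sum_i ((gvec k - gvec l) *m Z) 0 i ^+ 2 * d 0 i.
 rewrite gdistE eG !mulmxA -(mulmxA _ Z^T) -trmx_mul mxE; apply: eq_bigr => i _. by rewrite mul_mx_diag !mxE; ring.
have pe : \prod_i e i = 1.
 have : Num.sg (\prod_i d 0 i) = 1 by rewrite gtr0_sg. rewrite (big_morph (@Num.sg R) (@sgrM R) (@sgr1 R)) //.
have [i ei] : exists i, e i = 1.
 have [//|H] := pselect (exists i, e i = 1); exfalso; move: p1; rewrite val ltNge.
 move/negP; apply; apply: sumr_le0 => i _; rewrite mulr_ge0_le0 ?sqr_ge0 //.
 case: (e1 i) => ei; first by case: H; exists i.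
 by move: ei; rewrite /e; have [/ltW//|h|->//] := ltgtP (d 0 i) 0; rewrite gtr0_sg //; lra.
have [i' ei'] : exists i, e i = -1.
 have [//|H] := pselect (exists i, e i = -1); exfalso; move: p2; rewrite val ltNge.
 move/negP; apply; apply: sumr_ge0 => i' _; rewrite mulr_ge0 ?sqr_ge0 //.
 case: (e1 i') => ei2; last by case: H; exists i'.
 by move: ei2; rewrite /e; have [h|/ltW//|->//] := ltgtP (d 0 i') 0; rewrite ltr0_sg //; lra.
have [f fI ef] := signs_perm e1 pe (ex_intro _ _ ei) (ex_intro _ _ ei').
pose Y : 'M[R]_4 := \matrix_(k, j) (Z k (f j) * Num.sqrt `|d 0 (f j)|).
exists Y; rewrite eG; apply/matrixP => k l.
rewrite [LHS]mxE [RHS]mxE [RHS](reindex_inj fI) /=; apply: eq_bigr => j _.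
have q := ef j; rewrite mxE in q; rewrite !mul_mx_diag !mxE -q /e.
have := sqr_sqrtr (normr_ge0 (d 0 (f j))); rewrite expr2.
set qq := Num.sqrt _ => hq; rewrite [d 0 (f j) in RHS]numEsg -hq; ring.
Qed.

Lemma gram_gl Y0 Y : \det Y0 != 0 -> gram Y0 = gram Y -> exists2 T,
 Y = Y0 *m T & preserves T /\ \det T ^+ 2 = 1.
move=> dY e; have Yu : Y0 \in unitmx by rewrite unitmxE unitfE.
exists (invmx Y0 *m Y); first by rewrite mulKVmx.
have TQ : invmx Y0 *m Y *m formQ R *m (invmx Y0 *m Y)^T = formQ R.
 transitivity (invmx Y0 *m gram Y *m (invmx Y0)^T); first by rewrite trmx_mul !mulmxA.
 by rewrite -e /gram !mulmxA mulVmx // mul1mx -mulmxA -trmx_mul mulVmx // trmx1 mulmx1.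
split.
 move=> v w; rewrite !polar_pt; congr (2 * _); rewrite /bform trmx_mul !mulmxA. by rewrite -[in RHS]TQ !mulmxA.
have := congr1 (fun M : 'M[R]_4 => \det M) TQ.
by rewrite !det_mulmx det_tr !det_mulmx det_formQ mulr1 expr2.
Qed.

Lemma is_pts4 Y : good_gram (gram Y) -> is_pts (pts4 Y).
by move=> [_ _ h _ _] k l kl; rewrite det_pts4 h. Qed.

Lemma det_gram_neq0 Y : good_gram (gram Y) -> \det Y != 0.
by move=> [_ d _ _ _]; apply: contraTneq d; rewrite det_gram => ->; rewrite expr0n ltxx. Qed.

(** Equal Gram matrices differ by an isometry, and equal orientations make its determinant 1. By
    [isometry_normal] it is X -> P X P', which extends to a linear change of coordinates of positive
    determinant on the charts. *)
Lemma gram_unique Y Y' : good_gram (gram Y) -> gram Y = gram Y' ->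
 0 < \det Y * \det Y' -> eqv (chart (pts4 Y)) (chart (pts4 Y')).
move=> gY e dd; have [T eT [pT dT]] := gram_gl (det_gram_neq0 gY) e.
have dT1 : \det T = 1.
 move: dd; rewrite eT det_mulmx mulrA -expr2 pmulr_rgt0; last first.
  by rewrite exprn_even_gt0 // det_gram_neq0.
 move=> d0; apply/eqP; rewrite -(eqrXn2 (n := 2)) ?ltW // ?expr1n ?ler01 //; exact/eqP.
have [P [P' [dP hP]]] := isometry_normal pT dT1.
have [P0 P'0] : \det P != 0 /\ \det P' != 0.
 by apply/andP; rewrite -negb_or -mulf_eq0 dP oner_neq0.
have Pu : P \in unitmx by rewrite unitmxE unitfE.
have P'u : P' \in unitmx by rewrite unitmxE unitfE.
(* The graph row (1, X) becomes (P^-1, X P'), and P times this is (1, P X P'). *)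
pose g : 'M[R]_4 := @block_mx R 2 2 2 2 (invmx P) 0 0 P'.
have dg : 0 < \det g.
 rewrite /g (@det_ublock _ 2 2) det_inv; have -> : \det P' = (\det P)^-1.
  by apply: (mulfI P0); rewrite dP divff.
 by rewrite -expr2 exprn_even_gt0 // invr_eq0.
have cY := is_cfg_chart (is_pts4 gY).
apply: eqv_trans (conn_eqv (conn_gl cY dg)) _.
pose U (i : 'I_6) : 'M[R]_2 := if i == ord0 then invmx P' else P.
have dU i : \det (U i) != 0 by rewrite /U; case: ifP; rewrite ?det_inv ?invr_eq0.
have cg : is_cfg (fun i => chart (pts4 Y) i *m g).
 by move=> i j ij; rewrite cross_mulr mulf_neq0 ?cY // lt0r_neq0.
have := eqv_mul dU cg; rewrite (_ : (fun i => U i *m _) = chart (pts4 Y')) //.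
apply/funext => i; rewrite /U; case: (unliftP ord0 i) => [k|] -> /=; last first.
 rewrite !chart0 /at_infinity /g (@mul_row_block _ 2 2 2 2 2).
 by rewrite !mul0mx !mul1mx !add0r (@mul_mx_row _ 2 2 2 2) mulmx0 mulVmx.
rewrite !chartS /graph_form /g (@mul_row_block _ 2 2 2 2 2) !mulmx0 mul1mx addr0 add0r
 (@mul_mx_row _ 2 2 2 2) mulmxV //; congr (@row_mx R 2 2 2 _ _).
rewrite /pts4; case: (unlift ord_max k) => [j|] /=; last by rewrite mul0mx mulmx0.
by rewrite eT row_mul hP mulmxA.
Qed.

Lemma gram_local (H : R -> 'M[R]_4) t0 Y0 : (forall i j, continuous (fun t => H t i j)) ->
 (forall t, good_gram (H t)) -> gram Y0 = H t0 ->
 exists (d : R) (Y : R -> 'M[R]_4), [/\ 0 < d, forall i j, continuous (fun t => Y t i j),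
  Y t0 = Y0 & forall t, `|t - t0| < d -> gram (Y t) = H t].
move=> cH gH e; have dY : \det Y0 != 0 by apply: det_gram_neq0; rewrite e.
have Yu : Y0 \in unitmx by rewrite unitmxE unitfE.
pose K t := invmx Y0 *m H t *m (invmx Y0)^T.
have cK i j : continuous (fun t => K t i j).
 apply: cts_mulmx => k l; last exact: ctsC. by apply: cts_mulmx => k' l'; [exact: ctsC|exact: cH].
have sK t : (K t)^T = K t.
 by case: (gH t) => s _ _ _ _; rewrite /K !trmx_mul trmxK s mulmxA.
have K0 : K t0 = diag_mx (sgnQ R).
 by rewrite /K -e /gram !mulmxA mulVmx // mul1mx -mulmxA -trmx_mul mulVmx // trmx1 mulmx1.
have s1 j : sgnQ R 0 j = 1 \/ sgnQ R 0 j = -1 by rewrite mxE; case: ifP; [left|right].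
have [d [X [d0 cX X0 eX]]] := local_factor s1 cK sK K0.
exists d, (fun t => Y0 *m X t); split=> //.
- by move=> i j; apply: cts_mulmx => k l; [exact: ctsC|exact: cX].
- by rewrite X0 mulmx1.
- move=> t /eX eK; rewrite /gram trmx_mul !mulmxA -(mulmxA Y0) -(mulmxA Y0) -eK.
 by rewrite /K !mulmxA mulmxV // mul1mx -mulmxA -trmx_mul mulmxV // trmx1 mulmx1.
Qed.

(** No continuous lift over the whole interval is built. Local lifts come from [gram_local], and
    [gram_unique] makes any two lifts of one matrix with the same orientation equivalent. *)
Theorem gram_path (H : R -> 'M[R]_4) Y Y' : (forall i j, continuous (fun t => H t i j)) ->
 (forall t, good_gram (H t)) -> gram Y = H 0 -> gram Y' = H 1 -> 0 < \det Y * \det Y' ->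
 eqv (chart (pts4 Y)) (chart (pts4 Y')).
move=> cH gH eY eY' dd.
have dY : \det Y != 0 by apply: det_gram_neq0; rewrite eY.
pose P t := forall Y1, gram Y1 = H t -> 0 < \det Y * \det Y1 ->
 eqv (chart (pts4 Y)) (chart (pts4 Y1)).
suff : P 1 by exact.
apply: (@itv_const R P); last first.
 by move=> Y1 e1; apply: gram_unique; rewrite ?eY ?e1.
move=> t _.
(* An isometry of determinant -1, used to give a factor of [H t] the orientation of [Y]. *)
pose D : 'M[R]_4 := diag_mx (\row_j (if j == 0 then -1 else 1)).
have DQ : D *m formQ R *m D^T = formQ R.
 rewrite tr_diag_mx /D /formQ !mulmx_diag; congr diag_mx; apply/rowP => j; rewrite !mxE.
 by case: (j == 0); rewrite ?mulN1r ?mulrN1 ?mul1r ?mulr1 ?opprK.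
have dD : \det D = -1.
 rewrite det_diag (bigD1 0) //= mxE eqxx big1 ?mulr1 // => i i0. by rewrite mxE (negbTE i0).
have [Y0 e0 d0] : exists2 Y0, gram Y0 = H t & 0 < \det Y * \det Y0.
 have [Z eZ] := good_gram_factor (gH t). have dZ : \det Z != 0 by apply: det_gram_neq0; rewrite eZ.
 have [h|h|h] := ltgtP 0 (\det Y * \det Z); first by exists Z.
 - exists (Z *m D); last by rewrite det_mulmx dD mulrN1 mulrN oppr_gt0.
  by rewrite -eZ /gram trmx_mul !mulmxA -(mulmxA Z) -(mulmxA Z) DQ.
 - by move/eqP: h; rewrite eq_sym mulf_eq0 (negbTE dY) (negbTE dZ).
have [d [Z [d1 cZ Z0 eZ]]] := gram_local cH gH e0.
have cdet : continuous (fun s => \det Y * \det (Z s)).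
 by apply: ctsM; [exact: ctsC|exact: cts_det].
have [d' d'0 near_t] := cts_near t cdet d0.
have step s : `|s - t| < Num.min d d' -> eqv (chart (pts4 Y0)) (chart (pts4 (Z s))) /\
  0 < \det Y * \det (Z s).
 rewrite lt_min => /andP[s1 s2]; split; last first.
  by move: (near_t _ s2); rewrite Z0 ltr_norml => /andP[h _]; lra.
 apply/conn_eqv/pts_conn_chart.
 have -> : pts4 Y0 = (fun u => pts4 (Z (t + u * (s - t)))) 0 by rewrite /= mul0r addr0 Z0.
 have -> : pts4 (Z s) = (fun u => pts4 (Z (t + u * (s - t)))) 1.
  by rewrite /= mul1r addrC subrK.
 apply: (pconn_itv (g := fun u => pts4 (Z (t + u * (s - t))))) => [k i j|u /andP[u0 u1]].
  rewrite /pts4; case: (unlift ord_max k) => [l|] /=; last first.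
   by apply: (ctsE (g := fun=> 0)) => [u|]; [rewrite mxE|exact: ctsC].
  have cl m : continuous (fun u : R => Z (t + u * (s - t)) l m).
   by apply: ctsO (cZ l m); cts.
  apply: (ctsE (g := fun u : R => pt (row l (Z (t + u * (s - t)))) i j)) => [u //|].
  rewrite /pt; apply: (ctsE (g := fun u : R =>
   let z m := Z (t + u * (s - t)) l (i4 m) in
   if i == 0 then if j == 0 then z 0%N + z 2 else z 3 - z 1%N
   else if j == 0 then z 3 + z 1%N else z 0%N - z 2)) => [u|]. by rewrite !mxE; case: (i == 0); case: (j == 0).
  by case: (i == 0); case: (j == 0); [apply: ctsD|apply: ctsB|apply: ctsD|apply: ctsB].
 apply: is_pts4; rewrite eZ // [t + _]addrC addrK normrM ger0_norm //. by apply: le_lt_trans s1; rewrite ler_piMl.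
exists (Num.min d d'); first by rewrite lt_min d1 d'0.
move=> s _ st; have [st1 st2] := step s st.
have eZs : gram (Z s) = H s by apply: eZ; move: st; rewrite lt_min => /andP[].
have signs (a b c : R) : 0 < a * b -> 0 < a * c -> 0 < b * c.
 move=> ab ac; have : 0 < (a * b) * (a * c) by exact: mulr_gt0.
 rewrite mulrACA -expr2 pmulr_rgt0 // exprn_even_gt0 //=. by apply: contraTneq ab => ->; rewrite mul0r ltxx.
split=> h Y1 e1 dY1.
- apply: (eqv_trans (h _ eZs st2)); apply: eqv_trans (eqv_sym st1) _.
 by apply: gram_unique; rewrite ?e0 ?e1 //; exact: signs d0 dY1.
- apply: (eqv_trans (h _ e0 d0)); apply: eqv_trans st1 _.
 by apply: gram_unique; rewrite ?eZs ?e1 //; exact: signs st2 dY1.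
Qed.

End Gram.

(** * The Gram determinant as a polynomial in the fifteen pairs of planes *)

Section GramPolynomial.
Variable R : realType.
Implicit Types m : nat -> R.

(** The edges of the complete graph on six vertices; entries of [m] are addressed by position in
    this list, and the edges 0 to 4 are those at the vertex 0, the plane at infinity. *)
Definition pairs6 : seq (nat * nat) := [:: (0, 1); (0, 2); (0, 3); (0, 4); (0, 5);
 (1, 2); (1, 3); (1, 4); (1, 5); (2, 3); (2, 4); (2, 5); (3, 4); (3, 5); (4, 5)]%N.

(** The 15 perfect matchings, each as three edge numbers. *)
Definition matchings : seq (seq nat) := [:: [:: 0; 9; 14]; [:: 0; 10; 13]; [:: 0; 11; 12];
 [:: 1; 6; 14]; [:: 1; 7; 13]; [:: 1; 8; 12]; [:: 2; 5; 14]; [:: 2; 7; 11]; [:: 2; 8; 10];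
 [:: 3; 5; 13]; [:: 3; 6; 11]; [:: 3; 8; 9]; [:: 4; 5; 12]; [:: 4; 6; 10]; [:: 4; 7; 9]]%N.

(** The 10 splittings of the six vertices into two triangles, each as six edge numbers. *)
Definition triangles : seq (seq nat) := [:: [:: 0; 1; 5; 12; 13; 14];
 [:: 0; 2; 6; 10; 11; 14]; [:: 0; 3; 7; 9; 11; 13]; [:: 0; 4; 8; 9; 10; 12];
 [:: 1; 2; 9; 7; 8; 14]; [:: 1; 3; 10; 6; 8; 13]; [:: 1; 4; 11; 6; 7; 12];
 [:: 2; 3; 12; 5; 8; 11]; [:: 2; 4; 13; 5; 7; 10]; [:: 3; 4; 14; 5; 6; 9]]%N.

(** The three perfect matchings of the four vertices off the edge [e]. *)
Definition complementary (e : nat) : seq (seq nat) :=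
 [seq [seq k <- s | k != e] | s <- matchings & e \in s].

Definition mprod m (s : seq nat) : R := \prod_(k <- s) m k.

Definition comp_prod m e i : R := mprod m (nth [::] (complementary e) i).

(** The determinant of the symmetric 6 by 6 matrix with zero diagonal and entries [m]. Permutations
    without fixed points have cycle types 2+2+2, 4+2, 3+3 and 6; the squared sum over matchings
    supplies the hexagons, each of which is the union of two disjoint matchings in one way. *)
Definition fpol m : R :=
 4 * (\sum_(e <- iota 0 15) m e ^+ 2 * (comp_prod m e 0 * comp_prod m e 1 +
    comp_prod m e 0 * comp_prod m e 2 + comp_prod m e 1 * comp_prod m e 2) +
   \sum_(t <- triangles) mprod m t) - (\sum_(s <- matchings) mprod m s) ^+ 2.

Definition upd m e x : nat -> R := fun k => if k == e then x else m k.

(** The coefficient of the square of [m e] in [fpol]: minus the determinant of the 4 by 4 block of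
    the vertices off [e]. *)
Definition top_coef m e : R :=
 2 * comp_prod m e 0 * comp_prod m e 1 + 2 * comp_prod m e 0 * comp_prod m e 2 +
 2 * comp_prod m e 1 * comp_prod m e 2 -
 comp_prod m e 0 ^+ 2 - comp_prod m e 1 ^+ 2 - comp_prod m e 2 ^+ 2.

(* The derivative at c = 1 of fpol when m e is replaced by c m e. *)
Definition slope m e : R := top_coef m e * m e ^+ 2 + fpol m - fpol (upd m e 0).

Ltac expand_fpol := rewrite /slope /fpol /top_coef /comp_prod /mprod /= unlock /= /upd /=.

Lemma fpol_upd m e x : (e < 15)%N -> fpol (upd m e x) = fpol (upd m e 0) +
 x * (fpol (upd m e 1) - fpol (upd m e 0) - top_coef m e) + x ^+ 2 * top_coef m e.
case: e => [|[|[|[|[|[|[|[|[|[|[|[|[|[|[|//]]]]]]]]]]]]]]] _; expand_fpol; ring.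
Qed.

(** Euler's identity, as [fpol] is homogeneous of degree 2 in the five edges at a vertex: here the
    vertex 0, then the vertices 2 and 4. *)
Lemma euler0 m : slope m 0 + slope m 1 + slope m 2 + slope m 3 + slope m 4 = 2 * fpol m.
expand_fpol; ring. Qed.

Lemma euler2 m : slope m 1 + slope m 5 + slope m 9 + slope m 10 + slope m 11 = 2 * fpol m.
expand_fpol; ring. Qed.

Lemma euler4 m : slope m 3 + slope m 7 + slope m 10 + slope m 12 + slope m 14 = 2 * fpol m.
expand_fpol; ring. Qed.

(** On the left are the six edges among the vertices 0, 2, 3, 5, which the edge 7 = (1, 4) avoids.
    Euler's identities at these four vertices minus those at 1 and 4 give twice this relation. *)
Lemma slope_sum7 m : slope m 4 + slope m 9 + slope m 1 + slope m 2 + slope m 11 + slope m 13 =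
 2 * fpol m + slope m 7.
expand_fpol; ring. Qed.

Definition zero_at (L : seq nat) m : nat -> R := fun k => if k \in L then 0 else m k.

(** The edges 7, 4 and 9 form a perfect matching. On this face of the boundary the slope is minus a
    square, which will contradict a limit of positive slopes. *)
Lemma limit_slope4 m : slope (zero_at [:: 0; 1; 2; 8; 10; 11; 12; 13]%N m) 7 =
 - 2 * (m 7 * m 4 * m 9) ^+ 2.
rewrite /zero_at; expand_fpol; ring. Qed.

(** For the signs with only the entries 7 and 9 negative, the right side has the sign of [fpol], so
    the two slopes cannot both be nonnegative where [fpol] is negative. *)
Lemma limit_slope5 m (m' := zero_at [:: 7; 9; 1; 2; 8; 13; 14]%N m) :
 slope m' 0 * slope m' 3 = 4 * fpol m' * (m 0 * m 3 * m 11 ^+ 2 * m 12 * m 6).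
rewrite /m' /zero_at; expand_fpol; ring. Qed.

Lemma limit_slope7 m : slope (zero_at [:: 7]%N m) 7 = 0.
rewrite /zero_at; expand_fpol; ring. Qed.

End GramPolynomial.

(** * Raising and lowering single entries inside a sign pattern *)

Section GramSpace.
Variable R : realType.
Implicit Types (m : nat -> R) (neg : seq nat).

Definition sgp neg e : R := if e \in neg then -1 else 1.

(** The condition on [fpol] says that the Gram determinant is positive, see [mgram_fpol]. *)
Definition in_space neg m : Prop :=
 (forall e, (e < 15)%N -> 0 < sgp neg e * m e) /\ fpol m < 0.

(* The four vertices off the pair e do not span a sign pattern equivalent to
  the constant one. *)
Definition good neg e : bool := (e < 15)%N &&
 ~~ constant [seq odd (count (mem neg) s) | s <- complementary e].

Lemma mprod_sgn neg m s : (forall e, (e < 15)%N -> 0 < sgp neg e * m e) ->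
 all (fun k => k < 15)%N s -> 0 < (-1) ^+ odd (count (mem neg) s) * mprod m s.
move=> hm; rewrite /mprod; elim: s => [|k s IH] /=.
 by rewrite big_nil expr0 mulr1 ltr01.
move=> /andP[k15 /IH h]; rewrite big_cons oddD signr_addb mulrACA mulr_gt0 //.
by have := hm _ k15; rewrite /sgp; case: (k \in neg); rewrite ?expr1 ?expr0.
Qed.

(** The expression equals 4 x y - (x + y - z)^2, which is negative when x and y have opposite signs;
    among three signs that are not all equal such a pair exists. *)
Lemma opposite_signs (b1 b2 b3 : bool) (P Q T : R) : ~~ constant [:: b1; b2; b3] ->
 0 < (-1) ^+ b1 * P -> 0 < (-1) ^+ b2 * Q -> 0 < (-1) ^+ b3 * T ->
 2 * P * Q + 2 * P * T + 2 * Q * T - P ^+ 2 - Q ^+ 2 - T ^+ 2 < 0.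
have H (x y z : R) : 0 < (-1) * x -> 0 < y ->
  2 * x * y + 2 * x * z + 2 * y * z - x ^+ 2 - y ^+ 2 - z ^+ 2 < 0.
 move=> hx hy; have := mulr_gt0 hx hy; have := sqr_ge0 (x + y - z); lra.
case: b1; case: b2; case: b3 => //= _; rewrite ?expr1 ?expr0 ?mul1r => h1 h2 h3.
- by have := H _ _ Q h1 h3; lra.
- by have := H _ _ T h1 h2; lra.
- by have := H _ _ T h1 h2; lra.
- by have := H _ _ T h2 h1; lra.
- by have := H _ _ P h2 h3; lra.
- by have := H _ _ Q h3 h1; lra.
Qed.

Lemma good_top neg m e : (forall e, (e < 15)%N -> 0 < sgp neg e * m e) -> good neg e ->
 top_coef m e < 0.
move=> hm /andP[e15 ge].
have [s1 [s2 [s3 [es h1 h2 h3]]]] : exists s1 s2 s3,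
  [/\ complementary e = [:: s1; s2; s3], all (fun k => k < 15)%N s1,
   all (fun k => k < 15)%N s2 & all (fun k => k < 15)%N s3].
 by do 15?[case: e e15 ge => [|e] e15 ge; first by do 3?[eexists]].
move: ge; rewrite es /= => ge; rewrite /top_coef /comp_prod es /=.
by apply: opposite_signs ge _ _ _; exact: mprod_sgn.
Qed.

Lemma fpol_scale neg m e c : good neg e -> fpol (upd m e (c * m e)) - fpol m =
 (c - 1) * (slope m e + top_coef m e * m e ^+ 2 * (c - 1)).
move=> /andP[e15 _]; rewrite (fpol_upd _ _ e15) /slope.
have := fpol_upd m (m e) e15; rewrite (_ : upd m e (m e) = m); last first.
 by apply/funext => k; rewrite /upd; case: eqP => [->|].
by move=> ->; ring.
Qed.

(** Real entries are packed into 1 by 1 matrices so that [pconn] applies. *)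
Definition mconn neg m m' : Prop :=
 pconn (fun X : nat -> 'M[R]_1 => in_space neg (fun e => X e 0 0))
  (fun e => (m e)%:M) (fun e => (m' e)%:M).

Lemma scalar1E (x : R) : (x%:M : 'M[R]_1) 0 0 = x.
by rewrite mxE eqxx mulr1n. Qed.

Lemma mconn_itv neg (g : R -> nat -> R) : (forall e, continuous (g^~ e)) ->
 (forall t, 0 <= t <= 1 -> in_space neg (g t)) -> mconn neg (g 0) (g 1).
move=> cg hg; apply: (pconn_itv (g := fun t e => (g t e)%:M)) => [e r k|t t01].
 by apply: (ctsE (g := g^~ e)) => [t|//]; rewrite !ord1 scalar1E.
by under eq_fun do rewrite scalar1E; exact: hg.
Qed.

Lemma mconn_in neg m m' : mconn neg m m' -> in_space neg m /\ in_space neg m'.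
move=> [g [_ hg g0 g1]]; have := hg 0; have := hg 1; rewrite g0 g1.
by under eq_fun do rewrite scalar1E; under [X in _ -> in_space _ X -> _]eq_fun do rewrite scalar1E.
Qed.

Lemma mconn_refl neg m : in_space neg m -> mconn neg m m.
by move=> hm; apply: pconn_refl; under eq_fun do rewrite scalar1E. Qed.

Lemma cts_fpol (g : R -> nat -> R) : (forall e, continuous (g^~ e)) ->
 continuous (fun t => fpol (g t)).
move=> cg; have cp s : continuous (fun t => mprod (g t) s) by apply: cts_prod => k; exact: cg.
have cq (f : R -> R) : continuous f -> continuous (fun t : R => f t ^+ 2).
 by move=> cf; apply: (ctsE (g := fun t => f t * f t)) => [t|]; [rewrite expr2|exact: ctsM].
apply: ctsB; last by apply: cq; apply: cts_sum => s; exact: cp.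
apply: ctsM; first exact: ctsC.
apply: ctsD; last by apply: cts_sum => s; exact: cp.
apply: cts_sum => e; apply: ctsM; first by apply: cq; exact: cg.
by apply: ctsD; [apply: ctsD|]; apply: ctsM; exact: cp.
Qed.

Lemma cts_ptolemy (f g h : R -> R) : continuous f -> continuous g -> continuous h ->
 continuous (fun t => 2 * f t * g t + 2 * f t * h t + 2 * g t * h t -
  f t ^+ 2 - g t ^+ 2 - h t ^+ 2).
move=> cf cg ch; apply: (ctsE (g := fun t => 2 * f t * g t + 2 * f t * h t +
 2 * g t * h t - f t * f t - g t * g t - h t * h t)) => [t|]; first by rewrite !expr2.
by cts.
Qed.

Lemma cts_top (g : R -> nat -> R) e : (forall e, continuous (g^~ e)) ->
 continuous (fun t => top_coef (g t) e).
move=> cg; have cp i : continuous (fun t => comp_prod (g t) e i).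
 by apply: cts_prod => k; exact: cg.
exact: cts_ptolemy (cp 0%N) (cp 1%N) (cp 2%N).
Qed.

Lemma cts_upd (g : R -> nat -> R) e (h : R -> R) : (forall e, continuous (g^~ e)) ->
 continuous h -> forall k, continuous (fun t => upd (g t) e (h t) k).
by move=> cg ch k; rewrite /upd; case: (k == e). Qed.

Lemma cts_slope (g : R -> nat -> R) e : (forall e, continuous (g^~ e)) ->
 continuous (fun t => slope (g t) e).
move=> cg; apply: ctsB; last by apply: cts_fpol; apply: cts_upd => //; exact: ctsC.
apply: ctsD; last exact: cts_fpol.
apply: ctsM; first exact: cts_top.
by apply: (ctsE (g := fun t => g t e * g t e)) => [t|]; [rewrite expr2|exact: ctsM].
Qed.

Lemma upd_space neg m e c : in_space neg m -> 0 < c -> fpol (upd m e (c * m e)) <= fpol m ->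
 in_space neg (upd m e (c * m e)).
move=> [sm fm] c0 h; split; last exact: le_lt_trans h fm.
move=> k k15; rewrite /upd; case: eqP => [ke|_]; last exact: sm.
by rewrite mulrCA mulr_gt0 // -ke sm.
Qed.

Lemma upd_id m e : upd m e (1 * m e) = m.
by apply/funext => k; rewrite /upd mul1r; case: eqP => [->|]. Qed.

Lemma scale_path neg m e c : in_space neg m -> 0 < c ->
 (forall t, 0 <= t <= 1 -> fpol (upd m e ((1 + t * (c - 1)) * m e)) <= fpol m) ->
 mconn neg m (upd m e (c * m e)).
move=> hm c0 h; rewrite -[X in mconn _ X _](upd_id m e).
have -> : upd m e (1 * m e) = (fun t : R => upd m e ((1 + t * (c - 1)) * m e)) 0.
 by rewrite mul0r addr0.
have -> : upd m e (c * m e) = (fun t : R => upd m e ((1 + t * (c - 1)) * m e)) 1.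
 by rewrite mul1r addrC subrK.
apply: (mconn_itv (g := fun t : R => upd m e ((1 + t * (c - 1)) * m e))) => [k|t /andP[t0 t1]].
 by apply: cts_upd => [k'|]; [exact: ctsC|cts].
apply: upd_space => //; last by apply: h; rewrite t0.
have : (1 - t) + t * c > 0; last by lra.
have [->|tn] := eqVneq t 0; first by rewrite subr0 mul0r addr0.
by apply: ltr_wpDl; rewrite ?subr_ge0 // mulr_gt0 // lt0r tn.
Qed.

(** A negative [top_coef] makes [fpol] concave in the entry, so a nonpositive derivative stays
    nonpositive while the entry grows in absolute value. [lower] uses the same concavity in the
    other direction. *)
Lemma raise neg m e c : in_space neg m -> good neg e -> slope m e <= 0 -> 1 <= c ->
 mconn neg m (upd m e (c * m e)).
move=> hm ge sl c1; apply: scale_path => //; first by lra.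
move=> t /andP[t0 t1]; rewrite -subr_le0 (fpol_scale _ _ ge) addrAC subrr add0r.
apply: mulr_ge0_le0; first by rewrite mulr_ge0 // subr_ge0.
rewrite -[X in _ <= X]addr0; apply: lerD => //; apply: mulr_le0_ge0.
 by rewrite mulr_le0_ge0 ?sqr_ge0 // ltW // (good_top hm.1 ge).
by rewrite mulr_ge0 // subr_ge0.
Qed.

Lemma lower neg m e c : in_space neg m -> good neg e -> 0 <= slope m e -> 0 < c <= 1 ->
 fpol (upd m e (c * m e)) <= fpol m /\ mconn neg m (upd m e (c * m e)).
move=> hm ge sl /andP[c0 c1].
have le d : d <= 1 -> fpol (upd m e (d * m e)) <= fpol m.
 move=> d1; rewrite -subr_le0 (fpol_scale _ _ ge). apply: mulr_le0_ge0; first by rewrite subr_le0.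
 apply: addr_ge0 => //; apply: mulr_le0; last by rewrite subr_le0.
 by rewrite mulr_le0_ge0 ?sqr_ge0 // ltW // (good_top hm.1 ge).
split; first exact: le.
apply: scale_path => // t /andP[t0 t1]; apply: le.
by rewrite gerDl mulr_ge0_le0 // subr_le0.
Qed.

(** Both points are raised to one large value of the entry [e]. There the leading term keeps [fpol]
    negative along the whole segment between the other entries. *)
Lemma raise_join neg m m' e : in_space neg m -> in_space neg m' -> good neg e ->
 slope m e <= 0 -> slope m' e <= 0 -> mconn neg m m'.
move=> hm hm' ge sl sl'; have /andP[e15 _] := ge.
pose s := sgp neg e; have ss : s * s = 1 by rewrite /s /sgp; case: ifP; rewrite ?mulrNN mulr1.
pose g t k := m k + clip t * (m' k - m k).
have cc := @clamp_cts R.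
have cg k : continuous (g^~ k).
 by apply: ctsD; [exact: ctsC|apply: ctsM; [exact: cc|exact: ctsC]].
have sg t k : (k < 15)%N -> 0 < sgp neg k * g t k.
 move=> k15; have := hm.1 _ k15; have := hm'.1 _ k15. have := clamp_itv t; rewrite /g /= in_itv /= => /andP[h0 h1].
 set c := clip t in h0 h1 *; set q := sgp neg k; move=> p1 p2.
 have -> : q * (m k + c * (m' k - m k)) = (1 - c) * (q * m k) + c * (q * m' k) by ring.
 have [->|c0] := eqVneq c 0; first by rewrite subr0 mul1r mul0r addr0.
 by apply: ltr_wpDl; [rewrite mulr_ge0 ?subr_ge0 // ltW|rewrite mulr_gt0 // lt0r c0].
have tg t : top_coef (g t) e < 0 by apply: good_top ge; exact: sg.
pose C t := fpol (upd (g t) e 0).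
pose B t := fpol (upd (g t) e 1) - C t - top_coef (g t) e.
have cC : continuous C by apply: cts_fpol; apply: cts_upd => //; exact: ctsC.
have cB : continuous B.
 apply: ctsB; last exact: cts_top. by apply: ctsB => //; apply: cts_fpol; apply: cts_upd => //; exact: ctsC.
pose h t := (`|B t| + `|C t|) / `|top_coef (g t) e|.
have ch : continuous h.
 apply: ctsM; first by apply: ctsD; exact: cts_norm.
 by apply: ctsV => [t|]; [rewrite normr_eq0 ltr0_neq0|apply: cts_norm; exact: cts_top].
have [b hb] := bounded01 ch.
(* Larger than [b], which bounds the ratio of the lower coefficients to the leading one, and at
   least as large as both starting values, so that the two ends are indeed raised. *)
pose X := `|b| + 1 + `|m e| + `|m' e|.
have X1 : 1 <= X.
 by rewrite /X; have := normr_ge0 b; have := normr_ge0 (m e); have := normr_ge0 (m' e); lra.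
have neg_t t : 0 <= t <= 1 -> fpol (upd (g t) e (s * X)) < 0.
 move=> t01; rewrite (fpol_upd _ _ e15) -/(C t) -/(B t) exprMn expr2 ss mul1r.
 have := hb t t01; rewrite /h ler_pdivrMr ?normr_gt0 ?ltr0_neq0 //.
 rewrite (ltr0_norm (tg t)); move: (tg t) (B t) (C t) => {}tg b' c' hbc. set A := top_coef _ _ in tg hbc *.
 have h1 : s * X * b' <= X * `|b'|.
  apply: le_trans (ler_norm _) _; rewrite !normrM (_ : `|s| = 1) ?mul1r.
   by rewrite ger0_norm //; lra.
  by rewrite /s /sgp; case: ifP; rewrite ?normrN normr1.
 have h2 : c' <= X * `|c'| by apply: le_trans (ler_norm _) _; rewrite ler_peMl.
 have h3 : X * (`|b'| + `|c'|) <= X * (b * - A) by rewrite ler_pM2l //; lra. have h4 : X * (b * - A) < X * (X * - A).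
  rewrite ltr_pM2l ?ltr_pM2r ?oppr_gt0 //; last by lra.
  by rewrite /X; have := ler_norm b; have := normr_ge0 (m e); have := normr_ge0 (m' e); lra.
 move: h1 h2 h3 h4; rewrite mulrDr; clear; lra.
have up (n : nat -> R) : in_space neg n -> slope n e <= 0 -> `|n e| <= X ->
  mconn neg n (upd n e (s * X)).
 move=> hn sn nX; have n0 : 0 < s * n e by exact: hn.1. have nE : `|n e| = s * n e.
  rewrite -(gtr0_norm n0) normrM (_ : `|s| = 1) ?mul1r //. by rewrite /s /sgp; case: ifP; rewrite ?normrN normr1.
 rewrite (_ : s * X = X / (s * n e) * n e); last first.
  rewrite invfM mulrA mulfVK; last by apply: contraTneq n0 => ->; rewrite mulr0 ltxx.
  rewrite mulrC; congr (_ * _); apply: (mulfI (_ : s != 0)); last first.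
   by rewrite divff ?ss //; apply: contra_eqN ss => /eqP ->; rewrite mul0r eq_sym oner_neq0.
  by apply: contra_eqN ss => /eqP ->; rewrite mul0r eq_sym oner_neq0.
 by apply: raise => //; rewrite ler_pdivlMr // mul1r -nE.
have mX : `|m e| <= X by rewrite /X; have := normr_ge0 b; have := normr_ge0 (m' e); lra.
have mX' : `|m' e| <= X by rewrite /X; have := normr_ge0 b; have := normr_ge0 (m e); lra.
apply: pconnT (up _ hm sl mX) (pconnT _ (pconn_sym (up _ hm' sl' mX'))).
have -> : upd m e (s * X) = (fun t => upd (g t) e (s * X)) 0.
 by apply/funext => k; rewrite /upd /g clamp_le0 // mul0r addr0.
have -> : upd m' e (s * X) = (fun t => upd (g t) e (s * X)) 1.
 by apply/funext => k; rewrite /upd /g clamp_ge1 // mul1r addrC subrK.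
apply: (mconn_itv (g := fun t => upd (g t) e (s * X))) => [k|t t01].
 by apply: cts_upd => //; exact: ctsC.
split; last exact: neg_t.
move=> k k15; rewrite /upd; case: eqP => [->|_]; last exact: sg.
by rewrite mulrA -/s ss mul1r; lra.
Qed.

(** The slopes along [L] are positive on the whole path component of m; the entries in [L] can then
    be lowered in any order without leaving it, see [never_up_scale]. *)
Definition never_up neg (L : seq nat) m : Prop :=
 in_space neg m /\ forall m', mconn neg m m' -> forall e, e \in L -> 0 < slope m' e.

Lemma never_up_conn neg L m m' : never_up neg L m -> mconn neg m m' -> never_up neg L m'.
move=> [hm h] mm'; split; first by have [] := mconn_in mm'.
by move=> m'' mm'' e ge; apply: h ge; exact: pconnT mm' mm''.
Qed.

Definition scale_at (L : seq nat) (c : nat -> R) m : nat -> R :=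
 fun k => if k \in L then c k * m k else m k.

Lemma never_up_scale neg L0 m L c : all (good neg) L0 -> never_up neg L0 m ->
 {subset L <= L0} -> uniq L ->
 (forall k, 0 < c k <= 1) ->
 fpol (scale_at L c m) <= fpol m /\ mconn neg m (scale_at L c m).
move=> /allP gL0 nm; have [hm h] := nm; elim: L => [|e L IH] /=.
 by move=> *; split; [exact: lexx|exact: mconn_refl].
move=> sL /andP[eL uL] hc; have eL0 : e \in L0 by apply: sL; rewrite mem_head.
have [le cn] := IH (fun k kL => sL k (mem_behead (s := e :: L) kL)) uL hc.
have [hn h'] := never_up_conn nm cn.
have [le' cn'] := lower hn (gL0 _ eL0) (ltW (h' _ (mconn_refl hn) _ eL0)) (hc e).
suff -> : scale_at (e :: L) c m = upd (scale_at L c m) e (c e * scale_at L c m e).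
 by split; [exact: le_trans le' le|exact: pconnT cn cn'].
apply/funext => k; rewrite /scale_at /upd inE; case: eqP => [->|//] /=.
by rewrite (negbTE eL).
Qed.

Lemma limit_ge0 (f : R -> R) : continuous f -> (forall t, 0 < t <= 1 -> 0 <= f t) -> 0 <= f 0.
move=> cf h; rewrite leNgt; apply/negP => f0.
have f0' : 0 < - f 0 by rewrite oppr_gt0.
have [d d0 near0] := cts_near 0 cf f0'.
pose t := Num.min (d / 2) 1.
have t0 : 0 < t by rewrite lt_min ltr01 andbT divr_gt0.
have := h t; rewrite t0 /t ge_min lexx orbT -/t => /(_ isT).
have : `|t - 0| < d.
 by rewrite subr0 gtr0_norm // /t; apply: (@le_lt_trans _ _ (d / 2)); rewrite ?ge_min ?lexx //; lra.
by move=> /near0; rewrite ltr_norml => /andP[_]; lra.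
Qed.

(** Lowering the entries of [L] all the way to 0 leads to the boundary, where the inequalities
    survive in weak form and explicit identities can contradict them. *)
Lemma never_up_limit neg L0 m L : all (good neg) L0 -> never_up neg L0 m ->
 all (mem L0) L -> uniq L ->
 fpol (zero_at L m) <= fpol m /\ forall e, e \in L0 -> 0 <= slope (zero_at L m) e.
move=> gL0 nm /allP sL uL; pose g (t : R) := scale_at L (fun=> t) m.
have g0 : zero_at L m = g 0.
 by apply/funext => k; rewrite /g /scale_at /zero_at mul0r.
have cg k : continuous (g^~ k).
 by rewrite /g /scale_at; case: (k \in L); cts.
have H t : 0 < t <= 1 -> fpol (g t) <= fpol m /\ mconn neg m (g t).
 by move=> t01; apply: never_up_scale gL0 nm sL uL _ => k.
rewrite g0; split=> [|e ge].
 rewrite -subr_ge0; apply: (limit_ge0 (f := fun t => fpol m - fpol (g t))).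
  by apply: ctsB; [exact: ctsC|exact: cts_fpol].
 by move=> t /H[? _]; rewrite subr_ge0.
apply: (limit_ge0 (f := fun t => slope (g t) e)); first exact: cts_slope.
by move=> t /H[_ cn]; apply: ltW; have [_] := nm; apply.
Qed.

Definition can_rise neg (L : seq nat) m : Prop :=
 exists m' e, [/\ mconn neg m m', e \in L & slope m' e <= 0].

Lemma rise_or_never neg L m : in_space neg m -> can_rise neg L m \/ never_up neg L m.
move=> hm; have [|n] := pselect (can_rise neg L m); first by left.
right; split=> // m' mm' e ge; rewrite ltNge; apply/negP => sl; apply: n.
by exists m', e.
Qed.

(** A point that can be raised along every edge of [L]; by [raise_join] it is joined to each point
    that can be raised along one of them. *)
Definition is_hub neg (L : seq nat) m : Prop :=
 in_space neg m /\ forall e, e \in L -> slope m e <= 0.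

Lemma hub_join neg L m m' : all (good neg) L -> is_hub neg L m -> can_rise neg L m' ->
 mconn neg m' m.
move=> /allP gL [hm h] [m'' [e [cn eL sl]]]; have [_ h''] := mconn_in cn.
by apply: pconnT cn _; apply: raise_join (gL _ eL) sl (h _ eL).
Qed.

End GramSpace.

(** * The sign patterns on six planes, one by one *)

Section Sign.
Variable R : realType.
Implicit Types (m : nat -> R) (neg : seq nat).

Definition of_list (l : seq R) : nat -> R := fun k => nth 0 l k.

Definition space_connected neg : Prop :=
 forall m m', in_space neg m -> in_space neg m' -> mconn neg m m'.

Lemma hub_connected neg L m0 : all (good neg) L -> is_hub neg L m0 ->
 (forall m, in_space neg m -> can_rise neg L m) -> space_connected neg.
move=> gL h0 rise m m' hm hm'.
exact: pconnT (hub_join gL h0 (rise _ hm)) (pconn_sym (hub_join gL h0 (rise _ hm'))).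
Qed.

(** Five slopes with the negative sum 2 [fpol] cannot all be positive. *)
Lemma sum5_rise neg m e0 e1 e2 e3 e4 : in_space neg m ->
 slope m e0 + slope m e1 + slope m e2 + slope m e3 + slope m e4 = 2 * fpol m ->
 can_rise neg [:: e0; e1; e2; e3; e4] m.
move=> hm es; have [//|nm] := rise_or_never [:: e0; e1; e2; e3; e4] hm.
exfalso; have [_ h] := nm; have {}h e := h _ (mconn_refl hm) e.
have [_ f0] := hm; move: (h e0) (h e1) (h e2) (h e3) (h e4) f0 es.
rewrite !inE !eqxx !orbT => h0 h1 h2 h3 h4.
by move: (h0 isT) (h1 isT) (h2 isT) (h3 isT) (h4 isT); lra.
Qed.

Ltac eval_fpol := rewrite /slope /fpol /top_coef /comp_prod /mprod /= unlock /= /upd /of_list /=.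

Ltac all15 := case=> [|[|[|[|[|[|[|[|[|[|[|[|[|[|[|?]]]]]]]]]]]]]]] // _.
Ltac list_space := split; [rewrite /of_list /sgp; all15; rewrite /=; lra|eval_fpol; lra].
Ltac hub_tac := split; [list_space|
 move=> e; rewrite !inE; do ?[move=> /predU1P[->|]]; [..|move=> /eqP ->]; eval_fpol; lra].

(** Explicit points at which a list of slopes is nonpositive. The number in the name is the position
    of the sign pattern in [reps 6], counted from 1. *)
Definition hub4 : nat -> R := of_list [:: 2; 2; 1; 2; 2; -1; -2; 2; 2; -2; 2; 2; 1; 1; 2].
Definition hub5 : nat -> R := of_list [:: 1; 1; 2; 1; 2; 1; 2; -2; 2; -2; 1; 1; 1; 2; 2].
Definition hub6 : nat -> R := of_list [:: 2; 2; 2; 1; 1; -2; -2; 1; -1; 1; 2; 1; 2; 1; -2].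
Definition hub7 : nat -> R := of_list [:: 2; 1; 1; 2; 1; -1; -1; -1; 2; -1; 2; 1; 2; 1; 2].
Definition hub8 : nat -> R := of_list [:: 1; 1; 1; 3; 1; 1; -2; -1; 2; -2; -1; 2; 1; 3; 1].
Definition hub8' : nat -> R := of_list [:: 2; 1; 1; 1; 1; 1; -2; -2; 1; -2; -2; 3; 1; 1; 1].
Definition hub9 : nat -> R := of_list [:: 2; 1; 1; 2; 1; 1; -1; 1; -1; -2; -1; 1; 2; 1; 2].
Definition hub10 : nat -> R := of_list [:: 2; 1; 2; 2; 1; 2; 1; -1; -1; -1; 1; -1; -2; 1; 2].

Lemma hub4P : is_hub [:: 5; 6; 9]%N [:: 0; 1; 2; 8; 10; 11; 12; 13; 7]%N hub4.
by rewrite /hub4; hub_tac. Qed.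

Lemma hub5P : is_hub [:: 7; 9]%N [:: 7; 9; 1; 2; 8; 13; 14; 0; 3]%N hub5.
by rewrite /hub5; hub_tac. Qed.

Lemma hub6P : is_hub [:: 5; 6; 8; 14]%N [:: 1; 5; 9; 10; 11]%N hub6.
by rewrite /hub6; hub_tac. Qed.

Lemma hub7P : is_hub [:: 5; 6; 7; 9]%N [:: 4; 9; 1; 2; 11; 13; 7]%N hub7.
by rewrite /hub7; hub_tac. Qed.

Lemma hub9P : is_hub [:: 6; 8; 9; 10]%N [:: 3; 7; 10; 12; 14]%N hub9.
by rewrite /hub9; hub_tac. Qed.

Lemma hub10P : is_hub [:: 7; 8; 9; 11; 12]%N [:: 0; 1; 2; 3; 4]%N hub10.
by rewrite /hub10; hub_tac. Qed.

Lemma connected6 : space_connected [:: 5; 6; 8; 14]%N.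
apply: (hub_connected _ hub6P) => [//|m hm].
exact: (sum5_rise hm (euler2 m)).
Qed.

Lemma connected9 : space_connected [:: 6; 8; 9; 10]%N.
apply: (hub_connected _ hub9P) => [//|m hm].
exact: (sum5_rise hm (euler4 m)).
Qed.

Lemma connected10 : space_connected [:: 7; 8; 9; 11; 12]%N.
apply: (hub_connected _ hub10P) => [//|m hm].
exact: (sum5_rise hm (euler0 m)).
Qed.

Lemma in_space_neq0 neg m e : in_space neg m -> (e < 15)%N -> m e != 0.
by move=> [h _] /h; apply: contraTneq => ->; rewrite mulr0 ltxx. Qed.

Lemma in_space_gt0 neg m e : in_space neg m -> (e < 15)%N -> e \notin neg -> 0 < m e.
by move=> [h _] /h h' ne; move: h'; rewrite /sgp (negbTE ne) mul1r. Qed.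

(** If no listed entry could ever rise, eight of them could be lowered to 0, and in the limit the
    slope at the edge 7 would be negative. *)
Lemma connected4 : space_connected [:: 5; 6; 9]%N.
apply: (hub_connected _ hub4P) => [//|m hm].
have [//|nm] := rise_or_never [:: 0; 1; 2; 8; 10; 11; 12; 13; 7]%N hm; exfalso.
have [_ h] := @never_up_limit R [:: 5; 6; 9]%N [:: 0; 1; 2; 8; 10; 11; 12; 13; 7]%N m
 [:: 0; 1; 2; 8; 10; 11; 12; 13]%N isT nm isT isT.
have := h 7 isT; rewrite limit_slope4 mulNr oppr_ge0 leNgt mulr_gt0 //.
by rewrite exprn_even_gt0 //= !mulf_neq0 // (in_space_neq0 hm).
Qed.

Lemma connected5 : space_connected [:: 7; 9]%N.
apply: (hub_connected _ hub5P) => [//|m hm].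
have [//|nm] := rise_or_never [:: 7; 9; 1; 2; 8; 13; 14; 0; 3]%N hm; exfalso.
have [f0 h] := @never_up_limit R [:: 7; 9]%N [:: 7; 9; 1; 2; 8; 13; 14; 0; 3]%N m
 [:: 7; 9; 1; 2; 8; 13; 14]%N isT nm isT isT.
have := mulr_ge0 (h 0%N isT) (h 3 isT); rewrite limit_slope5 leNgt; apply/negP/negPn.
have [_ fm] := hm; rewrite nmulr_rlt0; last by rewrite pmulr_rlt0 // (le_lt_trans f0).
have p e : (e < 15)%N -> e \notin [:: 7; 9]%N -> 0 < m e by exact: in_space_gt0.
by rewrite !mulr_gt0 ?p // exprn_gt0 ?p.
Qed.

(** If nothing could rise, then at the limit with entry 7 equal to 0 its slope is 0, and
    [slope_sum7] makes six nonnegative slopes add up to the negative number 2 [fpol]. *)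
Lemma connected7 : space_connected [:: 5; 6; 7; 9]%N.
apply: (hub_connected _ hub7P) => [//|m hm].
have [//|nm] := rise_or_never [:: 4; 9; 1; 2; 11; 13; 7]%N hm; exfalso.
have [f0 h] := @never_up_limit R [:: 5; 6; 7; 9]%N [:: 4; 9; 1; 2; 11; 13; 7]%N m
 [:: 7]%N isT nm isT isT.
have := slope_sum7 (zero_at [:: 7]%N m); rewrite limit_slope7.
have [_ fm] := hm; move: f0 fm (h 4 isT) (h 9 isT) (h 1%N isT) (h 2 isT) (h 11 isT) (h 13 isT).
lra.
Qed.

Definition neg8 := [:: 6; 7; 9; 10]%N.
(** All edges except 4 = (0, 5), 5 = (1, 2) and 12 = (3, 4), which form a perfect matching. *)
Definition cross8 := [:: 0; 1; 2; 3; 6; 7; 8; 9; 10; 11; 13; 14]%N.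

Lemma hub8_space : in_space neg8 hub8.
by rewrite /hub8; list_space. Qed.

Lemma hub8'_space : in_space neg8 hub8'.
by rewrite /hub8'; list_space. Qed.

Lemma hub8_slope e : e \in [:: 0; 1; 3; 6; 7; 8; 9; 10; 11; 13]%N -> slope hub8 e <= 0.
by case: e => [|[|[|[|[|[|[|[|[|[|[|[|[|[|e]]]]]]]]]]]]]] // _; rewrite /hub8; eval_fpol; lra.
Qed.

Lemma hub8'_slope e : e \in [:: 0; 2; 14]%N -> slope hub8' e <= 0.
by case: e => [|[|[|[|[|[|[|[|[|[|[|[|[|[|[|e]]]]]]]]]]]]]]] // _; rewrite /hub8'; eval_fpol; lra.
Qed.

(** Two hubs share the edges of [cross8] between them; they are joined to each other through the
    edge 0, along which both can be raised. *)
Lemma rise8 m : can_rise neg8 cross8 m -> mconn neg8 m hub8.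
move=> [m' [e [cn ge sl]]]; have [_ hm'] := mconn_in cn.
have eL := ge; have {}ge : good neg8 e by exact: (allP (isT : all (good neg8) cross8)).
apply: pconnT cn _.
have [e8|] := boolP (e \in [:: 0; 1; 3; 6; 7; 8; 9; 10; 11; 13]%N).
 exact: raise_join hm' hub8_space ge sl (hub8_slope e8).
have [e8' _|] := boolP (e \in [:: 0; 2; 14]%N).
 apply: pconnT (raise_join hm' hub8'_space ge sl (hub8'_slope e8')) _.
 exact: raise_join hub8'_space hub8_space (isT : good neg8 0) (hub8'_slope _) (hub8_slope _).
move=> h1 h2; have := allP (isT : all (fun e => (e \in [:: 0; 2; 14]%N) ||
 (e \in [:: 0; 1; 3; 6; 7; 8; 9; 10; 11; 13]%N)) cross8) _ eL.
by rewrite (negbTE h1) (negbTE h2).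
Qed.

Definition vscale i c m : nat -> R :=
 fun k => if (nth (0, 0)%N pairs6 k).1 == i then c * m k
  else if ((nth (0, 0)%N pairs6 k).2 == i) && (k < 15)%N then c * m k else m k.

Lemma fpol_vertex_scale i c m : i \in [:: 0; 1; 3]%N ->
 fpol (vscale i c m) = c ^+ 2 * fpol m.
by rewrite !inE => /or3P[] /eqP ->; rewrite /vscale; eval_fpol; ring.
Qed.

Lemma vscale_conn neg i c m : i \in [:: 0; 1; 3]%N -> in_space neg m -> 0 < c ->
 mconn neg m (vscale i c m).
move=> i3 [sm fm] c0.
have -> : m = (fun t => vscale i (1 + t * (c - 1)) m) 0 :> (nat -> R).
 by apply/funext => k; rewrite /vscale mul0r addr0 mul1r !if_same.
rewrite [X in mconn _ _ (vscale _ _ X)](_ : _ = m); last first.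
 by apply/funext => k; rewrite /vscale mul0r addr0 mul1r !if_same.
have -> : vscale i c m = (fun t => vscale i (1 + t * (c - 1)) m) 1.
 by rewrite mul1r addrC subrK.
apply: (mconn_itv (g := fun t => vscale i (1 + t * (c - 1)) m)) => [k|t /andP[t0 t1]].
 by rewrite /vscale; case: (_.1 == i); [cts|case: (_ && _); cts].
have p : 0 < 1 + t * (c - 1).
 have -> : 1 + t * (c - 1) = (1 - t) + t * c by ring. have [->|tn] := eqVneq t 0; first by rewrite subr0 mul0r addr0.
 by apply: ltr_wpDl; rewrite ?subr_ge0 // mulr_gt0 // lt0r tn.
split=> [k k15|].
 have h := sm _ k15; have h' : 0 < sgp R neg k * ((1 + t * (c - 1)) * m k).
  by rewrite mulrCA mulr_gt0.
 by rewrite /vscale; case: (_.1 == i) => //; case: (_ && _).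
by rewrite fpol_vertex_scale // pmulr_rlt0 // exprn_gt0.
Qed.

(** The vertices 0, 1 and 3 lie on one each of the edges 4, 5 and 12, so rescaling the planes 0, 1
    and 3 makes these entries 1 without disturbing one another. *)
Lemma normalise8 m : in_space neg8 m -> (forall k, (15 <= k)%N -> m k = 0) ->
 exists m', [/\ mconn neg8 m m', forall k, (15 <= k)%N -> m' k = 0,
  m' 4 = 1, m' 5 = 1 & m' 12 = 1].
move=> hm junk.
have p e : (e < 15)%N -> e \notin neg8 -> 0 < m e by exact: in_space_gt0 hm.
have p4 := p 4 isT isT; have p5 := p 5 isT isT; have p12 := p 12 isT isT.
have c1 := vscale_conn (isT : 0 \in [:: 0; 1; 3])%N hm (_ : 0 < (m 4)^-1).
rewrite invr_gt0 in c1; have [_ h1] := mconn_in (c1 p4).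
have c2 := vscale_conn (isT : 1 \in [:: 0; 1; 3])%N h1 (_ : 0 < (m 5)^-1).
rewrite invr_gt0 in c2; have [_ h2] := mconn_in (c2 p5).
have c3 := vscale_conn (isT : 3 \in [:: 0; 1; 3])%N h2 (_ : 0 < (m 12)^-1).
rewrite invr_gt0 in c3.
exists (vscale 3 (m 12)^-1 (vscale 1 (m 5)^-1 (vscale 0 (m 4)^-1 m))); split.
- exact: pconnT (c1 p4) (pconnT (c2 p5) (c3 p12)).
- move=> k k15; have z i c (a : nat -> R) : a k = 0 -> vscale i c a k = 0.
  by move=> ak; rewrite /vscale ak mulr0 !if_same.
 by rewrite !z ?junk.
- by rewrite /vscale /= mulVf ?lt0r_neq0.
- by rewrite /vscale /= mulVf ?lt0r_neq0.
- by rewrite /vscale /= mulVf ?lt0r_neq0.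
Qed.

Lemma min_scale (c x : R) : 0 < c -> Num.min 1 c * x = Num.min 1 c^-1 * (c * x).
move=> c0; have [c1|c1] := leP 1 c.
 by rewrite min_r ?invf_le1 // mulKf ?lt0r_neq0 // mul1r.
by rewrite min_l ?mul1r // invf_ge1 // ltW.
Qed.

(** All entries of [cross8] may be lowered at both points. Once the three remaining entries are
    normalised, both are lowered to the entry of smaller absolute value, edge by edge, and so to the
    same point. *)
Lemma never_up8 m m' : never_up neg8 cross8 m -> never_up neg8 cross8 m' ->
 (forall k, (15 <= k)%N -> m k = 0) -> (forall k, (15 <= k)%N -> m' k = 0) ->
 mconn neg8 m m'.
move=> nm nm' jm jm'; have [n [cn jn n4 n5 n12]] := normalise8 nm.1 jm.
have [n' [cn' jn' n4' n5' n12']] := normalise8 nm'.1 jm'.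
have {nm} nn := never_up_conn nm cn; have {nm'} nn' := never_up_conn nm' cn'.
apply: pconnT cn (pconnT _ (pconn_sym cn')).
pose L := cross8.
have L15 k : k \in L -> (k < 15)%N by do 15?[case: k => [|k] //].
pose c (a b : nat -> R) k := if k \in L then Num.min 1 (b k / a k) else 1.
have q (a b : nat -> R) k : never_up neg8 cross8 a -> never_up neg8 cross8 b -> k \in L -> 0 < b k / a k.
 move=> [[ha _] _] [[hb _] _] /L15 k15; have := ha _ k15; have := hb _ k15.
 rewrite /sgp; case: ifP => _; rewrite ?mulN1r ?mul1r; last by move=> *; exact: divr_gt0.
 by rewrite !oppr_gt0 => *; rewrite nmulr_rgt0 // invr_lt0.
have c01 a b k : never_up neg8 cross8 a -> never_up neg8 cross8 b -> 0 < c a b k <= 1.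
 move=> na nb; rewrite /c; case: ifP => kL; last by rewrite ltr01 lexx. by rewrite lt_min ltr01 q //= ge_min lexx.
have [_ h1] := @never_up_scale R neg8 cross8 n L (c n n') isT nn (fun k (kL : k \in L) => kL) isT (fun k => c01 _ _ k nn nn').
have [_ h2] := @never_up_scale R neg8 cross8 n' L (c n' n) isT nn' (fun k (kL : k \in L) => kL) isT (fun k => c01 _ _ k nn' nn).
apply: pconnT h1 (pconn_sym _); rewrite (_ : scale_at L (c n n') n = scale_at L (c n' n) n') //.
apply/funext => k; rewrite /scale_at /c; case: ifP => kL; last first.
 have [k15|k15] := leqP 15 k; first by rewrite jn ?jn'.
 move: kL k15; do 15?[case: k => [|k] //]; rewrite ?n4 ?n5 ?n12 ?n4' ?n5' ?n12' //.
have n0 : n k != 0 by apply: in_space_neq0 nn.1 (L15 k kL).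
have n0' : n' k != 0 by apply: in_space_neq0 nn'.1 (L15 k kL).
have r0 := q _ _ _ nn nn' kL.
rewrite ?kL -[X in _ = _ * X](divfK n0) -[n k / n' k]invf_div; exact: min_scale.
Qed.

End Sign.

(** * From configurations to points of the Gram space and back *)

Section Pattern.
Variable R : realType.
Implicit Types (neg : seq nat) (Y : 'M[R]_4) (m : nat -> R).

Lemma heq_gl n (a : forms R n) (g : 'M[R]_4) : \det g != 0 ->
 heq a (fun i => a i *m g).
move=> dg; have gu : g^T \in unitmx by rewrite unitmx_tr unitmxE unitfE.
have cl (q : nat) (c : forms R q) (h : 'M[R]_4) k :
  continuous (fun x : complement (loci c) => (val x *m h) 0 k).
 apply: cts_mulmx => i j; last exact: ctsC. by rewrite ord1; exact: val_cts.
apply: (heq_straight (f := fun x => x *m invmx g^T) (g := fun x => x *m g^T)) => //.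
- by move=> x ax i; rewrite trmx_mul mulmxA mulmxKV.
- by move=> x ax i; move: (ax i); rewrite trmx_mul mulmxA.
- by move=> x s ax _; rewrite mulmxKV // subrr scaler0 addr0.
- by move=> x s ax _; rewrite mulmxK // subrr scaler0 addr0.
Qed.

Lemma heq_perm n (a : forms R n) (s : 'I_n -> 'I_n) : injective s ->
 heq a (a \o s).
move=> sI; have [s' sK s'K] := injF_bij sI.
apply: (heq_straight (f := id) (g := id)) => //; try by move=> k; exact: val_cts.
- by move=> x ax i; exact: ax.
- by move=> x ax i; have := ax (s' i); rewrite /= s'K.
- by move=> x t ax _; rewrite subrr scaler0 addr0.
- by move=> x t ax _; rewrite subrr scaler0 addr0.
Qed.

Definition i6 (k : nat) : 'I_6 := inord k.
Definition i5 (k : nat) : 'I_5 := inord k.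

(** The value 0 beyond the fifteen edges lets two such points be compared as functions on all
    numbers. *)
Definition mvals (a : forms R 6) : nat -> R := fun e =>
 if (e < 15)%N then let p := nth (0, 0)%N pairs6 e in cross (a (i6 p.1)) (a (i6 p.2)) else 0.

Definition pattern neg (a : forms R 6) : Prop :=
 forall e, (e < 15)%N -> 0 < sgp R neg e * mvals a e.

Lemma pair6_neq e : (e < 15)%N ->
 i6 (nth (0, 0)%N pairs6 e).1 != i6 (nth (0, 0)%N pairs6 e).2.
by move=> e15; rewrite -val_eqE; do 15?[case: e e15 => [|e] e15; first by rewrite /= !inordK].
Qed.

Lemma pair6P (i j : 'I_6) : i != j -> exists2 e, (e < 15)%N &
 (i = i6 (nth (0, 0)%N pairs6 e).1 /\ j = i6 (nth (0, 0)%N pairs6 e).2) \/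
 (j = i6 (nth (0, 0)%N pairs6 e).1 /\ i = i6 (nth (0, 0)%N pairs6 e).2).
move=> ij; have H k l : (k < l)%N -> (l < 6)%N -> exists2 e, (e < 15)%N &
  (nth (0, 0)%N pairs6 e) = (k, l).
 move=> kl l6; exists (index (k, l) pairs6); last rewrite nth_index //.
  by rewrite (_ : 15 = size pairs6)%N // index_mem;
   do 6?[case: l l6 kl => [|l] l6 kl //; try by do 6?[case: k kl => [|k] kl //]].
 by do 6?[case: l l6 kl => [|l] l6 kl //; try by do 6?[case: k kl => [|k] kl //]].
have E (k : 'I_6) : k = i6 k by rewrite /i6 inord_val.
have [lt|lt|e] := ltngtP i j; last by move: ij; rewrite (val_inj e) eqxx.
- by have [e e15 p] := H _ _ lt (ltn_ord j); exists e => //; left; rewrite p /= -!E.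
- by have [e e15 p] := H _ _ lt (ltn_ord i); exists e => //; right; rewrite p /= -!E.
Qed.

Lemma pattern_cfg neg a : pattern neg a -> is_cfg a.
move=> pa i j /pair6P[e e15 h]; have := pa e e15; rewrite /mvals e15 /=.
by case: h => -[-> ->] h; [|rewrite cross_sym]; apply: contraTneq h => ->; rewrite mulr0 ltxx.
Qed.

Lemma pattern_conn neg a b : conn a b -> pattern neg a -> pattern neg b.
move=> ab pa e e15; have := pa e e15; rewrite /mvals e15 /=.
have := conn_sg (pair6_neq e15) ab; set x := cross _ _; set y := cross _ _ => xy.
have y0 : y != 0 by rewrite -sgr_eq0 -xy sgr_eq0 (pattern_cfg pa) // pair6_neq.
have [h|h|h] := ltgtP 0 y; last by move: y0; rewrite h eqxx.
 by move: xy; rewrite (gtr0_sg h) => /eqP; rewrite sgr_cp0 => x0;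
  rewrite pmulr_lgt0 // pmulr_lgt0.
by move: xy; rewrite (ltr0_sg h) => /eqP; rewrite sgr_cp0 => x0;
 rewrite nmulr_lgt0 // nmulr_lgt0.
Qed.

Lemma lift0_i6 k : (k < 5)%N -> lift ord0 (i5 k) = i6 k.+1.
by move=> k5; apply: val_inj; rewrite /= !inordK. Qed.

Lemma i6_0 : i6 0 = ord0.
by apply: val_inj; rewrite /= inordK. Qed.

Lemma cross_chart0 (x : 'I_5 -> 'M[R]_2) k : (k < 5)%N ->
 cross (chart x (i6 0)) (chart x (i6 k.+1)) = 1.
by move=> k5; rewrite i6_0 -lift0_i6 // chart0 chartS cross_inf_form det1. Qed.

Lemma cross_chartS (x : 'I_5 -> 'M[R]_2) k l : (k < 5)%N -> (l < 5)%N ->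
 cross (chart x (i6 k.+1)) (chart x (i6 l.+1)) = \det (x (i5 k) - x (i5 l)).
by move=> k5 l5; rewrite -!lift0_i6 // !chartS cross_graph -det2N opprB.
Qed.

Lemma cross0_pos neg a j : ~~ has (mem (iota 0 5)) neg -> pattern neg a ->
 0 < cross (a ord0) (a (lift ord0 j)).
move=> n0 pa; have j15 : (j < 15)%N by apply: ltn_trans (ltn_ord j) _.
have := pa j j15; rewrite /mvals j15 /sgp (_ : (val j \in neg) = false) ?mul1r.
 have -> : nth (0, 0)%N pairs6 j = (0, j.+1)%N by case: j {j15} => [[|[|[|[|[|//]]]]] ?].
 by rewrite i6_0 -lift0_i6 // /i5 inord_val.
by apply: contraNF n0 => jn; apply/hasP; exists (val j) => //; rewrite inE mem_iota /=.
Qed.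

Lemma pts_near n (g : R -> 'I_n -> 'M[R]_2) : mxpath g -> is_pts (g 0) ->
 exists2 d, 0 < d & forall t, `|t| < d -> is_pts (g t).
move=> cg g0; pose F t := \prod_(p : 'I_n * 'I_n | p.1 != p.2) \det (g t p.1 - g t p.2).
have cF : continuous F.
 apply: cts_prod => -[i j]; apply: cts_det => r k.
 cts_mx. by apply: ctsB; exact: cg.
have F0 : 0 < `|F 0| by rewrite normr_gt0; apply/prodf_neq0 => -[i j] /= ij; exact: g0.
have [d d0 h] := cts_near 0 cF F0; exists d => // t td i j ij.
have : F t != 0.
 have := h t; rewrite subr0 => /(_ td); apply: contraTneq => ->. by rewrite sub0r normrN ltxx.
by move/prodf_neq0 => /(_ (i, j) ij).
Qed.

(** After passing to a chart, the last point is translated to the origin and the four rows are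
    perturbed by a small scalar matrix until they are independent. *)
Lemma pattern_gram neg a : ~~ has (mem (iota 0 5)) neg -> pattern neg a ->
 exists2 Y, \det Y != 0 & conn a (chart (pts4 Y)).
move=> n0 pa; have ca := pattern_cfg pa.
have [x px ax] := @chart_normal R 5 a isT ca (fun j => cross0_pos j n0 pa).
pose Y0 : 'M[R]_4 := \matrix_j unpt (x (lift ord_max j) - x ord_max).
have xY : pts_conn x (pts4 Y0).
 have -> : x = (fun t k => x k - t *: x ord_max) 0 :> ('I_5 -> _).
  by apply/funext => k; rewrite scale0r subr0.
 have -> : pts4 Y0 = (fun t k => x k - t *: x ord_max) 1.
  apply/funext => k; rewrite scale1r /pts4; case: (unliftP ord_max k) => [j|] -> /=.
   by rewrite rowK unptK.
  by rewrite subrr.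
 apply: (pconn_itv (g := fun t k => x k - t *: x ord_max)) => [k i j|t _ i j ij].
  cts_mx. by cts.
 by rewrite opprB addrA subrK px.
pose g t := pts4 (Y0 + t%:M).
have cg : mxpath g.
 move=> k i j; rewrite /g /pts4; case: (unlift ord_max k) => [l|] /=; last first.
  by apply: (ctsE (g := fun=> 0)) => [t|]; [rewrite mxE|exact: ctsC].
 apply: (ctsE (g := fun t : R => pt (row l Y0) i j + t * pt (row l 1%:M) i j)) => [t|].
  have -> : pt (row l (Y0 + t%:M)) = pt (row l Y0) + t *: pt (row l 1%:M).
   rewrite -linearZ -linearD; congr pt; apply/rowP => q. by rewrite !mxE mulr_natr.
  by move: (pt (row l Y0)) (pt (row l 1%:M)) => A B; rewrite !mxE.
 by cts.
have g0 : g 0 = pts4 Y0 by rewrite /g raddf0 addr0.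
have pY0 : is_pts (g 0) by rewrite g0; case: xY => h [_ hP _ <-]; exact: hP.
have [d d0 gd] := pts_near cg pY0.
have [t [t0 td dt]] : exists t, [/\ 0 < t, t < d & \det (Y0 + t%:M) != 0].
 (* Five distinct candidates in (0, d), while a characteristic polynomial of degree 4 has at most
    four roots. *)
 pose rs := [seq d / (k.+2)%:R | k <- iota 0 5]. have [/allP H|] := boolP (all (root (char_poly (- Y0))) rs).
  have c0 : char_poly (- Y0) != 0 by rewrite monic_neq0 ?char_poly_monic. have u : uniq rs.
   rewrite map_inj_uniq ?iota_uniq // => k l /(mulfI (lt0r_neq0 d0)).
   by move/invr_inj/eqP; rewrite eqr_nat => /eqP[].
  have rsr : all (root (char_poly (- Y0))) rs by apply/allP.
  by have := max_poly_roots c0 rsr u; rewrite size_char_poly size_map size_iota.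
 move=> /allPn[t /mapP[k _ ->] rt]; exists (d / k.+2%:R); split.
 - by rewrite divr_gt0.
 - by rewrite ltr_pdivrMr // ltr_pMr // ltr1n.
 - move: rt; rewrite /root /char_poly -horner_evalE -det_map_mx.
  rewrite (_ : map_mx _ _ = Y0 + (d / k.+2%:R)%:M) //.
  apply/matrixP => i j; rewrite !mxE /= /horner_eval hornerD hornerMn hornerX hornerN hornerC opprK. exact: addrC.
exists (Y0 + t%:M) => //; apply: pconnT ax _.
apply: pts_conn_chart; apply: pconnT xY _; rewrite -g0.
have -> : pts4 (Y0 + t%:M) = (fun s => g (s * t)) 1 by rewrite mul1r.
have -> : g 0 = (fun s => g (s * t)) 0 by rewrite mul0r.
apply: (pconn_itv (g := fun s => g (s * t))) => [|s /andP[s0 s1]].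
 by apply: (mxpath_comp (h := fun s => s * t)) => //; cts.
by apply: gd; rewrite normrM (ger0_norm s0) (gtr0_norm t0); apply: le_lt_trans td; rewrite ler_piMl // ltW.
Qed.

(* For a chart the numbers sdist are the values of det at the differences of
  the five points; mgram is the Gram matrix based at the last point. *)
Definition sdist (m : nat -> R) (k l : nat) : R :=
 if k == l then 0
 else m (index ((minn k l).+1, (maxn k l).+1) pairs6) / (m k * m l).

Definition mgram (m : nat -> R) : 'M[R]_4 :=
 \matrix_(k, l) ((sdist m k 4 + sdist m l 4 - sdist m k l) / 2).

Lemma sdist_sym m k l : sdist m k l = sdist m l k.
by rewrite /sdist eq_sym minnC maxnC [m k * _]mulrC. Qed.

Lemma fpol_det m (s : nat -> nat -> R) :
 (forall k l, (k < l)%N -> (l < 5)%N ->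
  m (index (k.+1, l.+1) pairs6) = s k l * m k * m l) ->
 (forall k, s k k = 0) -> (forall k l, s k l = s l k) ->
 fpol m = - 16 * (m 0 * m 1 * m 2 * m 3 * m 4) ^+ 2 *
  ddet 4 (fun k l => (s k 4 + s l 4 - s k l) / 2).
move=> h s0 sC; rewrite /= /bump /= !addn0 !add1n !s0.
rewrite (sC 1 0)%N (sC 2 0)%N (sC 2 1)%N (sC 3 0)%N (sC 3 1)%N (sC 3 2)%N.
have [h1 h2 h3 h4] := And4 (h 0 1 isT isT) (h 0 2 isT isT) (h 0 3 isT isT) (h 0 4 isT isT).
have [h5 h6 h7 h8] := And4 (h 1 2 isT isT) (h 1 3 isT isT) (h 1 4 isT isT) (h 2 3 isT isT).
have [h9 h10] := conj (h 2 4 isT isT) (h 3 4 isT isT).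
move: h1 h2 h3 h4 h5 h6 h7 h8 h9 h10; rewrite /= => h1 h2 h3 h4 h5 h6 h7 h8 h9 h10.
rewrite /fpol /comp_prod /mprod /= unlock /=.
by rewrite h1 h2 h3 h4 h5 h6 h7 h8 h9 h10; field.
Qed.

(** Dividing by the entries at the vertex 0 rescales the other planes; the factor 16 undoes the
    halves in the four rows of [mgram]. *)
Lemma mgram_fpol m : (forall k, (k < 5)%N -> m k != 0) ->
 fpol m = - 16 * (m 0 * m 1 * m 2 * m 3 * m 4) ^+ 2 * \det (mgram m).
move=> m0; rewrite det4E (fpol_det (s := sdist m)).
- congr (_ * _); have E k l : (k < 4)%N -> (l < 4)%N ->
  mgram m (i4 k) (i4 l) = (sdist m k 4 + sdist m l 4 - sdist m k l) / 2. by move=> hk hl; rewrite mxE !inordK.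
 by rewrite /= /bump /= !addn0 !add1n !E.
- move=> k l kl l5; rewrite /sdist (ltn_eqF kl) (minn_idPl (ltnW kl)) (maxn_idPr (ltnW kl)).
 by rewrite -mulrA divfK // mulf_neq0 ?m0 //; apply: ltn_trans l5.
- by move=> k; rewrite /sdist eqxx.
- exact: sdist_sym.
Qed.

Lemma gdist_mgram m (k l : 'I_5) : gdist (mgram m) k l = sdist m k l.
have s0 j : sdist m j j = 0 by rewrite /sdist eqxx.
have E (i j : 'I_5) : gext (mgram m) i j = (sdist m i 4 + sdist m j 4 - sdist m i j) / 2.
 rewrite /gext; case: (unliftP ord_max i) => [i'|] ->; last first.
  by rewrite s0 add0r (sdist_sym m 4) subrr mul0r.
 case: (unliftP ord_max j) => [j'|] -> /=; last by rewrite s0 addr0 subrr mul0r.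
 have B (p : 'I_4) : bump 4 p = p by rewrite /bump leqNgt ltn_ord. by rewrite mxE !B.
by rewrite /gdist !E !s0 (sdist_sym m l k); field.
Qed.

(** No negative pair at the plane 0, which can therefore be put at infinity, and both signs among
    the other five, as [good_gram] demands. *)
Definition mixed neg : bool := [&& ~~ has (mem (iota 0 5)) neg,
 has (mem neg) (iota 5 10) & has (fun e => e \notin neg) (iota 5 10)].

Lemma in_space_pos neg m k : mixed neg -> in_space neg m -> (k < 5)%N -> 0 < m k.
move=> /and3P[n0 _ _] hm k5; apply: (in_space_gt0 hm); first exact: ltn_trans k5 _.
by apply: contra n0 => kn; apply/hasP; exists k => //; rewrite inE mem_iota.
Qed.

Lemma sdist_sgn neg m e : mixed neg -> in_space neg m -> (5 <= e < 15)%N ->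
 exists k l : 'I_5, k != l /\ 0 < sgp R neg e * sdist m k l.
move=> mn hm /andP[e5 e15]; have p k := in_space_pos (k := k) mn hm.
have [k [l [k5 l5 kl ee]]] : exists k l, [/\ (k < 5)%N, (l < 5)%N, (k < l)%N &
  index (k.+1, l.+1) pairs6 = e].
 do 5?[case: e e5 e15 => [|e] e5 e15 //]. have : (e < 10)%N by [].
 case: e {e5 e15} => [|[|[|[|[|[|[|[|[|[|//]]]]]]]]]] _;
  [by exists 0%N, 1%N|by exists 0%N, 2%N|by exists 0%N, 3%N|by exists 0%N, 4%N|
   by exists 1%N, 2%N|by exists 1%N, 3%N|by exists 1%N, 4%N|by exists 2%N, 3%N|
   by exists 2%N, 4%N|by exists 3%N, 4%N].
exists (i5 k), (i5 l); split; first by rewrite -val_eqE /= !inordK // ltn_eqF.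
rewrite /sdist !inordK // (ltn_eqF kl) (minn_idPl (ltnW kl)) (maxn_idPr (ltnW kl)) ee.
by rewrite mulrA divr_gt0 //; [exact: hm.1|rewrite mulr_gt0 ?p].
Qed.

Lemma sdist_neq0 neg m (k l : 'I_5) : mixed neg -> in_space neg m -> k != l ->
 sdist m k l != 0.
move=> mn hm; rewrite -val_eqE /=; move: (ltn_ord k) (ltn_ord l).
move: (k : nat) (l : nat) => {}k {}l k5 l5 kl.
rewrite /sdist (negbTE kl) mulf_neq0 // ?invr_eq0 ?mulf_neq0 //.
- apply: (in_space_neq0 hm); rewrite (_ : 15 = size pairs6)%N // index_mem.
 by move: k5 l5 kl; case: k => [|[|[|[|[|//]]]]]; case: l => [|[|[|[|[|//]]]]].
- by rewrite lt0r_neq0 // (in_space_pos mn hm).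
- by rewrite lt0r_neq0 // (in_space_pos mn hm).
Qed.

Lemma good_mgram neg m : mixed neg -> in_space neg m -> good_gram (mgram m).
move=> mn hm; have m0 k : (k < 5)%N -> 0 < m k by exact: in_space_pos mn hm.
have /and3P[_ /hasP[e en e10] /hasP[e' en' e10']] := mn.
have r x : x \in iota 5 10 -> (5 <= x < 15)%N by rewrite mem_iota.
split.
- by apply/matrixP => k l; rewrite !mxE (sdist_sym m l k) [X in X - _]addrC.
- have := mgram_fpol (fun k k5 => lt0r_neq0 (m0 k k5)); have [_ f0] := hm => e0.
 move: f0; rewrite e0 -mulrA mulNr oppr_lt0 pmulr_rgt0 // pmulr_rgt0 //. by rewrite exprn_gt0 // !mulr_gt0 // m0.
- by move=> k l kl; rewrite gdist_mgram (sdist_neq0 mn hm).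
- have [k [l [_ h]]] := sdist_sgn mn hm (r _ en'); exists k, l.
 by rewrite gdist_mgram; move: h; rewrite /sgp (negbTE e10') mul1r.
- have [k [l [_ h]]] := sdist_sgn mn hm (r _ en); exists k, l.
 by rewrite gdist_mgram; move: h; rewrite /sgp (e10 : e \in neg) mulN1r oppr_gt0.
Qed.

Lemma mvals_chart0 (x : 'I_5 -> 'M[R]_2) k : (k < 5)%N -> mvals (chart x) k = 1.
move=> k5; rewrite /mvals (ltn_trans k5) //.
have -> : nth (0, 0)%N pairs6 k = (0, k.+1)%N by move: k5; case: k => [|[|[|[|[|//]]]]].
exact: cross_chart0.
Qed.

Lemma sdist_chart (x : 'I_5 -> 'M[R]_2) (k l : 'I_5) :
 sdist (mvals (chart x)) k l = \det (x k - x l).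
have H (i j : 'I_5) : (i < j)%N -> sdist (mvals (chart x)) i j = \det (x i - x j).
 move=> ij; rewrite /sdist (ltn_eqF ij) (minn_idPl (ltnW ij)) (maxn_idPr (ltnW ij)).
 rewrite (mvals_chart0 x (ltn_ord i)) (mvals_chart0 x (ltn_ord j)) mulr1 divr1 /mvals.
 have kin : (i.+1, j.+1)%N \in pairs6.
  by case: i j ij => [[|[|[|[|[|//]]]]] ?] [[|[|[|[|[|//]]]]] ?].
 rewrite (_ : 15 = size pairs6)%N // index_mem kin nth_index //=. by rewrite cross_chartS // /i5 !inord_val.
have [lt|lt|e] := ltngtP k l; first exact: H.
 by rewrite sdist_sym H // -det2N opprB.
by rewrite /sdist e eqxx (val_inj e) subrr det0.
Qed.

Lemma mgram_chart Y : mgram (mvals (chart (pts4 Y))) = gram Y.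
have gs : (gram Y)^T = gram Y by rewrite /gram !trmx_mul trmxK tr_diag_mx mulmxA.
apply/matrixP => k l; rewrite mxE.
have E (i : 'I_4) : lift ord_max i = i :> nat by rewrite /= /bump leqNgt ltn_ord.
have h1 (i j : 'I_4) : sdist (mvals (chart (pts4 Y))) i j =
  gdist (gram Y) (lift ord_max i) (lift ord_max j).
 by rewrite -det_pts4 -sdist_chart !E.
have h2 (i : 'I_4) : sdist (mvals (chart (pts4 Y))) i 4 = gdist (gram Y) (lift ord_max i) ord_max.
 by rewrite -det_pts4 -sdist_chart E.
rewrite h1 !h2 /gdist /gext !liftK !unlift_none /=.
have -> : gram Y l k = gram Y k l by rewrite -[in LHS]gs mxE.
by field.
Qed.

Lemma chart_space neg Y : pattern neg (chart (pts4 Y)) -> \det Y != 0 ->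
 in_space neg (mvals (chart (pts4 Y))).
move=> pY dY; split=> //; rewrite mgram_fpol => [|k k5]; last by rewrite mvals_chart0 ?oner_neq0.
rewrite mgram_chart det_gram !mvals_chart0 // !mulr1 expr1n mulr1 mulNr oppr_lt0.
by rewrite mulr_gt0 // exprn_even_gt0.
Qed.

(** Along the path the entries at the vertex 0 may leave the value 1 that they have in a chart;
    [mgram] divides by them, so that its values remain good Gram matrices. *)
Lemma mconn_eqv neg Y Y' : mixed neg ->
 mconn neg (mvals (chart (pts4 Y))) (mvals (chart (pts4 Y'))) -> 0 < \det Y * \det Y' ->
 eqv (chart (pts4 Y)) (chart (pts4 Y')).
move=> mn [g [cg hg g0 g1]] dd; pose H t := mgram (fun e => g t e 0 0).
have cs k l : (k < 5)%N -> (l < 5)%N -> continuous (fun t => sdist (fun e => g t e 0 0) k l).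
 move=> k5 l5; rewrite /sdist; case: (k == l); first exact: ctsC. apply: ctsM; first exact: cg.
 apply: ctsV => [t|]; last by apply: ctsM; exact: cg. by rewrite mulf_neq0 // lt0r_neq0 // (in_space_pos mn (hg t)).
apply: (gram_path (H := H)) dd => [i j|t||].
- apply: (ctsE (g := fun t => (sdist (fun e => g t e 0 0) i 4 +
  sdist (fun e => g t e 0 0) j 4 - sdist (fun e => g t e 0 0) i j) / 2)) => [t|]. by rewrite mxE.
 have i5' : (i < 5)%N by exact: ltn_trans (ltn_ord i) _. have j5' : (j < 5)%N by exact: ltn_trans (ltn_ord j) _.
 by apply: ctsM; [apply: ctsB; [apply: ctsD|]; exact: cs|exact: ctsC].
- exact: good_mgram mn (hg t).
- by rewrite /H g0 -mgram_chart; congr mgram; apply/funext => e; rewrite scalar1E.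
- by rewrite /H g1 -mgram_chart; congr mgram; apply/funext => e; rewrite scalar1E.
Qed.

End Pattern.

(** * Isotopy classes of the patterns and the orientation of the points *)

Section Classes.
Variable R : realType.
Implicit Types (neg sl : seq nat) (Y : 'M[R]_4) (a : forms R 6).

Lemma pair5P e : (5 <= e < 15)%N -> exists k l, [/\ (k < l)%N, (l < 5)%N &
 index (k.+1, l.+1) pairs6 = e].
move=> /andP[e5 e15]; do 5?[case: e e5 e15 => [|e] e5 e15 //].
have : (e < 10)%N by [].
by case: e {e5 e15} => [|[|[|[|[|[|[|[|[|[|//]]]]]]]]]] _;
 [exists 0%N, 1%N|exists 0%N, 2%N|exists 0%N, 3%N|exists 0%N, 4%N|exists 1%N, 2%N|
  exists 1%N, 3%N|exists 1%N, 4%N|exists 2%N, 3%N|exists 2%N, 4%N|exists 3%N, 4%N].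
Qed.

Definition sg5 neg k l : R := sgp R neg (index ((minn k l).+1, (maxn k l).+1) pairs6).

Definition pat5 neg (x : 'I_5 -> 'M[R]_2) : Prop :=
 forall k l, (k < l)%N -> (l < 5)%N -> 0 < sg5 neg k l * \det (x (i5 k) - x (i5 l)).

Lemma sg5C neg k l : sg5 neg k l = sg5 neg l k.
by rewrite /sg5 minnC maxnC. Qed.

Lemma detB_sym (X Y : 'M[R]_2) : \det (X - Y) = \det (Y - X).
by rewrite -det2N opprB. Qed.

Lemma chart_mvals (x : 'I_5 -> 'M[R]_2) k l : (k < l)%N -> (l < 5)%N ->
 mvals (chart x) (index (k.+1, l.+1) pairs6) = \det (x (i5 k) - x (i5 l)).
move=> kl l5; have k5 := ltn_trans kl l5.
have := sdist_chart x (i5 k) (i5 l); rewrite /sdist !inordK // (ltn_eqF kl).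
by rewrite (minn_idPl (ltnW kl)) (maxn_idPr (ltnW kl)) (mvals_chart0 x k5) (mvals_chart0 x l5) mulr1 divr1.
Qed.

Lemma pattern_chart neg x : ~~ has (mem (iota 0 5)) neg ->
 pattern neg (chart x) <-> pat5 neg x.
move=> n0; split=> h.
 move=> k l kl l5; rewrite -chart_mvals // /sg5 (minn_idPl (ltnW kl)) (maxn_idPr (ltnW kl)).
 by apply: h; rewrite (_ : 15 = size pairs6)%N // index_mem;
  move: kl l5; case: k => [|[|[|[|[|?]]]]]; case: l => [|[|[|[|[|?]]]]].
move=> e e15; have [e5|e5] := ltnP e 5.
 rewrite mvals_chart0 // mulr1 /sgp (_ : (e \in neg) = false) ?ltr01 //.
 by apply: contraNF n0 => en; apply/hasP; exists e => //; rewrite inE mem_iota.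
have [k [l [kl l5 ee]]] := pair5P (introT andP (conj e5 e15)).
have := h k l kl l5; rewrite -chart_mvals // /sg5 (minn_idPl (ltnW kl)) (maxn_idPr (ltnW kl)).
by rewrite ee.
Qed.

Lemma pat5_pts neg x : pat5 neg x -> is_pts x.
move=> h k l; have E (i : 'I_5) : i = i5 i by rewrite /i5 inord_val.
have [lt|lt|e] := ltngtP k l; last by rewrite (val_inj e) eqxx.
 have := h _ _ lt (ltn_ord l); rewrite -!E => p _. by apply: contraTneq p => ->; rewrite mulr0 ltxx.
have := h _ _ lt (ltn_ord k); rewrite -!E => p _.
by rewrite detB_sym; apply: contraTneq p => ->; rewrite mulr0 ltxx.
Qed.

(** Renames the planes 1 to 5 through their points 0 to 4 and keeps the plane at infinity;
    [relabel_ok] also keeps the last point, the origin. *)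
Definition relabel sl (i : 'I_6) : 'I_6 := i6 (nth 0 (0 :: map S sl) i)%N.

Definition relabel_ok sl : bool :=
 [&& size sl == 5, uniq sl, all (fun k => k < 5)%N sl & nth 0%N sl 4 == 4].

Definition relabel_rows sl Y : 'M[R]_4 := \matrix_j row (i4 (nth 0%N sl j)) Y.

Lemma relabel_inj sl : relabel_ok sl -> injective (relabel sl).
move=> /and4P[/eqP s5 u /allP a5 _] i j /(congr1 val) /=.
have b (k : 'I_6) : (nth 0 (0 :: map S sl) k < 6)%N.
 case: k => -[|k] //= k6; rewrite (nth_map 0%N) ?s5 // ltnS. by apply: a5; rewrite mem_nth ?s5.
rewrite !inordK // => /eqP; rewrite nth_uniq /= ?size_map ?s5 // => [/eqP/val_inj//|].
rewrite map_inj_uniq ?u ?andbT; last exact: succn_inj.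
by apply/mapP => -[].
Qed.

Lemma pts4_i5 Y k : (k < 4)%N -> pts4 Y (i5 k) = pt (row (i4 k) Y).
move=> k4; rewrite /pts4 (_ : i5 k = lift ord_max (i4 k)) ?liftK //.
by apply: val_inj; rewrite /= /bump !inordK // ?(leqNgt 4 k) ?k4 // ltnW.
Qed.

Lemma pts4_last Y : pts4 Y (i5 4) = 0.
by rewrite /pts4 (_ : i5 4 = ord_max) ?unlift_none //; apply: val_inj; rewrite /= inordK.
Qed.

Lemma pts4_relabel sl Y k : relabel_ok sl -> (k < 5)%N ->
 pts4 (relabel_rows sl Y) (i5 k) = pts4 Y (i5 (nth 0%N sl k)).
move=> /and4P[/eqP s5 u /allP a5 /eqP s4]; rewrite ltnS leq_eqVlt => /predU1P[->|k4].
 by rewrite s4 !pts4_last.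
rewrite pts4_i5 // rowK inordK //.
have k5 := ltnW k4 : (k < 5)%N.
have n5 : (nth 0%N sl k < 5)%N by apply: a5; rewrite mem_nth ?s5 // ltnW.
have : (nth 0%N sl k < 4)%N.
 rewrite ltn_neqAle -ltnS n5 andbT; apply: contraTneq k4 => e. have : nth 0%N sl k == nth 0%N sl 4 by rewrite s4 e.
 by rewrite nth_uniq ?s5 // => /eqP ->; rewrite ltnn.
by move=> n4; rewrite pts4_i5.
Qed.

Lemma chart_relabel sl Y : relabel_ok sl ->
 chart (pts4 (relabel_rows sl Y)) = chart (pts4 Y) \o relabel sl.
move=> ok; apply/funext => i /=; have E : i = i6 i by rewrite /i6 inord_val.
rewrite E /relabel; case: (i : nat) (ltn_ord i) => [|k] k5.
 by rewrite /= inordK // i6_0 !chart0.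
have /and4P[/eqP s5 _ /allP a5 _] := ok.
rewrite inordK //= (nth_map 0%N) ?s5 // -!lift0_i6 //; last by apply: a5; rewrite mem_nth ?s5.
by rewrite !chartS pts4_relabel.
Qed.

Definition maps_signs neg neg' sl : bool :=
 all (fun p => (index ((minn (nth 0 sl p.1) (nth 0 sl p.2)).+1,
   (maxn (nth 0 sl p.1) (nth 0 sl p.2)).+1) pairs6 \in neg) ==
  (index (p.1.+1, p.2.+1) pairs6 \in neg'))%N
  [seq p <- allpairs pair (iota 0 5) (iota 0 5) | p.1 < p.2]%N.

Lemma pat5_relabel neg neg' sl Y : relabel_ok sl -> maps_signs neg neg' sl ->
 pat5 neg (pts4 Y) -> pat5 neg' (pts4 (relabel_rows sl Y)).
move=> ok /allP pr h k l kl l5; have k5 := ltn_trans kl l5.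
rewrite !pts4_relabel //; have /and4P[/eqP s5 u /allP a5 _] := ok.
have kin : (k, l) \in [seq p <- allpairs pair (iota 0 5) (iota 0 5) | p.1 < p.2]%N.
 rewrite mem_filter kl; apply/allpairsP; exists (k, l); split=> //; rewrite mem_iota //.
have /= /eqP e := pr _ kin.
have n5 j : (j < 5)%N -> (nth 0%N sl j < 5)%N by move=> j5; apply: a5; rewrite mem_nth ?s5.
have ne : nth 0%N sl k != nth 0%N sl l by rewrite nth_uniq ?s5 // ltn_eqF.
have eg : sg5 neg' k l = sg5 neg (nth 0 sl k)%N (nth 0 sl l)%N.
 by rewrite /sg5 (minn_idPl (ltnW kl)) (maxn_idPr (ltnW kl)) /sgp e.
rewrite eg; have [lt|lt|ee] := ltngtP (nth 0%N sl k) (nth 0%N sl l).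
- by apply: h => //; exact: n5.
- by rewrite sg5C detB_sym; apply: h => //; exact: n5.
- by rewrite ee eqxx in ne.
Qed.

Lemma chart_class neg a : mixed neg -> pattern neg a -> exists Y,
 [/\ \det Y != 0, conn a (chart (pts4 Y)), pat5 neg (pts4 Y) &
   in_space neg (mvals (chart (pts4 Y)))].
move=> mn pa; have /and3P[n0 _ _] := mn; have [Y dY aY] := pattern_gram n0 pa.
have pY := pattern_conn aY pa; exists Y; split=> //; first exact/pattern_chart.
exact: chart_space.
Qed.

Lemma signs_mul (x y : R) : x != 0 -> y != 0 -> 0 < x * y \/ 0 < x * - y.
move=> x0 y0; have [h|h|h] := ltgtP 0 (x * y); first by left.
 by right; rewrite mulrN oppr_gt0.
by move/eqP: h; rewrite eq_sym mulf_eq0 (negbTE x0) (negbTE y0).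
Qed.

(** Connectedness of the Gram space still leaves the two signs of det Y. A symmetry of the sign
    pattern that is odd on the rows exchanges them, at the price of a renaming of the planes. *)
Lemma relabel_class neg sl a a' : mixed neg -> relabel_ok sl -> maps_signs neg neg sl ->
 (forall Y, \det (relabel_rows sl Y) = - \det Y) ->
 space_connected R neg ->
 pattern neg a -> pattern neg a' -> eqv a a' \/ eqv a (a' \o relabel sl).
move=> mn ok pr dr sc pa pa'.
have [Y [dY aY pY hY]] := chart_class mn pa; have [Y' [dY' aY' pY' hY']] := chart_class mn pa'.
have /and3P[n0 _ _] := mn.
have [dd|dd] := signs_mul dY dY'.
 left; apply: eqv_trans (conn_eqv aY) (eqv_trans _ (eqv_sym (conn_eqv aY'))). by apply: mconn_eqv mn _ dd; exact: sc.
right; pose Y2 := relabel_rows sl Y'.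
have d2 : 0 < \det Y * \det Y2 by rewrite dr.
have p2 : pat5 neg (pts4 Y2) by exact: pat5_relabel ok pr pY'.
have h2 : in_space neg (mvals (chart (pts4 Y2))).
 by apply: chart_space; [exact/pattern_chart|rewrite dr oppr_eq0].
have c2 := conn_sub (relabel_inj ok) aY'; rewrite -chart_relabel // in c2.
apply: eqv_trans (conn_eqv aY) (eqv_trans _ (eqv_sym (conn_eqv c2))).
by apply: mconn_eqv mn _ d2; exact: sc.
Qed.

Lemma det_relabel_rows sl Y : \det (relabel_rows sl Y) =
 ddet 4 (fun i j => Y (i4 (nth 0%N sl (i4 i))) (i4 j)).
by rewrite det4E; congr ddet; apply/funext => i; apply/funext => j; rewrite !mxE. Qed.

Ltac det_relabel := move=> Y; rewrite det_relabel_rows det4E /= /bump /= !inordK //=; ring.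

Lemma det_swap12 Y : \det (relabel_rows [:: 1; 0; 2; 3; 4]%N Y) = - \det Y.
by move: Y; det_relabel. Qed.

Lemma det_swap23 Y : \det (relabel_rows [:: 0; 2; 1; 3; 4]%N Y) = - \det Y.
by move: Y; det_relabel. Qed.

Lemma det_swap14 Y : \det (relabel_rows [:: 3; 1; 2; 0; 4]%N Y) = - \det Y.
by move: Y; det_relabel. Qed.

Lemma det_cycle Y : \det (relabel_rows [:: 3; 2; 0; 1; 4]%N Y) = - \det Y.
by move: Y; det_relabel. Qed.

Lemma relabel_heq sl a a' : relabel_ok sl -> eqv a a' \/ eqv a (a' \o relabel sl) ->
 heq a a'.
move=> ok [h|h]; first exact: eqv_heq.
exact: heqT (eqv_heq (isT : 1 < 6)%N h) (heqC (heq_perm _ (relabel_inj ok))).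
Qed.

Lemma class4 a a' : pattern [:: 5; 6; 9]%N a -> pattern [:: 5; 6; 9]%N a' -> heq a a'.
move=> pa pa'; apply: (@relabel_heq [:: 1; 0; 2; 3; 4]%N) => //.
apply: relabel_class pa pa' => //; [exact: det_swap12|exact: connected4].
Qed.

Lemma class5 a a' : pattern [:: 7; 9]%N a -> pattern [:: 7; 9]%N a' -> heq a a'.
move=> pa pa'; apply: (@relabel_heq [:: 3; 1; 2; 0; 4]%N) => //.
apply: relabel_class pa pa' => //; [exact: det_swap14|exact: connected5].
Qed.

Lemma class6_eqv a a' : pattern [:: 5; 6; 8; 14]%N a -> pattern [:: 5; 6; 8; 14]%N a' ->
 eqv a a' \/ eqv a (a' \o relabel [:: 0; 2; 1; 3; 4]%N).
move=> pa pa'; apply: relabel_class pa pa' => //; [exact: det_swap23|exact: connected6].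
Qed.

Lemma class6 a a' : pattern [:: 5; 6; 8; 14]%N a -> pattern [:: 5; 6; 8; 14]%N a' ->
 heq a a'.
by move=> pa pa'; apply: relabel_heq (class6_eqv pa pa'). Qed.

Lemma class7 a a' : pattern [:: 5; 6; 7; 9]%N a -> pattern [:: 5; 6; 7; 9]%N a' -> heq a a'.
move=> pa pa'; apply: (@relabel_heq [:: 0; 2; 1; 3; 4]%N) => //.
apply: relabel_class pa pa' => //; [exact: det_swap23|exact: connected7].
Qed.

Definition list_mx (L : seq (seq R)) : 'M[R]_4 := \matrix_(i, j) nth 0 (nth [::] L i) j.

Lemma pts4_list (L : seq (seq R)) k l : size L = 4%N -> (k < 5)%N -> (l < 5)%N ->
 \det (pts4 (list_mx L) (i5 k) - pts4 (list_mx L) (i5 l)) =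
 let d j := nth 0 (nth [::] L k) j - nth 0 (nth [::] L l) j in
 d 0%N ^+ 2 + d 1%N ^+ 2 - d 2 ^+ 2 - d 3 ^+ 2.
move=> sL k5 l5; pose v i : 'rV[R]_4 := \row_j nth 0 (nth [::] L i) j.
have E i : (i < 5)%N -> pts4 (list_mx L) (i5 i) = pt (v i).
 rewrite ltnS leq_eqVlt => /predU1P[->|i4'].
  rewrite pts4_last (_ : v 4 = 0) ?linear0 //; apply/rowP => j. by rewrite !mxE (nth_default [::]) ?sL // nth_nil.
 by rewrite pts4_i5 //; congr pt; apply/rowP => j; rewrite !mxE inordK.
by rewrite !E // -linearB det_pt bformE !mxE !inordK //=; ring.
Qed.

Ltac all_pairs5 := case=> [|[|[|[|[|?]]]]] [|[|[|[|[|?]]]]] //= _ _.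

Definition neg9 := [:: 6; 8; 9; 10]%N.

(** No renaming is used for this pattern. Along the segment the signs are constant while the
    determinant goes from 18 to -9, so both orientations occur in one isotopy class. *)
Definition row9 (t : R) : seq (seq R) :=
 [:: [:: 0; 0; -1; 2]; [:: 3 + 3 * t; 3; -3; 1 + 3 * t]; [:: 2; 0; 0; -1]; [:: 3; 3; 0; -2]].

Lemma pat9 t : 0 <= t <= 1 -> pat5 neg9 (pts4 (list_mx (row9 t))).
move=> /andP[t0 t1] k l kl l5; rewrite pts4_list //; last exact: ltn_trans l5.
by move: k l kl l5; all_pairs5; rewrite /sg5 /sgp /=; lra.
Qed.

Lemma det9 t : \det (list_mx (row9 t)) = 18 - 27 * t.
by rewrite det4E /= /bump /= !mxE !inordK //=; ring. Qed.

Lemma list_path_conn neg (r : R -> seq (seq R)) :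
 (forall t, list_mx (r t) = list_mx (r 0) + t *: (list_mx (r 1) - list_mx (r 0))) ->
 (forall t, 0 <= t <= 1 -> pat5 neg (pts4 (list_mx (r t)))) ->
 conn (chart (pts4 (list_mx (r 0)))) (chart (pts4 (list_mx (r 1)))).
move=> rE rp; apply: pts_conn_chart.
apply: (pconn_itv (g := fun t => pts4 (list_mx (r t)))) => [k i j|t /rp/pat5_pts //].
rewrite /pts4; case: (unlift ord_max k) => [l|] /=; last first.
 by apply: (ctsE (g := fun=> 0)) => [t|]; [rewrite mxE|exact: ctsC].
pose A := pt (row l (list_mx (r 0))); pose B := pt (row l (list_mx (r 1))).
apply: (ctsE (g := fun t : R => A i j + t * (B i j - A i j))) => [t|]; last by cts.
rewrite rE !(linearD, linearZ, linearN) /= -/A -/B; move: A B => A B; by rewrite !mxE.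
Qed.

Lemma conn9 : conn (chart (pts4 (list_mx (row9 0)))) (chart (pts4 (list_mx (row9 1)))).
apply: list_path_conn pat9 => t; apply/matrixP => l q; rewrite !mxE.
by case: l => [[|[|[|[|//]]]] ?]; case: q => [[|[|[|[|//]]]] ?] /=; ring.
Qed.

Lemma class9 a a' : pattern neg9 a -> pattern neg9 a' -> heq a a'.
have H b : pattern neg9 b -> eqv b (chart (pts4 (list_mx (row9 0)))).
 move=> pb; have [Y [dY bY pY hY]] := chart_class (isT : mixed neg9) pb.
 have [t [t01 dt ct]] : exists t, [/\ 0 <= t <= 1, 0 < \det Y * \det (list_mx (row9 t)) &
   eqv (chart (pts4 (list_mx (row9 t)))) (chart (pts4 (list_mx (row9 0))))].
  have [h|h|h] := ltgtP 0 (\det Y); last by rewrite -h eqxx in dY.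
   exists 0; split; [by rewrite lexx ler01|rewrite det9; lra|].
   by apply: eqv_refl; apply/is_cfg_chart/(pat5_pts (pat9 _)); rewrite lexx ler01.
  exists 1; split; [by rewrite lexx ler01|rewrite det9; lra|]. exact/eqv_sym/conn_eqv/conn9.
 have d0 : \det (list_mx (row9 t)) != 0.
  by apply: contraTneq dt => ->; rewrite mulr0 ltxx.
 apply: eqv_trans (conn_eqv bY) (eqv_trans _ ct); apply: mconn_eqv (isT : mixed neg9) _ dt.
 apply: connected9 hY (chart_space _ d0). by apply/pattern_chart => //; exact: pat9.
by move=> pa pa'; apply: eqv_heq => //; apply: eqv_trans (H _ pa) (eqv_sym (H _ pa')).
Qed.

Definition neg10 := [:: 7; 8; 9; 11; 12]%N.

(* The mirror image diag(1, -1) on the right reverses all signs among the points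
  and does not change the orientation; the pentagon is isomorphic to its
  complement by an odd permutation. *)
Lemma class10 a a' : pattern neg10 a -> pattern neg10 a' -> heq a a'.
move=> pa pa'; have mn : mixed neg10 by [].
have [Y [dY aY pY hY]] := chart_class mn pa; have [Y' [dY' aY' pY' hY']] := chart_class mn pa'.
apply: heqT (conn_heq (isT : 1 < 6)%N aY) _.
apply: heqT _ (heqC (conn_heq (isT : 1 < 6)%N aY')).
have [dd|dd] := signs_mul dY dY'.
 exact: eqv_heq (mconn_eqv mn (connected10 hY hY') dd).
pose D := mx2 1 0 0 (-1) : 'M[R]_2.
have dD : \det D = -1 by rewrite det2E !mxE /=; ring.
pose sl := [:: 3; 2; 0; 1; 4]%N; have ok : relabel_ok sl by [].
pose Z := Y' *m rmul_mx D; pose Y2 := relabel_rows sl Z.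
have dZ : \det Z = \det Y' by rewrite det_mulmx det_rmul dD sqrrN expr1n mulr1.
have xZ k : pts4 Z k = pts4 Y' k *m D.
 rewrite /pts4; case: (unlift _ _) => [j|] /=; last by rewrite mul0mx. by rewrite row_mul pt_rmul.
have d2 : 0 < \det Y * \det Y2 by rewrite det_cycle dZ.
have p2 : pat5 neg10 (pts4 Y2).
 (* The complement of [neg10] among the ten edges off the vertex 0, as the mirror image reverses all
    of these. *)
 apply: (@pat5_relabel [:: 5; 6; 10; 13; 14]%N) => // k l kl l5.
 have := pY' k l kl l5; rewrite !xZ -mulmxBl det_mulmx dD mulrN1 mulrN -mulNr.
 by move: k l kl l5; all_pairs5; rewrite /sg5 /sgp /= ?opprK.
have h2 : in_space neg10 (mvals (chart (pts4 Y2))).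
 by apply: chart_space; [exact/pattern_chart|rewrite det_cycle dZ oppr_eq0].
have e2 : eqv (chart (pts4 Y)) (chart (pts4 Y2)).
 exact: mconn_eqv mn (connected10 hY h2) d2.
apply: heqT (eqv_heq (isT : 1 < 6)%N e2) _; rewrite chart_relabel //.
apply: heqT (heqC (heq_perm _ (relabel_inj ok))) _.
pose g : 'M[R]_4 := @block_mx R 2 2 2 2 1%:M 0 0 D.
have dg : \det g != 0 by rewrite /g (@det_ublock _ 2 2) det1 dD mul1r oppr_eq0 oner_neq0.
apply: heqT _ (heqC (heq_gl (chart (pts4 Y')) dg)).
pose U (i : 'I_6) : 'M[R]_2 := if i == ord0 then D else 1%:M.
have dU i : \det (U i) != 0 by rewrite /U; case: ifP; rewrite ?det1 ?dD ?oppr_eq0 oner_neq0.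
have cZ : is_cfg (chart (pts4 Z)).
 apply/is_cfg_chart => k l kl. by rewrite !xZ -mulmxBl det_mulmx dD mulrN1 oppr_eq0 (pat5_pts pY').
have := eqv_heq (isT : 1 < 6)%N (eqv_mul dU cZ); rewrite (_ : (fun i => U i *m _) = fun i => chart (pts4 Y') i *m g) //.
apply/funext => i; rewrite /U; case: (unliftP ord0 i) => [k|] -> /=; last first.
 rewrite !chart0 /at_infinity /g (@mul_row_block _ 2 2 2 2 2).
 by rewrite !mul0mx !mul1mx !add0r (@mul_mx_row _ 2 2 2 2) mulmx0 mulmx1.
rewrite !chartS /graph_form /g (@mul_row_block _ 2 2 2 2 2) !mulmx0 !mul1mx addr0 add0r.
by rewrite xZ.
Qed.

End Classes.

(** * The class of K *)

Section Mazurovskii.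
Variable R : realType.
Implicit Types (Y : 'M[R]_4) (a : forms R 6) (m : nat -> R).

Definition swap12 := [:: 1; 0; 2; 3; 4]%N.

(** The action on edges of exchanging the planes 1 and 2, a symmetry of the pattern [neg8] that is
    odd on the rows. *)
Definition swaps (e : nat) : nat :=
 if (e < 15)%N then nth 0%N [:: 1; 0; 2; 3; 4; 5; 9; 10; 11; 6; 7; 8; 12; 13; 14]%N e else e.

Lemma swap_pairsK : involutive swaps.
move=> e; rewrite /swaps; case E: (e < 15)%N; last by rewrite E.
by move: e E; do 15?[case=> //].
Qed.

Lemma swap_pairs_lt e : (e < 15)%N -> (swaps e < 15)%N.
by move=> e15; rewrite /swaps e15; move: e e15; do 15?[case=> //]. Qed.

Lemma fpol_swap m : fpol (m \o swaps) = fpol m.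
rewrite /fpol /comp_prod /mprod /= unlock /= /swaps /=; ring. Qed.

Lemma top_coef_swap m e : (e < 15)%N -> top_coef (m \o swaps) e = top_coef m (swaps e).
move: e; do 15?[case=> [_|]]; last by [].
all: rewrite /top_coef /comp_prod /mprod /= unlock /= /swaps /=; ring.
Qed.

Lemma slope_swap m e : (e < 15)%N -> slope (m \o swaps) e = slope m (swaps e).
move=> e15; rewrite /slope top_coef_swap // fpol_swap; congr (_ + _ - _).
rewrite -[RHS]fpol_swap; congr fpol; apply/funext => k; rewrite /upd /=.
by rewrite (inv_eq swap_pairsK) swap_pairsK.
Qed.

Lemma in_space_swap m : in_space neg8 m -> in_space neg8 (m \o swaps).
move=> [h f0]; split; last by rewrite fpol_swap.
move=> e e15; have := h _ (swap_pairs_lt e15).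
suff -> : sgp R neg8 (swaps e) = sgp R neg8 e by [].
rewrite /sgp; congr (if _ then _ else _); move: e e15; by do 15?[case=> //].
Qed.

Lemma mconn_swap m m' : mconn neg8 m m' -> mconn neg8 (m \o swaps) (m' \o swaps).
move=> [g [cg hg g0 g1]]; exists (fun t => g t \o swaps); split.
- by move=> e r k; exact: cg.
- by move=> t; exact: (in_space_swap (hg t)).
- by rewrite g0.
- by rewrite g1.
Qed.

Lemma cross8_swap e : e \in cross8 -> (e < 15)%N /\ swaps e \in cross8.
by move: e; do 15?[case=> //].
Qed.

Lemma swapK m : (m \o swaps) \o swaps = m.
by apply/funext => e /=; rewrite swap_pairsK. Qed.

Lemma can_rise_swap m : can_rise neg8 cross8 m -> can_rise neg8 cross8 (m \o swaps).
move=> [m' [e [cn eL sl]]]; have [e15 sL] := cross8_swap eL.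
exists (m' \o swaps), (swaps e); split=> //; first exact: mconn_swap.
by rewrite slope_swap ?swap_pairsK // swap_pairs_lt.
Qed.

Lemma never_up_swap m : never_up neg8 cross8 m -> never_up neg8 cross8 (m \o swaps).
move=> [hm h]; split; first exact: in_space_swap.
move=> m' cn e eL; have [e15 sL] := cross8_swap eL.
have := mconn_swap cn; rewrite swapK => /h /(_ _ sL).
by rewrite slope_swap ?swap_pairs_lt // swap_pairsK.
Qed.

Lemma mvals_relabel a : mvals (a \o relabel swap12) = mvals a \o swaps.
apply/funext => e; rewrite /mvals /= /swaps.
have [e15|e15] := ltnP e 15; last by rewrite ltnNge e15.
have E k : (k < 6)%N -> relabel swap12 (i6 k) = i6 (nth 0 [:: 0; 2; 1; 3; 4; 5] k)%N.
 by move=> k6; rewrite /relabel inordK.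
by move: e e15; do 15?[case=> [_|]]; rewrite /= ?E //= cross_sym.
Qed.

Lemma mvals_junk a k : (15 <= k)%N -> mvals a k = 0.
by move=> k15; rewrite /mvals ltnNge k15. Qed.

Definition rises a : Prop := exists Y, [/\ eqv a (chart (pts4 Y)), \det Y != 0 &
 can_rise neg8 cross8 (mvals (chart (pts4 Y)))].

Definition never_rises a : Prop := exists Y, [/\ eqv a (chart (pts4 Y)), \det Y != 0 &
 never_up neg8 cross8 (mvals (chart (pts4 Y)))].

Lemma rises_or_never a : pattern neg8 a -> rises a \/ never_rises a.
move=> pa; have [Y [dY aY _ hY]] := chart_class (isT : mixed neg8) pa.
by have [h|h] := rise_or_never cross8 hY; [left|right]; exists Y; split=> //; exact: conn_eqv.
Qed.

(** Each alternative describes a connected set of Gram points, by [rise8] and [never_up8]. If the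
    orientations differ, [a'] is replaced by its image under the exchange of planes 1 and 2, under
    which both alternatives are invariant. *)
Lemma same_class8 a a' : (rises a /\ rises a') \/ (never_rises a /\ never_rises a') ->
 eqv a a' \/ eqv a (a' \o relabel swap12).
have ok : relabel_ok swap12 by [].
have H (P : (nat -> R) -> Prop) Y Y' : eqv a (chart (pts4 Y)) -> eqv a' (chart (pts4 Y')) ->
  \det Y != 0 -> \det Y' != 0 -> (forall m, P m -> P (m \o swaps)) ->
  (forall m m', P m -> P m' -> (forall k, (15 <= k)%N -> m k = 0) ->
   (forall k, (15 <= k)%N -> m' k = 0) -> mconn neg8 m m') ->
  P (mvals (chart (pts4 Y))) -> P (mvals (chart (pts4 Y'))) ->
  eqv a a' \/ eqv a (a' \o relabel swap12).
 move=> aY aY' dY dY' Psw Pc PY PY'; have [dd|dd] := signs_mul dY dY'.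
  left; apply: eqv_trans aY (eqv_trans _ (eqv_sym aY')). apply: (mconn_eqv (isT : mixed neg8)) dd.
  by apply: Pc => // k k15; exact: mvals_junk.
 right; have := eqv_sub (relabel_inj ok) aY'; rewrite -chart_relabel // => aY2.
 apply: eqv_trans aY (eqv_trans _ (eqv_sym aY2)). apply: (mconn_eqv (isT : mixed neg8)); last by rewrite det_swap12.
 apply: Pc => //; try by move=> k k15; exact: mvals_junk. by rewrite chart_relabel // mvals_relabel; exact: Psw.
move=> [[[Y [aY dY hY]] [Y' [aY' dY' hY']]]|[[Y [aY dY hY]] [Y' [aY' dY' hY']]]].
 apply: (H (can_rise neg8 cross8)) aY aY' dY dY' can_rise_swap _ hY hY'.
 by move=> m m' hm hm' _ _; exact: pconnT (rise8 hm) (pconn_sym (rise8 hm')).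
apply: (H (never_up neg8 cross8)) aY aY' dY dY' never_up_swap _ hY hY'.
exact: never_up8.
Qed.

(* K with its fifth plane at infinity and its sixth plane at the origin: the
  other points are the diagonal matrices 12 ((5 - i)^-1 + 1, (5 - tau_i)^-1 + 1),
  and K_rows t moves two of them off the diagonal. *)
Definition K_forms : forms R 6 := horizontal_forms R perm_K.

Definition K_order (i : 'I_6) : 'I_6 := i6 (nth 0 [:: 4; 0; 1; 2; 3; 5] i)%N.

Definition K_rows (t : R) : seq (seq R) :=
 [:: [:: 33 / 2; - t / 2; - 3 / 2; - t / 2]; [:: 20; 0; - 4; 0];
   [:: 33 / 2; 0; 3 / 2; 0]; [:: 20; t / 2; 4; - t / 2]].

Ltac all_pairs5 := case=> [|[|[|[|[|?]]]]] [|[|[|[|[|?]]]]] //= _ _.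

Lemma patK t : 0 <= t <= 1 -> pat5 neg8 (pts4 (list_mx (K_rows t))).
move=> /andP[t0 t1] k l kl l5; rewrite pts4_list //; last exact: ltn_trans l5.
have tt : t * t <= 1 by rewrite mulr_ile1.
have tt0 : 0 <= t * t by rewrite mulr_ge0.
by move: k l kl l5; all_pairs5; rewrite /sg5 /sgp /=; lra.
Qed.

Lemma connK : conn (chart (pts4 (list_mx (K_rows 0)))) (chart (pts4 (list_mx (K_rows 1)))).
apply: list_path_conn patK => t; apply/matrixP => l q; rewrite !mxE.
by case: l => [[|[|[|[|//]]]] ?]; case: q => [[|[|[|[|//]]]] ?] /=; field.
Qed.

Lemma mvalsK : mvals (chart (pts4 (list_mx (K_rows 1)))) =
 of_list [:: 1; 1; 1; 1; 1; 6; -9; -17; 270; -18; -64; 384; 6; 270; 384].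
apply/funext => e; have [e15|e15] := ltnP e 15; last by rewrite mvals_junk // /of_list nth_default.
have [e5|e5] := ltnP e 5; first by rewrite mvals_chart0 //; move: e e5 {e15}; do 5?[case=> //].
have [k [l [kl l5 <-]]] := pair5P (introT andP (conj e5 e15)).
rewrite chart_mvals // pts4_list //; last exact: ltn_trans l5.
by move: k l kl l5; all_pairs5; rewrite /of_list /=; field.
Qed.

(** At time 0 the rows are diagonal matrices and span only two dimensions; leaving the diagonal
    makes them independent, as membership in the Gram space requires. *)
Lemma detK : \det (list_mx (K_rows 1)) != 0.
have -> : \det (list_mx (K_rows 1)) = (- 48) by rewrite det4E /= /bump /= !mxE !inordK //=; field.
by rewrite ?oppr_eq0 pnatr_eq0.
Qed.

Lemma K_forms_graph i :
 K_forms i = graph_form (mx2 (- i.+1%:R) 0 0 (- (perm_K i).+1%:R)).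
apply/matrixP => r k; rewrite /graph_form; have [k' ->|k' ->] := split_ordP (k : 'I_(2 + 2)).
 rewrite (@row_mxEl R 2 2 2) !mxE /=. by case: r => [[|[|//]] ?]; case: k' => [[|[|//]] ?].
rewrite (@row_mxEr R 2 2 2) !mxE /=.
by case: r => [[|[|//]] ?]; case: k' => [[|[|//]] ?].
Qed.

Lemma K_chart : eqv (K_forms \o K_order) (chart (pts4 (list_mx (K_rows 0)))).
(* The row (1, X) becomes (5 + X, 72 + 12 X). For X = - diag(i, tau_i) this is the point 12 (6 + X)
   / (5 + X), which is infinite for the fifth plane and 0 for the sixth. *)
pose g : 'M[R]_4 := @block_mx R 2 2 2 2 5%:M 72%:M 1%:M 12%:M.
have dg : 0 < \det g.
 have -> : g = @block_mx R 2 2 2 2 1%:M 5%:M 0 1%:M *m @block_mx R 2 2 2 2 0 12%:M 1%:M 12%:M.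
  rewrite (@mulmx_block _ 2 2 2 2 2 2) !mul1mx !mul0mx mulmx1 !add0r -scalar_mxM.
  by rewrite -raddfD /= (_ : 12 + 5 * 12 = 72 :> R) //; ring.
 have -> : @block_mx R 2 2 2 2 0 12%:M 1%:M 12%:M =
   @block_mx R 2 2 2 2 1%:M 1%:M 0 1%:M *m @block_mx R 2 2 2 2 (- 1%:M) 0 1%:M 12%:M.
  by rewrite (@mulmx_block _ 2 2 2 2 2 2) !mul1mx !mul0mx !add0r ?mul1mx ?addNr.
 rewrite 2!det_mulmx 2!(@det_ublock _ 2 2) (@det_lblock _ 2 2) !det1 !mul1r det2N det1 mul1r.
 by rewrite det_scalar exprn_gt0.
have n0 : ~~ has (mem (iota 0 5)) neg8 by [].
have p0 : pat5 neg8 (pts4 (list_mx (K_rows 0))) by apply: patK; rewrite lexx ler01.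
have cK : is_cfg (chart (pts4 (list_mx (K_rows 0)))) by exact/is_cfg_chart/pat5_pts/p0.
(* The left blocks 5 + X in the order [K_order]; for the plane at infinity the right block 12. *)
pose P (i : 'I_6) : 'M[R]_2 := mx2 (nth 0 [:: 12; 4; 3; 2; 1; -1] i) 0 0
 (nth 0 [:: 12; 2; 1; 4; 3; -1] i).
have dP i : \det (P i) != 0.
 by rewrite det2E !mxE /=; case: i => [[|[|[|[|[|[|//]]]]]] ?] /=; lra.
have e : (fun i => P i *m chart (pts4 (list_mx (K_rows 0))) i) =
  fun i => (K_forms \o K_order) i *m g.
 apply/funext => i /=; rewrite -(inord_val i) -/(i6 i). move: (i : nat) (ltn_ord i) => k k6 {i}.
 rewrite K_forms_graph perm_KE /graph_form /g (@mul_row_block _ 2 2 2 2 2)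
  !mul1mx mulmx1 mul_mx_scalar /K_order /P (inordK k6); case: k k6 => [|k] k6.
  rewrite i6_0 chart0 /at_infinity (@mul_mx_row _ 2 2 2 2) mulmx0 mulmx1 /= !inordK //=.
  by congr (@row_mx R 2 2 2 _ _); apply: mx2E; rewrite !mxE /=; ring.
 rewrite -lift0_i6 // chartS /graph_form (@mul_mx_row _ 2 2 2 2) mulmx1 /=.
 have pE : pts4 (list_mx (K_rows 0)) (i5 k) =
   mx2 (nth 0 [:: 15; 16; 18; 24; 0] k) 0 0 (nth 0 [:: 18; 24; 15; 16; 0] k).
  have [k4|k4] := ltnP k 4.
   rewrite pts4_i5 //; apply: mx2E; rewrite !mxE !inordK //=;
    by move: k k4 {k6}; do 4?[case=> [_|]] => //=; field.
  rewrite (_ : k = 4) ?pts4_last; last by apply/eqP; rewrite eqn_leq k4 andbT -ltnS. by apply: mx2E; rewrite !mxE.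
 rewrite pE; congr (@row_mx R 2 2 2 _ _).
  apply: mx2E; rewrite !mxE /=; move: k k6 {pE};
   do 5?[case=> [_|]] => //; rewrite /= ?inordK //=; ring.
 apply: mx2E; rewrite !mul2E !mxE /=; move: k k6 {pE};
  do 5?[case=> [_|]] => //; rewrite /= ?inordK //=; ring.
have cKo : is_cfg (K_forms \o K_order).
 move=> i j ij; have := cK i j ij; have := cross_mul (P i) (P j)
  (chart (pts4 (list_mx (K_rows 0))) i) (chart (pts4 (list_mx (K_rows 0))) j).
 have ei := congr1 (fun f : forms R 6 => f i) e.
 have ej := congr1 (fun f : forms R 6 => f j) e. rewrite /= in ei ej; rewrite ei ej cross_mulr => h c0.
 have : cross (K_forms (K_order i)) (K_forms (K_order j)) * \det g != 0.
  by rewrite h !mulf_neq0.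
 by rewrite mulf_eq0 negb_or => /andP[].
apply: eqv_trans (conn_eqv (conn_gl cKo dg)) _; rewrite -e.
exact: eqv_sym (eqv_mul dP cK).
Qed.

Lemma K_rises : rises (K_forms \o K_order).
exists (list_mx (K_rows 1)); split.
- exact: eqv_trans K_chart (conn_eqv connK).
- exact: detK.
- exists (mvals (chart (pts4 (list_mx (K_rows 1))))), 1%N; split=> //.
  apply/mconn_refl/chart_space; first by apply/pattern_chart => //; apply: patK; rewrite ler01 lexx. exact: detK.
 rewrite mvalsK /slope /fpol /top_coef /comp_prod /mprod /= unlock /= /upd /of_list /=; lra.
Qed.

End Mazurovskii.

(** * Two-class patterns in general, and the pentagon on five planes *)

Section TwoClass.
Variable R : realType.

Lemma two_class_heq n (p : pred 'I_n.+1) (a a' : forms R n.+2) :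
 let ok b := is_cfg b /\ (forall j, 0 < cross (b ord0) (b (lift ord0 j))) /\
  (forall i j, i != j -> if p i == p j then cross (b (lift ord0 i)) (b (lift ord0 j)) < 0
   else 0 < cross (b (lift ord0 i)) (b (lift ord0 j))) in
 ok a -> ok a' -> heq a a'.
have H (b : forms R n.+2) : is_cfg b -> (forall j, 0 < cross (b ord0) (b (lift ord0 j))) ->
  (forall i j, i != j -> if p i == p j then cross (b (lift ord0 i)) (b (lift ord0 j)) < 0
   else 0 < cross (b (lift ord0 i)) (b (lift ord0 j))) ->
  exists2 x, conn b (chart x) & two_class p x.
 move=> cb b0 bp; have [x px bx] := chart_normal (ltn0Sn n) cb b0; exists x => // i j ij.
 have ij' : lift ord0 i != lift ord0 j by rewrite (inj_eq lift_inj).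
 have := conn_sg ij' bx; rewrite !chartS cross_graph -det2N opprB => e.
 have := bp i j ij; case: ifP => _ h; move: e; [rewrite (ltr0_sg h)|rewrite (gtr0_sg h)];
  by move/esym/eqP; rewrite sgr_cp0.
move=> ok [ca [a0 ap]] [ca' [a0' ap']].
have [x ax px] := H a ca a0 ap; have [x' ax' px'] := H a' ca' a0' ap'.
apply: (@conn_heq R n.+2 a a' isT); apply: pconnT ax _.
exact: pconnT (pts_conn_chart (two_class_conn px px')) (pconn_sym ax').
Qed.

Definition drop_twin (i : 'I_5) : 'I_6 := i6 (nth 0 [:: 0; 1; 2; 5; 4] i)%N.

(** [b] enters in position 3 as a twin of the plane in position 2; the last two planes are exchanged
    to match a pattern of [reps 6]. *)
Definition double_plane (a : forms R 5) (b : 'M[R]_(2, 4)) : forms R 6 :=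
 fun i => if i == i6 3 then b else a (i5 (nth 0 [:: 0; 1; 2; 0; 4; 3] i)%N).

Definition neg_pentagon : seq (nat * nat) := [:: (1, 2); (1, 3); (3, 4)]%N.

Definition pentagon (a : forms R 5) : Prop := is_cfg a /\
 forall i j : 'I_5, (i < j)%N -> (cross (a i) (a j) < 0) = ((val i, val j) \in neg_pentagon).

(** Five planes are reduced to a class of six by doubling plane 2. The twin a_2 + t c meets the
    other planes with the signs of a_2 for small t, and meets a_2 itself with the sign of c; the
    reflection in [c] makes that sign positive. *)
Lemma pentagon_double a : pentagon a -> exists b, pattern [:: 5; 6; 8; 14]%N (double_plane a b) /\
 conn a (double_plane a b \o relabel [:: 0; 2; 1; 3; 4]%N \o drop_twin).
move=> [ca sa]; pose D := mx2 1 0 0 (-1) : 'M[R]_2.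
have dD : \det D = -1 by rewrite det2E !mxE /=; ring.
pose c := D *m a (i5 1).
have sg i j : (i < j)%N -> (j < 5)%N ->
  if (i, j) \in neg_pentagon then cross (a (i5 i)) (a (i5 j)) < 0
  else 0 < cross (a (i5 i)) (a (i5 j)).
 move=> ij j5; have i5' := ltn_trans ij j5; have := sa (i5 i) (i5 j).
 rewrite /= !inordK // => /(_ ij) <-; case: ifP => // h.
 have /ca : i5 i != i5 j by rewrite -val_eqE /= !inordK // ltn_eqF. by rewrite neq_lt h.
have c2 : 0 < cross (a (i5 2)) c.
 rewrite /c -[a (i5 2)]mul1mx cross_mul det1 mul1r dD mulN1r oppr_gt0 cross_sym. exact: (sg 1%N 2%N).
pose g (t : R) := a (i5 2) + t *: c.
have cross2 t : cross (a (i5 2)) (g t) = t ^+ 2 * cross (a (i5 2)) c.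
 have -> : cross (a (i5 2)) (g t) = cross (a (i5 2)) (t%:M *m c).
  rewrite /cross /g; have -> : col_mx (a (i5 2)) (a (i5 2) + t *: c) =
   @block_mx R 2 2 2 2 1%:M 0 1%:M 1%:M *m col_mx (a (i5 2)) (t *: c) :> 'M[R]_(2 + 2, 4).
   by rewrite (@mul_block_col _ 2 2 2 2 4) !mul1mx mul0mx addr0.
  apply: etrans (det_mulmx (@block_mx R 2 2 2 2 1%:M 0 1%:M 1%:M) (@col_mx R 2 2 4 (a (i5 2)) (t *: c))) _.
  by rewrite (@det_lblock _ 2 2) !det1 !mul1r mul_scalar_mx.
 by rewrite -[a (i5 2)]mul1mx cross_mul det1 mul1r det_scalar mul1mx.
have cg (i : 'I_5) : continuous (fun t => cross (g t) (a i)).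
 apply: cts_det => r k; have [r' ->|r' ->] := split_ordP (r : 'I_(2 + 2)).
  apply: (ctsE (g := fun t : R => a (i5 2) r' k + t * c r' k)) => [t|]; last by cts.
  by rewrite (@col_mxEu _ 2 2 4) !mxE.
 by apply: (ctsE (g := fun t => a i r' k)) => [t|]; [rewrite (@col_mxEd _ 2 2 4)|exact: ctsC].
have g0 : g 0 = a (i5 2) by rewrite /g scale0r addr0.
have near i : (i < 5)%N -> i != 2%N -> exists2 d, 0 < d & forall t, `|t| < d ->
  Num.sg (cross (g t) (a (i5 i))) = Num.sg (cross (a (i5 2)) (a (i5 i))).
 move=> i_5 i2; have x0 : cross (a (i5 2)) (a (i5 i)) != 0.
  by apply: ca; rewrite -val_eqE /= !inordK // eq_sym.
 have x0' : 0 < `|cross (a (i5 2)) (a (i5 i))| by rewrite normr_gt0.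
 have [d d0 h] := cts_near 0 (cg (i5 i)) x0'; exists d => // t td. have := h t; rewrite subr0 g0 => /(_ td).
 move: (cross _ _) (cross _ _) x0 => y x x0. have [p|p|p] := ltgtP x 0; last by rewrite p eqxx in x0.
  by rewrite (ltr0_norm p) ltr_distl => /andP[_ q]; rewrite !ltr0_sg //; lra.
 by rewrite (gtr0_norm p) ltr_distl => /andP[q _]; rewrite !gtr0_sg //; lra.
have [d0 d00 n0] := near 0%N isT isT; have [d1 d10 n1] := near 1%N isT isT.
have [d3 d30 n3] := near 3%N isT isT; have [d4 d40 n4] := near 4%N isT isT.
pose d := Num.min (Num.min d0 d1) (Num.min d3 d4).
have dp : 0 < d by rewrite !lt_min d00 d10 d30 d40.
have nr t i : `|t| < d -> (i < 5)%N -> i != 2%N ->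
  Num.sg (cross (g t) (a (i5 i))) = Num.sg (cross (a (i5 2)) (a (i5 i))).
 rewrite !lt_min => /andP[/andP[t0 t1] /andP[t3 t4]]. by case: i => [|[|[|[|[|//]]]]] // _ _; auto.
pose t := d / 2; have t0 : 0 < t by rewrite divr_gt0.
have td : `|t| < d by rewrite gtr0_norm // /t; lra.
have sgg i : (i < 5)%N -> i != 2%N -> if (minn i 2, maxn i 2) \in neg_pentagon
  then cross (g t) (a (i5 i)) < 0 else 0 < cross (g t) (a (i5 i)).
 move=> i_5 i2; have e := nr t i td i_5 i2; have e1 := sg i 2%N; have e2 := sg 2%N i.
 move: i_5 i2 e e1 e2; case: i => [|[|[|[|[|//]]]]] //= _ _ e e1 e2;
  first [have {e1}e1 := e1 isT isT; rewrite cross_sym in e1|have {e2}e1 := e2 isT isT];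
  by move/eqP: e; rewrite ?(gtr0_sg e1) ?(ltr0_sg e1) sgr_cp0.
have E3 (i : nat) : (i < 6)%N -> i != 3%N -> (i6 i == i6 3) = false.
 by move=> i_6 i3; rewrite -val_eqE /= !inordK //; apply: negbTE.
exists (g t); split; last first.
 pose h (s : R) (i : 'I_5) := if i == i5 2 then g (s * t) else a i.
 have -> : double_plane a (g t) \o relabel [:: 0; 2; 1; 3; 4]%N \o drop_twin = h 1.
  apply/funext => i; rewrite /h mul1r /double_plane /drop_twin /relabel /= -(inord_val i).
  move: (val i) (ltn_ord i) => k; do 5?[case: k => [_|k]] => //=;
   rewrite /i6 /i5 -?val_eqE /= ?inordK //= -?val_eqE /= ?inordK //.
 have -> : a = h 0 by apply/funext => i; rewrite /h mul0r g0; case: eqP => [->|].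
 apply: (pconn_itv (g := h)) => [i r k|s s01 i j ij].
  rewrite /h; case: (i == i5 2); last exact: ctsC.
  cts_mx. by cts.
 have st : `|s * t| < d.
  have /andP[s0 s1] := s01. rewrite normrM ger0_norm //; apply: le_lt_trans td; rewrite ler_piMl //.
 have ne (k : 'I_5) : k != i5 2 -> cross (g (s * t)) (a k) != 0.
  move=> k2; have kk : k = i5 k by rewrite /i5 inord_val.
  have k2' : val k != 2%N by apply: contra k2 => /eqP e; rewrite kk e.
  have := nr (s * t) _ st (ltn_ord k) k2'; rewrite -kk => e; rewrite -sgr_eq0 e sgr_eq0.
  by apply: ca; rewrite eq_sym.
 rewrite /h; case: (eqVneq i (i5 2)) => [ei|i2]; case: (eqVneq j (i5 2)) => [ej|j2].
 - by rewrite ei ej eqxx in ij.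
 - exact: ne.
 - by rewrite -/(cross _ _) cross_sym; exact: ne.
 - exact: ca.
move=> e e15; rewrite /mvals e15 /double_plane /sgp.
move: e e15; do 15?[case=> [_|]]; last by [].
all: rewrite /= ?eqxx ?E3 //= ?inordK //=.
all: try by [].
all: rewrite ?mul1r ?mulN1r ?oppr_gt0.
all: first [exact: (sg 0%N 1%N)|exact: (sg 0%N 2%N)|exact: (sg 0%N 4%N)|exact: (sg 0%N 3%N)
 |exact: (sg 1%N 2%N)|exact: (sg 1%N 4%N)|exact: (sg 1%N 3%N)|exact: (sg 2%N 4%N)|exact: (sg 2%N 3%N)
 |rewrite cross_sym; exact: (sg 3%N 4%N)|exact: (sgg 4%N)|exact: (sgg 3%N)
 |rewrite cross_sym; exact: (sgg 0%N)|rewrite cross_sym; exact: (sgg 1%N)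
 |rewrite cross2 mulr_gt0 // exprn_gt0].
all: try done.
Unshelve.
all: exact: isT.
Qed.

Lemma drop_twin_inj : injective drop_twin.
move=> i j /(congr1 val); rewrite /drop_twin /=.
by case: i => [[|[|[|[|[|//]]]]] ?]; case: j => [[|[|[|[|[|//]]]]] ?];
 rewrite /= !inordK // => _; exact: val_inj.
Qed.

(** The renaming allowed by [class6_eqv] exchanges the twins, so in both cases dropping one twin
    leaves five planes isotopic to [a']. *)
Lemma pentagon_heq a a' : pentagon a -> pentagon a' -> heq a a'.
have ok : relabel_ok [:: 0; 2; 1; 3; 4]%N by [].
move=> /pentagon_double[b [pb ab]] /pentagon_double[b' [pb' ab']].
set r := relabel _ in ab ab'.
have rI : injective (r \o drop_twin) by apply: inj_comp drop_twin_inj; exact: relabel_inj.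
have rr : r \o r =1 id.
 move=> i; apply: val_inj; rewrite /r /relabel /=.
 by case: i => [[|[|[|[|[|[|//]]]]]] ?] /=; rewrite ?inordK //= ?inordK.
have fin (x : forms R 6) : eqv (double_plane a b) x -> heq a (x \o (r \o drop_twin)).
 move=> e; apply: heqT (conn_heq _ ab) _ => //. exact: eqv_heq (eqv_sub rI e).
have e2 : heq (double_plane a' b' \o (r \o drop_twin)) a' by apply/heqC/conn_heq.
have [/fin h|/fin h] := class6_eqv pb pb'; first exact: heqT h e2.
suff <- : double_plane a' b' \o r \o (r \o drop_twin) = a' by [].
apply/funext => i; have := rr (drop_twin i); rewrite /= => ->; rewrite /double_plane /drop_twin.
rewrite -(inord_val i); move: (val i) (ltn_ord i) => k; do 5?[case: k => [_|k]] => //=;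
 by rewrite /i6 /i5 -?val_eqE /= ?inordK //= -?val_eqE /= ?inordK.
Qed.

End TwoClass.

(** * Paths in the Grassmannian compared with paths of forms *)

Section Isotopies.
Variable R : realType.
Implicit Types (f c : 'M[R]_(2, 4)).

Lemma row_freeE f : row_free f = (\det (f *m f^T) != 0).
rewrite -unitfE -unitmxE -row_free_unit; apply/idP/idP => h; last first.
 by rewrite /row_free eqn_leq rank_leq_row /=; move/eqP: h => {1}<-; exact: mxrankM_maxl.
apply: inj_row_free => v /(congr1 (mulmx^~ v^T)); rewrite mul0mx -mulmxA mulmxA.
rewrite (mulmxA v) -(mulmxA (v *m f)) -trmx_mul => h0.
have : v *m f = 0.
 apply/rowP => j; have /matrixP/(_ 0 0) := h0; rewrite !mxE => /eqP.
 rewrite psumr_eq0 => [/allP/(_ j)|k _]; last by rewrite [_^T _ _]mxE -expr2 sqr_ge0.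
 by rewrite mem_index_enum => /(_ isT); rewrite [_^T _ _]mxE mulf_eq0 orbb !mxE => /eqP.
by rewrite -(mul0mx _ f) => /(row_free_inj h).
Qed.

Lemma exists_orth f : row_free f -> exists2 c : 'M[R]_(2, 4), row_free c & c *m f^T = 0.
move=> ff; have : exists2 c : 'M[R]_(\rank (kermx f^T), 4), row_free c & c *m f^T = 0.
 exists (row_base (kermx f^T)); first exact: row_base_free. by apply/sub_kermxP; rewrite eq_row_base.
by rewrite mxrank_ker mxrank_tr (eqP ff).
Qed.

Lemma orthogonal_sym f c : c *m f^T = 0 -> f *m c^T = 0.
by move=> /(congr1 trmx); rewrite trmx_mul trmxK trmx0. Qed.

Lemma row_span_locus f c : row_free f -> row_free c -> c *m f^T = 0 ->
 row_span c = zero_locus f.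
move=> ff fc cf; have sub : (c <= kermx f^T)%MS by apply/sub_kermxP.
have sup : (kermx f^T <= c)%MS.
 by rewrite -(mxrank_leqif_sup sub) mxrank_ker mxrank_tr (eqP ff) (eqP fc).
apply/vspaceP => x; rewrite mem_zero_locus; apply/mem_row_span/eqP => [[u ->]|x0].
 by rewrite -mulmxA cf mulmx0.
by have /submxP[u ->] : (x <= c)%MS; [apply: submx_trans sup; apply/sub_kermxP|exists u].
Qed.

Lemma dim_zero_locus f : row_free f -> \dim (zero_locus f) = 2.
move=> ff; pose h := linfun (mulmxr f^T : 'rV[R]_4 -> 'rV[R]_2).
have /row_fullP[B Bf] : row_full f^T by rewrite /row_full mxrank_tr.
have lh : limg h = fullv.
 apply/eqP; rewrite eqEsubv subvf; apply/subvP => y _; apply/memv_imgP.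
 by exists (y *m B); rewrite ?memvf // lfunE /= -mulmxA Bf mulmx1.
have := limg_ker_dim h fullv; rewrite lh capfv !dimvf /dim /= /zero_locus -/h.
by move: (\dim _) => d; lia.
Qed.

Lemma locus_of_plane (W : subsp R) : \dim W = 2 -> exists2 f, row_free f & W = zero_locus f.
move=> dW; have : exists2 c : 'M[R]_(\dim W, 4), row_free c & forall x, (x \in W) = (x <= c)%MS.
 exists (\matrix_k (vbasis W)`_k).
  apply: inj_row_free => v v0; apply/rowP => k; rewrite mxE.
  have /freeP := basis_free (vbasisP W); apply; rewrite -[RHS]v0 mulmx_sum_row.
  by apply: eq_bigr => i _; rewrite rowK.
 move=> x; apply/idP/submxP => [/coord_vbasis ->|[u ->]].
  exists (\row_k coord (vbasis W) k x); rewrite mulmx_sum_row. by apply: eq_bigr => i _; rewrite rowK mxE.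
 rewrite mulmx_sum_row; apply: memv_suml => i _; rewrite rowK memvZ //.
 by apply: vbasis_mem; rewrite mem_nth // size_tuple.
rewrite dW => -[c fc Wc]; have [f ff fc0] := exists_orth fc; exists f => //.
rewrite -(row_span_locus ff fc (orthogonal_sym fc0)); apply/vspaceP => x.
by rewrite Wc; apply/submxP/mem_row_span.
Qed.

Lemma cross_neq0P f c : reflect (forall x : 'rV[R]_4, x *m f^T = 0 -> x *m c^T = 0 -> x = 0)
 (cross f c != 0).
have E (x : 'rV[R]_4) : x *m (col_mx f c : 'M[R]_4)^T = row_mx (x *m f^T) (x *m c^T).
 by apply: etrans (@mul_mx_row _ 1 4 2 2 x f^T c^T); congr (_ *m _); exact: (@tr_col_mx _ 2 2 4).
rewrite /cross -det_tr -unitfE -unitmxE -row_free_unit; apply: (iffP idP) => [fr x xf xc|h].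
 by apply: (row_free_inj fr); rewrite mul0mx E xf xc row_mx0.
apply: inj_row_free => x; rewrite E -[0](@row_mx0 _ 1 2 2) => /(@eq_row_mx _ 1 2 2)[xf xc].
by rewrite (@row_mx0 _ 1 2 2); exact: h.
Qed.

Lemma cfg_row_free n (a : forms R n) i : (1 < n)%N -> is_cfg a -> row_free (a i).
move=> n1 ca; have [j ij] : exists j, i != j.
 case: n n1 a i ca => [|[|n]] // _ a i ca.
 by exists (if i == ord0 then lift ord0 ord0 else ord0); case: ifP => // [/eqP ->|->].
have := ca i j ij; rewrite /cross -unitfE -unitmxE -row_free_unit => fr.
apply: inj_row_free => v v0; have : row_mx v 0 = 0 :> 'rV[R]_(2 + 2).
 apply: (row_free_inj fr); rewrite mul0mx.
 by apply: etrans (@mul_row_col _ 1 2 2 4 v 0 (a i) (a j)) _; rewrite v0 mul0mx addr0.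
by rewrite -row_mx0 => /eq_row_mx[].
Qed.

Lemma arrangement_loci n (H : 'I_n -> subsp R) : two_arrangement H ->
 exists2 a, is_cfg a & H = loci a.
move=> [dH tH]; have W i := locus_of_plane (dH i).
pose a i := s2val (cid2 (W i)); have aE i : H i = zero_locus (a i) by rewrite /a; case: cid2.
exists a; last by apply/funext.
move=> i j /tH ij; apply/cross_neq0P => x xi xj.
have : x \in (H i :&: H j)%VS by rewrite memv_cap !aE !mem_zero_locus xi xj eqxx.
by rewrite ij memv0 => /eqP.
Qed.

Lemma loci_arrangement n (a : forms R n) : (1 < n)%N -> is_cfg a ->
 two_arrangement (loci a).
move=> n1 ca; split=> [i|i j /ca/cross_neq0P h]; first exact/dim_zero_locus/cfg_row_free.
apply/eqP; rewrite -subv0; apply/subvP => x; rewrite memv_cap !mem_zero_locus memv0.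
by move=> /andP[/eqP xi /eqP xj]; apply/eqP; exact: h.
Qed.

(* A multiple of the orthogonal projection of the rows of c to the orthogonal
  complement of those of f, without denominators so that it is continuous. *)
Definition reject f c : 'M[R]_(2, 4) := \det (f *m f^T) *: c - c *m f^T *m \adj (f *m f^T) *m f.

Lemma reject_orth f c : reject f c *m f^T = 0.
rewrite mulmxBl -scalemxAl -(mulmxA _ f) -(mulmxA _ (\adj _)) mul_adj_mx.
by rewrite mul_mx_scalar subrr.
Qed.

Lemma reject_id f c : c *m f^T = 0 -> reject f c = \det (f *m f^T) *: c.
by rewrite /reject => ->; rewrite !mul0mx subr0. Qed.

Lemma cts_reject (T : topologicalType) (f c : T -> 'M[R]_(2, 4)) :
 (forall i j, continuous (fun t => f t i j)) -> (forall i j, continuous (fun t => c t i j)) ->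
 forall i j, continuous (fun t => reject (f t) (c t) i j).
move=> cf cc i j; have cT (g : T -> 'M[R]_(2, 4)) k l : (forall i j, continuous (fun t => g t i j)) ->
  continuous (fun t => (g t)^T k l).
 by move=> cg; apply: (ctsE (g := fun t => g t l k)) => [t|]; [rewrite mxE|exact: cg].
have cM k l : continuous (fun t => (f t *m (f t)^T) k l).
 by apply: cts_mulmx => // *; exact: cT.
apply: (ctsE (g := fun t => \det (f t *m (f t)^T) * c t i j -
  (c t *m (f t)^T *m \adj (f t *m (f t)^T) *m f t) i j)) => [t|]; first by rewrite !mxE.
apply: ctsB; first by apply: ctsM => //; exact: cts_det.
apply: cts_mulmx => // k l; apply: cts_mulmx => // k' l'.
 by apply: cts_mulmx => // *; exact: cT.
apply: (ctsE (g := fun t => cofactor (f t *m (f t)^T) l' k')) => [t|]; first by rewrite mxE.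
apply: ctsM; first exact: ctsC.
by apply: cts_det => p q; apply: (ctsE (g := fun t => (f t *m (f t)^T) (lift l' p) (lift k' q)))
 => [t|]; [rewrite !mxE|exact: cM].
Qed.

Lemma row_freeZ (d : R) f : d != 0 -> row_free (d *: f) = row_free f.
by move=> d0; rewrite /row_free (eqmx_scale _ d0). Qed.

Lemma zero_locusZ (d : R) f : d != 0 -> zero_locus (d *: f) = zero_locus f.
by move=> d0; rewrite -mul_scalar_mx zero_locus_mul // det_scalar expf_eq0 (negPf d0) andbF.
Qed.

(** Open sets of planes are described through spanning rows, not forms. A fixed basis of the plane
    at time t, projected by [reject] to the planes at nearby times, provides such rows
    continuously. *)
Lemma plane_path_loci (g : R -> 'M[R]_(2, 4)) :
 (forall i j, continuous (fun t => g t i j)) -> (forall t, row_free (g t)) ->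
 plane_path (fun t => zero_locus (g t)).
move=> cg fg U oU; apply: open_subspaceW; rewrite openE => t Ut.
have [c fc cf] := exists_orth (fg t).
have d0 : \det (g t *m (g t)^T) != 0 by rewrite -row_freeE.
have cr : continuous (fun s => reject (g s) c).
 by apply: mx_cts; apply: cts_reject => // i j; exact: ctsC.
have : nbhs (reject (g t) c) [set c | row_free c /\ U (row_span c)].
 apply: open_nbhs_nbhs; split; first exact: oU.
 have fr : row_free (reject (g t) c) by rewrite reject_id // row_freeZ.
 by split=> //; rewrite (row_span_locus (fg t) fr (reject_orth _ _)).
move=> N; have {N} := cr t _ N.
have FF : Filter (nbhs t) by exact: nbhs_filter.
move=> N; have {}N : nbhs t ((fun s => reject (g s) c) @^-1` [set c | row_free c /\ U (row_span c)]) := N.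
refine (filterS _ N) => s /= [fr].
by rewrite (row_span_locus (fg s) fr (reject_orth _ _)).
Qed.

Lemma conn_isotopic n (a b : forms R n) : (1 < n)%N -> conn a b ->
 isotopic (loci a) (loci b).
move=> n1 [g [cg gc g0 g1]]; exists id, (fun t => loci (g t)); split.
- by exists id.
- by move=> i; apply: plane_path_loci => [r k|t]; [exact: cg|exact: cfg_row_free].
- by move=> t _; exact: loci_arrangement.
- by rewrite g0.
- by rewrite g1.
Qed.

Lemma eqv_isotopic n (a b : forms R n) (s : 'I_n -> 'I_n) : (1 < n)%N ->
 injective s -> eqv a (b \o s) -> isotopic (loci a) (loci b).
move=> n1 sI [P [dP ab]]; have [sg [Q [_ cQ aQ Q0 Q1]]] := conn_isotopic n1 ab.
have [g [cg gc g0 g1]] := ab.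
exists s, (fun t => loci (g t)); split.
- exact: injF_bij.
- by move=> i; apply: plane_path_loci => [r k|t]; [exact: cg|exact: cfg_row_free].
- by move=> t _; exact: loci_arrangement.
- by rewrite g0.
- by move=> i; rewrite g1 /loci zero_locus_mul.
Qed.

Lemma image_loci n (h : 'M[R]_4) (a : forms R n) : \det h != 0 ->
 image_arrangement h (loci a) = loci (fun i => a i *m (invmx h)^T).
move=> dh; have hu : h \in unitmx by rewrite unitmxE unitfE.
apply/funext => i; apply/vspaceP => x; rewrite /image_arrangement mem_zero_locus.
rewrite trmx_mul trmxK mulmxA; apply/memv_imgP/eqP => [[y]|x0].
 by rewrite mem_zero_locus => /eqP y0 ->; rewrite lfunE /= mulmxK.
by exists (x *m invmx h); rewrite ?mem_zero_locus ?x0 // lfunE /= mulmxKV.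
Qed.

(** The scalar d makes the condition homogeneous, so that the projection without denominators can
    serve as a defining form of a nearby plane. *)
Lemma near_open (b : 'M[R]_(2, 4)) (e : R) : grassmannian_open [set W | exists f d,
 [/\ row_free f, nm (f - d *: b) < e * `|d| & W = zero_locus f]].
rewrite /grassmannian_open openE => c1 [fc1 [f1 [d [ff1 fd W1]]]].
have c1f : c1 *m f1^T = 0.
 have r0 (u : 'rV[R]_2) : u *m c1 *m f1^T = 0.
  by apply/eqP; rewrite -mem_zero_locus -W1; apply/mem_row_span; exists u.
 by apply/row_matrixP => i; rewrite row0 row_mul rowE r0.
pose F c := reject c f1; pose D c : R := \det (c *m c^T).
(* One continuous function whose positivity expresses both the estimate for [F c] and its full
   rank. *)
pose h c := Num.min (e * `|D c * d| - nm (F c - (D c * d) *: b)) `|\det (F c *m (F c)^T)|.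
have F1 : F c1 = D c1 *: f1 by rewrite /F reject_id // orthogonal_sym.
have D0 : D c1 != 0 by rewrite /D -row_freeE.
have h1 : 0 < h c1.
 rewrite lt_min subr_gt0 normr_gt0 F1 -row_freeE row_freeZ // ff1 andbT -scalerA -scalerBr nmZ.
 by rewrite normrM mulrCA ltr_pM2l ?normr_gt0.
have cid (i : 'I_2) (j : 'I_4) : continuous (fun c : 'M[R]_(2, 4) => c i j) by exact: coord_continuous.
have cT (g : 'M[R]_(2, 4) -> 'M[R]_(2, 4)) k l : (forall i j, continuous (fun t => g t i j)) ->
  continuous (fun t => (g t)^T k l).
 by move=> cg; apply: (ctsE (g := fun t => g t l k)) => [t|]; [rewrite mxE|exact: cg].
have cF i j : continuous (fun c => F c i j) by apply: cts_reject => // k l; exact: ctsC.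
have cD : continuous D by apply: cts_det => i j; apply: cts_mulmx => // k l; exact: cT.
have ch : continuous h.
 apply: cts_min; last first.
  by apply/cts_norm/cts_det => i j; apply: cts_mulmx => // k l; exact: cT.
 apply: ctsB; first by apply: ctsM; [exact: ctsC|apply/cts_norm/ctsM; [|exact: ctsC]]. apply: cts_nm => r k.
 apply: (ctsE (g := fun c => F c r k - D c * d * b r k)) => [c|]; first by rewrite !mxE.
 by apply: ctsB => //; apply: ctsM; [apply: ctsM => //|]; exact: ctsC.
have : \forall c \near c1, 0 < h c.
 by have := ch c1; move/cvgrPdist_lt/(_ _ h1); apply: filterS => c; rewrite ltr_distlC => /andP[+ _];
  rewrite subrr.
apply: filterS => c; rewrite lt_min subr_gt0 normr_gt0 -row_freeE => /andP[hn fF].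
have Dc : D c != 0.
 apply: contraTneq hn => ->; rewrite mul0r normr0 mulr0 -leNgt; exact: nm_ge0.
have fc : row_free c by rewrite row_freeE.
split=> //; exists (F c), (D c * d); split=> //.
by apply: row_span_locus => //; apply/orthogonal_sym/reject_orth.
Qed.

Lemma heq_loci n (a b : forms R n) : loci a = loci b -> heq a b.
by move=> e; rewrite /heq e; exact: homotopy_eq_refl. Qed.

(** An isotopy comes without a continuous choice of forms. Forms are chosen separately at each time,
    and [near_open] with [heq_near] compares neighbouring times. *)
Lemma isotopic_heq n (a b : forms R n) : (1 < n)%N ->
 is_cfg a -> isotopic (loci a) (loci b) -> heq a b.
move=> n1 ca [s [Q [bs cQ aQ Q0 Q1]]].
pose G t := exists2 c, heq a c & Q t = loci c.
suff [c hc e] : G 1.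
 apply: heqT hc _; apply: heqC; apply: heqT (heq_perm b (bij_inj bs)) _.
 rewrite /heq (_ : loci (b \o s) = loci c); last first.
  by rewrite -e; apply/funext => i; rewrite Q1.
 exact: heq_refl.
apply: (@itv_const R G); last first.
 by exists a; [exact: heq_refl|apply/funext].
move=> t t01; have [a0 ca0 Qt] := arrangement_loci (aQ t t01).
have [e e0 He] := heq_near ca0 n1.
have near (c : forms R n) : (forall i, [set W | exists f d, [/\ row_free f, nm (f - d *: a0 i) < e * `|d| &
  W = zero_locus f]] (loci c i)) -> heq a0 c.
 move=> h; have hc i : exists f, nm (f - a0 i) <= e /\ zero_locus f = zero_locus (c i).
  have [f [d [ff fd cf]]] := h i; have d0 : d != 0.
   by apply: contraTneq fd => ->; rewrite normr0 mulr0 -leNgt; exact: nm_ge0.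
  exists (d^-1 *: f); rewrite zero_locusZ ?invr_eq0 // -cf; split=> //.
  rewrite -[a0 i]scale1r -(mulVf d0) -scalerA -scalerBr nmZ normfV mulrC ler_pdivrMr ?normr_gt0 //. exact: ltW.
 pose f i := sval (cid (hc i)). have := He f; rewrite /heq (_ : loci f = loci c); last first.
  by apply/funext => i; rewrite /loci /f; case: (cid _) => x [].
 by apply=> i; rewrite /f; case: (cid _) => x [].
have [d d0 Hd] : exists2 d, 0 < d & forall s, 0 <= s <= 1 -> `|s - t| < d -> forall i,
  [set W | exists f d, [/\ row_free f, nm (f - d *: a0 i) < e * `|d| & W = zero_locus f]] (Q s i).
 pose S i : set (subsp R) := [set W | exists f d, [/\ row_free f, nm (f - d *: a0 i) < e * `|d| &
  W = zero_locus f]].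
 have V i : exists2 V : set R, open V & V `&` `[0, 1]%classic = (Q^~ i @^-1` S i) `&` `[0, 1]%classic.
  by apply/open_subspaceP; apply: cQ; exact: near_open.
 pose W i := s2val (cid2 (V i)). have oW i : open (W i) by rewrite /W; case: cid2.
 have WE i : W i `&` `[0, 1]%classic = (Q^~ i @^-1` S i) `&` `[0, 1]%classic.
  by rewrite /W; case: cid2.
 have nW i : nbhs t (W i).
  apply: open_nbhs_nbhs; split=> //. suff : (W i `&` `[0, 1]%classic) t by case.
  rewrite WE; split; last by rewrite /= in_itv. exists (a0 i), 1; split; first exact: cfg_row_free.
   by rewrite scale1r subrr nm0 normr1 mulr1.
  by rewrite /= Qt.
 have /nbhs_ballP[d /= d0 dW] := filter_forall (nbhs_filter t) nW.
 exists d => // u u01 ud i; suff : (W i `&` `[0, 1]%classic) u by rewrite WE => -[].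
 by split; [apply: dW; rewrite /ball /= distrC|rewrite /= in_itv].
exists d => // u u01 ud; have [c cc Qu] := arrangement_loci (aQ u u01).
have h0 : heq a0 c by apply: near => i; rewrite -Qu; exact: Hd.
split=> -[c' hc' Q'].
 exists a0; last exact: Qt.
 exact: heqT hc' (heqT (heq_loci (etrans (esym Q') Qu)) (heqC h0)).
exists c; last exact: Qu.
exact: heqT hc' (heqT (heq_loci (etrans (esym Q') Qt)) h0).
Qed.

(** These changes preserve the homotopy type; a [g] of negative determinant, however, passes to the
    mirror image. *)
Definition moves n (a b : forms R n) : Prop :=
 exists (s : 'I_n -> 'I_n) (P : 'I_n -> 'M[R]_2) (g : 'M[R]_4),
  [/\ injective s, forall i, \det (P i) != 0, \det g != 0 & b = fun i => P i *m (a (s i) *m g)].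

Lemma moves_cfg n (a b : forms R n) : is_cfg a -> moves a b -> is_cfg b.
move=> ca [s [P [g [sI dP dg ->]]]] i j ij; rewrite cross_mul cross_mulr !mulf_neq0 //.
by apply: ca; rewrite (inj_eq sI).
Qed.

Lemma moves_heq n (a b : forms R n) : moves a b -> heq a b.
move=> [s [P [g [sI dP dg ->]]]]; apply: heqT (heq_perm a sI) _.
apply: heqT (heq_gl (a \o s) dg) _; rewrite /heq.
rewrite (_ : loci (fun i => P i *m _) = loci (fun i => (a \o s) i *m g)); first exact: heq_refl.
by apply/funext => i; rewrite /loci zero_locus_mul.
Qed.

Lemma eqv_mulr n (a b : forms R n) (g : 'M[R]_4) : \det g != 0 -> eqv a b ->
 eqv (fun i => a i *m g) (fun i => b i *m g).
move=> dg [P [dP [h [ch hc h0 h1]]]]; exists P; split=> //; exists (fun t i => h t i *m g); split.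
- by move=> i; apply: cts_mulmx => [r k|r k]; [exact: ch|exact: ctsC].
- by move=> t i j ij; rewrite cross_mulr mulf_neq0 // hc.
- by rewrite h0.
- by apply/funext => i; rewrite h1 mulmxA.
Qed.

Lemma moves_isotopic n (a b c : forms R n) (r : 'I_n -> 'I_n) : (1 < n)%N ->
 is_cfg a -> moves a b -> injective r -> eqv b (c \o r) ->
 isotopic (loci a) (loci c) \/ isotopic_to_mirror (loci a) (loci c).
move=> n1 ca [s [P [g [sI dP dg bE]]]] rI bc; have [s' sK s'K] := injF_bij sI.
have cas : is_cfg (a \o s) by move=> i j ij; apply: ca; rewrite (inj_eq sI).
have casg : is_cfg (fun i => (a \o s) i *m g).
 by move=> i j ij; rewrite cross_mulr mulf_neq0 // cas.
have rsI : injective (r \o s') by apply: inj_comp rI (can_inj s'K).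
have e1 : eqv (fun i => (a \o s) i *m g) (c \o r).
 by apply: eqv_trans (eqv_mul dP casg) _; rewrite bE in bc.
have aE : a = (a \o s) \o s' by apply/funext => i /=; rewrite s'K.
have [dg0|dg0] : \det g < 0 \/ 0 < \det g by apply/orP; rewrite -neq_lt.
 right; have gu : g \in unitmx by rewrite unitmxE unitfE. exists g^T; rewrite det_tr; split=> //.
 rewrite image_loci ?det_tr //; apply: (eqv_isotopic (s := r \o s')) => //.
 have dg' : \det (invmx g) != 0 by rewrite det_inv invr_eq0. have := eqv_sub (can_inj s'K) (eqv_mulr dg' e1).
 rewrite (_ : (fun i => _) \o s' = a); last by apply/funext => i /=; rewrite mulmxK // s'K.
 by rewrite trmx_inv trmxK.
left; apply: (eqv_isotopic (s := r \o s')) => //; rewrite {1}aE.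
exact: (eqv_sub (can_inj s'K) (eqv_trans (conn_eqv (conn_gl cas dg0)) e1)).
Qed.

End Isotopies.

(** * Pairs of arrangements in the class of K *)

Section MazurovskiiCase.
Variable R : realType.
Implicit Types a b : forms R 6.

Lemma K_order_inj : injective K_order.
move=> i j /(congr1 val); rewrite /K_order /=.
by case: i => [[|[|[|[|[|[|//]]]]]] ?]; case: j => [[|[|[|[|[|[|//]]]]]] ?];
 rewrite /= !inordK // => _; exact: val_inj.
Qed.

Lemma K_pattern : pattern neg8 (@K_forms R \o K_order).
have cE (i j : 'I_6) : cross (K_forms R i) (K_forms R j) =
  (j.+1%:R - i.+1%:R) * ((perm_K j).+1%:R - (perm_K i).+1%:R).
 by rewrite !K_forms_graph cross_graph det2E !mxE /=; ring.
move=> e e15; rewrite /mvals e15 /sgp cE !perm_KE /K_order.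
by move: e e15; do 15?[case=> [_|]] => //; rewrite /= !inordK //=; lra.
Qed.

Lemma pattern_linking a b i j : pattern neg8 a -> pattern neg8 b -> i != j ->
 linking_number a i j = linking_number b i j.
move=> pa pb ij; rewrite /linking_number -!/(cross _ _).
have H e : (e < 15)%N -> Num.sg (mvals a e) = Num.sg (mvals b e).
 move=> e15; have := pa e e15; have := pb e e15; rewrite /sgp.
 by case: ifP => _; rewrite ?mul1r ?mulN1r ?oppr_gt0 => q p;
  [rewrite (ltr0_sg p) (ltr0_sg q)|rewrite (gtr0_sg p) (gtr0_sg q)].
have [e e15 [[-> ->]|[-> ->]]] := pair6P ij; have := H e e15; rewrite /mvals e15 //.
by rewrite [in RHS]cross_sym cross_sym.
Qed.

Lemma rises_K a b : is_cfg a -> moves a b -> pattern neg8 b -> rises b ->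
 equivalent_to_K (loci a).
move=> ca ab pb rb.
have H r : injective r -> eqv b (@K_forms R \o r) -> equivalent_to_K (loci a).
 by move=> rI e; exact: (moves_isotopic (isT : (1 < 6)%N) ca ab rI e).
have := same_class8 (or_introl (conj rb (K_rises R))); case=> [|e]; first exact: (H _ K_order_inj).
apply: (H (K_order \o relabel swap12)) e.
by apply: inj_comp K_order_inj _; apply: relabel_inj.
Qed.

(** Whether [b] might still be isotopic to K is not decided: if it is, up to mirror image, then it
    is homotopy equivalent to K; otherwise its planes satisfy the definition of L. *)
Lemma never_rises_L a b : is_cfg a -> moves a b -> pattern neg8 b ->
 heq b (@K_forms R) \/ equivalent_to_L (loci a).
move=> ca ab pb; have cb := moves_cfg ca ab.
have cK : is_cfg (@K_forms R).
 have := pattern_cfg K_pattern => h i j ij.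
 have [s' _ K'] := injF_bij K_order_inj; rewrite -(K' i) -(K' j); apply: h. by rewrite (inj_eq (can_inj K')).
have [iso|niso] := pselect (isotopic (loci b) (mazurovskii_K R)).
 by left; exact: isotopic_heq iso.
have [[g [dg iso]]|nmir] := pselect (isotopic_to_mirror (loci b) (mazurovskii_K R)).
 left; have dg0 : \det g != 0 by rewrite lt_eqF.
 rewrite (_ : mazurovskii_K R = loci (@K_forms R)) // image_loci // in iso.
 apply: heqT (isotopic_heq _ cb iso) (heqC (heq_gl _ _)) => //.
 by rewrite det_tr det_inv invr_eq0.
right; exists (loci b); last first.
 apply: (moves_isotopic (r := id) (isT : (1 < 6)%N) ca ab) => //; exact: eqv_refl.
split=> //; first exact: loci_arrangement.
pose s := perm K_order_inj; exists (s^-1)%g, b, (@K_forms R); split=> // i j ij.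
have Ks k : K_order ((s^-1)%g k) = k by rewrite -[LHS](permE K_order_inj) permKV.
rewrite (pattern_linking pb K_pattern) ?(inj_eq perm_inj) //.
by rewrite /linking_number /= !Ks.
Qed.

Lemma class8 a a' b b' : is_cfg a -> is_cfg a' -> moves a b -> moves a' b' ->
 pattern neg8 b -> pattern neg8 b' -> ~ mazurovskii_pair (loci a) (loci a') -> heq a a'.
move=> ca ca' ab ab' pb pb' nm.
have up : heq b b' -> heq a a'.
 move=> h; apply: heqT (moves_heq ab) _. exact: heqT h (heqC (moves_heq ab')).
have same : (rises b /\ rises b') \/ (never_rises b /\ never_rises b') -> heq a a'.
 move=> /same_class8 e; apply: up => //; apply: (@relabel_heq R swap12) => //.
have mixed (c c' d d' : forms R 6) : is_cfg c -> is_cfg c' -> moves c d -> moves c' d' ->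
  pattern neg8 d -> pattern neg8 d' -> rises d ->
  heq d' d \/ (equivalent_to_K (loci c) /\ equivalent_to_L (loci c')).
 move=> cc cc' cd cd' pd pd' rd; have [h|h] := never_rises_L cc' cd' pd'.
  left; apply: heqT h _; apply: heqC. have eK := same_class8 (or_introl (conj rd (K_rises R))).
  apply: heqT (@relabel_heq R swap12 _ _ _ eK) _ => //. exact: heqC (heq_perm _ K_order_inj).
 by right; split=> //; exact: rises_K pd rd.
have [rb|nb] := rises_or_never pb; have [rb'|nb'] := rises_or_never pb'.
- by apply: same; left.
- have [h|h] := mixed _ _ _ _ ca ca' ab ab' pb pb' rb; first exact: up (heqC h).
 by case: nm; left.
- have [h|[h h']] := mixed _ _ _ _ ca' ca ab' ab pb' pb rb'; first exact: up.
 by case: nm; right.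
- by apply: same; right.
Qed.

End MazurovskiiCase.

(** * Circle-valued functions, their lifts and winding numbers *)

Section Circle.
Variable R : realType.

Definition rnd (x : R) : R := (Num.floor (x + 2^-1))%:~R.

Lemma rnd_int x : rnd x \is a Num.int.
exact: intr_int. Qed.

Lemma int_eq (m n : R) : m \is a Num.int -> n \is a Num.int -> `|m - n| < 1 -> m = n.
move=> /intrP[i ->] /intrP[j ->]; rewrite -intrB -intr_norm -[1](mulr1z (1 : R)) ltr_int => h.
by congr (_%:~R); lia.
Qed.

Lemma rnd_eq x m : m \is a Num.int -> `|x - m| < 2^-1 -> rnd x = m.
move=> mi xm; apply: int_eq => //; first exact: rnd_int.
have /andP[] := floor_itv (x + 2^-1); rewrite -/(rnd x) intrD -/(rnd x) => h1 h2.
move: xm; rewrite !ltr_norml => /andP[h3 h4]; apply/andP; split; lra.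
Qed.

(** Continuity of the composite with R -> R/Z; the function itself may jump by integers. *)
Definition cmod (T : topologicalType) (k : T -> R) : Prop :=
 forall x e, 0 < e -> \forall y \near x, exists2 m, m \is a Num.int & `|k y - k x - m| < e.

Lemma cmod_cts (T : topologicalType) (k : T -> R) : continuous k -> cmod k.
move=> ck x e e0; have /cvgrPdist_lt/(_ _ e0) := ck x.
by apply: filterS => y h; exists 0; rewrite ?rpred0 // subr0 distrC.
Qed.

Lemma cmodD (T : topologicalType) (k l : T -> R) : cmod k -> cmod l -> cmod (fun x => k x + l x).
move=> ck cl x e e0; have e2 : 0 < e / 2 by rewrite divr_gt0.
have FF : Filter (nbhs x) by exact: nbhs_filter.
apply: filterS2 (ck x _ e2) (cl x _ e2) => y [m mi hm] [n ni hn]; exists (m + n); first exact: rpredD.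
by have := ler_normD (k y - k x - m) (l y - l x - n); move=> h;
 rewrite (_ : _ - (m + n) = k y - k x - m + (l y - l x - n)); [lra|ring].
Qed.

Lemma cmodN (T : topologicalType) (k : T -> R) : cmod k -> cmod (fun x => - k x).
move=> ck x e e0; apply: filterS (ck x _ e0) => y [m mi hm]; exists (- m); first by rewrite rpredN.
by rewrite (_ : _ - - m = - (k y - k x - m)) ?normrN //; ring.
Qed.

Lemma cmod_int (T : topologicalType) (k l : T -> R) : (forall x, l x - k x \is a Num.int) ->
 cmod k -> cmod l.
move=> kl ck x e e0; apply: filterS (ck x _ e0) => y [m mi hm].
exists (m + (l y - k y) - (l x - k x)); first by rewrite rpredB // rpredD.
by rewrite (_ : _ - _ = k y - k x - m) //; ring.
Qed.

Lemma cmod_comp (T U : topologicalType) (k : T -> R) (f : U -> T) : continuous f -> cmod k ->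
 cmod (k \o f).
by move=> cf ck x e e0; exact: cf (ck (f x) _ e0). Qed.

(** The margin 1/8 between 3/8 and 1/2 absorbs the variation of [k] near a point, so rounding
    follows the integer jumps of [k]. *)
Lemma cmod_near (T : topologicalType) (k : T -> R) : cmod k ->
 (forall x, exists2 m, m \is a Num.int & `|k x - m| < 3 / 8) ->
 continuous (fun x => k x - rnd (k x)).
move=> ck k4 x; apply/cvgrPdist_lt => e e0.
have me : 0 < Num.min e 8^-1 by rewrite lt_min e0 invr_gt0 ltr0n.
apply: filterS (ck x _ me) => y [m mi]; rewrite lt_min => /andP[he h4].
have [n ni hn] := k4 x; rewrite (rnd_eq ni); last by lra.
rewrite (@rnd_eq _ (m + n)) ?rpredD //; last first.
 have := ler_normD (k y - k x - m) (k x - n). rewrite (_ : k y - k x - m + (k x - n) = k y - (m + n)); [lra|ring].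
by rewrite distrC (_ : _ - _ = k y - k x - m) //; ring.
Qed.

Lemma lift_unique (f g : R -> R) : continuous f -> continuous g ->
 (forall t, 0 <= t <= 1 -> f t - g t \is a Num.int) -> f 1 - g 1 = f 0 - g 0.
move=> cf cg fg; apply: (@itv_const R (fun t => f t - g t = f 0 - g 0)) => // t t01.
have cfg : continuous (fun t => f t - g t) by exact: ctsB.
have [d d0 h] := cts_near t cfg ltr01; exists d => // s s01 /h st.
by rewrite (int_eq (fg s s01) (fg t t01) st).
Qed.

Definition clamp2 (p : R * R) : R * R := (clip p.1, clip p.2).

Lemma cts_fst (T U : topologicalType) : continuous (fun p : T * U => p.1).
by move=> p; exact: cvg_fst. Qed.

Lemma cts_snd (T U : topologicalType) : continuous (fun p : T * U => p.2).
by move=> p; exact: cvg_snd. Qed.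

Lemma clamp2_id p : 0 <= p.1 <= 1 -> 0 <= p.2 <= 1 -> clamp2 p = p.
by case: p => x y /= hx hy; rewrite /clamp2 /= !clamp_id. Qed.

Lemma cmod_uniform (k : R * R -> R) : cmod k -> exists2 d, 0 < d & forall p q,
 clamp2 p = p -> clamp2 q = q -> `|p.1 - q.1| < d -> `|p.2 - q.2| < d ->
 exists2 m, m \is a Num.int & `|k p - k q - m| < 3 / 8.
move=> ck; pose K : set (R * R) := `[0, 1]%classic `*` `[0, 1]%classic.
have KK : compact K by apply: compact_setX; exact: segment_compact.
pose P (d : R) (q : R * R) := forall p, `|p.1 - q.1| < d -> `|p.2 - q.2| < d ->
 exists2 m, m \is a Num.int & `|k p - k q - m| < 3 / 8.
have : \forall d \near 0^'+, K `<=` P d.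
 apply: (proj1 (compact_near_coveringP K)) => // x _. have e8 : 0 < 8^-1 :> R by rewrite invr_gt0.
 have /nbhs_ballP[r /= r0 hr] := ck x _ e8. have r2 : 0 < r / 2 by rewrite divr_gt0.
 exists (ball x (r / 2), [set d | d < r / 2]).
  by split; [exact: nbhsx_ballx|exact: nbhs_right_lt].
 move=> [q d] [/= [xq1 xq2] dr] p p1 p2; rewrite /ball /= in xq1 xq2. have [|m mi hm] := hr q.
  by split; rewrite /ball /=; [apply: lt_trans xq1 _|apply: lt_trans xq2 _]; lra.
 have [|n ni hn] := hr p.
  split; rewrite /ball /=.
   have := ler_normD (x.1 - q.1) (q.1 - p.1); rewrite addrA subrK (distrC q.1) => h.
   by apply: le_lt_trans h _; clear - xq1 p1 dr; lra.
  have := ler_normD (x.2 - q.2) (q.2 - p.2); rewrite addrA subrK (distrC q.2) => h.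
  by apply: le_lt_trans h _; clear - xq2 p2 dr; lra.
 exists (n - m); first exact: rpredB. have := ler_normB (k p - k x - n) (k q - k x - m).
 rewrite (_ : _ - _ = k p - k q - (n - m)); [|ring]. by move=> h; apply: le_lt_trans h _; clear - hm hn; lra.
move=> /nbhs_ballP[r /= r0 hr]; exists (r / 2); first by rewrite divr_gt0.
move=> p q Kp Kq p1 p2; have r2 : 0 < r / 2 by rewrite divr_gt0.
have KP : K q by rewrite -Kq; split; exact: clamp_itv.
apply: (hr (r / 2) _ r2 q KP p p1 p2).
by rewrite /ball /= sub0r normrN gtr0_norm //; lra.
Qed.

Lemma lift2 (k : R * R -> R) : cmod k -> exists2 th : R * R -> R, continuous th &
 forall p, th p - k (clamp2 p) \is a Num.int.
move=> ck; have [d d0 hd] := cmod_uniform ck.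
have [N N0 Nd] : exists2 N, (0 < N)%N & N%:R^-1 < d.
 exists (Num.truncn d^-1).+1 => //; rewrite invf_plt ?posrE ?ltr0Sn //. exact: truncnS_gt.
have Np : 0 < N%:R :> R by rewrite ltr0n.
pose ray i (p : R * R) : R * R := (i%:R / N%:R * clip p.1, i%:R / N%:R * clip p.2).
have c01 (t : R) : 0 <= clip t <= 1 by have := clamp_itv t; rewrite /= in_itv.
have cray i : continuous (ray i).
 apply: cts_pair; apply: ctsM; try exact: ctsC; apply: ctsO (@clamp_cts R); [exact: cts_fst|exact: cts_snd].
have rK i p : (i <= N)%N -> clamp2 (ray i p) = ray i p.
 move=> iN; have i01 : 0 <= (i%:R / N%:R : R) <= 1.
  by rewrite divr_ge0 //= ler_pdivrMr // mul1r ler_nat.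
 have H (t : R) : 0 <= i%:R / N%:R * clip t <= 1.
  have /andP[t0 t1] := c01 t; have /andP[i0 i1] := i01. by rewrite mulr_ge0 //= mulr_ile1.
 by apply: clamp2_id; exact: H.
pose D i p := k (ray i.+1 p) - k (ray i p).
pose th p := \sum_(i < N) (D i p - rnd (D i p)).
exists (fun p => th p + k (0, 0)).
 apply: ctsD; last exact: ctsC. apply: cts_sum => i; have iN := ltn_ord i; apply: cmod_near => [|p].
  apply: cmodD; first exact: cmod_comp (cray _) ck. by apply: cmodN; exact: cmod_comp (cray _) ck.
 apply: hd; [exact: rK|exact/rK/ltnW| |]; rewrite /ray /=.
  have /andP[t0 t1] := c01 p.1; rewrite -mulrBl -mulrBl -natrB // subSnn mul1r normrM.
  rewrite gtr0_norm ?invr_gt0 // ger0_norm //; apply: le_lt_trans Nd. by rewrite ler_piMr // invr_ge0 ltW.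
 have /andP[t0 t1] := c01 p.2; rewrite -mulrBl -mulrBl -natrB // subSnn mul1r normrM.
 rewrite gtr0_norm ?invr_gt0 // ger0_norm //; apply: le_lt_trans Nd. by rewrite ler_piMr // invr_ge0 ltW.
move=> p; have -> : k (clamp2 p) = \sum_(i < N) D i p + k (0, 0).
 rewrite -(big_mkord xpredT (fun i => D i p)) telescope_sumr //.
 rewrite /ray mul0r !mul0r subrK divff ?gt_eqF // !mul1r //.
rewrite opprD addrACA subrr addr0 -sumrB rpred_sum // => i _.
by rewrite addrAC subrr sub0r rpredN rnd_int.
Qed.

Definition is_lift (k th : R -> R) : Prop := continuous th /\
 forall t, 0 <= t <= 1 -> th t - k t \is a Num.int.

Definition is_lift2 (k th : R * R -> R) : Prop := continuous th /\
 forall p, 0 <= p.1 <= 1 -> 0 <= p.2 <= 1 -> th p - k p \is a Num.int.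

Lemma cmod_is_lift2 k : cmod k -> exists th, is_lift2 k th.
move=> /lift2[th cth h]; exists th; split=> // p p1 p2.
by have := h p; rewrite clamp2_id.
Qed.

Lemma is_lift2_comp k th (f : R -> R * R) : continuous f ->
 (forall t, 0 <= t <= 1 -> 0 <= (f t).1 <= 1 /\ 0 <= (f t).2 <= 1) ->
 is_lift2 k th -> is_lift (k \o f) (th \o f).
move=> cf f01 [cth h]; split=> [|t t01]; first exact: ctsO cf cth.
by have [f1 f2] := f01 t t01; exact: h.
Qed.

Lemma cmod_is_lift k : cmod k -> exists th, is_lift k th.
move=> ck; have ckf : cmod (k \o fst : R * R -> R) by apply: cmod_comp ck; exact: cts_fst.
have [th hth] := cmod_is_lift2 ckf; exists (th \o (fun t : R => (t, 0))).
have cf : continuous (fun t : R => (t, 0 : R)) by apply: cts_pair; [exact: cts_id|exact: ctsC].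
have := is_lift2_comp cf _ hth; apply=> t t01; split=> //=; rewrite lexx ler01 //.
Qed.

(** Not the increment of a lift but its excess over k 1 - k 0, which is an integer for every path
    and the degree for a loop. *)
Definition wind (k : R -> R) : int :=
 xget 0 [set m : int | exists2 th, is_lift k th & m%:~R = th 1 - th 0 - (k 1 - k 0)].

Lemma is_lift_unique k th th' : is_lift k th -> is_lift k th' -> th 1 - th 0 = th' 1 - th' 0.
move=> [cth h] [cth' h'].
have H : th 1 - th' 1 = th 0 - th' 0.
 apply: lift_unique => // t t01.
 by rewrite (_ : _ - _ = th t - k t - (th' t - k t)); [apply: rpredB; [exact: h|exact: h']|ring].
by move: H; lra.
Qed.

Lemma windE k th : is_lift k th -> (wind k)%:~R = th 1 - th 0 - (k 1 - k 0).
move=> h; have /intrP[m mE] : th 1 - th 0 - (k 1 - k 0) \is a Num.int.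
 rewrite (_ : _ - _ = th 1 - k 1 - (th 0 - k 0)); last by ring. by apply: rpredB; apply: (h.2); rewrite ?lexx ?ler01.
rewrite /wind; case: xgetP => [n _ [th' h' ->]|/(_ m)].
 by rewrite (is_lift_unique h' h).
by case; exists th.
Qed.

End Circle.

(** * The degree one class of a circle-valued function *)

Section CircleClasses.
Variables (R : realType) (X : topologicalType).
Implicit Types (b : X -> R).

Definition edge_row (t : R) : 'rV[R]_2 := \row_j [:: 1 - clip t; clip t]`_j.

Lemma edge_subproof (t : R) : edge_row t \in @std_simplex R 1.
have := clamp_itv t; rewrite /= in_itv /= => /andP[t0 t1]; apply/mem_set; split=> [j|].
 by rewrite mxE; case: j => [[|[|//]] ?] /=; rewrite ?subr_ge0.
by rewrite !big_ord_recl big_ord0 !mxE /= addr0 subrK.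
Qed.

Definition edge (t : R) : @std_simplex R 1 := exist _ (edge_row t) (edge_subproof t).

(** The square covers the triangle with its left side collapsed to the vertex 0, and its other sides
    run along the faces, so lifts on the square serve singular triangles. *)
Definition corner_row (p : R * R) : 'rV[R]_3 := let q := clamp2 p in
 \row_j [:: 1 - q.1; q.1 * (1 - q.2); q.1 * q.2]`_j.

Lemma corner_subproof (p : R * R) : corner_row p \in @std_simplex R 2.
have := clamp_itv p.1; have := clamp_itv p.2; rewrite /= !in_itv /= => /andP[t0 t1] /andP[s0 s1].
apply/mem_set; split=> [j|].
 by rewrite mxE; case: j => [[|[|[|//]]] ?] /=; rewrite ?subr_ge0 ?mulr_ge0 ?subr_ge0.
by rewrite !big_ord_recl big_ord0 !mxE /=; ring.
Qed.

Definition corner (p : R * R) : @std_simplex R 2 := exist _ (corner_row p) (corner_subproof p).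

Lemma edge_cts : continuous edge.
apply: continuous_comp_initial; apply: mx_cts => i j.
apply: (ctsE (g := fun t => [:: 1 - clip t; clip t]`_j)) => [t|]; first by rewrite mxE.
case: j => [[|[|//]] ?] /=; last exact: clamp_cts.
by apply: ctsB; [exact: ctsC|exact: clamp_cts].
Qed.

Lemma corner_cts : continuous corner.
have c1 : continuous (fun p : R * R => clip p.1).
 by apply: ctsO (@clamp_cts R); exact: cts_fst.
have c2 : continuous (fun p : R * R => clip p.2).
 by apply: ctsO (@clamp_cts R); exact: cts_snd.
apply: continuous_comp_initial; apply: mx_cts => i j.
apply: (ctsE (g := fun p => [:: 1 - clip p.1; clip p.1 * (1 - clip p.2);
 clip p.1 * clip p.2]`_j)) => [t|]; first by rewrite mxE.
by case: j => [[|[|[|//]]] ?] /=; cts.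
Qed.

Lemma corner_face (i : 'I_3) t : simplex_map (lift i) (edge t) =
 corner (nth (1, t) [:: (1, t); (t, 1); (t, 0)] i).
have c0 : clip (0 : R) = 0 by rewrite clamp_le0.
have c1 : clip (1 : R) = 1 by rewrite clamp_ge1.
apply: val_inj; apply/rowP => j; rewrite !mxE big_mkcond /= !big_ord_recl big_ord0 !mxE -!val_eqE /=.
by case: i => [[|[|[|//]]] ?]; case: j => [[|[|[|//]]] ?];
 rewrite /= /bump /= ?c0 ?c1; ring.
Qed.

(** A cocycle for the pullback of the generator of H^1 of the circle. *)
Definition winding b : cochain R X 1 := fun s => wind (fun t => b (s (edge t))).

Lemma cmod_edge b (s : sing R X 1) : cmod b -> cmod (fun t => b (s (edge t))).
move=> cb; apply: (cmod_comp (k := b) (f := fun t => s (edge t))) cb.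
by apply: ctsO edge_cts _; exact: cts_fun.
Qed.

Lemma cmod_corner b (s : sing R X 2) : cmod b -> cmod (fun t => b (s (corner t))).
move=> cb; apply: (cmod_comp (k := b) (f := fun t => s (corner t))) cb.
by apply: ctsO corner_cts _; exact: cts_fun.
Qed.

Lemma corner_left t : corner (0, t) = corner (0, 0).
apply: val_inj; apply/rowP => j; rewrite !mxE /=.
have -> : clip (0 : R) = 0 by rewrite clamp_le0.
by rewrite !mul0r.
Qed.

Definition sq_edges (i : nat) (t : R) : R * R := nth (1, t) [:: (1, t); (t, 1); (t, 0)] i.

Lemma sq_edges_cts i : continuous (sq_edges i).
have c1 : continuous (fun t : R => (1 : R, t)) by apply: cts_pair; [exact: ctsC|exact: cts_id].
case: i => [|[|[|i]]] //.
- by apply: cts_pair; [exact: cts_id|exact: ctsC].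
- by apply: cts_pair; [exact: cts_id|exact: ctsC].
- by rewrite (_ : sq_edges _ = fun t => (1, t)) //; apply/funext => t; rewrite /sq_edges /= nth_nil.
Qed.

Lemma is_lift_face b (s : sing R X 2) th (i : 'I_3) : is_lift2 (fun p => b (s (corner p))) th ->
 is_lift (fun t => b (sing_map (lift i) s (edge t))) (th \o sq_edges i).
move=> h; have := is_lift2_comp (@sq_edges_cts i) _ h.
rewrite (_ : _ \o sq_edges i = fun t => b (sing_map (lift i) s (edge t))); last first.
 by apply/funext => t /=; rewrite corner_face.
apply=> t t01; rewrite /sq_edges.
by case: i => [[|[|[|//]]] ?] /=; rewrite ?lexx ?ler01 t01.
Qed.

Lemma is_lift2_left k (s : sing R X 2) th b : k = (fun p => b (s (corner p))) -> is_lift2 k th ->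
 forall t, 0 <= t <= 1 -> th (0, t) = th (0, 0).
move=> -> [cth h] t t01; have /andP[t0 t1] := t01.
have cu : continuous (fun u : R => (0 : R, u * t)) by apply: cts_pair; [exact: ctsC|cts].
have := @lift_unique R (fun u => th (0, u * t)) (fun=> b (s (corner (0, 0)))).
rewrite mul0r mul1r => H; have {}H := H (ctsO cu cth) (@ctsC _ _ _).
suff : th (0, t) - b (s (corner (0, 0))) = th (0, 0) - b (s (corner (0, 0))) by move/addIr.
apply: H => u /andP[u0 u1]; rewrite -(corner_left (u * t)); apply: h => /=; first by rewrite lexx ler01.
by rewrite mulr_ge0 //= mulr_ile1.
Qed.

Lemma coboundary1 (c : cochain R X 1) s : coboundary c s =
 c (sing_map (lift (inord 0 : 'I_3)) s) - c (sing_map (lift (inord 1 : 'I_3)) s) +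
 c (sing_map (lift (inord 2 : 'I_3)) s).
have e (i : 'I_3) (k : nat) : val i = k -> i = inord k by move=> <-; rewrite inord_val.
rewrite /coboundary !big_ord_recl big_ord0 /= /bump /= expr0 expr1 mul1r mulN1r addr0 addrA expr2 mulrNN !mul1r.
by rewrite -(e ord0 0%N) // -(e (lift ord0 ord0) 1%N) // -(e (lift ord0 (lift ord0 ord0)) 2%N).
Qed.

Lemma winding_cocycle b : cmod b -> winding b \in @is_cocycle R X 1.
move=> cb; apply/is_cocycleP/funext => s; rewrite coboundary1 /winding.
have [th h] := cmod_is_lift2 (cmod_corner s cb).
have L := is_lift2_left erefl h; have l1 := L 1; rewrite ler01 lexx in l1; have {}l1 := l1 isT.
apply: (@intr_inj R); rewrite rmorphD rmorphB /=.
do 3 rewrite (windE (is_lift_face _ h)); rewrite /= !corner_face /sq_edges !inordK //=.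
rewrite (corner_left 1) l1; ring.
Qed.

Definition circle_cocycle b (cb : cmod b) : cocycle R X 1 := Cocycle (winding_cocycle cb).

Lemma circle_classD b b' : cmod b -> cmod b' ->
 winding (fun x => b x + b' x) = winding b + winding b'.
move=> cb cb'; apply/funext => s; apply: (@intr_inj R).
rewrite (_ : (winding b + winding b') s = winding b s + winding b' s) // rmorphD /= /winding.
have [th [ct h]] := cmod_is_lift (cmod_edge s cb); have [th' [ct' h']] := cmod_is_lift (cmod_edge s cb').
rewrite (windE (conj ct h)) (windE (conj ct' h')) (@windE _ _ (fun t => th t + th' t)); last first.
 split=> [|t t01]; first exact: ctsD. by rewrite opprD addrACA rpredD ?h ?h'.
ring.
Qed.

Lemma winding_int b b' : cmod b -> (forall x, b x - b' x \is a Num.int) ->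
 exists p : X -> int, (forall x, (p x)%:~R = b x - b' x) /\ forall s,
 winding b' s = winding b s + (p (s (edge 1)) - p (s (edge 0))).
move=> cb bb; exists (fun x => Num.floor (b x - b' x)).
have pE x : (Num.floor (b x - b' x))%:~R = b x - b' x by apply/floorK/bb.
split=> // s; apply: (@intr_inj R); rewrite rmorphD rmorphB /= !pE /winding.
have [th [ct h]] := cmod_is_lift (cmod_edge s cb).
rewrite (windE (conj ct h)) (@windE _ _ th); last first.
 split=> // t t01; rewrite (_ : _ - _ = th t - b (s (edge t)) + (b (s (edge t)) - b' (s (edge t)))).
  by rewrite rpredD ?bb ?h.
 by ring.
ring.
Qed.

Lemma winding_cts b : continuous b -> winding b = 0.
move=> cb; apply/funext => s; apply: (@intr_inj R); rewrite /winding (@windE _ _ (fun t => b (s (edge t)))).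
 by rewrite subrr.
split=> [|t _]; last by rewrite subrr rpred0.
apply: ctsO cb; apply: ctsO edge_cts _; exact: cts_fun.
Qed.

Lemma coboundary0 (p : X -> int) (s : sing R X 1) :
 coboundary (fun v : sing R X 0 => p (v (simplex_map (fun=> ord0) (edge 0)))) s =
 p (s (edge 1)) - p (s (edge 0)).
rewrite /coboundary !big_ord_recl big_ord0 /= expr0 expr1 mul1r mulN1r addr0.
have E (i : 'I_2) : simplex_map (lift i) (simplex_map (fun=> ord0 : 'I_1) (edge 0)) =
  edge (if i == ord0 then 1 else 0).
 rewrite simplex_map_comp; apply: val_inj; apply/rowP => j; rewrite !mxE.
 rewrite big_mkcond /= !big_ord_recl big_ord0 !mxE -!val_eqE /= addr0.
 have c0 : clip (0 : R) = 0 by rewrite clamp_le0. have c1 : clip (1 : R) = 1 by rewrite clamp_ge1.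
 by case: i => [[|[|//]] ?]; case: j => [[|[|//]] ?]; rewrite /= ?c0 ?c1 ?subr0 ?subrr ?addr0 ?add0r.
by rewrite !E.
Qed.

(** A circle function that stays away from the antipode of the base point has the continuous real
    lift b - rnd b, and the integers rnd b provide the coboundary. *)
Lemma winding_near_int b : cmod b ->
 (forall x, exists2 m, m \is a Num.int & `|b x - m| < 3 / 8) -> in_coboundary (winding b).
move=> cb b4; have cr := cmod_near cb b4.
have [|p [_ pE]] := @winding_int (fun x => b x - rnd (b x)) b (cmod_cts cr).
 by move=> x; rewrite addrAC subrr sub0r rpredN rnd_int.
exists (fun v : sing R X 0 => p (v (simplex_map (fun=> ord0) (edge 0)))).
by apply/funext => s; rewrite coboundary0 pE winding_cts // add0r.
Qed.

Lemma cmod_int_mul (T : topologicalType) (n k : T -> R) (x : T) : cmod k ->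
 (\forall y \near x, n y = n x) -> n x \is a Num.int ->
 forall e, 0 < e -> \forall y \near x, exists2 m, m \is a Num.int & `|n y * k y - n x * k x - m| < e.
move=> ck nx ni e e0; have d0 : 0 < e / (`|n x| + 1).
 by rewrite divr_gt0 // ltr_wpDl.
have FF : Filter (nbhs x) by exact: nbhs_filter.
apply: filterS2 nx (ck x _ d0) => y -> [m mi hm]; exists (n x * m); first exact: rpredM.
rewrite -!mulrBr normrM; have [->|n0] := eqVneq (n x) 0; first by rewrite normr0 mul0r.
have n0' : 0 < `|n x| by rewrite normr_gt0.
rewrite -ltr_pdivlMl //; apply: lt_trans hm _.
by rewrite [ltRHS]mulrC ltr_pM2l // ltf_pV2 ?posrE ?ltrDl ?ltr01 // addr_gt0.
Qed.

Lemma locally_int (T : topologicalType) (n : T -> R) (x : T) : continuous n ->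
 (\forall y \near x, n y \is a Num.int) -> \forall y \near x, n y = n x.
move=> cn ni; have FF : Filter (nbhs x) by exact: nbhs_filter.
have /cvgrPdist_lt/(_ _ ltr01) h := cn x.
have nx : n x \is a Num.int by exact: nbhs_singleton ni.
by apply: filterS2 ni h => y yi hy; apply/esym/int_eq.
Qed.

(** [K] plays the part of the integral of the step function th1 - k1 against the differential of
    th2; starting [th1] at k1 0 removes the integer ambiguity. *)
Definition is_secondary (k1 k2 : R -> R) (m : int) : Prop := exists th1 th2 K,
 [/\ is_lift k1 th1, is_lift k2 th2, th1 0 = k1 0, is_lift (fun t => (th1 t - k1 t) * th2 t) K &
 m%:~R = K 1 - K 0 - (th1 1 - k1 1) * k2 1].

Definition secondary k1 k2 : int := xget 0 [set m | is_secondary k1 k2 m].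

Lemma is_secondary_unique k1 k2 m m' : is_secondary k1 k2 m -> is_secondary k1 k2 m' -> m = m'.
move=> [t1 [t2 [K [l1 l2 e1 lK mE]]]] [s1 [s2 [L [l1' l2' e1' lL mE']]]].
have ts t : 0 <= t <= 1 -> s1 t = t1 t.
 move=> t01; have /andP[t0 t1'] := t01. have cut : continuous (fun u : R => u * t) by cts.
 have := lift_unique (ctsO cut l1'.1) (ctsO cut l1.1).
 rewrite mul1r mul0r e1 e1' subrr => H; apply/eqP; rewrite -subr_eq0; apply/eqP/H => u /andP[u0 u1].
 have ut : 0 <= u * t <= 1 by rewrite mulr_ge0 //= mulr_ile1.
 rewrite (_ : _ - _ = s1 (u * t) - k1 (u * t) - (t1 (u * t) - k1 (u * t))); last by ring.
 by apply: rpredB; [exact: l1'.2|exact: l1.2].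
have lL' : is_lift (fun t => (t1 t - k1 t) * t2 t) L.
 split=> [|t t01]; first exact: lL.1. have := lL.2 t t01; rewrite ts //= => h.
 rewrite (_ : _ - _ = L t - (t1 t - k1 t) * s2 t - (t1 t - k1 t) * (t2 t - k2 t - (s2 t - k2 t))); last by ring.
 apply: rpredB h _; apply: rpredM; first exact: l1.2. by apply: rpredB; [exact: l2.2|exact: l2'.2].
apply: (@intr_inj R); rewrite mE mE' (is_lift_unique lK lL') ts // ler01 lexx //.
Qed.

Lemma secondaryE k1 k2 th1 th2 K : is_lift k1 th1 -> is_lift k2 th2 -> th1 0 = k1 0 ->
 is_lift (fun t => (th1 t - k1 t) * th2 t) K ->
 (secondary k1 k2)%:~R = K 1 - K 0 - (th1 1 - k1 1) * k2 1.
move=> l1 l2 e1 lK; have i0 : 0 <= (0 : R) <= 1 by rewrite lexx ler01.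
have i1 : 0 <= (1 : R) <= 1 by rewrite lexx ler01.
have /intrP[m mE] : K 1 - K 0 - (th1 1 - k1 1) * k2 1 \is a Num.int.
 have h0 := lK.2 0 i0; have h1 := lK.2 1 i1; move: h0 h1; rewrite e1 subrr mul0r subr0 => h0 h1.
 rewrite (_ : _ - _ = K 1 - (th1 1 - k1 1) * th2 1 + (th1 1 - k1 1) * (th2 1 - k2 1) - K 0); last by ring.
 by apply: rpredB h0; apply: rpredD h1 _; apply: rpredM; [exact: l1.2|exact: l2.2].
have h : is_secondary k1 k2 m by exists th1, th2, K.
rewrite /secondary; case: xgetP => [n _ h'|/(_ m) //].
by rewrite (is_secondary_unique h' h).
Qed.

(* If one of the two circle functions vanishes near every point then the product of one with
  the differential of the other makes sense, and integrating it gives a primitive. *)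
Lemma winding_cup0 b1 b2 : cmod b1 -> cmod b2 ->
 (forall x : X, (\forall y \near x, b1 y = 0) \/ (\forall y \near x, b2 y = 0)) ->
 in_coboundary (@cup_cochain R X 1 1 2 (winding b1) (winding b2)).
move=> cb1 cb2 b0.
exists (fun s => - secondary (fun t => b1 (s (edge t))) (fun t => b2 (s (edge t)))).
apply/funext => s; rewrite coboundary1; apply: (@intr_inj R).
pose k1 p := b1 (s (corner p)); pose k2 p := b2 (s (corner p)).
have cc p : corner (clamp2 p) = corner p.
 apply: val_inj; apply/rowP => j; rewrite !mxE /clamp2 /=. have id t : clip (clip t) = clip t :> R.
  by apply: clamp_id; have := clamp_itv t; rewrite /= in_itv.
 by rewrite !id.
have [th0 ct0 h0] := lift2 (cmod_corner s cb1); have [th2 ct2 h2] := lift2 (cmod_corner s cb2).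
have {}h0 p : th0 p - k1 p \is a Num.int by have := h0 p; rewrite cc.
have {}h2 p : th2 p - k2 p \is a Num.int by have := h2 p; rewrite cc.
pose th1 p := th0 p - (th0 (0, 0) - k1 (0, 0)).
have ct1 : continuous th1 by apply: ctsB => //; exact: ctsC.
have h1 p : th1 p - k1 p \is a Num.int by rewrite /th1 addrAC; apply: rpredB.
have csc : continuous (fun p => s (corner p)).
 by apply: ctsO corner_cts _; exact: cts_fun.
have ck1 : cmod k1 by exact: cmod_corner.
(* Near a point where k1 vanishes th1 - k1 is a constant integer; where k2 vanishes both factors are
   integers. In either case the product is continuous modulo integers. *)
have cn : cmod (fun p => (th1 p - k1 p) * th2 p).
 move=> p e e0; have FF : Filter (nbhs p) by exact: nbhs_filter.
 have [z|z] := b0 (s (corner p)); have {}z := csc p _ z.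
  apply: cmod_int_mul e0 => //; first exact: cmod_cts. have zE : \forall q \near p, k1 q = 0 by exact: z.
  have ni : \forall q \near p, th1 q \is a Num.int.
   by apply: filterS (zE) => q e'; have := h1 q; rewrite e' subr0.
  have lc := locally_int ct1 ni. by apply: filterS2 (zE) lc => q e1 ->; rewrite e1 (nbhs_singleton zE).
 have zE : \forall q \near p, k2 q = 0 by exact: z.
 apply: filterS (zE) => q e2; exists ((th1 q - k1 q) * th2 q - (th1 p - k1 p) * th2 p).
  apply: rpredB; apply: rpredM => //; first by have := h2 q; rewrite e2 subr0.
  by have := h2 p; rewrite (nbhs_singleton zE) subr0.
 by rewrite subrr normr0.
have [K lK] := cmod_is_lift2 cn.
have l1 : is_lift2 k1 th1 by split=> // p _ _; exact: h1.
have l2 : is_lift2 k2 th2 by split=> // p _ _; exact: h2.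
have i0 : 0 <= (0 : R) <= 1 by rewrite lexx ler01.
have i1 : 0 <= (1 : R) <= 1 by rewrite lexx ler01.
have th1_0 t : 0 <= t <= 1 -> th1 (0, t) = k1 (0, 0).
 by move=> t01; rewrite (is_lift2_left erefl l1 t01) /th1 subKr.
have k1_0 t : k1 (0, t) = k1 (0, 0) by rewrite /k1 corner_left.
have sqK i : (i < 3)%N -> is_lift (fun t => (th1 (sq_edges i t) - k1 (sq_edges i t)) *
  th2 (sq_edges i t)) (K \o sq_edges i).
 move=> i3; apply: (is_lift2_comp (sq_edges_cts (i := i)) _ lK) => t t01.
 by case: i i3 => [|[|[|//]]] _; rewrite /sq_edges /= ?lexx ?ler01 t01.
have K0 : K (0, 1) = K (0, 0).
 have cu : continuous (fun t : R => (0 : R, t)) by apply: cts_pair; [exact: ctsC|exact: cts_id].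
 have lK0 : is_lift (fun t => (th1 (0, t) - k1 (0, t)) * th2 (0, t)) (fun t => K (0, t)).
  by apply: (is_lift2_comp cu _ lK) => t t01 /=; rewrite lexx ler01.
 have l0 : is_lift (fun t => (th1 (0, t) - k1 (0, t)) * th2 (0, t)) (fun=> 0).
  split=> [|t t01]; first exact: ctsC. by rewrite th1_0 // k1_0 subrr mul0r subrr rpred0.
 have := is_lift_unique lK0 l0; rewrite subrr => /eqP; rewrite subr_eq0 => /eqP //.
have face (b : X -> R) (i : 'I_3) t : b (sing_map (lift i) s (edge t)) = b (s (corner (sq_edges i t))).
 by rewrite /= corner_face.
have S (i : nat) : (i < 3)%N -> i != 0%N ->
  (secondary (fun t => b1 (sing_map (lift (inord i : 'I_3)) s (edge t)))
   (fun t => b2 (sing_map (lift (inord i : 'I_3)) s (edge t))))%:~R =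
  K (sq_edges i 1) - K (sq_edges i 0) - (th1 (sq_edges i 1) - k1 (sq_edges i 1)) * k2 (sq_edges i 1).
 move=> i3 in0; have iE : (inord i : 'I_3) = i :> nat by rewrite inordK.
 have := sqK i i3; rewrite -{1 2 3 4}iE => lKi.
 have e1 := is_lift_face (inord i) l1; have e2 := is_lift_face (inord i) l2.
 rewrite (secondaryE e1 e2 _ (K := K \o sq_edges i)) /=.
 - by rewrite !face iE.
 - rewrite face iE; case: i i3 in0 {iE lKi e1 e2} => [|[|[|//]]] // _ _; rewrite /sq_edges /=.
   by rewrite th1_0 // -(k1_0 1).
  by rewrite th1_0.
 - move: lKi; rewrite iE; congr (is_lift _ _); apply/funext => t.
  by rewrite face iE.
(* The face 0 does not start at the base vertex of the triangle, so the lift of k1 has to be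
   normalised anew there; the correction is the cup product. *)
have S0 : (secondary (fun t => b1 (sing_map (lift (inord 0 : 'I_3)) s (edge t)))
   (fun t => b2 (sing_map (lift (inord 0 : 'I_3)) s (edge t))))%:~R =
  K (1, 1) - K (1, 0) - (th1 (1, 0) - k1 (1, 0)) * (th2 (1, 1) - th2 (1, 0)) -
  (th1 (1, 1) - k1 (1, 1) - (th1 (1, 0) - k1 (1, 0))) * k2 (1, 1).
 have iE : (inord 0 : 'I_3) = 0%N :> nat by rewrite inordK.
 have e1 := is_lift_face (inord 0) l1; have e2 := is_lift_face (inord 0) l2.
 rewrite (secondaryE (th1 := fun t => th1 (1, t) - (th1 (1, 0) - k1 (1, 0))) (th2 := fun t => th2 (1, t))
  (K := fun t => K (1, t) - (th1 (1, 0) - k1 (1, 0)) * th2 (1, t))).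
 - by rewrite !face iE /sq_edges /=; rewrite -/(k1 _) -/(k2 _); ring.
 - split=> [|t t01].
   by apply: ctsB; [have := e1.1; rewrite iE; exact|exact: ctsC].
  rewrite face iE /sq_edges /= -/(k1 _) addrAC; apply: rpredB => //.
 - by move: e2; rewrite iE; exact.
 - by rewrite face iE /sq_edges /= -/(k1 _) subKr.
 - have [cK hK] := sqK 0%N isT; split=> [|t t01].
   by apply: ctsB; [exact: cK|apply: ctsM; [exact: ctsC|move: e2.1; rewrite iE; exact]].
  have := hK t t01; rewrite face iE /sq_edges /= -/(k1 _) => h.
  by rewrite (_ : _ - _ = K (1, t) - (th1 (1, t) - k1 (1, t)) * th2 (1, t)) //; ring.
rewrite /cup_cochain rmorphM rmorphD rmorphB /= !rmorphN /= S0 !S //= /winding.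
have F0 t : sing_map (fun i : 'I_2 => inord i : 'I_3) s (edge t) = s (corner (t, 0)).
 have := corner_face (inord 2) t; rewrite inordK //= => <-; congr (s (simplex_map _ _)); apply/funext => j; apply: val_inj.
 by rewrite /= /bump !inordK //; case: j => [[|[|//]] ?].
have F1 t : sing_map (fun i : 'I_2 => inord (1 + i) : 'I_3) s (edge t) = s (corner (1, t)).
 have := corner_face (inord 0) t; rewrite inordK //= => <-; congr (s (simplex_map _ _)); apply/funext => j; apply: val_inj.
 by rewrite /= /bump !inordK //; case: j => [[|[|//]] ?].
have W1 : (wind (fun t => b1 (sing_map (fun i : 'I_2 => inord i : 'I_3) s (edge t))))%:~R =
  th1 (1, 0) - k1 (1, 0).
 rewrite (_ : (fun t => b1 _) = k1 \o sq_edges 2); last by apply/funext => t; rewrite F0.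
 rewrite (windE (th := th1 \o sq_edges 2)) /=.
  by rewrite /sq_edges /= th1_0 //; ring.
 apply: (is_lift2_comp (sq_edges_cts (i := 2)) _ l1) => t t01. by rewrite /sq_edges /= lexx ler01 t01.
have W2 : (wind (fun t => b2 (sing_map (fun i : 'I_2 => inord (1 + i) : 'I_3) s (edge t))))%:~R =
  th2 (1, 1) - th2 (1, 0) - (k2 (1, 1) - k2 (1, 0)).
 rewrite (_ : (fun t => b2 _) = k2 \o sq_edges 0); last by apply/funext => t; rewrite F1.
 rewrite (windE (th := th2 \o sq_edges 0)) //. apply: (is_lift2_comp (sq_edges_cts (i := 0)) _ l2) => t t01.
 by rewrite /sq_edges /= lexx ler01 t01.
have k2_0 : k2 (0, 1) = k2 (0, 0) by rewrite /k2 corner_left.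
by rewrite W1 W2 /sq_edges /= K0; ring.
Qed.

End CircleClasses.

(** * Arguments measured in turns *)

Section Angles.
Variable R : realType.
Implicit Types t x y : R.

Definition cosT t := cos (t * (pi *+ 2)).
Definition sinT t := sin (t * (pi *+ 2)).

Lemma cosT_sinT t : cosT t ^+ 2 + sinT t ^+ 2 = 1.
exact: cos2Dsin2. Qed.

Lemma cosTD t u : cosT (t + u) = cosT t * cosT u - sinT t * sinT u.
by rewrite /cosT mulrDl cosD. Qed.

Lemma sinTD t u : sinT (t + u) = sinT t * cosT u + cosT t * sinT u.
by rewrite /sinT mulrDl sinD. Qed.

Lemma cosTN t : cosT (- t) = cosT t.
by rewrite /cosT mulNr cosN. Qed.

Lemma sinTN t : sinT (- t) = - sinT t.
by rewrite /sinT mulNr sinN. Qed.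

Lemma cosTB t u : cosT (t - u) = cosT t * cosT u + sinT t * sinT u.
by rewrite cosTD cosTN sinTN; ring. Qed.

Lemma sinTB t u : sinT (t - u) = sinT t * cosT u - cosT t * sinT u.
by rewrite sinTD cosTN sinTN; ring. Qed.

Lemma cosT_nat n : cosT n%:R = 1 /\ sinT n%:R = 0.
by rewrite /cosT /sinT mulr_natl -[pi *+ 2 *+ n]add0r !periodicn ?cos0 ?sin0 //;
 [exact: sinD2pi|exact: cosD2pi].
Qed.

Lemma cosT_int m : m \is a Num.int -> cosT m = 1 /\ sinT m = 0.
move=> /intrP[[n|n] ->]; first exact: cosT_nat.
by rewrite NegzE mulrNz cosTN sinTN; have [-> ->] := cosT_nat n.+1; rewrite oppr0.
Qed.

Lemma cosTDint t m : m \is a Num.int -> cosT (t + m) = cosT t /\ sinT (t + m) = sinT t.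
by move=> /cosT_int[c s]; rewrite cosTD sinTD c s; split; ring. Qed.

Lemma rnd_half x : `|x - rnd x| <= 2^-1.
have /andP[] := floor_itv (x + 2^-1); rewrite -/(rnd x) intrD -/(rnd x) => h1 h2.
by rewrite ler_norml; apply/andP; split; lra.
Qed.

Lemma cosT_rnd t : cosT (t - rnd t) = cosT t.
have ri : - rnd t \is a Num.int by rewrite rpredN rnd_int.
by have [-> _] := cosTDint t ri. Qed.

Lemma turn_itv t : 0 <= `|t - rnd t| * (pi *+ 2) <= pi.
have h := rnd_half t; have p0 := @pi_gt0 R.
move: `|_| (normr_ge0 (t - rnd t)) (pi : R) h p0 => u u0 q h q0.
by apply/andP; split; nra.
Qed.

Lemma cosT_norm t : cosT t = cos (`|t - rnd t| * (pi *+ 2)).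
rewrite -(cosT_rnd t) /cosT -cos_norm normrM (@ger0_norm _ (pi *+ 2)) //.
by rewrite mulrn_wge0 ?pi_ge0.
Qed.

Lemma turn_int t : cosT t = 1 -> t \is a Num.int.
rewrite cosT_norm -cos0 => /cos_inj h.
have /eqP : `|t - rnd t| * (pi *+ 2) = 0.
 apply: h; rewrite in_itv /=; first exact: turn_itv. by rewrite lexx pi_ge0.
have p2 : pi *+ 2 != 0 :> R by rewrite mulrn_eq0 /= gt_eqF ?pi_gt0.
rewrite mulf_eq0 (negPf p2) orbF normr_eq0 subr_eq0 => /eqP ->.
exact: rnd_int.
Qed.

Lemma turn_near t : 0 < cosT t -> `|t - rnd t| < 4^-1.
rewrite cosT_norm; apply: contraTT; rewrite -!leNgt => h.
have p0 := @pi_gt0 R.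
have : ~~ (cos (pi / 2) < cos (`|t - rnd t| * (pi *+ 2))).
 rewrite ltr_cos ?in_itv /= ?turn_itv //; last by apply/andP; split; lra.
 by rewrite -leNgt mulrnAr -mulr_natl; move: h; set u := `|_| => h; nra.
by rewrite cos_pihalf -leNgt.
Qed.

(** An arbitrary choice among the possible values; only its class modulo integers matters. *)
Definition arg x y : R := xget 0 [set t | exists2 r, 0 < r & x = r * cosT t /\ y = r * sinT t].

Lemma argP x y : 0 < x ^+ 2 + y ^+ 2 ->
 exists2 r, 0 < r & x = r * cosT (arg x y) /\ y = r * sinT (arg x y).
move=> xy; pose r := Num.sqrt (x ^+ 2 + y ^+ 2); have r0 : 0 < r by rewrite sqrtr_gt0.
have r2 : r ^+ 2 = x ^+ 2 + y ^+ 2 by rewrite sqr_sqrtr ?ltW.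
suff [t tE] : exists t, x = r * cosT t /\ y = r * sinT t.
 by rewrite /arg; case: xgetP => [u _ //|/(_ t)]; case; exists r.
have p0 := @pi_gt0 R; have p2 : pi *+ 2 != 0 :> R by rewrite mulrn_eq0 /= gt_eqF.
have xr : - 1 <= x / r <= 1.
 rewrite -ler_norml normrM (@gtr0_norm _ r^-1) ?invr_gt0 // ler_pdivrMr // mul1r.
 by rewrite -[leRHS]gtr0_norm // -ler_sqr ?nnegrE // !real_normK ?num_real // r2 lerDl sqr_ge0.
have ac : cos (acos (x / r)) = x / r by apply: acosK; rewrite in_itv.
have as_ : r * sin (acos (x / r)) = `|y|.
 have e : r ^+ 2 * (1 - (x / r) ^+ 2) = y ^+ 2.
  by rewrite mulrBr mulr1 -exprMn mulrCA divff ?gt_eqF // mulr1 r2 addrAC subrr add0r.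
 by rewrite sin_acos // -{1}[r]gtr0_norm // -sqrtr_sqr -sqrtrM ?sqr_ge0 // e sqrtr_sqr.
have [y0|y0] := leP 0 y.
 exists (acos (x / r) / (pi *+ 2)); rewrite /cosT /sinT divfK // ac mulrC divfK ?gt_eqF // as_. by rewrite ger0_norm.
exists (- (acos (x / r) / (pi *+ 2))); rewrite cosTN sinTN /cosT /sinT divfK // ac.
rewrite mulrN as_ ltr0_norm // opprK; split=> //.
by rewrite mulrC divfK ?gt_eqF.
Qed.

Lemma arg_int x y r t : 0 < r -> x = r * cosT t -> y = r * sinT t -> arg x y - t \is a Num.int.
move=> r0 xE yE; have xy : x ^+ 2 + y ^+ 2 = r ^+ 2.
 by rewrite xE yE !exprMn -mulrDr cosT_sinT mulr1.
have [s s0 [xs ys]] : exists2 r, 0 < r & x = r * cosT (arg x y) /\ y = r * sinT (arg x y).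
 by apply: argP; rewrite xy exprn_gt0.
move: (arg x y) xs ys => a xs ys.
have s2 : s ^+ 2 = x ^+ 2 + y ^+ 2 by rewrite xs ys !exprMn -mulrDr cosT_sinT mulr1.
have rs : s = r by apply/eqP; rewrite -(@eqrXn2 _ 2) ?ltW // s2 xy.
apply: turn_int; rewrite cosTB; apply: (mulfI (x := r ^+ 2)); first by rewrite expf_eq0 gt_eqF.
transitivity (s * cosT a * (r * cosT t) + s * sinT a * (r * sinT t)); first by rewrite rs; ring.
by rewrite -xs -xE -ys -yE mulr1 -xy; ring.
Qed.

Lemma argM x y x' y' : 0 < x ^+ 2 + y ^+ 2 -> 0 < x' ^+ 2 + y' ^+ 2 ->
 arg (x * x' - y * y') (x * y' + y * x') - (arg x y + arg x' y') \is a Num.int.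
move=> /argP[r r0 [xE yE]] /argP[s s0 [xE' yE']].
apply: (@arg_int _ _ (r * s)); first exact: mulr_gt0.
 by rewrite cosTD; move: (arg x y) (arg x' y') xE yE xE' yE' => a b -> -> -> ->; ring.
by rewrite sinTD; move: (arg x y) (arg x' y') xE yE xE' yE' => a b -> -> -> ->; ring.
Qed.

Lemma argJ x y : 0 < x ^+ 2 + y ^+ 2 -> arg x (- y) + arg x y \is a Num.int.
move=> /argP[r r0 [xE yE]]; rewrite -[arg x y]opprK.
by apply: (arg_int r0); rewrite ?cosTN ?sinTN // mulrN {1}yE.
Qed.

Lemma argZ c x y : 0 < c -> 0 < x ^+ 2 + y ^+ 2 -> arg (c * x) (c * y) - arg x y \is a Num.int.
move=> c0 /argP[r r0 [xE yE]]; apply: (@arg_int _ _ (c * r)); first exact: mulr_gt0.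
 by rewrite {1}xE; ring.
by rewrite {1}yE; ring.
Qed.

Lemma argN x y : 0 < x ^+ 2 + y ^+ 2 -> arg (- x) (- y) - (arg x y + 2^-1) \is a Num.int.
move=> /argP[r r0 [xE yE]].
have e : 2^-1 * (pi *+ 2) = pi :> R by rewrite (mulr2n pi) mulrDr -mulrDl -div1r -splitr mul1r.
apply: (arg_int r0).
 by rewrite cosTD [cosT 2^-1]/cosT [sinT 2^-1]/sinT e cospi sinpi {1}xE; ring.
by rewrite sinTD [cosT 2^-1]/cosT [sinT 2^-1]/sinT e cospi sinpi {1}yE; ring.
Qed.

Lemma arg_diff x y x' y' : 0 < x ^+ 2 + y ^+ 2 -> 0 < x' ^+ 2 + y' ^+ 2 -> exists2 r, 0 < r &
 x * x' + y * y' = r * cosT (arg x y - arg x' y') /\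
 y * x' - x * y' = r * sinT (arg x y - arg x' y').
move=> /argP[r r0 [xE yE]] /argP[s s0 [xE' yE']].
exists (r * s); first exact: mulr_gt0.
rewrite cosTB sinTB; move: (arg x y) (arg x' y') xE yE xE' yE' => a b -> -> -> ->.
by split; ring.
Qed.

Lemma arg_near x y x' y' : 0 < x * x' + y * y' ->
 exists2 m, m \is a Num.int & `|arg x y - arg x' y' - m| < 4^-1.
move=> xx; have nz u v u' v' : 0 < u * u' + v * v' -> 0 < u ^+ 2 + v ^+ 2 :> R.
 move=> h; rewrite lt_def addr_ge0 ?sqr_ge0 // andbT; apply: contraTneq h => /eqP.
 rewrite paddr_eq0 ?sqr_ge0 // !sqrf_eq0 => /andP[/eqP -> /eqP ->]. by rewrite !mul0r addr0 ltxx.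
have xx' : 0 < x' * x + y' * y by rewrite mulrC (mulrC y').
have [r r0 [cE _]] := arg_diff (nz _ _ _ _ xx) (nz _ _ _ _ xx').
exists (rnd (arg x y - arg x' y')); first exact: rnd_int.
by apply: turn_near; move: xx; rewrite cE pmulr_rgt0.
Qed.

Lemma atan_arg t : 0 < cosT t -> atan (sinT t / cosT t) = (t - rnd t) * (pi *+ 2).
move=> ct; have p0 := @pi_gt0 R; have ri : - rnd t \is a Num.int by rewrite rpredN rnd_int.
have [<- <-] := cosTDint t ri; rewrite -/(tan _) tanK //.
have pp : 0 < pi *+ 2 :> R by rewrite mulrn_wgt0.
rewrite in_itv /= -ltr_norml normrM (gtr0_norm pp).
have {}ct := turn_near ct; move: `|_| (pi : R) ct p0 => u q h q0; nra.
Qed.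

(** Up to a positive factor u and w are the real and imaginary parts of the quotient by the value at
    p, so near p the difference of arguments is the arctangent of w / u up to an integer. *)
Lemma cmod_arg (T : topologicalType) (f g : T -> R) : continuous f -> continuous g ->
 (forall x : T, 0 < f x ^+ 2 + g x ^+ 2) -> cmod (fun x : T => arg (f x) (g x)).
move=> cf cg fg p e e0; have p0 := @pi_gt0 R.
pose u q := f q * f p + g q * g p; pose w q := g q * f p - f q * g p.
have FF : Filter (nbhs p) by exact: nbhs_filter.
have cu : continuous u by apply: ctsD; apply: ctsM => //; exact: ctsC.
have cw : continuous w by apply: ctsB; apply: ctsM => //; exact: ctsC.
have up : 0 < u p by rewrite /u -!expr2.
have wp : w p = 0 by rewrite /w mulrC subrr.
have nu : \forall q \near p, 0 < u q.
 have /cvgrPdist_lt/(_ _ up) := cu p; apply: filterS => q; rewrite ltr_distlC => /andP[+ _]. by rewrite subrr.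
have e1 : 0 < e * (pi *+ 2) by rewrite mulr_gt0 // mulrn_wgt0.
have cv : (fun q => atan (w q / u q)) @ p --> atan (w p / u p).
 apply: continuous_comp; last exact: continuous_atan.
 by apply: cvgM; [exact: cw|apply: cvgV; [rewrite gt_eqF|exact: cu]].
have /cvgrPdist_lt/(_ _ e1) := cv; rewrite wp mul0r atan0.
apply: filterS2 (nu) => q uq; rewrite sub0r normrN.
have [r r0 [cE sE]] := arg_diff (fg q) (fg p).
have ct : 0 < cosT (arg (f q) (g q) - arg (f p) (g p)) by move: uq; rewrite /u cE pmulr_rgt0.
rewrite /w /u cE sE -mulf_div divff ?gt_eqF // mul1r atan_arg // normrM.
have pp : 0 < pi *+ 2 :> R by rewrite mulrn_wgt0.
rewrite (gtr0_norm pp) ltr_pM2r // => h.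
by exists (rnd (arg (f q) (g q) - arg (f p) (g p))); first exact: rnd_int.
Qed.

End Angles.

Notation coh1 R X := (\pi_(cohomology R X 1)%qT).

(** * Products of degree one classes and the Steinberg relation *)

Section CupProducts.
Variables (R : realType) (X : topologicalType).

Lemma pi_cocycleD n (a b : cocycle R X n) : \pi_(cohomology R X n)%qT (a + b) =
 \pi_(cohomology R X n)%qT a + \pi_(cohomology R X n)%qT b.
by rewrite !piE. Qed.

Lemma pi_cocycle0 n (a : cocycle R X n) : in_coboundary (val a) ->
 \pi_(cohomology R X n)%qT a = 0.
move=> a0; have -> : (0 : cohomology R X n) = \pi_(cohomology R X n)%qT 0 by rewrite !piE.
by apply/pi_cohomologyP; rewrite raddf0 subr0.
Qed.

Lemma cupDl (x y z : cohomology R X 1) : cup (x + y) z = cup x z + cup y z.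
elim/quotW: x => a; elim/quotW: y => b; elim/quotW: z => c.
rewrite -pi_cocycleD !cup_pi -pi_cocycleD; congr (\pi_(_)%qT _).
by apply: val_inj; apply/funext => s; exact: mulrDl.
Qed.

Lemma cupDr (x y z : cohomology R X 1) : cup x (y + z) = cup x y + cup x z.
elim/quotW: x => a; elim/quotW: y => b; elim/quotW: z => c.
rewrite -pi_cocycleD !cup_pi -pi_cocycleD; congr (\pi_(_)%qT _).
by apply: val_inj; apply/funext => s; exact: mulrDr.
Qed.

Lemma sing_front_back (c : cochain R X 1) s : let d i j := c (sing_map (fun k : 'I_2 =>
  inord (if k == ord0 then i else j) : 'I_3) s) in
 [/\ coboundary c s = d 1%N 2%N - d 0%N 2%N + d 0%N 1%N,
  c (sing_map (fun i : 'I_2 => inord i : 'I_3) s) = d 0%N 1%N &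
  c (sing_map (fun i : 'I_2 => inord (1 + i) : 'I_3) s) = d 1%N 2%N].
have E (f g : 'I_2 -> 'I_3) : f =1 g -> c (sing_map f s) = c (sing_map g s).
 by move=> fg; rewrite (eq_sing_map _ fg).
split; last 2 first.
- by apply: E => -[[|[|//]] ?] /=; apply: val_inj; rewrite /= !inordK.
- by apply: E => -[[|[|//]] ?] /=; apply: val_inj; rewrite /= !inordK.
rewrite coboundary1; congr (_ - _ + _); apply: E => -[[|[|//]] ?]; apply: val_inj;
 by rewrite /= /bump !inordK.
Qed.

(** In degree one the homotopy is explicit: minus the pointwise product of the two cocycles on
    edges. *)
Lemma cupC (x y : cohomology R X 1) : cup x y = - cup y x.
elim/quotW: x => a; elim/quotW: y => b; rewrite !cup_pi.
apply/eqP; rewrite -addr_eq0 -pi_cocycleD; apply/eqP.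
apply: pi_cocycle0; exists (fun s => - (val a s * val b s)); apply/funext => s.
have /is_cocycleP/(congr1 (fun c => c s)) a0 := valP a.
have /is_cocycleP/(congr1 (fun c => c s)) b0 := valP b.
have [ca a1 a2] := sing_front_back (val a) s; have [cb b1 b2] := sing_front_back (val b) s.
have [-> _ _] := sing_front_back (fun s => - (val a s * val b s)) s.
rewrite ca in a0; rewrite cb in b0.
transitivity (val a (sing_map (fun i : 'I_2 => inord i : 'I_3) s) *
 val b (sing_map (fun i : 'I_2 => inord (1 + i) : 'I_3) s) +
 val b (sing_map (fun i : 'I_2 => inord i : 'I_3) s) *
 val a (sing_map (fun i : 'I_2 => inord (1 + i) : 'I_3) s)); first by [].
rewrite a1 a2 b1 b2; move: a0 b0; rewrite -!/(0 : int).
move: (val a _) (val a _) (val a _) (val b _) (val b _) (val b _) => a12 a02 a01 b12 b02 b01 e e'.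
have -> : a02 = a12 + a01 by apply/eqP; rewrite eq_sym -subr_eq0 -[X in _ == X]e; apply/eqP; ring.
have -> : b02 = b12 + b01 by apply/eqP; rewrite eq_sym -subr_eq0 -[X in _ == X]e'; apply/eqP; ring.
by ring.
Qed.

Definition ccls (b : X -> R) : cohomology R X 1 :=
 if pselect (cmod b) is left cb then coh1 R X (circle_cocycle cb) else 0.

Lemma cclsE b (cb : cmod b) : ccls b = coh1 R X (circle_cocycle cb).
rewrite /ccls; case: pselect => [cb'|//]; congr (\pi_(_)%qT _); exact: val_inj.
Qed.

Lemma cclsD b b' : cmod b -> cmod b' -> ccls (fun x => b x + b' x) = ccls b + ccls b'.
move=> cb cb'; rewrite (cclsE cb) (cclsE cb') (cclsE (cmodD cb cb')) -pi_cocycleD.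
by congr (\pi_(_)%qT _); apply: val_inj; exact: circle_classD.
Qed.

Lemma ccls_near b b' : cmod b -> cmod b' ->
 (forall x : X, exists2 m, m \is a Num.int & `|b x - b' x - m| < 3 / 8) -> ccls b = ccls b'.
move=> cb cb' h; have cbb := cmodD cb (cmodN cb').
have e : ccls (fun x => b x - b' x) = 0.
 by rewrite (cclsE cbb); apply: pi_cocycle0; exact: winding_near_int.
rewrite -[RHS]add0r -e -cclsD //; congr ccls; apply/funext => x.
by rewrite subrK.
Qed.

Lemma ccls_int b b' : cmod b -> (forall x : X, b x - b' x \is a Num.int) -> ccls b = ccls b'.
move=> cb bb; apply: ccls_near => // [|x]; last first.
 by exists (b x - b' x) => //; rewrite subrr normr0; lra.
by apply: cmod_int cb => x; rewrite -opprB rpredN.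
Qed.

Lemma cclsB b b' : cmod b -> cmod b' -> ccls (fun x => b x - b' x) = ccls b - ccls b'.
move=> cb cb'; apply/eqP; rewrite eq_sym subr_eq; apply/eqP; rewrite -cclsD //; last first.
 exact: (cmodD cb (cmodN cb')).
by congr ccls; apply/funext => x; rewrite subrK.
Qed.

Lemma ccls_cup0 b1 b2 : cmod b1 -> cmod b2 ->
 (forall x : X, (\forall y \near x, b1 y = 0) \/ (\forall y \near x, b2 y = 0)) ->
 cup (ccls b1) (ccls b2) = 0.
move=> cb1 cb2 h; rewrite (cclsE cb1) (cclsE cb2) cup_pi.
by apply: pi_cocycle0; exact: winding_cup0.
Qed.

(** A representative of the class of the argument supported where f < 0: across that half-plane the
    argument of -(f, g) covers half a turn, so its double covers a whole turn, and 1/2 fits the ends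
    to integers. *)
Definition half_arg (f g : X -> R) (x : X) : R :=
 if f x < 0 then arg (- f x) (- g x) + arg (- f x) (- g x) + 2^-1 else 0.

Section Angle.
Variables f g : X -> R.
Hypotheses (cf : continuous f) (cg : continuous g).
Hypothesis fg : forall x : X, 0 < f x ^+ 2 + g x ^+ 2.

Let fgN x : 0 < (- f x) ^+ 2 + (- g x) ^+ 2.
by rewrite !sqrrN. Qed.

Lemma cmod_half_arg : cmod (half_arg f g).
pose K x := arg (- f x) (- g x) + arg (- f x) (- g x) + 2^-1.
have cN : cmod (fun x => arg (- f x) (- g x)) by apply: cmod_arg => //; exact: ctsN.
have cK : cmod K by apply: cmodD; [exact: cmodD|apply: cmod_cts; exact: ctsC].
move=> x e e0; have FF : Filter (nbhs x) by exact: nbhs_filter.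
have [f0|f0|f0] := ltgtP (f x) 0.
- have fn : \forall y \near x, f y < 0.
  have d0 : 0 < - f x by rewrite oppr_gt0.
  have /cvgrPdist_lt/(_ _ d0) := @cf x; apply: filterS => y; rewrite ltr_distlC => /andP[_]. by rewrite subrr.
 by apply: filterS2 fn (cK x e e0) => y yn; rewrite /half_arg yn f0.
- have fn : \forall y \near x, 0 < f y.
  have /cvgrPdist_lt/(_ _ f0) := @cf x; apply: filterS => y; rewrite ltr_distlC => /andP[+ _]. by rewrite subrr.
 apply: filterS fn => y yn; exists 0; first exact: rpred0.
 have [fx fy] : (f x < 0) = false /\ (f y < 0) = false by rewrite !ltNge !ltW.
 by rewrite /half_arg fx fy !subr0 normr0.
have Ki : K x \is a Num.int.
 have [r r0 [c0 _]] := argP (fgN x); move/eqP: c0; rewrite f0 oppr0 eq_sym mulf_eq0 gt_eqF //= => /eqP.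
 rewrite /K f0 oppr0; set t := arg _ _ => c0; apply: turn_int.
 have epi : 2^-1 * (pi *+ 2) = pi :> R by rewrite (mulr2n pi) (mulrDr 2^-1 pi pi) -mulrDl -div1r -splitr mul1r.
 have s1 : sinT t ^+ 2 = 1 by rewrite -(cosT_sinT t) c0 expr0n add0r.
 rewrite cosTD [cosT 2^-1]/cosT [sinT 2^-1]/sinT epi cospi sinpi cosTD c0.
 by rewrite !mulr0 subr0 sub0r mulrN1 opprK -expr2.
apply: filterS (cK x e e0) => y [m mi hm]; rewrite {2}/half_arg f0 ltxx subr0 /half_arg.
case: ifP => _; last by exists 0; rewrite ?rpred0 // subr0 normr0.
by exists (m + K x); [exact: rpredD|rewrite opprD addrA addrAC].
Qed.

Lemma ccls_half_arg : ccls (half_arg f g) = ccls (fun x => arg (f x) (g x)).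
apply/esym/ccls_near => [|//|x]; [exact: cmod_arg|exact: cmod_half_arg|].
have [r r0 [c0 _]] := argP (fg x).
rewrite /half_arg; case: ltgtP => f0.
- have [s s0 [c1 _]] := argP (fgN x); have h : 0 < cosT (arg (- f x) (- g x)).
  by rewrite -(pmulr_rgt0 _ s0) -c1 oppr_gt0.
 have hi := argN (fg x); set t := arg (- f x) _ in hi h *; have tn := turn_near h. set A := arg (f x) (g x) in hi *.
 (* [t] and A + 1/2 agree modulo integers, so A - (2 t + 1/2) is congruent to - t, which is within
    1/4 of an integer because the cosine is positive. *)
 exists (- (t - (A + 2^-1)) - 1 - rnd t).
  by rewrite rpredB ?rnd_int // rpredB ?rpredN ?rpred1.
 have -> : A - (t + t + 2^-1) - (- (t - (A + 2^-1)) - 1 - rnd t) = - (t - rnd t) by field. rewrite normrN.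
 by apply: lt_trans tn _; lra.
- exists (rnd (arg (f x) (g x))); first exact: rnd_int.
 rewrite subr0; apply: lt_trans (turn_near _) _; last by lra. by move: f0; rewrite {1}c0 pmulr_rgt0.
exists (rnd (arg (f x) (g x))); first exact: rnd_int.
rewrite subr0; set t := arg _ _ in c0 *.
have c1 : cosT t = 0 by move/eqP: c0; rewrite f0 eq_sym mulf_eq0 gt_eqF //= => /eqP.
have p0 := @pi_gt0 R; have h : `|t - rnd t| * (pi *+ 2) = pi / 2.
 apply: cos_inj; rewrite ?in_itv /= ?turn_itv ?cos_pihalf -?cosT_norm //.
 by apply/andP; split; move: (pi : R) p0 => q q0; lra.
by move: `|_| (pi : R) h p0 => u q h q0; nra.
Qed.

End Angle.

(* For u + v = 1 the functions half_arg u and half_arg v vanish outside the disjoint sets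
  re u < 0 and 1 < re u. *)
Lemma cup_one_sum (u1 u2 : X -> R) : continuous u1 -> continuous u2 ->
 (forall x : X, 0 < u1 x ^+ 2 + u2 x ^+ 2) -> (forall x : X, 0 < (1 - u1 x) ^+ 2 + (- u2 x) ^+ 2) ->
 cup (ccls (fun x => arg (u1 x) (u2 x))) (ccls (fun x => arg (1 - u1 x) (- u2 x))) = 0.
move=> c1 c2 nu nv; have cv1 : continuous (fun x => 1 - u1 x) by apply: ctsB => //; exact: ctsC.
have cv2 : continuous (fun x => - u2 x) by exact: ctsN.
rewrite -(ccls_half_arg c1 c2 nu) -(ccls_half_arg cv1 cv2 nv).
apply: ccls_cup0 => [||x]; [exact: cmod_half_arg|exact: cmod_half_arg|].
have FF : Filter (nbhs x) by exact: nbhs_filter.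
have [u0|u0] := ltP 0 (u1 x); [left|right].
 have /cvgrPdist_lt/(_ _ u0) := c1 x; apply: filterS => y; rewrite ltr_distlC => /andP[+ _].
 by rewrite subrr /half_arg => /ltW; rewrite leNgt => /negPf ->.
have /cvgrPdist_lt/(_ _ ltr01) := c1 x; apply: filterS => y; rewrite ltr_distlC => /andP[_ h].
by rewrite /half_arg subr_lt0 ltNge; case: leP => //; move: h u0; lra.
Qed.

(** Division of f and g by h = f + g gives u and 1 - u. It is done by multiplying with the conjugate
    of h and the positive number [n], whose effect on arguments is known modulo integers. *)
Lemma steinberg (f1 f2 g1 g2 : X -> R) : continuous f1 -> continuous f2 ->
 continuous g1 -> continuous g2 ->
 (forall x : X, 0 < f1 x ^+ 2 + f2 x ^+ 2) -> (forall x : X, 0 < g1 x ^+ 2 + g2 x ^+ 2) ->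
 (forall x : X, 0 < (f1 x + g1 x) ^+ 2 + (f2 x + g2 x) ^+ 2) ->
 let h := ccls (fun x => arg (f1 x + g1 x) (f2 x + g2 x)) in
 cup (ccls (fun x => arg (f1 x) (f2 x)) - h) (ccls (fun x => arg (g1 x) (g2 x)) - h) = 0.
move=> cf1 cf2 cg1 cg2 nf ng nh.
pose h1 x := f1 x + g1 x; pose h2 x := f2 x + g2 x; pose n x := (h1 x ^+ 2 + h2 x ^+ 2)^-1.
have ch1 : continuous h1 by exact: ctsD.
have ch2 : continuous h2 by exact: ctsD.
have n0 x : 0 < n x by rewrite invr_gt0; exact: nh.
have cn : continuous n.
 apply: ctsV; first by move=> x; rewrite gt_eqF //; exact: nh.
 by apply: ctsD; rewrite /=; apply: (ctsM (f := _) (g := _)).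
have cah : cmod (fun x => arg (h1 x) (h2 x)) by exact: cmod_arg.
have div (k1 k2 : X -> R) : continuous k1 -> continuous k2 ->
  (forall x : X, 0 < k1 x ^+ 2 + k2 x ^+ 2) ->
  let u1 x := n x * (k1 x * h1 x - k2 x * - h2 x) in let u2 x := n x * (k1 x * - h2 x + k2 x * h1 x) in
  [/\ continuous u1, continuous u2, (forall x : X, 0 < u1 x ^+ 2 + u2 x ^+ 2) &
  ccls (fun x => arg (u1 x) (u2 x)) = ccls (fun x => arg (k1 x) (k2 x)) - ccls (fun x => arg (h1 x) (h2 x))].
 move=> ck1 ck2 nk u1 u2; have cu1 : continuous u1.
  by apply: ctsM => //; apply: ctsB; apply: ctsM => //; exact: ctsN.
 have cu2 : continuous u2.
  by apply: ctsM => //; apply: ctsD; apply: ctsM => //; exact: ctsN.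
 have nu x : 0 < u1 x ^+ 2 + u2 x ^+ 2.
  have -> : u1 x ^+ 2 + u2 x ^+ 2 = n x ^+ 2 * ((k1 x ^+ 2 + k2 x ^+ 2) * (h1 x ^+ 2 + h2 x ^+ 2)).
   by rewrite /u1 /u2; ring.
  by rewrite mulr_gt0 ?exprn_gt0 // mulr_gt0 //; exact: nh.
 split=> //; have ck : cmod (fun x => arg (k1 x) (k2 x)) by exact: cmod_arg.
 rewrite -cclsB //; apply: ccls_int => [|x]; first exact: cmod_arg.
 have nhN : 0 < h1 x ^+ 2 + (- h2 x) ^+ 2 by rewrite sqrrN; exact: nh.
 have nkh : 0 < (k1 x * h1 x - k2 x * - h2 x) ^+ 2 + (k1 x * - h2 x + k2 x * h1 x) ^+ 2.
  have -> : (k1 x * h1 x - k2 x * - h2 x) ^+ 2 + (k1 x * - h2 x + k2 x * h1 x) ^+ 2 =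
   (k1 x ^+ 2 + k2 x ^+ 2) * (h1 x ^+ 2 + (- h2 x) ^+ 2) by ring.
  by rewrite mulr_gt0.
 have i1 := argZ (n0 x) nkh; have i2 := argM (nk x) nhN; have i3 := argJ (nh x).
 move: i1 i2 i3; rewrite -/(h1 x) -/(h2 x) -/(u1 x) -/(u2 x).
 set A := arg (u1 x) _; set B := arg (_ - _) _; set C := arg (k1 x) _; set D := arg (h1 x) (- _).
 set E := arg (h1 x) _ => i1 i2 i3. have -> : A - (C - E) = A - B + (B - (C + D)) + (D + E) by ring.
 by rewrite rpredD // rpredD.
have [cu1 cu2 nu uE] := div f1 f2 cf1 cf2 nf; have [cv1 cv2 nv vE] := div g1 g2 cg1 cg2 ng.
move=> h; rewrite -[h]/(ccls (fun x => arg (h1 x) (h2 x))) -uE -vE.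
set u1 := fun x => n x * (f1 x * _ - _) in cu1 nu *; set u2 := fun x => n x * (f1 x * - _ + _) in cu2 nu *.
have e1 x : n x * (g1 x * h1 x - g2 x * - h2 x) = 1 - u1 x.
 have nx : n x * (h1 x ^+ 2 + h2 x ^+ 2) = 1 by rewrite mulVf // gt_eqF //; exact: nh.
 by rewrite -nx /u1 /h1 /h2; ring.
have e2 x : n x * (g1 x * - h2 x + g2 x * h1 x) = - u2 x by rewrite /u2 /h1 /h2; ring.
rewrite (_ : (fun x => arg (n x * (g1 x * _ - _)) _) = fun x => arg (1 - u1 x) (- u2 x)); last first.
 by apply/funext => x; rewrite e1 e2.
by apply: cup_one_sum => // x; rewrite -e1 -e2.
Qed.

End CupProducts.

(** * Values of a cocycle on paths and its local primitives *)

Section Paths.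
Variables (R : realType) (n : nat) (a : forms R n).
Let X := complement (loci a).

Definition is_path (g : R -> 'rV[R]_4) : Prop :=
 continuous g /\ forall t, 0 <= t <= 1 -> avoids a (g t).

Definition scoord m (i : 'I_m.+1) (p : @std_simplex R m) : R := val p 0 i.

Lemma scoord_cts m (i : 'I_m.+1) : continuous (@scoord m i).
apply: (ctsO (f := fun p : @std_simplex R m => val p) (h := fun v : 'rV[R]_m.+1 => v 0 i)).
 exact: initial_continuous.
exact: coord_continuous.
Qed.

Lemma scoord_itv (p : @std_simplex R 1) : 0 <= scoord 1 p <= 1.
have /set_mem[p0 p1] := valP p; rewrite /scoord p0 /= -p1 !big_ord_recl big_ord0 addr0.
by rewrite (_ : lift ord0 ord0 = 1) ?lerDr //; exact: val_inj.
Qed.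

Lemma path_avoids g (h : is_path g) (p : @std_simplex R 1) : avoids a (g (scoord 1 p)).
by apply: h.2; exact: scoord_itv. Qed.

Definition path_map g (h : is_path g) (p : @std_simplex R 1) : X :=
 to_compl (path_avoids h p).

Lemma path_map_cts g (h : is_path g) : continuous (path_map h).
apply: to_compl_cts => k; apply: cts_coord.
exact: ctsO (@scoord_cts _ _) h.1.
Qed.

Definition path_sing g (h : is_path g) : sing R X 1 :=
 HB.pack_for (sing R X 1) (path_map h) (isContinuous.Build _ _ (path_map h) (@path_map_cts g h)).

(** Total in the path, with value 0 off the complement, so that no proof of avoidance enters the
    type. *)
Definition on_path (c : cochain R X 1) (g : R -> 'rV[R]_4) : int :=
 if pselect (is_path g) is left h then c (path_sing h) else 0.

Lemma on_pathE c g (h : is_path g) : on_path c g = c (path_sing h).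
rewrite /on_path; case: pselect => // h'; congr (c _).
by apply/continuousEP => p; exact: val_inj.
Qed.

Definition is_square (F : R * R -> 'rV[R]_4) : Prop := continuous F /\
 forall p, 0 <= p.1 <= 1 -> 0 <= p.2 <= 1 -> avoids a (F p).

Lemma square_path F (f : R -> R * R) : is_square F -> continuous f ->
 (forall t, 0 <= t <= 1 -> 0 <= (f t).1 <= 1 /\ 0 <= (f t).2 <= 1) -> is_path (F \o f).
move=> [cF aF] cf f01; split; first exact: ctsO cf cF.
by move=> t /f01[f1 f2]; exact: aF.
Qed.

Lemma triangle_itv (p : @std_simplex R 2) :
 0 <= scoord 1 p + scoord 2 p <= 1 /\ 0 <= scoord 2 p <= 1.
have /set_mem[p0 p1] := valP p; rewrite /scoord.
have e : val p 0 0 + val p 0 1 + val p 0 2 = 1.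
 rewrite -p1 !big_ord_recl big_ord0 addr0 addrA. by congr (_ + val p 0 _ + val p 0 _); apply: val_inj.
have := p0 0; have := p0 1; have := p0 2; move: (val p 0 0) (val p 0 1) (val p 0 2) e => x y z e z0 y0 x0.
by split; apply/andP; split; lra.
Qed.

Lemma triangle_avoids F (sF : is_square F) (p : @std_simplex R 2) :
 avoids a (F (scoord 1 p + scoord 2 p, scoord 2 p)).
by have [h1 h2] := triangle_itv p; exact: sF.2. Qed.

Definition tri_map F (sF : is_square F) (p : @std_simplex R 2) : X :=
 to_compl (triangle_avoids sF p).

Lemma tri_map_cts F (sF : is_square F) : continuous (tri_map sF).
apply: to_compl_cts => k; apply: cts_coord.
apply: (ctsO (f := fun p => (scoord 1 p + scoord 2 p, scoord 2 p))) sF.1.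
apply: cts_pair; last exact: scoord_cts.
by apply: ctsD; exact: scoord_cts.
Qed.

Definition tri_sing F (sF : is_square F) : sing R X 2 := HB.pack_for (sing R X 2) (tri_map sF)
 (isContinuous.Build _ _ (tri_map sF) (@tri_map_cts F sF)).

Lemma square_bottom F : is_square F -> is_path (fun t => F (t, 0)).
move=> sF; apply: (square_path sF (f := fun t => (t, 0))) => [|t t01]; last by rewrite lexx ler01.
by apply: cts_pair; [exact: cts_id|exact: ctsC].
Qed.

Lemma square_right F : is_square F -> is_path (fun t => F (1, t)).
move=> sF; apply: (square_path sF (f := fun t => (1, t))) => [|t t01]; last by rewrite lexx ler01.
by apply: cts_pair; [exact: ctsC|exact: cts_id].
Qed.

Lemma square_diagonal F : is_square F -> is_path (fun t => F (t, t)).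
move=> sF; apply: (square_path sF (f := fun t => (t, t))) => [|t t01]; last by [].
by apply: cts_pair; exact: cts_id.
Qed.

Lemma tri_faces F (sF : is_square F) (c : cochain R X 1) :
 [/\ c (sing_map (lift (inord 0 : 'I_3)) (tri_sing sF)) = on_path c (fun t => F (1, t)),
   c (sing_map (lift (inord 1 : 'I_3)) (tri_sing sF)) = on_path c (fun t => F (t, t)) &
   c (sing_map (lift (inord 2 : 'I_3)) (tri_sing sF)) = on_path c (fun t => F (t, 0))].
have co (i j : 'I_3) (p : @std_simplex R 1) : scoord j (simplex_map (lift i) p) =
  (if lift i ord0 == j then scoord 0 p else 0) + (if lift i 1 == j then scoord 1 p else 0).
 rewrite /scoord mxE big_mkcond /= !big_ord_recl big_ord0 addr0.
 by rewrite (_ : lift ord0 ord0 = 1) //; exact: val_inj.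
have s01 (p : @std_simplex R 1) : scoord 0 p + scoord 1 p = 1.
 have /set_mem[_ <-] := valP p; rewrite !big_ord_recl big_ord0 addr0. by congr (_ + val p 0 _); exact: val_inj.
rewrite (on_pathE c (square_bottom sF)) (on_pathE c (square_right sF)) (on_pathE c (square_diagonal sF)).
split; congr (c _); apply/continuousEP => p; apply: val_inj; congr (F _);
 rewrite !co -!val_eqE /= /bump !inordK //= ?addr0 ?add0r ?s01 //.
Qed.

Lemma triangle F (c : cochain R X 1) : coboundary c = 0 -> is_square F ->
 on_path c (fun t => F (t, 0)) + on_path c (fun t => F (1, t)) = on_path c (fun t => F (t, t)).
move=> c0 sF; have := congr1 (fun c => c (tri_sing sF)) c0.
rewrite coboundary1; have [-> -> ->] := tri_faces sF c.
move: (on_path _ _) (on_path _ _) (on_path _ _) => u v w e.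
by apply/eqP; rewrite -subr_eq0 -[X in _ == X]e; apply/eqP; ring.
Qed.

Variable c : cochain R X 1.
Hypothesis c0 : coboundary c = 0.

Lemma square F : is_square F ->
 on_path c (fun t => F (t, 0)) + on_path c (fun t => F (1, t)) =
 on_path c (fun t => F (0, t)) + on_path c (fun t => F (t, 1)).
move=> sF; rewrite (triangle c0 sF).
have sF' : is_square (fun p => F (p.2, p.1)).
 split; last by move=> p p1 p2; exact: sF.2.
 by apply: (ctsO (f := fun p : R * R => (p.2, p.1))) sF.1; apply: cts_pair;
  [exact: cts_snd|exact: cts_fst].
by rewrite -(triangle c0 sF').
Qed.

Lemma on_path_const x : on_path c (fun=> x) = 0.
have [ax|nax] := pselect (avoids a x); last first.
 rewrite /on_path; case: pselect => // h; exfalso; apply: nax. by apply: (h.2 0); rewrite lexx ler01.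
have sF : is_square (fun=> x) by split=> // p; exact: cvg_cst.
by have /(congr1 (fun u => u - on_path c (fun=> x))) := triangle c0 sF; rewrite addrK subrr.
Qed.

Lemma on_path_cut g s t : is_path g -> 0 <= s <= 1 -> 0 <= t <= 1 ->
 on_path c (fun u => g (u * s)) + on_path c (fun u => g (s + u * (t - s))) =
 on_path c (fun u => g (u * t)).
move=> pg s01 t01; pose F (p : R * R) := g (p.1 * (s + p.2 * (t - s))).
have sF : is_square F.
 split=> [|[u v] /= /andP[u0 u1] /andP[v0 v1]].
  apply: (ctsO (f := fun p : R * R => p.1 * (s + p.2 * (t - s)))) pg.1.
  by apply: ctsM; [exact: cts_fst|apply: ctsD; [exact: ctsC|apply: ctsM; [exact: cts_snd|exact: ctsC]]].
 apply: pg.2; move: s01 t01 => /andP[s0 s1] /andP[t0 t1]. have w0 : 0 <= s + v * (t - s) <= 1.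
  by apply/andP; split; nra.
 by have /andP[w0' w1] := w0; rewrite mulr_ge0 //= mulr_ile1.
have := square sF; rewrite /F /=.
under eq_fun do rewrite mul0r addr0; under [X in _ + on_path c X]eq_fun do rewrite mul1r.
under [X in _ = on_path c X + _]eq_fun do rewrite mul0r; rewrite on_path_const add0r.
rewrite (_ : (fun u => g (u * (s + 1 * (t - s)))) = fun u => g (u * t)) //.
by apply/funext => u; rewrite mul1r addrC subrK.
Qed.

Definition primitive_on (S : set 'rV[R]_4) (r : 'rV[R]_4 -> int) : Prop :=
 forall g, is_path g -> (forall t, 0 <= t <= 1 -> S (g t)) -> on_path c g = r (g 1) - r (g 0).

Definition exact_on (S : set 'rV[R]_4) : Prop := exists r, primitive_on S r.

Definition convex_region (S : set 'rV[R]_4) : Prop := forall x y t, S x -> S y -> 0 <= t <= 1 ->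
 S (x + t *: (y - x)).

Lemma convex_exact (S : set 'rV[R]_4) : convex_region S -> (forall x, S x -> avoids a x) -> exact_on S.
move=> cS aS; have [[x0 Sx0]|nS] := pselect (exists x, S x); last first.
 exists (fun=> 0) => g _ gS; case: nS; exists (g 0); apply: gS; by rewrite lexx ler01.
exists (fun x => on_path c (fun t => x0 + t *: (x - x0))) => g pg gS.
pose F (p : R * R) := x0 + p.2 *: (g p.1 - x0).
have sF : is_square F.
 split=> [|[u v] /= u01 v01]; last by apply/aS/cS => //; exact: gS.
 apply: mx_cts => i j; cts_mx.
 apply: ctsD; first exact: ctsC. apply: ctsM; first exact: cts_snd. apply: ctsB; last exact: ctsC.
 by apply: (ctsO (f := fst) (h := fun t => g t i j)); [exact: cts_fst|apply: cts_coord; exact: pg.1].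
have := square sF; rewrite /F /=; under eq_fun do rewrite scale0r addr0.
rewrite on_path_const add0r => ->; rewrite addrC.
rewrite addKr; congr on_path; apply/funext => t.
by rewrite scale1r addrC subrK.
Qed.

Lemma exact_subset (S T : set 'rV[R]_4) : S `<=` T -> exact_on T -> exact_on S.
by move=> ST [r h]; exists r => g pg gS; apply: h => // t /gS/ST. Qed.

Definition segment_in (S : set 'rV[R]_4) (x y : 'rV[R]_4) : Prop :=
 forall t, 0 <= t <= 1 -> S (x + t *: (y - x)).

Lemma segment_path x y : segment_in (avoids a) x y -> is_path (fun t => x + t *: (y - x)).
move=> h; split=> //; apply: mx_cts => i j.
by cts_mx; cts.
Qed.

Definition region_connected (S : set 'rV[R]_4) : Prop := forall x y, S x -> S y ->
 exists2 z, segment_in S x z & segment_in S z y.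

Lemma primitives_differ (S T U : set 'rV[R]_4) (r r' : 'rV[R]_4 -> int) : region_connected U ->
 U `<=` S -> U `<=` T -> U `<=` avoids a -> primitive_on S r -> primitive_on T r' ->
 forall x y, U x -> U y -> r x - r' x = r y - r' y.
move=> cU US UT Ua h h'; have seg x y : segment_in U x y -> r x - r' x = r y - r' y.
 move=> sxy; have pg := segment_path (fun t t01 => Ua _ (sxy t t01)).
 have := h _ pg (fun t t01 => US _ (sxy t t01)); rewrite (h' _ pg (fun t t01 => UT _ (sxy t t01))) /=.
 rewrite scale1r scale0r addr0 (addrC x) subrK. by move: (r x) (r y) (r' x) (r' y) => p q p' q' e; lia.
by move=> x y Ux Uy; have [z /seg -> /seg ->] := cU x y Ux Uy.
Qed.

(** Along a path, agreement of the cocycle on the initial piece with the glued primitive persists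
    for small changes of the end time, so [itv_const] applies. *)
Lemma exact_glue3 (S : 'I_3 -> set 'rV[R]_4) (r : 'I_3 -> 'rV[R]_4 -> int) :
 (forall k x, S k x -> exists2 d, 0 < d & forall y, nm (y - x) < d -> S k y) ->
 (forall k, primitive_on (S k) (r k)) ->
 (forall k l x, S k x -> S l x -> r k x = r l x) ->
 exact_on [set x | exists k, S k x].
move=> oS h hr; pose p x := if pselect (exists k, S k x) is left e then r (sval (cid e)) x else 0.
have pE k x : S k x -> p x = r k x.
 move=> Sx; rewrite /p; case: pselect => [e|]; last by case; exists k. by case: (cid e) => l Sl /=; exact: hr.
exists p => g pg gS.
pose P t := on_path c (fun u => g (u * t)) = p (g t) - p (g 0).
suff : P 1 by rewrite /P; under eq_fun do rewrite mulr1.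
apply: itv_const => [t t01|]; last first.
 by rewrite /P; under eq_fun do rewrite mulr0; rewrite on_path_const subrr.
have [k Sk] := gS t t01.
have [d d0 hd] := oS k _ Sk.
have cn : continuous (fun s => nm (g s - g t)).
 apply: cts_nm => i j; cts_mx.
 by apply: ctsB; [exact: cts_coord pg.1|exact: ctsC].
have [e e0 he'] := cts_near t cn d0; exists e => // s s01 st.
have he u : `|u - t| < e -> S k (g u).
 move=> /he'; rewrite subrr nm0 subr0 => ud; apply: hd. by apply: le_lt_trans ud; exact: ler_norm.
have between u : 0 <= u <= 1 -> S k (g (t + u * (s - t))).
 move=> /andP[u0 u1]; apply: he; rewrite addrAC subrr add0r normrM.
 by rewrite (ger0_norm u0); apply: le_lt_trans st; rewrite ler_piMl.
have cut := on_path_cut pg t01 s01.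
have ps : is_path (fun u => g (t + u * (s - t))).
 split=> [|u /andP[u0 u1]]; first by apply: ctsO pg.1; cts.
 apply: pg.2; move: s01 t01 => /andP[s0 s1] /andP[t0 t1]; apply/andP; split; nra.
have := h k _ ps between; rewrite mul1r mul0r addr0 (addrC t) subrK => e1.
have Ss : S k (g s) by have := between 1; rewrite mul1r addrC subrK; apply; rewrite ler01 lexx.
move: cut; rewrite e1 /P (pE k _ Sk) (pE k _ Ss).
by move: (on_path _ _) (on_path _ _) (r k _) (r k _) (p _) => u v w w' q <-; split; lia.
Qed.

End Paths.

(** * Generic segments, and three half-planes around a plane *)

Section Detection.
Variables (R : realType) (n : nat) (a : forms R n).
Hypotheses (n1 : (1 < n)%N) (ca : is_cfg a).

Definition nm_open (S : set 'rV[R]_4) : Prop :=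
 forall x, S x -> exists2 d, 0 < d & forall y, nm (y - x) < d -> S y.

Lemma nm_openI (S T : set 'rV[R]_4) : nm_open S -> nm_open T -> nm_open (S `&` T).
move=> oS oT x [/oS[d d0 hd] /oT[e e0 he]]; exists (Num.min d e); first by rewrite lt_min d0 e0.
by move=> y; rewrite lt_min => /andP[yd ye]; split; auto.
Qed.

Lemma nm_open_cts (f : 'rV[R]_4 -> R) : (forall x, exists2 k, 0 < k & forall y, `|f y - f x| <= k * nm (y - x)) ->
 nm_open [set x | 0 < f x].
move=> lf x /= fx; have [k k0 hk] := lf x; exists (f x / k); first exact: divr_gt0.
move=> y; rewrite ltr_pdivlMr // mulrC => h; have := le_lt_trans (hk y) h.
by rewrite ltr_distl subrr => /andP[].
Qed.

Lemma finite_min (d : 'I_n -> R) : (forall i, 0 < d i) -> exists2 e, 0 < e & forall i, e <= d i.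
move=> d0; have s0 : 0 <= \sum_i (d i)^-1 by apply: sumr_ge0 => i _; rewrite invr_ge0 ltW.
have s1 : 0 < 1 + \sum_i (d i)^-1 by rewrite ltr_pwDl.
exists (1 + \sum_i (d i)^-1)^-1; first by rewrite invr_gt0.
move=> i; rewrite -[leRHS]invrK lef_pV2 ?posrE ?invr_gt0 // (bigD1 i) //= addrCA lerDl addr_ge0 //.
by apply: sumr_ge0 => j _; rewrite invr_ge0 ltW.
Qed.

Lemma nm_open_avoids : nm_open (avoids a).
have one i : nm_open [set x | 0 < nm (x *m (a i)^T)].
 apply: nm_open_cts => x; exists (nm (a i)^T + 1); first by rewrite ltr_wpDl // nm_ge0.
 move=> y; have := nmM (y - x) (a i)^T; rewrite mulmxBl => h.
 have h1 := nmBr (y *m (a i)^T) (x *m (a i)^T); have h2 := nmBr (x *m (a i)^T) (y *m (a i)^T).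
 have h3 : nm (x *m (a i)^T - y *m (a i)^T) = nm (y *m (a i)^T - x *m (a i)^T).
  by rewrite -nmN opprB.
 have h4 := nm_ge0 (y - x); rewrite ler_norml; apply/andP; split; nra.
have pos x i : (x *m (a i)^T != 0) = (0 < nm (x *m (a i)^T)).
 by rewrite lt_def nm_ge0 andbT nm_eq0.
move=> x ax; have H i : exists d, 0 < d /\ forall y, nm (y - x) < d -> 0 < nm (y *m (a i)^T).
 by have [|d d0 hd] := one i x; [rewrite /= -pos|exists d].
pose d i := sval (cid (H i)).
have dP i : 0 < d i /\ forall y, nm (y - x) < d i -> 0 < nm (y *m (a i)^T) by rewrite /d; case: cid.
have [e e0 ed] := finite_min (fun i => (dP i).1).
by exists e => // y yd i; rewrite pos; apply: (dP i).2; apply: lt_le_trans yd _.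
Qed.

Definition rot2 (z : 'rV[R]_2) : 'rV[R]_2 := \row_j [:: - z 0 1; z 0 0]`_j.

Definition wedge (z w : 'rV[R]_2) : R := z 0 0 * w 0 1 - z 0 1 * w 0 0.

Lemma wedge_lin z (t : R) w w' : wedge z (w + t *: w') = wedge z w + t * wedge z w'.
by rewrite /wedge !mxE; ring. Qed.

Lemma wedge_rot z : wedge z (rot2 z) = z 0 0 ^+ 2 + z 0 1 ^+ 2.
by rewrite /wedge !mxE /=; ring. Qed.

Lemma row2_eq0 (z : 'rV[R]_2) : z 0 0 = 0 -> z 0 1 = 0 -> z = 0.
move=> z0 z1; apply/rowP => -[[|[|//]] i]; rewrite mxE.
 by rewrite -[RHS]z0; congr (z 0 _); exact: val_inj.
by rewrite -[RHS]z1; congr (z 0 _); exact: val_inj.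
Qed.

Lemma row2_pos (z : 'rV[R]_2) : z != 0 -> 0 < z 0 0 ^+ 2 + z 0 1 ^+ 2.
move=> z0; rewrite lt_def addr_ge0 ?sqr_ge0 // andbT paddr_eq0 ?sqr_ge0 // !sqrf_eq0.
by apply: contra z0 => /andP[/eqP h0 /eqP h1]; apply/eqP/row2_eq0.
Qed.

Lemma right_inverse i : exists V : 'M[R]_(2, 4), V *m (a i)^T = 1%:M.
by apply/row_fullP; rewrite /row_full mxrank_tr -/(row_free _) cfg_row_free. Qed.

(** If the forms of x and z are independent at every plane, the segment from x to z misses all
    planes. The conditions are met one after the other: a small step in the direction [w] repairs
    the next one and keeps the earlier ones. *)
Lemma generic_point x y d : avoids a x -> 0 < d ->
 exists2 z, nm (z - y) < d & forall i, wedge (x *m (a i)^T) (z *m (a i)^T) != 0.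
move=> ax d0; suff H k : (k <= n)%N -> exists2 z, nm (z - y) < d &
  forall i : 'I_n, (i < k)%N -> wedge (x *m (a i)^T) (z *m (a i)^T) != 0.
 by have [z zd h] := H n (leqnn n); exists z => // i; exact: h.
elim: k => [_|k IH kn]; first by exists y; rewrite ?subrr ?nm0.
have [z zd hz] := IH (ltnW kn); pose i0 := Ordinal kn; have [V VE] := right_inverse i0.
pose w := rot2 (x *m (a i0)^T) *m V.
have we : wedge (x *m (a i0)^T) (w *m (a i0)^T) != 0.
 by rewrite /w -mulmxA VE mulmx1 wedge_rot gt_eqF // row2_pos.
pose P (t : R) := \prod_(i < n | (i < k)%N) wedge (x *m (a i)^T) ((z + t *: w) *m (a i)^T).
have ew i t : wedge (x *m (a i)^T) ((z + t *: w) *m (a i)^T) =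
  wedge (x *m (a i)^T) (z *m (a i)^T) + t * wedge (x *m (a i)^T) (w *m (a i)^T).
 by rewrite mulmxDl -scalemxAl wedge_lin.
have cP : continuous P.
 apply: cts_prod => i; apply: (ctsE (fun t => ew i t)).
 by apply: ctsD; [exact: ctsC|apply: ctsM; [exact: cts_id|exact: ctsC]].
have P0 : P 0 != 0.
 by apply/prodf_neq0 => i ik; rewrite ew mul0r addr0 hz.
have P0' : 0 < `|P 0| by rewrite normr_gt0.
have [e e0 he] := cts_near 0 cP P0'.
have [z0|z0] := eqVneq (wedge (x *m (a i0)^T) (z *m (a i0)^T)) 0; last first.
 exists z => // i; rewrite ltnS leq_eqVlt => /orP[/eqP ik|]; last exact: hz.
 by rewrite (_ : i = i0) //; exact: val_inj.
pose q := (d - nm (z - y)) / (nm w + 1).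
have w1 : 0 < nm w + 1 by rewrite ltr_wpDl // nm_ge0.
have q0 : 0 < q by rewrite divr_gt0 // subr_gt0.
pose t := Num.min e q / 2; have mp : 0 < Num.min e q by rewrite lt_min e0 q0.
have t0 : 0 < t by rewrite divr_gt0.
have tm : t < Num.min e q by rewrite /t; move: (Num.min _ _) mp => u u0; lra.
have [te tq] : t < e /\ t < q by move: tm; rewrite lt_min => /andP.
exists (z + t *: w).
 rewrite addrAC; apply: le_lt_trans (nmD _ _) _; rewrite nmZ gtr0_norm // -ltrBrDl.
 apply: le_lt_trans (_ : t * (nm w + 1) < _); first by rewrite ler_pM2l // lerDl. by rewrite -ltr_pdivlMr.
move=> i; rewrite ltnS leq_eqVlt => /orP[/eqP ik|ik].
 rewrite (_ : i = i0); last exact: val_inj. by rewrite ew z0 add0r mulf_neq0 // gt_eqF.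
have Pt : P t != 0.
 have := he t; rewrite subr0 gtr0_norm // => /(_ te); apply: contraTneq => ->. by rewrite sub0r normrN ltxx.
by move: Pt; rewrite /P; move/prodf_neq0/(_ i ik).
Qed.

Lemma region_connected_convex (W : set 'rV[R]_4) : convex_region W -> nm_open W ->
 region_connected (W `&` avoids a).
move=> cW oW x y [Wx ax] Uy; have [d d0 hd] := nm_openI oW nm_open_avoids Uy.
have [z zd hz] := generic_point y ax d0; have [Wz az] := hd z zd.
exists z => t t01.
 split; first exact: cW. move=> i; apply/eqP; rewrite mulmxDl -scalemxAl mulmxBl => e.
 have w0 : t * wedge (x *m (a i)^T) (z *m (a i)^T) = 0.
  have : wedge (x *m (a i)^T) (x *m (a i)^T + t *: (z *m (a i)^T - x *m (a i)^T)) = 0.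
   by rewrite e /wedge !mxE; ring.
  by move: (x *m _) (z *m _) => p q <-; rewrite /wedge !mxE; ring.
 move/eqP: w0; rewrite mulf_eq0 (negPf (hz i)) orbF => /eqP t0.
 by move/eqP: e; rewrite t0 scale0r addr0 (negPf (ax i)).
apply: hd; have -> : z + t *: (y - z) - y = (1 - t) *: (z - y).
 by rewrite scalerBl scale1r -[X in _ - X]opprK -scalerN opprB addrAC opprK.
rewrite nmZ; apply: le_lt_trans zd; rewrite ler_piMl ?nm_ge0 // ler_norml.
by have /andP[t0 t1] := t01; apply/andP; split; lra.
Qed.

Definition circ (t : R) : 'rV[R]_2 := \row_j [:: cosT t; sinT t]`_j.

(** The angles 1/6, 1/2 and 5/6 of a turn: three half-planes that cover the punctured plane and
    whose normals add up to 0. *)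
Definition lens_angle (m : 'I_3) : R := (m.*2.+1)%:R / 6.

Definition lens (m : 'I_3) (z : 'rV[R]_2) : R :=
 z 0 0 * cosT (lens_angle m) + z 0 1 * sinT (lens_angle m).

Lemma lens_angleE : (lens_angle 0 = 6^-1) * (lens_angle 1 = 2^-1) * (lens_angle 2 = 5 / 6).
have h0 : lens_angle 0 = 1%:R / 6 by [].
have h1 : lens_angle 1 = 3%:R / 6 by [].
have h2 : lens_angle 2 = 5%:R / 6 by [].
by rewrite h0 h1 h2 div1r; split=> //; split=> //; field.
Qed.

Lemma cosT_pos (t : R) : `|t| < 4^-1 -> 0 < cosT t.
move=> t4; apply: cos_gt0_pihalf; have p0 := @pi_gt0 R; move: t4 (pi : R) p0; rewrite ltr_norml.
by move=> /andP[h1 h2] q q0; apply/andP; split; nra.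
Qed.

Lemma lens_circ m t : lens m (circ t) = cosT (t - lens_angle m).
by rewrite cosTB /lens !mxE. Qed.

Lemma lens_sum z : lens 0 z + lens 1 z + lens 2 z = 0.
have cosT_half : cosT (2^-1 : R) = -1 /\ sinT (2^-1 : R) = 0.
 have epi : 2^-1 * (pi *+ 2) = pi :> R by rewrite (mulr2n pi) (mulrDr 2^-1 pi pi) -mulrDl -div1r -splitr mul1r.
 by rewrite /cosT /sinT epi cospi sinpi.
have [ch sh] := cosT_half; pose c : R := cosT 6^-1; pose s : R := sinT 6^-1.
have cs : c ^+ 2 + s ^+ 2 = 1 by exact: cosT_sinT.
have c0 : 0 < c by apply: cosT_pos; rewrite gtr0_norm ?invr_gt0 ?ltr0n // ltf_pV2 ?posrE ?ltr0n // ltr_nat.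
have c3 : c * (c * c - s * s) - s * (s * c + c * s) = -1.
 rewrite -ch -[in RHS](_ : 6^-1 + (6^-1 + 6^-1) = 2^-1 :> R); last by field.
 by rewrite [in RHS]cosTD [cosT (_ + _)]cosTD [sinT (_ + _)]sinTD.
have c2 : c = 2^-1.
 have s2 : s ^+ 2 = 1 - c ^+ 2 by rewrite -cs addrAC subrr add0r. have : (c + 1) * (c *+ 2 - 1) ^+ 2 = 0.
  rewrite (_ : _ * _ = c * (c * c - s ^+ 2) - s ^+ 2 * (c + c) + 1); last by rewrite s2; ring.
  by rewrite -[X in _ = X](subrr (-1)) -[X in _ = X - _]c3; ring.
 move/eqP; rewrite mulf_eq0 expf_eq0 /= gt_eqF ?addr_gt0 //= subr_eq0 => /eqP h.
 by apply: (mulIf (x := 2)); rewrite ?pnatr_eq0 // mulVf ?pnatr_eq0 // mulr_natr h.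
have e2 : 5 / 6 = 1 - 6^-1 :> R by field.
have o1 : (1 : R) \is a Num.int by exact: rpred1.
have [i1 i2] := cosT_int o1.
rewrite /lens !lens_angleE e2 cosTB sinTB i1 i2 ch sh -/c -/s c2.
set x := z 0 0; set y := z 0 1; lra.
Qed.

Lemma lens_cover z : z != 0 -> exists m, 0 < lens m z.
move=> z0; have [r r0 [x y]] := argP (row2_pos z0).
set t := arg _ _ in x y; pose u := t - (Num.floor t)%:~R.
have zE : z = r *: circ u.
 have fi : - (Num.floor t)%:~R \is a @Num.int R by rewrite rpredN intr_int. have [c s] := cosTDint t fi.
 apply/rowP => -[[|[|//]] i]; rewrite !mxE /= /u ?c ?s -?x -?y; congr (z 0 _); exact: val_inj.
have /andP[u0 u1] : 0 <= u < 1.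
 have /andP[h1 h2] := floor_itv t; rewrite /u subr_ge0 h1 /= ltrBlDl. by move: h2; rewrite intrD addrC.
have L m : lens m z = r * cosT (u - lens_angle m).
 by rewrite -lens_circ zE /lens !mxE; ring.
have [h|h] := ltP u 3^-1.
 exists 0; rewrite L mulr_gt0 //; apply: cosT_pos. by rewrite lens_angleE ltr_norml; apply/andP; split; lra.
have [h'|h'] := ltP u (2 / 3).
 exists 1; rewrite L mulr_gt0 //; apply: cosT_pos. by rewrite lens_angleE ltr_norml; apply/andP; split; lra.
exists 2; rewrite L mulr_gt0 //; apply: cosT_pos.
by rewrite lens_angleE ltr_norml; apply/andP; split; lra.
Qed.

(** One point in each overlap of two half-planes forces the triangle to contain the origin; the
    coefficients are the 2 by 2 minors of the first two lens values. *)
Lemma surround (z0 z1 z2 : 'rV[R]_2) : 0 < lens 0 z0 -> 0 < lens 1 z0 -> 0 < lens 1 z1 -> 0 < lens 2 z1 ->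
 0 < lens 2 z2 -> 0 < lens 0 z2 -> exists l0 l1 l2, [/\ 0 < l0, 0 < l1, 0 < l2, l0 + l1 + l2 = 1 &
 l0 *: z0 + l1 *: z1 + l2 *: z2 = 0].
pose L m z := lens m z; move=> a0 a1 b1 b2 c2 c0.
have sa := lens_sum z0; have sb := lens_sum z1; have sc := lens_sum z2.
pose p := lens 0 z1 * lens 1 z2 - lens 1 z1 * lens 0 z2.
pose q := lens 0 z2 * lens 1 z0 - lens 1 z2 * lens 0 z0.
pose s := lens 0 z0 * lens 1 z1 - lens 1 z0 * lens 0 z1.
have p0 : 0 < p by rewrite /p; nra.
have q0 : 0 < q by rewrite /q; nra.
have s0 : 0 < s by rewrite /s; nra.
have d0 : 0 < p + q + s by lra.
pose d := p + q + s.
exists (p / d), (q / d), (s / d); split; rewrite ?divr_gt0 //.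
 by rewrite -!mulrDl divff // gt_eqF.
set w := _ + _; have lw m : lens m w = p / d * lens m z0 + q / d * lens m z1 + s / d * lens m z2.
 by rewrite /lens /w !mxE; ring.
have w0 : lens 0 w = 0.
 by rewrite lw -!mulrA !(mulrC d^-1) !mulrA -!mulrDl (_ : _ + _ = 0) ?mul0r // /p /q /s; ring.
have w1 : lens 1 w = 0.
 by rewrite lw -!mulrA !(mulrC d^-1) !mulrA -!mulrDl (_ : _ + _ = 0) ?mul0r // /p /q /s; ring.
have w2 : lens 2 w = 0 by have := lens_sum w; rewrite w0 w1 !add0r.
apply/eqP; apply: contraT => /lens_cover[[[|[|[|//]]] i]].
- by rewrite (_ : Ordinal i = 0) ?w0 ?ltxx //; exact: val_inj.
- by rewrite (_ : Ordinal i = 1) ?w1 ?ltxx //; exact: val_inj.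
- by rewrite (_ : Ordinal i = 2) ?w2 ?ltxx //; exact: val_inj.
Qed.

End Detection.

(** * A cocycle that vanishes on meridians is a coboundary *)

Section Meridians.
Variables (R : realType) (n : nat) (a : forms R n).
Hypotheses (n1 : (1 < n)%N) (ca : is_cfg a).

Lemma nm_circ (t : R) : 1 <= nm (circ t) <= 2.
have e : nm (circ t) = `|cosT t| + `|sinT t|.
 by rewrite /nm !big_ord_recl !big_ord0 !addr0 !mxE.
have c1 : `|cosT t| <= 1 by exact: cos_max.
have s1 : `|sinT t| <= 1 by exact: sin_max.
have := cosT_sinT t; rewrite e -(real_normK (num_real (cosT t))) -(real_normK (num_real (sinT t))).
have := normr_ge0 (cosT t); have := normr_ge0 (sinT t).
by move: `|cosT t| `|sinT t| c1 s1 => u v u1 v1 v0 u0 h; apply/andP; split; nra.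
Qed.

Definition tube (H V : 'M[R]_(2, 4)) (u w : 'rV[R]_2) : 'rV[R]_4 := u *m H + w *m V.

(* H spans the k-th plane, V is transverse to it, and tubes of radius less
  than kap times the distance to the origin avoid all the planes. *)
Definition frame (k : 'I_n) (H V : 'M[R]_(2, 4)) (kap : R) : Prop :=
 [/\ H *m (a k)^T = 0, row_free H, V *m (a k)^T = 1%:M, 0 < kap &
  forall r p e t, 0 < e -> e < kap * r -> avoids a (tube H V (r *: circ p) (e *: circ t))].

Lemma plane_unit k H i : H *m (a k)^T = 0 -> row_free H -> i != k -> H *m (a i)^T \in unitmx.
move=> Hk fH ik; rewrite -row_free_unit; apply: inj_row_free => u u0.
apply: (row_free_inj fH); rewrite mul0mx; apply: (cross_neq0P _ _ (ca ik)).
 by rewrite -mulmxA.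
by rewrite -mulmxA Hk mulmx0.
Qed.

Lemma frame_exists k : exists H V kap, frame k H V kap.
have [H fH Hk] := exists_orth (cfg_row_free k n1 ca); have [V Vk] := right_inverse n1 ca k.
pose B i := nm (V *m (a i)^T *m invmx (H *m (a i)^T)).
have d0 (i : 'I_n) : 0 < (2 * B i + 1)^-1 by rewrite invr_gt0 ltr_wpDl // mulr_ge0 // nm_ge0.
have [kap kap0 hk] := finite_min d0; exists H, V, kap; split=> // r p e t e0 er i.
rewrite /tube mulmxDl -!mulmxA; have [->|ik] := eqVneq i k.
 rewrite Hk Vk mulmx0 add0r mulmx1 scaler_eq0 gt_eqF //= -nm_eq0 gt_eqF //.
 by have /andP[h _] := nm_circ t; exact: lt_le_trans h.
have Mu := plane_unit Hk fH ik.
apply/eqP => /eqP; rewrite addr_eq0 => /eqP /(congr1 (fun z => nm (z *m invmx (H *m (a i)^T)))).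
rewrite mulmxK // mulNmx nmN nmZ -mulmxA.
have r0 : 0 < r by rewrite -(pmulr_rgt0 _ kap0); exact: lt_trans er.
rewrite gtr0_norm // => E; have /andP[p1 _] := nm_circ p.
have h1 : r <= r * nm (circ p) by rewrite ler_peMr // ltW.
have h2 := nmM (e *: circ t) (V *m (a i)^T *m invmx (H *m (a i)^T)).
rewrite nmZ gtr0_norm // -/(B i) in h2; have /andP[_ t2] := nm_circ t.
have B0 : 0 <= B i by exact: nm_ge0.
have h3 : e * nm (circ t) * B i <= e * 2 * B i by rewrite ler_wpM2r // ler_pM2l.
have h4 : e * (2 * B i + 1) < r.
 rewrite -ltr_pdivlMr ?ltr_wpDl ?mulr_ge0 //; apply: lt_le_trans er _. by rewrite mulrC ler_pM2l // hk.
have h5 : r <= e * 2 * B i by apply: le_trans h1 _; rewrite E; exact: le_trans h2 h3.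
by move: h4; rewrite (_ : e * _ = e * 2 * B i + e); [lra|ring].
Qed.

Section Frame.
Variables (k : 'I_n) (H V : 'M[R]_(2, 4)) (kap : R).
Hypothesis fr : frame k H V kap.

Definition mer r p e (t : R) : 'rV[R]_4 := tube H V (r *: circ p) (e *: circ t).

Lemma circ_cts (T : topologicalType) (f : T -> R) j : continuous f ->
 continuous (fun x => circ (f x) 0 j).
move=> cf; have cg : continuous (fun x => f x * (pi *+ 2)) by apply: ctsM => //; exact: ctsC.
case: j => [[|[|//]] i]; apply: (ctsE (fun x => _)); try by move=> x; rewrite mxE /=; reflexivity.
 exact: ctsO cg (@continuous_cos R).
exact: ctsO cg (@continuous_sin R).
Qed.

Lemma tube_cts (T : topologicalType) (r p e t : T -> R) : continuous r -> continuous p ->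
 continuous e -> continuous t -> continuous (fun x => tube H V (r x *: circ (p x)) (e x *: circ (t x))).
move=> cr cp ce ct; apply: mx_cts => i j.
apply: (ctsE (g := fun x => (r x *: circ (p x) *m H) i j + (e x *: circ (t x) *m V) i j)) => [x|].
 by rewrite /tube mxE.
have cz (f g : T -> R) (M : 'M[R]_(2, 4)) : continuous f -> continuous g ->
  continuous (fun x => (f x *: circ (g x) *m M) i j).
 move=> cf cg; apply: cts_mulmx => [k' l|k' l]; last exact: ctsC.
 apply: (ctsE (g := fun x => f x * circ (g x) 0 l)) => [x|]; first by rewrite mxE ord1.
 by apply: ctsM => //; exact: circ_cts.
by apply: ctsD; exact: cz.
Qed.

Lemma tube_k u w : tube H V u w *m (a k)^T = w.
by case: fr => Hk _ Vk _ _; rewrite /tube mulmxDl -!mulmxA Hk Vk mulmx0 add0r mulmx1.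
Qed.

Lemma mer_path r p e : 0 < e -> e < kap * r -> is_path a (mer r p e).
move=> e0 er; split; last by move=> t _; case: fr => _ _ _ _; apply.
by apply: tube_cts; try exact: ctsC; exact: cts_id.
Qed.

Lemma circ1 : circ 1 = circ 0 :> 'rV[R]_2.
have o1 : (1 : R) \is a Num.int by exact: rpred1.
have o0 : (0 : R) \is a Num.int by exact: rpred0.
have [c1 s1] := cosT_int o1; have [c0 s0] := cosT_int o0.
by rewrite /circ c1 s1 c0 s0.
Qed.

(** Radius, position and width are interpolated linearly; the condition e < kap r is convex, so the
    two meridians bound a square of closed loops. *)
Lemma mer_indep (c : cochain R (complement (loci a)) 1) r p e r' p' e' : coboundary c = 0 ->
 0 < e -> e < kap * r -> 0 < e' -> e' < kap * r' -> on_path c (mer r p e) = on_path c (mer r' p' e').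
move=> c0 e0 er e0' er'.
pose F (q : R * R) := tube H V ((r + q.2 * (r' - r)) *: circ (p + q.2 * (p' - p)))
 ((e + q.2 * (e' - e)) *: circ q.1).
have aff (x y : R) : continuous (fun q : R * R => x + q.2 * (y - x)).
 by apply: ctsD; [exact: ctsC|apply: ctsM; [exact: cts_snd|exact: ctsC]].
have sF : is_square a F.
 split=> [|q _ /andP[q0 q1]]; first by apply: tube_cts => //; exact: cts_fst. case: fr => _ _ _ k0; apply; first nra.
 move: q.2 q0 q1 => v v0 v1; rewrite -subr_gt0.
 rewrite (_ : _ - _ = (1 - v) * (kap * r - e) + v * (kap * r' - e')); last by ring.
 have [->|vn] := eqVneq v 0; first by rewrite mul0r addr0 subr0 mul1r subr_gt0.
 apply: ltr_wpDl; first by apply: mulr_ge0; rewrite subr_ge0 // ltW.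
 by apply: mulr_gt0; rewrite ?subr_gt0 // lt_def vn.
have := square c0 sF; rewrite /F /= circ1 addrC => /addrI.
have E x y : (fun t : R => x + 0 * (y - x)) = fun=> x :> R by apply/funext => t; rewrite mul0r addr0.
rewrite !mul0r !addr0 !mul1r !(addrC _ (_ - _)) !subrK; exact.
Qed.

End Frame.

Lemma lens_lipschitz l (M : 'M[R]_(4, 2)) (x : 'rV[R]_4) : exists2 q, 0 < q &
 forall y, `|lens l (y *m M) - lens l (x *m M)| <= q * nm (y - x).
exists (nm M + 1); first by rewrite ltr_wpDl // nm_ge0.
move=> y; have -> : lens l (y *m M) - lens l (x *m M) = lens l ((y - x) *m M).
 rewrite mulmxBl; move: (y *m M) (x *m M) => p q; by rewrite /lens !mxE; ring.
apply: (@le_trans _ _ (nm ((y - x) *m M))).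
 rewrite /nm !big_ord_recl !big_ord0 !addr0; apply: le_trans (ler_normD _ _) _.
 rewrite (_ : lift ord0 ord0 = 1); last exact: val_inj.
 by rewrite !normrM; apply: lerD; rewrite ler_piMr ?cos_max ?sin_max.
apply: le_trans (nmM _ _) _; rewrite mulrC ler_wpM2r ?nm_ge0 // lerDl.
by [].
Qed.

Definition lens_region (k : 'I_n) l : set 'rV[R]_4 := [set x | 0 < lens l (x *m (a k)^T)].

Lemma lens_region_open k l : nm_open (lens_region k l).
by apply: nm_open_cts => x; exact: lens_lipschitz. Qed.

Lemma convex_regionI (S T : set 'rV[R]_4) : convex_region S -> convex_region T -> convex_region (S `&` T).
by move=> cS cT x y t [Sx Tx] [Sy Ty] t01; split; [exact: cS|exact: cT]. Qed.

Lemma lens_region_convex k l : convex_region (lens_region k l).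
move=> x y t /= hx hy /andP[t0 t1]; rewrite /lens_region /=.
have -> : lens l ((x + t *: (y - x)) *m (a k)^T) =
  (1 - t) * lens l (x *m (a k)^T) + t * lens l (y *m (a k)^T).
 rewrite mulmxDl -scalemxAl mulmxBl; move: (x *m _) (y *m _) => p q; by rewrite /lens !mxE; ring.
have [->|tn] := eqVneq t 0; first by rewrite mul0r addr0 subr0 mul1r.
by rewrite ltr_wpDl ?mulr_ge0 ?subr_ge0 // ?ltW // mulr_gt0 // lt_def tn.
Qed.

Section Vanishing.
Variable c : cochain R (complement (loci a)) 1.
Hypothesis c0 : coboundary c = 0.
Hypothesis mer0 : forall k, exists H V kap, frame k H V kap /\
 forall r p e, 0 < e -> e < kap * r -> on_path c (mer H V r p e) = 0.

Section Step.
Variables (W : set 'rV[R]_4) (k : 'I_n).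
Hypotheses (cW : convex_region W) (oW : nm_open W).

Let S l := (W `&` lens_region k l) `&` avoids a.

Variable r : 'I_3 -> 'rV[R]_4 -> int.
Hypothesis rP : forall l, primitive_on c (S l) (r l).

Lemma S_overlap l l' x y : S l x -> S l' x -> S l y -> S l' y -> r l x - r l' x = r l y - r l' y.
move=> Sx Sx' Sy Sy'; pose U := (W `&` lens_region k l `&` lens_region k l') `&` avoids a.
apply: (primitives_differ (S := S l) (T := S l') (U := U) (r := r l) (r' := r l')); try exact: rP.
- apply: region_connected_convex => //.
  by do 2 (apply: convex_regionI; last exact: lens_region_convex).
 by do 2 (apply: nm_openI; last exact: lens_region_open).
- by move=> z [[[Wz h] h'] az]; split.
- by move=> z [[[Wz h] h'] az]; split.
- by move=> z [_ az].
- by case: Sx => [[Wx hx] ax]; case: Sx' => [[_ hx'] _].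
- by case: Sy => [[Wx hx] ax]; case: Sy' => [[_ hx'] _].
Qed.

Lemma plane_meets_region x0 x1 x2 : S 0 x0 -> S 1 x0 -> S 1 x1 -> S 2 x1 -> S 2 x2 -> S 0 x2 ->
 exists2 h, W h & h *m (a k)^T = 0.
move=> [[W0 a0] _] [[_ a1] _] [[W1 b1] _] [[_ b2] _] [[W2 d2] _] [[_ d0] _].
have [l0 [l1 [l2 [p0 p1 p2 s e]]]] := surround a0 a1 b1 b2 d2 d0.
exists (l0 *: x0 + l1 *: x1 + l2 *: x2); last by rewrite !mulmxDl -!scalemxAl.
have s01 : 0 < l0 + l1 by exact: addr_gt0.
pose y := x0 + (l1 / (l0 + l1)) *: (x1 - x0).
have Wy : W y by apply: cW => //; apply/andP; split; [rewrite divr_ge0 // ltW|rewrite ler_pdivrMr // mul1r lerDr ltW].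
have -> : l0 *: x0 + l1 *: x1 + l2 *: x2 = y + l2 *: (x2 - y).
 have l2E : l2 = 1 - (l0 + l1) by rewrite -s addrAC subrr add0r.
 have q : (l0 + l1) * (l1 / (l0 + l1)) = l1 by rewrite mulrC divfK // gt_eqF.
 rewrite scalerBr addrCA addrC; congr (_ + _); rewrite -[X in _ = X - _]scale1r -scalerBl.
 rewrite l2E opprB addrCA subrr addr0 /y scalerDr scalerA q scalerBr addrCA addrC. by rewrite -scalerBl addrK.
by apply: cW => //; rewrite ltW //=; move: s p0 p1 => s p0 p1; lra.
Qed.

(** The obstruction to gluing three primitives. If all overlaps are inhabited, the plane k meets
    [W]; the differences can then be computed along a small meridian in [W], which passes through
    the three regions in turn and has value 0. *)
Lemma overlap_cycle x0 x1 x2 : S 0 x0 -> S 1 x0 -> S 1 x1 -> S 2 x1 -> S 2 x2 -> S 0 x2 ->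
 r 0 x0 - r 1 x0 + (r 1 x1 - r 2 x1) + (r 2 x2 - r 0 x2) = 0.
move=> s00 s10 s11 s21 s22 s02; have [h Wh hk] := plane_meets_region s00 s10 s11 s21 s22 s02.
have [H [V [kap [fr mc]]]] := mer0 k; have [Hk fH Vk kap0 av] := fr.
have [d d0 hd] := oW Wh.
(* A meridian needs a nonzero point of the plane; should the point found be 0, a small one in the
   open set [W] replaces it. *)
have [q [p [q0 Wq]]] : exists q p, 0 < q /\ W (q *: circ p *m H).
 have [h0|h0] := eqVneq h 0.
  pose q := d / (2 * nm H + 1); have B0 : 0 < 2 * nm H + 1 by rewrite ltr_wpDl // mulr_ge0 // nm_ge0.
  have q0 : 0 < q by exact: divr_gt0.
  exists q, 0; split=> //; apply: hd; rewrite h0 subr0; apply: le_lt_trans (nmM _ _) _.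
  rewrite nmZ gtr0_norm // -[ltRHS](divfK (lt0r_neq0 B0)) -/q -mulrA ltr_pM2l //.
  have /andP[_ n2] := @nm_circ 0; apply: le_lt_trans (_ : 2 * nm H < _); last by rewrite ltrDl.
  by rewrite ler_wpM2r // nm_ge0.
 have : h \in row_span H.
  by rewrite (row_span_locus (cfg_row_free k n1 ca) fH Hk) mem_zero_locus hk.
 move/mem_row_span => [u uE]; have u0 : u != 0 by apply: contra h0 => /eqP u0; rewrite uE u0 mul0mx.
 have [q q0 [ux uy]] := argP (row2_pos u0); exists q, (arg (u 0 0) (u 0 1)); split=> //.
 suff -> : q *: circ (arg (u 0 0) (u 0 1)) = u by rewrite -uE.
 apply/rowP => -[[|[|//]] i]; rewrite !mxE /= -?ux -?uy; congr (u 0 _); exact: val_inj.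
have [d' d0' hd'] := oW Wq.
pose B := 2 * nm V + 1; have B0 : 0 < B by rewrite ltr_wpDl // mulr_ge0 // nm_ge0.
pose e := Num.min (kap * q) (d' / B) / 2.
have m0 : 0 < Num.min (kap * q) (d' / B) by rewrite lt_min mulr_gt0 // divr_gt0.
have e0 : 0 < e by rewrite divr_gt0.
have em : e < Num.min (kap * q) (d' / B) by rewrite /e; move: (Num.min _ _) m0 => u u0; lra.
have [eq ed] : e < kap * q /\ e < d' / B by move: em; rewrite lt_min => /andP.
pose g := mer H V q p e; have pg : is_path a g := mer_path fr p e0 eq.
have gW t : W (g t).
 apply: hd'; rewrite /g /mer /tube addrAC subrr add0r; apply: le_lt_trans (nmM _ _) _.
 rewrite nmZ gtr0_norm //; move: ed; rewrite ltr_pdivlMr // => ed; apply: le_lt_trans ed.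
 rewrite -mulrA ler_pM2l //; have /andP[_ n2] := nm_circ t. apply: (@le_trans _ _ (2 * nm V)); last by rewrite lerDl.
 by rewrite ler_wpM2r // nm_ge0.
have gS l t : `|t - lens_angle R l| < 4^-1 -> S l (g t).
 move=> tl; split; last by apply: av. split=> //; rewrite /lens_region /= (tube_k fr) /lens !mxE /=.
 rewrite (_ : _ + _ = e * cosT (t - lens_angle R l)); last by rewrite cosTB; ring. by rewrite mulr_gt0 // cosT_pos.
(* On each third of the turn the angle stays within 1/6 of [lens_angle l], so that this arc lies in
   the region l. *)
have arc l s t : 0 <= s -> s <= t -> t <= 1 -> lens_angle R l - 6^-1 <= s -> t <= lens_angle R l + 6^-1 ->
  on_path c (fun u => g (s + u * (t - s))) = r l (g t) - r l (g s).
 move=> s0 st t1 ls tl; have in01 u : 0 <= u <= 1 -> s <= s + u * (t - s) <= t.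
  by move=> /andP[u0 u1]; apply/andP; split; nra.
 rewrite (rP (l := l)) /=; first by rewrite mul1r mul0r addr0 (addrC s) subrK.
  split=> [|u u01]; last by apply: pg.2; have /andP[h1 h2] := in01 u u01; apply/andP; split; lra.
  by apply: ctsO pg.1; cts.
 move=> u u01; apply: gS; have /andP[h1 h2] := in01 u u01; rewrite ltr_norml; apply/andP; split; lra.
have a0 : on_path c (fun u => g (u * 3^-1)) = r 0 (g 3^-1) - r 0 (g 0).
 have := arc 0 0 3^-1; rewrite subr0; under eq_fun do rewrite add0r. by rewrite !lens_angleE; apply; lra.
have a1 : on_path c (fun u => g (3^-1 + u * (2 / 3 - 3^-1))) = r 1 (g (2 / 3)) - r 1 (g 3^-1).
 by apply: arc; rewrite ?lens_angleE; lra.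
have a2 : on_path c (fun u => g (2 / 3 + u * (1 - 2 / 3))) = r 2 (g 1) - r 2 (g (2 / 3)).
 by apply: arc; rewrite ?lens_angleE; lra.
have i3 : 0 <= (3^-1 : R) <= 1 by apply/andP; split; lra.
have i23 : 0 <= (2 / 3 : R) <= 1 by apply/andP; split; lra.
have i1 : 0 <= (1 : R) <= 1 by apply/andP; split; lra.
have cut1 := on_path_cut c0 pg i3 i23; have cut2 := on_path_cut c0 pg i23 i1.
have e1 : on_path c (fun u => g (u * 1)) = 0 by under eq_fun do rewrite mulr1; exact: mc.
have g1 : g 1 = g 0 by rewrite /g /mer circ1.
rewrite -cut1 a0 a1 a2 e1 g1 in cut2.
have S01 : S 0 (g 3^-1) /\ S 1 (g 3^-1).
 by split; apply: gS; rewrite lens_angleE ltr_norml; apply/andP; split; lra.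
have S12 : S 1 (g (2 / 3)) /\ S 2 (g (2 / 3)).
 by split; apply: gS; rewrite lens_angleE ltr_norml; apply/andP; split; lra.
have S20 : S 2 (g 0) /\ S 0 (g 0).
 split; last by apply: gS; rewrite lens_angleE ltr_norml; apply/andP; split; lra.
 by rewrite -g1; apply: gS; rewrite lens_angleE ltr_norml; apply/andP; split; lra.
rewrite (S_overlap s00 s10 S01.1 S01.2) (S_overlap s11 s21 S12.1 S12.2) (S_overlap s22 s02 S20.1 S20.2).
by rewrite -cut2; ring.
Qed.

Lemma exact_step : exact_on c (W `&` avoids a).
have D l l' : exists z : int, forall x, S l x -> S l' x -> r l x - r l' x = z.
 have [[x [Sx Sx']]|no] := pselect (exists x, S l x /\ S l' x).
  by exists (r l x - r l' x) => y Sy Sy'; exact: S_overlap.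
 by exists 0 => x Sx Sx'; case: no; exists x.
(* If an overlap is empty its constant is free and is chosen to close the cycle; otherwise
   [overlap_cycle] closes it. *)
have [z [z0 z1 z2]] : exists z : int * int, [/\ forall x, S 0 x -> S 1 x -> r 0 x - r 1 x = z.1,
  forall x, S 1 x -> S 2 x -> r 1 x - r 2 x = z.2 &
  forall x, S 2 x -> S 0 x -> r 2 x - r 0 x = - (z.1 + z.2)].
 have [y0 h0] := D 0 1; have [y1 h1] := D 1 2; have [y2 h2] := D 2 0.
 have [[x0 [s00 s10]]|no0] := pselect (exists x, S 0 x /\ S 1 x); last first.
  exists (- (y1 + y2), y1); split=> //= x Sx Sx'; first by case: no0; exists x. by rewrite h2 //; ring.
 have [[x1 [s11 s21]]|no1] := pselect (exists x, S 1 x /\ S 2 x); last first.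
  exists (y0, - (y0 + y2)); split=> //= x Sx Sx'; first by case: no1; exists x. by rewrite h2 //; ring.
 have [[x2 [s22 s02]]|no2] := pselect (exists x, S 2 x /\ S 0 x); last first.
  by exists (y0, y1); split=> //= x Sx Sx'; case: no2; exists x.
 exists (y0, y1); split=> //= x Sx Sx'.
 have := overlap_cycle s00 s10 s11 s21 s22 s02; rewrite h0 // h1 // !h2 // => e.
 by apply/eqP; rewrite -addr_eq0 addrC e.
pose d (l : 'I_3) : int := if l == 0 then 0 else if l == 1 then z.1 else z.1 + z.2.
have cases (l : 'I_3) : [\/ l = 0, l = 1 | l = 2].
 by case: l => [[|[|[|//]]] i]; [constructor 1|constructor 2|constructor 3]; exact: val_inj.
have gl : exact_on c [set x | exists l, S l x].
 apply: (exact_glue3 c0 (S := S) (r := fun l x => r l x + d l)).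
 - move=> l; apply: nm_openI; last exact: nm_open_avoids.
  by apply: nm_openI => //; exact: lens_region_open.
 - by move=> l g pg gS; rewrite (rP pg gS); ring.
 - have H l l' x : S l x -> S l' x -> (l < l')%N -> r l x + d l = r l' x + d l'.
   move=> Sl Sl'; case: (cases l) (cases l') Sl Sl' => -> [] -> // Sl Sl' _.
   + by have := z0 x Sl Sl'; rewrite /d /= => <-; ring.
   + by have := z2 x Sl' Sl; rewrite /d /= => e; move: e; lia.
   + by have := z1 x Sl Sl'; rewrite /d /= => e; move: e; lia.
  move=> l l' x Sl Sl'; have [lt|lt|/val_inj -> //] := ltngtP l l'; first exact: H. by apply/esym/H.
apply: exact_subset gl => x [Wx ax].
by have [l hl] := lens_cover (ax k); exists l.
Qed.

End Step.

(** Induction on the number of planes that may still meet the convex set [W]: each of the three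
    pieces cut out by [lens_region] misses the plane k, and [exact_step] glues them. *)
Lemma vanishing_exact : exact_on c (avoids a).
suff H m : (m <= n)%N -> forall W, convex_region W -> nm_open W ->
  (forall i : 'I_n, (m <= i)%N -> forall x, W x -> x *m (a i)^T != 0) -> exact_on c (W `&` avoids a).
 have := H n (leqnn n) setT; rewrite setTI; apply=> //; first by move=> x _; exists 1.
 by move=> i; rewrite leqNgt ltn_ord.
elim: m => [_|m IH mn] W cW oW hW.
 apply: convex_exact => //; last by move=> x [].
 move=> x y t [Wx _] [Wy _] t01; have Wz := cW x y t Wx Wy t01; split=> // i. exact: hW.
pose k := Ordinal mn.
have E l : exact_on c ((W `&` lens_region k l) `&` avoids a).
 apply: IH; first exact: ltnW.
 - by apply: convex_regionI => //; exact: lens_region_convex.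
 - by apply: nm_openI => //; exact: lens_region_open.
 - move=> i; rewrite leq_eqVlt => /orP[/eqP mi|mi] x [Wx lx]; last exact: hW.
  rewrite (_ : i = k); last exact: val_inj.
  by apply: contraTneq lx => x0; rewrite /lens_region /= x0 /lens !mxE !mul0r addr0 ltxx.
pose r l := sval (cid (E l)).
have rP l : primitive_on c ((W `&` lens_region k l) `&` avoids a) (r l) by rewrite /r; case: cid.
exact: exact_step rP.
Qed.

End Vanishing.

End Meridians.

(** * Winding numbers on meridians and longitudes *)

Section Loops.
Variables (R : realType) (n : nat) (a : forms R n).
Hypotheses (n1 : (1 < n)%N) (ca : is_cfg a).
Let X := complement (loci a).

Definition form (i : 'I_n) (x : X) : 'rV[R]_2 := val x *m (a i)^T.

Definition form_arg (i : 'I_n) (x : X) : R := arg (form i x 0 0) (form i x 0 1).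

Lemma form_cts i j : continuous (fun x => form i x 0 j).
rewrite /form; apply: (ctsE (g := fun x : X => \sum_k (val x : 'rV[R]_4) 0 k * (a i)^T k j)) => [x|].
 by rewrite mxE.
by apply: cts_sum => k; apply: ctsM; [exact: val_cts|exact: ctsC].
Qed.

Lemma form_pos i x : 0 < form i x 0 0 ^+ 2 + form i x 0 1 ^+ 2.
by apply: row2_pos; exact: avoids_val. Qed.

Lemma cmod_form_arg i : cmod (form_arg i).
by apply: cmod_arg; [exact: form_cts|exact: form_cts|exact: form_pos]. Qed.

Lemma polar_row (z : 'rV[R]_2) : exists r p, 0 <= r /\ z = r *: circ p.
have [->|z0] := eqVneq z 0; first by exists 0, 0; rewrite scale0r lexx.
have [r r0 [x y]] := argP (row2_pos z0); exists r, (arg (z 0 0) (z 0 1)); split; first exact: ltW.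
by apply/rowP => -[[|[|//]] i]; rewrite !mxE /= -?x -?y; congr (z 0 _); exact: val_inj.
Qed.

Definition dot (z w : 'rV[R]_2) : R := z 0 0 * w 0 0 + z 0 1 * w 0 1.

Lemma dotDl z z' w : dot (z + z') w = dot z w + dot z' w.
by rewrite /dot !mxE; ring. Qed.

Lemma dotZl r z w : dot (r *: z) w = r * dot z w.
by rewrite /dot !mxE; ring. Qed.

Lemma dot_circ s t : dot (circ s) (circ t) = cosT (s - t).
by rewrite cosTB /dot !mxE. Qed.

Lemma dot_nm z t : - nm z <= dot z (circ t).
have -> : nm z = `|z 0 0| + `|z 0 1|.
 by rewrite /nm !big_ord_recl !big_ord0 !addr0 (_ : lift ord0 ord0 = 1) //; exact: val_inj.
rewrite /dot !mxE /= -lerN2 opprK; apply: le_trans (ler_norm _) _; rewrite normrN.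
apply: le_trans (ler_normD _ _) _; rewrite !normrM; apply: lerD; rewrite ler_piMr //.
 exact: cos_max.
exact: sin_max.
Qed.

(** The degree is read off from a comparison angle [tau] that stays within a quarter turn of the
    argument of the form. *)
Lemma on_path_loop i g (tau : R -> R) : is_path a g -> g 1 = g 0 -> (forall t, avoids a (g t)) ->
 continuous tau -> tau 1 - tau 0 \is a Num.int -> (forall t, 0 < dot (g t *m (a i)^T) (circ (tau t))) ->
 (on_path (winding (form_arg i)) g)%:~R = tau 1 - tau 0.
move=> pg g10 ag ct ti hd; rewrite (on_pathE _ pg).
pose B (x : 'rV[R]_4) := arg ((x *m (a i)^T) 0 0) ((x *m (a i)^T) 0 1).
pose k t := B (g t) - tau t.
have cB : cmod (fun t => B (g t)).
 have cc j : continuous (fun t => (g t *m (a i)^T) 0 j).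
  apply: (ctsE (g := fun t => \sum_k g t 0 k * (a i)^T k j)) => [t|]; first by rewrite mxE.
  by apply: cts_sum => l; apply: ctsM; [exact: cts_coord pg.1|exact: ctsC].
 by apply: cmod_arg => // t; apply: row2_pos; exact: ag.
have ck : cmod k by apply: cmodD => //; exact: cmodN (cmod_cts ct).
have nk t : exists2 m, m \is a Num.int & `|k t - m| < 4^-1.
 have [m mi hm] := arg_near (hd t). have ci : arg (circ (tau t) 0 0) (circ (tau t) 0 1) - tau t \is a Num.int.
  by apply: (@arg_int _ _ _ 1); rewrite // mul1r mxE.
 exists (m + (arg (circ (tau t) 0 0) (circ (tau t) 0 1) - tau t)); first exact: rpredD.
 by rewrite /k /B; apply: le_lt_trans hm; rewrite le_eqVlt; apply/orP; left; apply/eqP;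
  congr (`|_|); ring.
have cr : continuous (fun t => k t - rnd (k t)).
 by apply: cmod_near => // t; have [m mi hm] := nk t; exists m => //; apply: lt_trans hm _; lra.
have g01 t : 0 <= t <= 1 -> val (path_sing pg (edge t)) = g t.
 by move=> t01; rewrite /= /scoord /= mxE /= clamp_id.
have i0 : 0 <= (0 : R) <= 1 by rewrite lexx ler01.
have i1 : 0 <= (1 : R) <= 1 by rewrite lexx ler01.
have lw : is_lift (fun t => form_arg i (path_sing pg (edge t))) (fun t => tau t + (k t - rnd (k t))).
 split; first exact: ctsD. move=> t t01; rewrite /form_arg /form g01 // -/(B (g t)) /k.
 rewrite (_ : _ - _ = - rnd (B (g t) - tau t)) ?rpredN ?rnd_int //; ring.
rewrite /winding; apply: int_eq => //.
rewrite (windE lw) /form_arg /form !g01 // g10 subrr subr0.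
have b0 : `|k 0 - rnd (k 0)| < 4^-1 by have [m mi hm] := nk 0; rewrite (rnd_eq mi) //; apply: lt_trans hm _; lra.
have b1 : `|k 1 - rnd (k 1)| < 4^-1 by have [m mi hm] := nk 1; rewrite (rnd_eq mi) //; apply: lt_trans hm _; lra.
move: (k 0 - _) (k 1 - _) b0 b1 => u v; rewrite !ltr_norml => /andP[h1 h2] /andP[h3 h4].
by apply/andP; split; lra.
Qed.

Variables (k : 'I_n) (H V : 'M[R]_(2, 4)) (kap : R).
Hypothesis fr : frame a k H V kap.

Definition longi e (s : R) : 'rV[R]_4 := tube H V (circ s) (e *: circ 0).

Lemma longi_path e : 0 < e -> e < kap -> is_path a (longi e).
move=> e0 ek; split.
 have := @tube_cts R H V R (fun=> 1) id (fun=> e) (fun=> 0).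
 rewrite (_ : (fun x : R => tube H V (1 *: _) _) = longi e); last first.
  by apply/funext => x; rewrite scale1r.
 by apply; try exact: ctsC; exact: cts_id.
move=> t _; case: fr => _ _ _ _ av; rewrite /longi -[circ t]scale1r; apply: av => //.
by rewrite mulr1.
Qed.

Lemma meridian_self e : 0 < e -> e < kap -> on_path (winding (form_arg k)) (mer H V 1 0 e) = 1.
move=> e0 ek; have ek1 : e < kap * 1 by rewrite mulr1.
apply: (@intr_inj R); rewrite (on_path_loop (tau := id)) ?subr0 //.
- exact: (mer_path fr 0 e0 ek1).
- by rewrite /mer circ1.
- by move=> t; case: fr => _ _ _ _; apply.
- exact: cts_id.
- by move=> t; rewrite /mer (tube_k fr) dotZl dot_circ subrr /cosT mul0r cos0 mulr1.
Qed.

Lemma longi_self e : 0 < e -> e < kap -> on_path (winding (form_arg k)) (longi e) = 0.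
move=> e0 ek; apply: (@intr_inj R); rewrite (on_path_loop (tau := fun=> 0)) ?subr0 //.
- exact: longi_path.
- by rewrite /longi circ1.
- move=> t; case: fr => _ _ _ _ av; rewrite /longi -[circ t]scale1r; apply: av => //.
 by rewrite mulr1.
- exact: ctsC.
- by move=> t; rewrite /longi (tube_k fr) dotZl dot_circ subrr /cosT mul0r cos0 mulr1.
Qed.

(** The complex linear part turns with s and the antilinear part against it. The sign of the
    determinant P^2 - Q^2 tells which part dominates, hence the degree of the image of the
    circle. *)
Lemma complex_split (M : 'M[R]_2) : exists P Q al be, [/\ 0 <= P, 0 <= Q, P ^+ 2 - Q ^+ 2 = \det M &
 forall s, circ s *m M = P *: circ (s + al) + Q *: circ (be - s)].
have [P [al [P0 PE]]] := polar_row (\row_j [:: (M 0 0 + M 1 1) / 2; (M 0 1 - M 1 0) / 2]`_j).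
have [Q [be [Q0 QE]]] := polar_row (\row_j [:: (M 0 0 - M 1 1) / 2; (M 0 1 + M 1 0) / 2]`_j).
have := congr1 (fun z : 'rV[R]_2 => z 0 0) PE; have := congr1 (fun z : 'rV[R]_2 => z 0 1) PE.
have := congr1 (fun z : 'rV[R]_2 => z 0 0) QE; have := congr1 (fun z : 'rV[R]_2 => z 0 1) QE.
rewrite !mxE /= => q1 q0 p1 p0; exists P, Q, al, be; split=> //.
 rewrite det2E -[P ^+ 2]mulr1 -[Q ^+ 2]mulr1 -{1}(cosT_sinT al) -(cosT_sinT be) !mulrDr -!exprMn.
 by rewrite -p0 -p1 -q0 -q1; field.
have m00 : M 0 0 = P * cosT al + Q * cosT be by rewrite -p0 -q0; field.
have m11 : M 1 1 = P * cosT al - Q * cosT be by rewrite -p0 -q0; field.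
have m01 : M 0 1 = P * sinT al + Q * sinT be by rewrite -p1 -q1; field.
have m10 : M 1 0 = Q * sinT be - P * sinT al by rewrite -p1 -q1; field.
move=> s; apply/rowP => j; rewrite !mxE big_ord_recl big_ord1 !mxE.
have -> : lift ord0 ord0 = 1 :> 'I_2 by exact: val_inj.
case: j => [[|[|//]] i] /=.
 rewrite (_ : Ordinal i = 0); last exact: val_inj. by rewrite m00 m10 cosTD cosTB; ring.
rewrite (_ : Ordinal i = 1); last exact: val_inj.
by rewrite m01 m11 sinTD sinTB; ring.
Qed.

Lemma small_shift (e : R) t (N : 'M[R]_2) p : 0 < e -> - (e * (2 * nm N)) <= dot (e *: (circ t *m N)) (circ p).
move=> e0; apply: le_trans (dot_nm _ _); rewrite lerN2 nmZ gtr0_norm // ler_pM2l //.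
apply: le_trans (nmM _ _) _; rewrite ler_wpM2r ?nm_ge0 //.
by have /andP[] := @nm_circ R t.
Qed.

Lemma tube_other i u e t : tube H V u (e *: circ t) *m (a i)^T =
 u *m (H *m (a i)^T) + e *: (circ t *m (V *m (a i)^T)).
by rewrite /tube mulmxDl -!mulmxA -scalemxAl. Qed.

Lemma meridian_other i : i != k -> exists2 m, 0 < m & forall e, 0 < e -> e < kap -> e < m ->
 on_path (winding (form_arg i)) (mer H V 1 0 e) = 0.
move=> ik; have [Hk fH _ _ av] := fr; have Mu := plane_unit ca Hk fH ik.
have [r [p [r0 pE]]] := polar_row (circ 0 *m (H *m (a i)^T)).
pose N := V *m (a i)^T; have B0 : 0 < 2 * nm N + 1 by rewrite ltr_wpDl // mulr_ge0 // nm_ge0.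
have rp : 0 < r.
 rewrite lt_def r0 andbT; apply: contraTneq (isT) => rz; move: pE; rewrite rz scale0r.
 move/(congr1 (mulmx^~ (invmx (H *m (a i)^T)))); rewrite mulmxK // mul0mx => /(congr1 (fun z : 'rV[R]_2 => z 0 0)).
 by rewrite !mxE /= /cosT mul0r cos0 => /eqP; rewrite oner_eq0.
exists (r / (2 * nm N + 1)); first exact: divr_gt0.
move=> e e0 ek; rewrite ltr_pdivlMr // => em; have ek1 : e < kap * 1 by rewrite mulr1.
apply: (@intr_inj R); rewrite (on_path_loop (tau := fun=> p)) ?subrr //.
- exact: (mer_path fr 0 e0 ek1).
- by rewrite /mer circ1.
- by move=> t; apply: av.
- exact: ctsC.
move=> t; rewrite /mer tube_other scale1r pE dotDl !dotZl dot_circ subrr /cosT mul0r cos0 mulr1.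
have := small_shift t N p e0; rewrite -/N dotZl; move: em; rewrite mulrDr mulr1.
by move: (e * _) (dot _ _) => u v; lra.
Qed.

Lemma longi_other i : i != k -> exists2 m, 0 < m & forall e, 0 < e -> e < kap -> e < m ->
 (on_path (winding (form_arg i)) (longi e))%:~R = Num.sg (\det (H *m (a i)^T)).
move=> ik; have [Hk fH _ _ av] := fr; have Mu := plane_unit ca Hk fH ik.
have d0 : \det (H *m (a i)^T) != 0 by rewrite -unitfE -unitmxE.
have [P [Q [al [be [P0 Q0 PQ MS]]]]] := complex_split (H *m (a i)^T).
pose N := V *m (a i)^T; have B0 : 0 < 2 * nm N + 1 by rewrite ltr_wpDl // mulr_ge0 // nm_ge0.
have nPQ : 0 < `|P - Q|.
 rewrite normr_gt0 subr_eq0; apply: contra d0 => /eqP PQe; by rewrite -PQ PQe subrr.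
exists (`|P - Q| / (2 * nm N + 1)); first exact: divr_gt0.
move=> e e0 ek; rewrite ltr_pdivlMr // mulrDr mulr1 => em.
have avl t : avoids a (longi e t).
 by rewrite /longi -[circ t]scale1r; apply: av => //; rewrite mulr1.
have cb (u : R) : `|cosT u| <= 1 by exact: cos_max.
have [dp|dn|de] := ltgtP 0 (\det (H *m (a i)^T)); last by rewrite -de eqxx in d0.
 have QP : Q < P by rewrite -ltr_sqr ?nnegrE // -subr_gt0 PQ.
 rewrite gtr0_sg // (on_path_loop (tau := fun t => t + al)); first ring.
 - exact: longi_path.
 - by rewrite /longi circ1.
 - exact: avl.
 - by cts.
 - by rewrite (_ : _ - _ = 1) ?rpred1 //; ring.
 move=> t; rewrite /longi tube_other MS !dotDl !dotZl !dot_circ subrr {1}/cosT mul0r cos0 mulr1.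
 have := small_shift 0 N (t + al) e0; rewrite -/N dotZl.
 move: em (cb (be - t - (t + al))); rewrite gtr0_norm ?subr_gt0 // ler_norml.
 move: (cosT _) (e * (2 * _)) (e * dot _ _) => c u v em /andP[c1 c2] h.
 have : - Q <= Q * c by rewrite -[X in - X]mulr1 -mulrN ler_wpM2l. by lra.
have PQ' : P < Q by rewrite -ltr_sqr ?nnegrE // -subr_lt0 PQ.
rewrite ltr0_sg // (on_path_loop (tau := fun t => be - t)); first ring.
- exact: longi_path.
- by rewrite /longi circ1.
- exact: avl.
- by cts.
- by rewrite (_ : _ - _ = -1) ?rpredN ?rpred1 //; ring.
move=> t; rewrite /longi tube_other MS !dotDl !dotZl !dot_circ subrr {2}/cosT mul0r cos0 mulr1.
have := small_shift 0 N (be - t) e0; rewrite -/N dotZl.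
move: em (cb (t + al - (be - t))); rewrite ltr0_norm ?subr_lt0 // opprB ler_norml.
move: (cosT _) (e * (2 * _)) (e * dot _ _) => c u v em /andP[c1 c2] h.
have : - P <= P * c by rewrite -[X in - X]mulr1 -mulrN ler_wpM2l.
by lra.
Qed.

(** The signs seen along the longitude agree with those of [cross] up to one factor that depends on
    the frame and not on [i]. *)
Lemma frame_sign i : \det (H *m (a i)^T) = \det (col_mx H V : 'M[R]_4) * cross (a k) (a i).
have [Hk fH Vk _ _] := fr; rewrite /cross -[in RHS](det_tr (col_mx (a k) (a i))).
rewrite -(@det_mulmx _ 4) (@tr_col_mx _ 2 2 4).
have -> : (col_mx H V : 'M[R]_4) *m (@row_mx R 4 2 2 (a k)^T (a i)^T) =
  @block_mx R 2 2 2 2 0 (H *m (a i)^T) 1%:M (V *m (a i)^T).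
 by apply: etrans (@mul_col_row _ 2 2 4 2 2 _ _ _ _) _; rewrite Hk Vk.
move: (H *m _) (V *m _) => M N.
have sw : \det (@block_mx R 2 2 2 2 0 1%:M 1%:M 0) = 1.
 by have := @cross_inf_form R 1%:M 0; rewrite det1.
have -> : @block_mx R 2 2 2 2 0 M 1%:M N =
  @block_mx R 2 2 2 2 M 0 N 1%:M *m @block_mx R 2 2 2 2 0 1%:M 1%:M 0.
 by rewrite (@mulmx_block _ 2 2 2 2 2 2) !mulmx0 !mulmx1 !addr0 !add0r.
by rewrite det_mulmx sw mulr1 (@det_lblock _ 2 2) det1 mulr1.
Qed.

End Loops.

Lemma loops_exist (R : realType) n (a : forms R n) k : (1 < n)%N -> is_cfg a ->
 exists H V kap e (s : R), [/\ frame a k H V kap, 0 < e /\ e < kap, s != 0,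
  forall i, on_path (winding (@form_arg R n a i)) (mer H V 1 0 e) = (i == k)%:Z &
  forall i, (on_path (winding (@form_arg R n a i)) (longi H V e))%:~R =
   if i == k then 0 else Num.sg s * Num.sg (cross (a k) (a i))].
move=> n1 ca; have [H [V [kap fr]]] := frame_exists n1 ca k; have [_ _ _ kap0 _] := fr.
have M i : exists m, 0 < m /\ (i != k -> forall e, 0 < e -> e < kap -> e < m ->
  on_path (winding (@form_arg R n a i)) (mer H V 1 0 e) = 0 /\
  (on_path (winding (@form_arg R n a i)) (longi H V e))%:~R = Num.sg (\det (H *m (a i)^T))).
 have [_|ik] := eqVneq i k; first by exists 1.
 have [m m0 hm] := meridian_other ca fr ik; have [l l0 hl] := longi_other ca fr ik.
 exists (Num.min m l); rewrite lt_min m0 l0; split=> // _ e e0 ek; rewrite lt_min => /andP[em el]. by split; auto.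
have m0 i : 0 < sval (cid (M i)) by case: cid => m [].
have [q q0 hq] := finite_min m0; pose e := Num.min q kap / 2.
have mq : 0 < Num.min q kap by rewrite lt_min q0 kap0.
have e0 : 0 < e by rewrite divr_gt0.
have [eq ek] : e < q /\ e < kap.
 by apply/andP; rewrite -lt_min /e; move: (Num.min _ _) mq => u u0; lra.
have E i : i != k -> on_path (winding (@form_arg R n a i)) (mer H V 1 0 e) = 0 /\
  (on_path (winding (@form_arg R n a i)) (longi H V e))%:~R = Num.sg (\det (H *m (a i)^T)).
 move=> ik; have em : e < sval (cid (M i)) by apply: lt_le_trans (hq i).
 by case: (cid (M i)) em => m [_ hm] /= em; exact: hm.
exists H, V, kap, e, (\det (col_mx H V : 'M[R]_4)); split=> //.
- have [j jk] : exists j, j != k.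
  case: n n1 a k {ca fr M m0 hq E} => [|[|n]] // _ _ k.
  by exists (if k == ord0 then lift ord0 ord0 else ord0); case: ifP => [/eqP ->|/negbT k0];
   rewrite eq_sym // neq_lift.
 have [Hk fH _ _ _] := fr; have := plane_unit ca Hk fH jk; rewrite unitmxE unitfE (frame_sign fr).
 by rewrite mulf_eq0 negb_or => /andP[].
- move=> i; have [->|ik] := eqVneq i k; first exact: (meridian_self fr e0 ek).
 by have [] := E i ik.
- move=> i; have [->|ik] := eqVneq i k; first by rewrite (longi_self fr e0 ek).
 by have [_ ->] := E i ik; rewrite (frame_sign fr) sgrM.
Qed.

(** * The first cohomology group and its products on tori *)

Section First.
Variables (R : realType) (n : nat) (a : forms R n).
Hypotheses (n1 : (1 < n)%N) (ca : is_cfg a).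
Let X := complement (loci a).

Definition link (k i : 'I_n) : int := if i == k then 0 else sgz (cross (a k) (a i)).

Lemma cup_triangle F (sF : is_square a F) (b c : cochain R X 1) :
 @cup_cochain R X 1 1 2 b c (tri_sing sF) =
 on_path b (fun t => F (t, 0)) * on_path c (fun t => F (1, t)).
have [_ _ b2] := tri_faces sF b; have [c0 _ _] := tri_faces sF c.
rewrite -b2 -c0 /cup_cochain; congr (b _ * c _); apply: eq_sing_map => -[[|[|//]] i]; apply: val_inj;
 by rewrite /= /bump !inordK.
Qed.

Lemma coboundary_triangle F (sF : is_square a F) (d : cochain R X 1) :
 coboundary d (tri_sing sF) = on_path d (fun t => F (1, t)) - on_path d (fun t => F (t, t)) +
  on_path d (fun t => F (t, 0)).
by rewrite coboundary1; have [-> -> ->] := tri_faces sF d. Qed.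

(** What is kept of a meridian [M] and a longitude [L]. The last clause evaluates a product on the
    torus that they span, modulo 3. *)
Definition loop_pair (k : 'I_n) (M L : R -> 'rV[R]_4) (s : int) : Prop :=
 [/\ is_path a M /\ M 1 = M 0, s = 1 \/ s = -1,
  forall i, on_path (winding (@form_arg R n a i)) M = (i == k)%:Z /\
   on_path (winding (@form_arg R n a i)) L = s * link k i,
  forall c : cochain R X 1, coboundary c = 0 -> on_path c M = 0 -> exists H V kap, frame a k H V kap /\
   forall r p e, 0 < e -> e < kap * r -> on_path c (mer H V r p e) = 0 &
  forall (b c d : cochain R X 1) (z : cochain R X 2),
   (forall s, @cup_cochain R X 1 1 2 b c s = z s * 3 + coboundary d s) ->
   exists m, on_path b L * on_path c M - on_path b M * on_path c L = m * 3].

Lemma loop_pair_exists k : exists M L s, loop_pair k M L s.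
have [H [V [kap [e [s [fr [e0 ek] s0 hM hL]]]]]] := loops_exist k n1 ca.
have ek1 : e < kap * 1 by rewrite mulr1.
exists (mer H V 1 0 e), (longi H V e), (sgz s); split.
- by split; [exact: (mer_path fr 0 e0 ek1)|rewrite /mer circ1].
- by move: s0; rewrite -sgz_eq0; case: sgzP => // _ _; [left|right].
- move=> i; split; first exact: hM.
 apply: (@intr_inj R); rewrite hL /link rmorphM /=; case: eqP => _; first by rewrite mulr0. by rewrite !sgrEz.
- move=> c c0 cM; exists H, V, kap; split=> // r p e' e0' er.
 by rewrite (mer_indep fr p 0 c0 e0' er e0 ek1).
move=> b c d z E; pose F (p : R * R) := tube H V (circ p.1) (e *: circ p.2).
have [_ _ _ _ av] := fr.
have sF : is_square a F.
 split=> [|p _ _]; last by rewrite /F -[circ p.1]scale1r; apply: av.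
 have := @tube_cts R H V (R * R)%type (fun=> 1) fst (fun=> e) snd.
 rewrite (_ : (fun x => tube H V (1 *: _) _) = F); last by apply/funext => x; rewrite scale1r.
 by apply; try exact: ctsC; [exact: cts_fst|exact: cts_snd].
(* [F] and its transpose are the two triangles of the torus. The coboundary of [d] takes the same
   value on both, so it disappears in the difference. *)
pose F' (p : R * R) := F (p.2, p.1).
have sF' : is_square a F'.
 split; last by move=> p p1 p2; exact: sF.2. apply: (ctsO (f := fun p : R * R => (p.2, p.1))) sF.1.
 by apply: cts_pair; [exact: cts_snd|exact: cts_fst].
have FM : (fun t => F (1, t)) = mer H V 1 0 e by apply/funext => t; rewrite /F /mer /= circ1 scale1r.
have FM' : (fun t => F' (t, 0)) = mer H V 1 0 e by apply/funext => t; rewrite /F' /F /mer /= scale1r.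
have FL : (fun t => F (t, 0)) = longi H V e by [].
have FL' : (fun t => F' (1, t)) = longi H V e by apply/funext => t; rewrite /F' /F /longi /= circ1.
have := E (tri_sing sF); have := E (tri_sing sF').
rewrite !cup_triangle !coboundary_triangle FM FM' FL FL' (_ : (fun t => F' (t, t)) = fun t => F (t, t)) //.
move=> e2 e1; exists (z (tri_sing sF) - z (tri_sing sF')); rewrite e1 e2; ring.
Qed.

Lemma loop_coboundary (g : R -> 'rV[R]_4) (p : cochain R X 0) : is_path a g -> g 1 = g 0 ->
 on_path (coboundary p) g = 0.
move=> pg g10; rewrite (on_pathE _ pg) /coboundary !big_ord_recl big_ord0 /= expr0 expr1 mul1r mulN1r addr0.
apply/eqP; rewrite subr_eq0; apply/eqP; congr (p _); apply/continuousEP => q; apply: val_inj => /=.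
have q1 : val q 0 ord0 = 1 by have /set_mem[_ <-] := valP q; rewrite big_ord_recl big_ord0 addr0.
have -> : scoord 1 (simplex_map (lift ord0 : 'I_1 -> 'I_2) q) = 1.
 by rewrite /scoord mxE (big_pred1 ord0) // => i; rewrite !ord1.
have -> : scoord 1 (simplex_map (lift (lift ord0 ord0) : 'I_1 -> 'I_2) q) = 0.
 by rewrite /scoord mxE big_pred0 // => i; rewrite !ord1.
exact: g10.
Qed.

Definition form_cocycle i : cocycle R X 1 := circle_cocycle (@cmod_form_arg R n a i).

Definition comb (x : 'I_n -> int) : cocycle R X 1 := \sum_i form_cocycle i *~ x i.

Lemma cocycle_mulz (c : cocycle R X 1) (m : int) s : val (c *~ m) s = val c s * m.
have H (k : nat) : val (c *+ k) s = val c s *+ k.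
 elim: k => [|k IH]; first by rewrite !mulr0n. by rewrite !mulrS -IH.
case: m => k; first by rewrite -[c *~ _]/(c *+ k) H -mulr_natr natz.
by rewrite NegzE mulrNz mulrN -[LHS]/(- (val (c *~ k.+1) s)) -[c *~ _]/(c *+ k.+1) H -mulr_natr natz.
Qed.

Lemma combE x s : val (comb x) s = \sum_i winding (@form_arg R n a i) s * x i.
rewrite /comb; elim/big_rec2: _ => [|i u v _ <-]; first by [].
by rewrite -[LHS]/(val (form_cocycle i *~ x i) s + val v s) cocycle_mulz.
Qed.

Lemma comb_path x g : is_path a g ->
 on_path (val (comb x)) g = \sum_i on_path (winding (@form_arg R n a i)) g * x i.
move=> pg; rewrite (on_pathE _ pg) combE; apply: eq_bigr => i _; by rewrite (on_pathE _ pg).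
Qed.

Definition E1 (x : 'I_n -> int) : cohomology R X 1 := coh1 R X (comb x).

Lemma E1D x y : E1 (fun i => x i + y i) = E1 x + E1 y.
rewrite /E1 -pi_cocycleD; congr (\pi_(_)%qT _); rewrite /comb -big_split /=.
by apply: eq_bigr => i _; rewrite mulrzDr.
Qed.

Lemma exact_coboundary (c : cochain R X 1) : exact_on c (avoids a) -> in_coboundary c.
move=> [r rP]; exists (fun v : sing R X 0 => r (val (v (simplex_map (fun=> ord0) (@edge R 0))))).
apply/funext => s; rewrite (coboundary0 (fun x : X => r (val x))).
pose g t := val (s (edge t)) : 'rV[R]_4.
have pg : is_path a g.
 split; last by move=> t _; exact: avoids_val.
 apply: (ctsO (f := fun t => s (edge t)) (h := fun x : X => val x : 'rV[R]_4)); last exact: initial_continuous.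
 by apply: ctsO (@edge_cts R) _; exact: cts_fun.
rewrite -[RHS](rP g pg (fun t t01 => pg.2 t t01)) (on_pathE _ pg); congr (c _).
apply/continuousEP => p; apply: val_inj; rewrite /= /g; congr (val (s _)).
apply: val_inj; apply/rowP => j; rewrite /= mxE clamp_id; last exact: scoord_itv.
have /set_mem[_ s1] := valP p; move: s1; rewrite !big_ord_recl big_ord0 addr0 /scoord.
rewrite (_ : lift ord0 ord0 = 1); last exact: val_inj.
case: j => [[|[|//]] i] /=.
 by rewrite (_ : Ordinal i = ord0) => [<-|]; [rewrite addrK|exact: val_inj].
by move=> _; congr (val p 0 _); exact: val_inj.
Qed.

Lemma comb_loops k x M L s : loop_pair k M L s -> on_path (val (comb x)) M = x k.
move=> [[pM M1] _ hE _ _]; rewrite comb_path // (bigD1 k) //= big1 => [|i ik].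
 by have [-> _] := hE k; rewrite eqxx mul1r addr0.
by have [-> _] := hE i; rewrite (negPf ik) mul0r.
Qed.

Lemma E1_inj x y : E1 x = E1 y -> forall i, x i = y i.
move=> /pi_cohomologyP[p E] k; have [M [L [s lp]]] := loop_pair_exists k.
have [[pM M1] _ _ _ _] := lp; apply/eqP; rewrite -subr_eq0 -(comb_loops x lp) -(comb_loops y lp).
have := loop_coboundary p pM M1; rewrite -E !(on_pathE _ pM) => <-.
by [].
Qed.

(** Subtracting the combination whose coefficients are the values on the meridians leaves a cocycle
    that vanishes on every meridian. *)
Lemma E1_surj h : exists x, h = E1 x.
elim/quotW: h => c.
pose ml k := cid (loop_pair_exists k); pose M k := sval (ml k).
have lp k : exists L s, loop_pair k (M k) L s by rewrite /M; exact: (svalP (ml k)).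
exists (fun k => on_path (val c) (M k)); set x := fun k => _.
apply/pi_cohomologyP; apply: exact_coboundary; apply: (vanishing_exact n1 ca).
 have /is_cocycleP c0 := valP c; have /is_cocycleP x0 := valP (comb x). by rewrite coboundaryB c0 x0 subr0.
move=> k; have [L [s lpk]] := lp k; have [[pM _] _ _ vz _] := lpk; apply: vz.
 have /is_cocycleP c0 := valP c; have /is_cocycleP x0 := valP (comb x). by rewrite coboundaryB c0 x0 subr0.
have := comb_loops x lpk; rewrite {2}/x !(on_pathE _ pM) => e.
by rewrite -[LHS]/(val c (path_sing pM) - val (comb x) (path_sing pM)) e subrr.
Qed.

(** For each plane, the value of the product on its torus modulo 3: the coefficients are the values
    on the meridian, and the sums those on the longitude up to sign. *)
Definition rel3 (x y : 'I_n -> int) : Prop := forall k, exists m : int,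
 x k * (\sum_i link k i * y i) - y k * (\sum_i link k i * x i) = m * 3.

Lemma cup_rel3 x y : (exists z, cup (E1 x) (E1 y) = z *+ 3) -> rel3 x y.
move=> [z]; elim/quotW: z => z; rewrite cup_pi => E k.
have e3 : (\pi_(cohomology R X 2)%qT z) *+ 3 = \pi_(cohomology R X 2)%qT (z + z + z).
 by rewrite !pi_cocycleD !mulrS mulr0n addr0 addrA.
move: E; rewrite e3 => /pi_cohomologyP[d E].
have [M [L [s lp]]] := loop_pair_exists k; have [[pM _] s1 hE _ torus] := lp.
have {}E u : @cup_cochain R X 1 1 2 (val (comb x)) (val (comb y)) u = val z u * 3 + coboundary d u.
 rewrite -E; have -> : val z u * 3 = val (z + z + z) u.
  by rewrite -[RHS]/(val z u + val z u + val z u); ring.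
 by rewrite -[X in _ = _ + X]/(_ - val (z + z + z) u) addrC subrK.
have [m] := torus _ _ _ _ E; rewrite !(comb_loops _ lp) => em.
have pL : on_path (val (comb x)) L = s * \sum_i link k i * x i /\
  on_path (val (comb y)) L = s * \sum_i link k i * y i.
 have [hL|nL] := pselect (is_path a L).
  by rewrite !comb_path // !mulr_sumr; split; apply: eq_bigr => i _; have [_ ->] := hE i; ring.
 have o (c : cochain R X 1) : on_path c L = 0 by rewrite /on_path; case: pselect => // /nL.
 have l0 i : s * link k i = 0 by have [_ <-] := hE i; exact: o.
 by rewrite !o !mulr_sumr !big1 // => i _; rewrite mulrA l0 mul0r.
move: em; rewrite pL.1 pL.2; move: (\sum_i _) (\sum_i _) => q p em.
exists (- s * m); have ss : s * s = 1 by case: s1 => ->.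
have : s * (s * p * y k - x k * (s * q)) = s * (m * 3) by rewrite em.
rewrite (_ : s * _ = (s * s) * (p * y k - x k * q)); last by ring.
by rewrite ss mul1r => e; rewrite (_ : x k * q - y k * p = - (p * y k - x k * q)); [rewrite e; ring|ring].
Qed.

Lemma ccls_cts b : continuous b -> ccls (R := R) (X := X) b = 0.
move=> cb; rewrite (cclsE (cmod_cts cb)); apply: pi_cocycle0.
have -> : \val (circle_cocycle (cmod_cts cb)) = 0 by exact: winding_cts.
exact: in_coboundary0.
Qed.

Lemma ccls_dot (F : X -> 'rV[R]_2) (tau : X -> R) : cmod (fun x => arg (F x 0 0) (F x 0 1)) ->
 cmod tau -> (forall x, 0 < dot (F x) (circ (tau x))) ->
 ccls (fun x => arg (F x 0 0) (F x 0 1)) = ccls tau.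
move=> cF ct h; apply: ccls_near => // x; have [m mi hm] := arg_near (h x).
have ci : arg (circ (tau x) 0 0) (circ (tau x) 0 1) - tau x \is a Num.int.
 by apply: (@arg_int _ _ _ 1); rewrite // mul1r mxE.
exists (m + (arg (circ (tau x) 0 0) (circ (tau x) 0 1) - tau x)); first exact: rpredD.
apply: (@lt_trans _ _ 4^-1); last by lra.
by apply: le_lt_trans hm; rewrite le_eqVlt; apply/orP; left; apply/eqP; congr (`|_|); ring.
Qed.

Definition e1 i : cohomology R X 1 := ccls (@form_arg R n a i).

Lemma form_polar i x : exists2 r, 0 < r & @form R n a i x = r *: circ (@form_arg R n a i x).
have [r r0 [h0 h1]] := argP (form_pos i x); exists r => //.
apply/rowP => j; rewrite [RHS]mxE; have [->|->] : j = 0 \/ j = 1.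
- by case: j => [[|[|//]] jj]; [left|right]; exact: val_inj.
- by rewrite [circ _ 0 0]mxE /= -h0.
- by rewrite [circ _ 0 1]mxE /= -h1.
Qed.

Lemma form_mul_cts i (M : 'M[R]_2) j : continuous (fun x => (@form R n a i x *m M) 0 j).
apply: (ctsE (g := fun x => \sum_k @form R n a i x 0 k * M k j)) => [x|]; first by rewrite mxE.
by apply: cts_sum => k; apply: ctsM; [exact: form_cts|exact: ctsC].
Qed.

Lemma form_mul_pos i (M : 'M[R]_2) x : \det M != 0 ->
 0 < (@form R n a i x *m M) 0 0 ^+ 2 + (@form R n a i x *m M) 0 1 ^+ 2.
move=> dM; apply: row2_pos; have Mu : M \in unitmx by rewrite unitmxE unitfE.
apply: contraTneq (form_pos i x) => e0; have : @form R n a i x = 0.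
 by rewrite -[LHS](mulmxK Mu) e0 mul0mx.
by move=> ->; rewrite !mxE expr0n addr0 ltxx.
Qed.

(** By [complex_split] the argument of the image follows, within a quarter turn, a constant plus or
    minus the argument of the form. *)
Lemma ccls_linear i (M : 'M[R]_2) : \det M != 0 ->
 ccls (fun x => arg ((@form R n a i x *m M) 0 0) ((@form R n a i x *m M) 0 1)) = e1 i *~ sgz (\det M).
move=> dM; have cM : cmod (fun x => arg ((@form R n a i x *m M) 0 0) ((@form R n a i x *m M) 0 1)).
 apply: cmod_arg; [exact: form_mul_cts|exact: form_mul_cts|]. by move=> x; exact: form_mul_pos.
have ct := @cmod_form_arg R n a i.
have [P [Q [al [be [P0 Q0 PQ MS]]]]] := complex_split M.
have cb (u : R) : `|cosT u| <= 1 by exact: cos_max.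
have E (x : X) t : exists2 r, 0 < r & dot (@form R n a i x *m M) (circ t) =
  r * (P * cosT (@form_arg R n a i x + al - t) + Q * cosT (be - @form_arg R n a i x - t)).
 have [r r0 ->] := form_polar i x; exists r => //. by rewrite -scalemxAl MS dotZl dotDl !dotZl !dot_circ.
have cc (u : R) : cmod (fun _ : X => u) by apply: cmod_cts; exact: ctsC.
have [dp|dn|de] := ltgtP 0 (\det M); last by rewrite -de eqxx in dM.
 have QP : Q < P by rewrite -ltr_sqr ?nnegrE // -subr_gt0 PQ.
 rewrite gtr0_sgz // mulr1z (ccls_dot (tau := fun x => @form_arg R n a i x + al)) //.
 - apply: etrans (cclsD ct (cc al)) _.
  exact: etrans (congr1 (+%R (e1 i)) (ccls_cts (@ctsC _ _ al))) (addr0 _).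
 - exact: cmodD.
 move=> x; have [r r0 ->] := E x (@form_arg R n a i x + al); rewrite subrr {1}/cosT mul0r cos0 mulr1 mulr_gt0 //.
 have := cb (be - @form_arg R n a i x - (@form_arg R n a i x + al)); rewrite ler_norml; move: (cosT _) => c /andP[c1 c2].
 have : - Q <= Q * c by rewrite -[X in - X]mulr1 -mulrN ler_wpM2l. by lra.
have PQ' : P < Q by rewrite -ltr_sqr ?nnegrE // -subr_lt0 PQ.
rewrite ltr0_sgz // (ccls_dot (tau := fun x => be - @form_arg R n a i x)) //.
- rewrite mulrN1z; apply: etrans (cclsB (cc be) ct) _.
 exact: etrans (congr1 (fun w => w - e1 i) (ccls_cts (@ctsC _ _ be))) (sub0r _).
- exact: cmodD (cmodN ct).
move=> x; have [r r0 ->] := E x (be - @form_arg R n a i x); rewrite subrr {2}/cosT mul0r cos0 mulr1 mulr_gt0 //.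
have := cb (@form_arg R n a i x + al - (be - @form_arg R n a i x)); rewrite ler_norml; move: (cosT _) => c /andP[c1 c2].
have : - P <= P * c by rewrite -[X in - X]mulr1 -mulrN ler_wpM2l.
by lra.
Qed.

Lemma link_sym i j : link i j = link j i.
by rewrite /link eq_sym cross_sym. Qed.

Lemma link_sq i j : i != j -> link i j * link i j = 1.
by move=> ij; rewrite /link eq_sym (negPf ij); have := ca ij; rewrite -sgz_eq0; case: sgzP.
Qed.

(** Coordinates of the form o in the basis given by i and j; the signs of the blocks come from
    Cramer's rule for [cross]. *)
Lemma three_forms o i j : o != i -> o != j -> i != j -> exists P Q : 'M[R]_2,
 [/\ (a i)^T *m P + (a j)^T *m Q = (a o)^T, sgz (\det P) = link o j * link i j &
  sgz (\det Q) = link o i * link i j].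
move=> oi oj ij; have cu : (col_mx (a i) (a j) : 'M[R]_4) \in unitmx by rewrite unitmxE unitfE; exact: ca.
pose W : 'M[R]_(2, 4) := a o *m invmx (col_mx (a i) (a j) : 'M[R]_4).
pose P := @lsubmx R 2 2 2 W; pose Q := @rsubmx R 2 2 2 W.
have oE : a o = P *m a i + Q *m a j.
 rewrite -(@mul_row_col R 2 2 2 4 P Q (a i) (a j)) (@hsubmxK R 2 2 2 W). exact: (esym (mulmxKV cu (a o))).
have row_op (A B : 'M[R]_2) (f g : 'M[R]_(2, 4)) : cross (A *m f + B *m g) g = \det A * cross f g.
 rewrite /cross; have -> : col_mx (A *m f + B *m g) g =
   @block_mx R 2 2 2 2 A B 0 1%:M *m col_mx f g :> 'M[R]_(2 + 2, 4).
  by rewrite (@mul_block_col _ 2 2 2 2 4) mul0mx add0r mul1mx.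
 apply: etrans (det_mulmx (@block_mx R 2 2 2 2 A B 0 1%:M) (@col_mx R 2 2 4 f g)) _.
 by rewrite (@det_ublock _ 2 2) det1 mulr1.
exists P^T, Q^T; rewrite !det_tr; split; first by rewrite -!trmx_mul -raddfD -oE.
 have := row_op P Q (a i) (a j); rewrite -oE => e.
 rewrite /link (eq_sym j o) (eq_sym j i) (negPf oj) (negPf ij) e sgzM -mulrA.
 have := ca ij; rewrite -sgz_eq0 => s0; suff -> : sgz (cross (a i) (a j)) * sgz (cross (a i) (a j)) = 1.
  by rewrite mulr1.
 by move: s0; case: sgzP.
have := row_op Q P (a j) (a i); rewrite addrC -oE => e.
rewrite /link (eq_sym i o) (eq_sym j i) (negPf oi) (negPf ij) e sgzM -mulrA (cross_sym (a j)).
have := ca ij; rewrite -sgz_eq0 => s0; suff -> : sgz (cross (a i) (a j)) * sgz (cross (a i) (a j)) = 1.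
 by rewrite mulr1.
by move: s0; case: sgzP.
Qed.

Lemma triple_relation o i j : o != i -> o != j -> i != j ->
 cup (e1 i *~ (link o j * link i j) - e1 o) (e1 j *~ (link o i * link i j) - e1 o) = 0.
move=> oi oj ij; have [P [Q [PQ sP sQ]]] := three_forms oi oj ij.
have l0 (k l : 'I_n) : k != l -> link k l != 0 by move=> kl; apply: contra_eqN (link_sq kl) => /eqP ->.
have dP : \det P != 0 by rewrite -sgz_eq0 sP mulf_neq0 // l0.
have dQ : \det Q != 0 by rewrite -sgz_eq0 sQ mulf_neq0 // l0.
rewrite -sP -sQ -!ccls_linear //.
have hE x : @form R n a i x *m P + @form R n a j x *m Q = @form R n a o x.
 by rewrite /form -!mulmxA -mulmxDr PQ.
have hc (l : 'I_2) x : (@form R n a i x *m P) 0 l + (@form R n a j x *m Q) 0 l = @form R n a o x 0 l.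
 by rewrite -hE [RHS]mxE.
have := @steinberg R X _ _ _ _ (@form_mul_cts i P 0) (@form_mul_cts i P 1)
 (@form_mul_cts j Q 0) (@form_mul_cts j Q 1) (fun x => form_mul_pos i x dP)
 (fun x => form_mul_pos j x dQ).
rewrite /= (_ : (fun x => arg (_ + _) (_ + _)) = @form_arg R n a o); last first.
 by apply/funext => x; rewrite !hc.
by apply=> x; rewrite !hc; exact: form_pos.
Qed.

End First.

(** * Divisibility by 3 under an anticommutative pairing *)

Section Cubes.
Variables (V W : zmodType) (B : V -> V -> W).
Hypotheses (BDl : forall x y z, B (x + y) z = B x z + B y z)
 (BDr : forall x y z, B x (y + z) = B x y + B x z) (BC : forall x y, B x y = - B y x).

Lemma prod0r x : B x 0 = 0.
by apply: (@addIr _ (B x 0)); rewrite -BDr !add0r. Qed.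

Lemma prodNr x y : B x (- y) = - B x y.
by apply: (@addIr _ (B x y)); rewrite -BDr !addNr prod0r. Qed.

Lemma prodNl x y : B (- x) y = - B x y.
by rewrite BC prodNr -BC. Qed.

Lemma prodMr x y (m : int) : B x (y *~ m) = B x y *~ m.
have H (k : nat) : B x (y *+ k) = B x y *+ k.
 by elim: k => [|k IH]; rewrite ?mulr0n ?prod0r // !mulrS BDr IH.
by case: m => k; [exact: H|rewrite !NegzE !mulrNz prodNr; congr (- _); exact: H].
Qed.

Lemma prodMl x y (m : int) : B (x *~ m) y = B x y *~ m.
by rewrite BC prodMr (BC x) mulNrz. Qed.

Lemma prod_sumr (I : finType) x (f : I -> V) : B x (\sum_i f i) = \sum_i B x (f i).
exact: (big_morph (B x) (BDr x) (prod0r x)). Qed.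

Lemma prod_suml (I : finType) y (f : I -> V) : B (\sum_i f i) y = \sum_i B (f i) y.
by rewrite BC prod_sumr -sumrN; apply: eq_bigr => i _; rewrite -BC. Qed.

Definition triple (w : W) : Prop := exists u, w = u *+ 3.

Lemma tripleD u v : triple u -> triple v -> triple (u + v).
by move=> [u' ->] [v' ->]; exists (u' + v'); rewrite mulrnDl. Qed.

Lemma tripleM u (m : int) : triple u -> triple (u *~ m).
by move=> [u' ->]; exists (u' *~ m); rewrite !pmulrn -!mulrzA mulrC. Qed.

Lemma triple_sum (I : finType) (f : I -> W) : (forall i, triple (f i)) -> triple (\sum_i f i).
by move=> h; elim/big_rec: _ => [|i x _]; [exists 0; rewrite mul0rn|exact: tripleD]. Qed.

(** Anticommutativity yields only 2 B(x, x) = 0, and this makes B(x, x) equal to 3 B(x, x). *)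
Lemma triple_sq x : triple (B x x).
by exists (B x x); rewrite !mulrS mulr0n addr0 [X in X + _]BC addKr. Qed.

Variables (n : nat) (l : 'I_n -> 'I_n -> int) (e : 'I_n -> V) (o : 'I_n).
Hypotheses (lC : forall i j, l i j = l j i) (l0 : forall i, l i i = 0)
 (l1 : forall i j, i != j -> l i j * l i j = 1)
 (rel : forall i j, o != i -> o != j -> i != j ->
  B (e i *~ (l o j * l i j) - e o) (e j *~ (l o i * l i j) - e o) = 0).

Let u i := B (e o) (e i) *~ l o i.

(** The relation for o, i, j, multiplied by the sign l_oi l_oj, solves for the product of e_i and
    e_j in terms of products with the base class e_o, up to the square of e_o. *)
Lemma product_mod3 i j : triple (B (e i) (e j) - (u j - u i) *~ l i j).
have uo : u o = 0 by rewrite /u l0.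
have [<-|ij] := eqVneq i j; first by rewrite l0 subr0; exact: triple_sq.
have [oi|oi] := eqVneq o i.
 by exists 0; rewrite -oi uo subr0 /u -mulrzA l1 ?oi // subrr mul0rn.
have [oj|oj] := eqVneq o j.
 exists 0; rewrite -oj uo sub0r /u mulNrz -mulrzA (lC i) l1 //. by rewrite mulr1z opprK (BC (e i)) addNr mul0rn.
set p := l o j * l i j; set q := l o i * l i j.
have E : B (e i) (e j) *~ (p * q) + B (e o) (e i) *~ p - B (e o) (e j) *~ q + B (e o) (e o) = 0.
 rewrite -(rel oi oj ij) BDl !BDr !prodNr !prodNl !prodMr !prodMl opprK -mulrzA (BC (e i) (e o)).
 by rewrite mulNrz opprK !addrA.
have EX : (B (e i) (e j) *~ (p * q)) *~ (l o i * l o j) = B (e i) (e j).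
 rewrite -mulrzA (_ : p * q * _ = (l o i * l o i) * (l o j * l o j) * (l i j * l i j)); last by rewrite /p /q; ring.
 by rewrite !l1 // !mulr1 mulr1z.
have EY : (B (e o) (e i) *~ p) *~ (l o i * l o j) = (u i) *~ l i j.
 rewrite /u -!mulrzA (_ : p * _ = (l o j * l o j) * (l o i * l i j)); last by rewrite /p; ring.
 by rewrite l1 // mul1r.
have EZ : (B (e o) (e j) *~ q) *~ (l o i * l o j) = (u j) *~ l i j.
 rewrite /u -!mulrzA (_ : q * _ = (l o i * l o i) * (l o j * l i j)); last by rewrite /q; ring.
 by rewrite l1 // mul1r.
have := congr1 (fun w => w *~ (l o i * l o j)) E; rewrite /= mul0rz !mulrzDl mulNrz EX EY EZ => EE.
rewrite (_ : _ - _ = - (B (e o) (e o) *~ (l o i * l o j))).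
 by rewrite -mulrNz; apply: tripleM; exact: triple_sq.
apply/eqP; rewrite -addr_eq0 mulNrz opprD opprK -EE; apply/eqP.
by rewrite [- _ + _]addrC addrA.
Qed.

(** After expansion by [product_mod3], the coefficient of u_k is, up to sign, the left side of the
    k-th hypothesis. *)
Lemma comb_product x y :
 (forall k, exists m : int, x k * (\sum_i l k i * y i) - y k * (\sum_i l k i * x i) = m * 3) ->
 triple (B (\sum_i e i *~ x i) (\sum_i e i *~ y i)).
move=> h; have T : triple (\sum_i \sum_j (B (e i) (e j) - (u j - u i) *~ l i j) *~ (x i * y j)).
 by apply: triple_sum => i; apply: triple_sum => j; apply: tripleM; exact: product_mod3.
have T' : triple (\sum_k u k *~ (x k * (\sum_i l k i * y i) - y k * (\sum_i l k i * x i))).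
 by apply: triple_sum => k; have [m ->] := h k; exists (u k *~ m); rewrite mulrzA pmulrn.
have := tripleD T (tripleM (-1) T'); congr triple; rewrite mulrN1z.
apply/eqP; rewrite subr_eq; apply/eqP; rewrite prod_suml.
have -> : \sum_k u k *~ (x k * (\sum_i l k i * y i) - y k * (\sum_i l k i * x i)) =
  \sum_i \sum_j ((u i - u j) *~ l i j) *~ (x i * y j).
 rewrite (eq_bigr (fun k => \sum_i u k *~ (l k i * (x k * y i)) - \sum_i u k *~ (l k i * (x i * y k)))).
  rewrite sumrB [X in _ - X]exchange_big -sumrB; apply: eq_bigr => i _; rewrite -sumrB.
  by apply: eq_bigr => j _; rewrite -mulrzA mulrzBl lC.
 move=> k _; rewrite mulrzBr !mulr_sumr !mulrz_sumr; congr (_ - _); apply: eq_bigr => i _; congr (_ *~ _); ring.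
transitivity (\sum_i (B (e i *~ x i) (\sum_j e j *~ y j) + \sum_j (u i - u j) *~ l i j *~ (x i * y j)));
 last exact: big_split.
apply: eq_bigr => i _; rewrite prodMl prod_sumr mulrz_suml.
transitivity (\sum_j (B (e i) (e j *~ y j) *~ x i + (u i - u j) *~ l i j *~ (x i * y j))); last exact: big_split.
apply: eq_bigr => j _; rewrite prodMr -mulrzA (mulrC (y j)) -[in RHS]mulrzDl; congr (_ *~ _).
by congr (_ + _); rewrite -mulNrz opprB.
Qed.

End Cubes.

(** * Counting over the field with three elements *)

Section Counting.

Definition relF n (l : 'I_n -> 'I_n -> int) (x y : n.-tuple 'F_3) : bool :=
 [forall k, tnth x k * (\sum_i (l k i)%:~R * tnth y i) == tnth y k * (\sum_i (l k i)%:~R * tnth x i)].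

(** Each x contributes 9^d, where d is the dimension of the space of all y related to x. *)
Definition count3 n (l : 'I_n -> 'I_n -> int) : nat :=
 #|[pred t : n.-tuple 'F_3 * (n.-tuple 'F_3 * n.-tuple 'F_3) | relF l t.1 t.2.1 && relF l t.1 t.2.2]|.

(* The field with three elements, in a form on which the kernel computes fast. *)
Definition trit := option bool.

Definition trit_opp (t : trit) : trit := omap negb t.

Definition trit_mul (t u : trit) : trit :=
 match t with None => None | Some true => u | Some false => trit_opp u end.

Definition trit_add (t u : trit) : trit :=
 match t, u with
 | None, _ => u
 | _, None => t
 | Some true, Some true => Some false
 | Some false, Some false => Some true
 | _, _ => None
 end.

Definition trit_val (t : trit) : 'F_3 :=
 match t with None => 0 | Some true => 1 | Some false => -1 end.

Lemma trit_valN t : trit_val (trit_opp t) = - trit_val t.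
by case: t => [[]|]; apply/val_inj. Qed.

Lemma trit_valM t u : trit_val (trit_mul t u) = trit_val t * trit_val u.
by case: t => [[]|]; case: u => [[]|]; apply/val_inj. Qed.

Lemma trit_valD t u : trit_val (trit_add t u) = trit_val t + trit_val u.
by case: t => [[]|]; case: u => [[]|]; apply/val_inj. Qed.

Fixpoint dotp (r : seq trit) (y : seq 'F_3) : 'F_3 :=
 match r, y with t :: r', v :: y' => trit_val t * v + dotp r' y' | _, _ => 0 end.

Fixpoint axpy (c : trit) (p r : seq trit) : seq trit :=
 match p, r with
 | t :: p', u :: r' => trit_add u (trit_mul c t) :: axpy c p' r'
 | _, [::] => [seq trit_mul c t | t <- p]
 | [::], _ => r
 end.

(** One step of Gaussian elimination; a pivot is 1 or -1, hence its own inverse. *)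
Definition reduce (p r : seq trit) : seq trit :=
 match trit_mul (head None r) (head None p) with
 | None => behead r
 | c => axpy (trit_opp c) (behead p) (behead r)
 end.

Fixpoint kernel_dim (n : nat) (rows : seq (seq trit)) : nat :=
 match n with
 | 0 => 0
 | m.+1 => match [seq r <- rows | head None r != None] with
      | [::] => (kernel_dim m (map behead rows)).+1
      | p :: _ => kernel_dim m (map (reduce p) rows)
      end
 end.

Lemma dotp_nil r : dotp r [::] = 0.
by case: r. Qed.

Lemma dotp_scale c p y : dotp [seq trit_mul c t | t <- p] y = trit_val c * dotp p y.
elim: p y => [|t p IH] [|v y] /=; rewrite ?mulr0 // IH trit_valM; ring.
Qed.

Lemma dotp_axpy c p r y : dotp (axpy c p r) y = dotp r y + trit_val c * dotp p y.
elim: p r y => [|t p IH] [|u r] [|v y]; rewrite /= ?mulr0 ?addr0 ?add0r //.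
 by rewrite trit_valM dotp_scale; ring.
by rewrite IH trit_valD trit_valM; ring.
Qed.

Lemma dotp_cons r v y : dotp r (v :: y) = trit_val (head None r) * v + dotp (behead r) y.
by case: r => [|t r] //=; rewrite mul0r add0r. Qed.

Lemma dotp_reduce p r y : dotp (reduce p r) y =
 dotp (behead r) y - trit_val (head None r) * trit_val (head None p) * dotp (behead p) y.
rewrite /reduce -trit_valM; case: trit_mul => [b|]; last by rewrite mul0r subr0.
by rewrite dotp_axpy trit_valN mulNr.
Qed.

Lemma sum_tuple_cons n (f : seq 'F_3 -> nat) :
 (\sum_(x : n.+1.-tuple 'F_3) f x = \sum_(v : 'F_3) \sum_(y : n.-tuple 'F_3) f (v :: y))%N.
rewrite pair_big /= (reindex (fun p : 'F_3 * n.-tuple 'F_3 => [tuple of p.1 :: p.2])) //=.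
exists (fun t => (thead t, [tuple of behead t])) => [[v y] _|t _]; last by rewrite [RHS]tuple_eta.
by congr (_, _); apply: val_inj.
Qed.

Lemma card_tuple_sum n (P : pred (seq 'F_3)) :
 #|[pred y : n.-tuple 'F_3 | P y]| = (\sum_(y : n.-tuple 'F_3) P y)%N.
by rewrite -sum1_card big_mkcond; apply: eq_bigr => y _; rewrite inE /=; case: (P _). Qed.

Lemma sum_F3 (f : 'F_3 -> nat) : (\sum_v f v = f 0%R + f 1%R + f (-1)%R)%N.
have z (v : 'F_3) : [|| v == 0, v == 1 | v == -1] by case: v => [[|[|[|m]]] im].
rewrite (bigD1 0) // (bigD1 1) // (bigD1 (-1)) // big1 => [|v /andP[/andP[h0 h1] h2]].
 by rewrite /= addn0 addnA.
by have := z v; rewrite (negPf h0) (negPf h1) (negPf h2).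
Qed.

Lemma kernel_dimE n rows :
 #|[pred y : n.-tuple 'F_3 | all (fun r => dotp r y == 0) rows]| = (3 ^ kernel_dim n rows)%N.
elim: n rows => [|n IH] rows.
 rewrite (eq_card (B := predT)) ?card_tuple // => y; have y0 : tval y = [::] by apply/size0nil/size_tuple.
 by rewrite !inE; apply/allP => r _; rewrite y0 dotp_nil.
rewrite (card_tuple_sum _ (fun y => all (fun r => dotp r y == 0) rows)).
rewrite (sum_tuple_cons _ (fun y => all (fun r => dotp r y == 0) rows : nat)) exchange_big /=.
case E: [seq r <- rows | head None r != None] => [|p s].
 rewrite expnS -IH (card_tuple_sum _ (fun y => all (fun r => dotp r y == 0) (map behead rows))).
 rewrite big_distrr; apply: eq_bigr => y _.
 rewrite (eq_bigr (fun=> all (fun r => dotp r y == 0) (map behead rows) : nat)).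
  by rewrite sum_F3; case: (all _ _).
 move=> v _; congr (nat_of_bool _); rewrite all_map; apply: eq_in_all => r rr /=.
 rewrite dotp_cons; case h: (head None r) => [b|]; last by rewrite mul0r add0r.
 by have : r \in [seq r <- rows | head None r != None] by [rewrite mem_filter h]; rewrite E.
have pr : p \in rows /\ head None p != None.
 have : p \in [seq r <- rows | head None r != None] by rewrite E mem_head. by rewrite mem_filter => /andP[].
have h2 : trit_val (head None p) * trit_val (head None p) = 1.
 by have [_] := pr; case: (head None p) => [[]|] // _; apply/val_inj.
rewrite -IH (card_tuple_sum _ (fun y => all (fun r => dotp r y == 0) (map (reduce p) rows))).
apply: eq_bigr => y _; pose w := - (trit_val (head None p) * dotp (behead p) y).
rewrite (bigD1 w) //= big1 ?addn0 => [|v vw]; last first.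
 apply/eqP; rewrite eqb0; apply: contra vw => /allP/(_ p pr.1); rewrite dotp_cons => /eqP e.
 rewrite /w; apply/eqP; rewrite -[LHS]mul1r -h2 -mulrA (eqP (_ : trit_val (head None p) * v == - dotp (behead p) y)).
  by rewrite mulrN.
 by rewrite -addr_eq0 e.
congr (nat_of_bool _); rewrite all_map; apply: eq_all => r /=.
by rewrite dotp_cons dotp_reduce /w; congr (_ == 0); ring.
Qed.

Fixpoint trit_seqs n : seq (seq trit) :=
 match n with
 | 0 => [:: [::]]
 | m.+1 => [seq t :: s | t <- [:: None; Some true; Some false], s <- trit_seqs m]
 end.

Lemma sum_trit_seqs n (f : seq 'F_3 -> nat) :
 (\sum_(x : n.-tuple 'F_3) f x = \sum_(s <- trit_seqs n) f (map trit_val s))%N.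
elim: n f => [|n IH] f; first by rewrite big_seq1 (big_pred1 [tuple]) // => y; symmetry; apply/eqP/val_inj/size0nil/size_tuple.
rewrite sum_tuple_cons sum_F3 (IH (fun s => f (0 :: s))) (IH (fun s => f (1 :: s))) (IH (fun s => f (-1 :: s))) /=.
rewrite !big_cat /= !big_map !addnA.
by rewrite ?big_nil ?addn0.
Qed.

Definition dot_sum (l : nat -> nat -> trit) n (s : seq trit) k : trit :=
 foldr (fun i acc => trit_add (trit_mul (l k i) (nth None s i)) acc) None (iota 0 n).

(** The relation with fixed first argument [s], as linear equations in the second; the diagonal
    entry of row k comes from the term with y_k, as l vanishes on the diagonal. *)
Definition rel_rows (l : nat -> nat -> trit) n (s : seq trit) : seq (seq trit) :=
 [seq let c := dot_sum l n s k in let x := nth None s k in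
    [seq if i == k then trit_opp c else trit_mul x (l k i) | i <- iota 0 n] | k <- iota 0 n].

Definition pow9 d : BinNums.N := iter d (BinNat.N.mul (BinNat.N.of_nat 9)) (BinNat.N.of_nat 1).

Definition rel_count n (l : nat -> nat -> trit) : BinNums.N :=
 foldr (fun s acc => BinNat.N.add (pow9 (kernel_dim n (rel_rows l n s))) acc) (BinNat.N.of_nat 0) (trit_seqs n).

Lemma dotp_iota (f : nat -> trit) m n (y : seq 'F_3) : size y = n ->
 dotp [seq f i | i <- iota m n] y = \sum_(i < n) trit_val (f (m + i)%N) * nth 0 y i.
elim: n m y => [|n IH] m [|v y] //=; first by rewrite big_ord0.
move=> [sy]; rewrite IH // big_ord_recl addn0; congr (_ + _); apply: eq_bigr => i _.
by rewrite addSnnS.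
Qed.

Lemma dot_sumE l n s k : trit_val (dot_sum l n s k) =
 \sum_(i < n) trit_val (l k i) * trit_val (nth None s i).
rewrite -(big_mkord predT (fun i => trit_val (l k i) * trit_val (nth None s i))) /index_iota subn0 /dot_sum.
by elim: (iota 0 n) => [|i r IH]; rewrite ?big_nil // big_cons -IH /= trit_valD trit_valM.
Qed.

Lemma relF_rows n (l : 'I_n -> 'I_n -> int) (lt : nat -> nat -> trit) s (x y : n.-tuple 'F_3) :
 (forall k i : 'I_n, (l k i)%:~R = trit_val (lt k i)) -> (forall k : 'I_n, lt k k = None) ->
 tval x = map trit_val s -> relF l x y = all (fun r => dotp r y == 0) (rel_rows lt n s).
move=> lE l0 xE; have sx : size s = n by rewrite -(size_tuple x) xE size_map.
have xk (k : 'I_n) : tnth x k = trit_val (nth None s k).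
 by rewrite (tnth_nth 0) xE (nth_map None) ?sx.
have E (k : 'I_n) : tnth x k * (\sum_i (l k i)%:~R * tnth y i) - tnth y k * (\sum_i (l k i)%:~R * tnth x i) =
  dotp [seq if i == val k then trit_opp (dot_sum lt n s k) else trit_mul (nth None s k) (lt k i) | i <- iota 0 n] y.
 rewrite dotp_iota ?size_tuple // [RHS](eq_bigr (fun i : 'I_n => tnth x k * ((l k i)%:~R * tnth y i) +
  (if i == k then - (trit_val (dot_sum lt n s k) * tnth y i) else 0))); last first.
  move=> i _; rewrite /= add0n val_eqE -(tnth_nth 0) lE; case: eqP => [->|_].
   by rewrite trit_valN l0 mul0r mulr0 add0r mulNr.
  by rewrite addr0 trit_valM -xk mulrA.
 rewrite big_split -big_distrr -big_mkcond big_pred1_eq /= dot_sumE [tnth y k * _]mulrC; congr (_ - _ * _).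
 by apply: eq_bigr => i _; rewrite lE xk.
rewrite /relF /rel_rows all_map; apply/forallP/allP => [h k|h k].
 by rewrite mem_iota add0n => kn; have := h (Ordinal kn); rewrite -subr_eq0 E.
by rewrite -subr_eq0 E; have := h k; rewrite mem_iota add0n ltn_ord => /(_ isT).
Qed.

Lemma card_pairs (T : finType) (P : T -> pred T) :
 #|[pred t : T * (T * T) | P t.1 t.2.1 && P t.1 t.2.2]| = (\sum_x #|[pred y | P x y]| ^ 2)%N.
rewrite -sum1_card (eq_bigl (fun t => predT t.1 && (P t.1 t.2.1 && P t.1 t.2.2))) //.
rewrite -(pair_big_dep predT (fun x yz => P x yz.1 && P x yz.2) (fun _ _ => 1%N)) /=.
apply: eq_bigr => x _; rewrite -(pair_big_dep (P x) (fun _ => P x) (fun _ _ => 1%N)) /=.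
rewrite (eq_bigr (fun=> #|[pred y | P x y]|)) => [|y _]; last exact: sum1_card.
by rewrite sum_nat_const expnS expn1; congr (_ * _)%N; apply: eq_card => y; rewrite !inE.
Qed.

Lemma pow9E d : BinNat.N.to_nat (pow9 d) = ((3 ^ d) ^ 2)%N.
by elim: d => [|d IH] //; rewrite (expnS 3 d) expnMn -IH; exact: Nnat.N2Nat.inj_mul. Qed.

Lemma size_trit_seqs n s : s \in trit_seqs n -> size s = n.
elim: n s => [|n IH] s /=; first by rewrite mem_seq1 => /eqP ->.
by rewrite cats0 !mem_cat => /or3P[] /mapP[t /IH <- ->].
Qed.

Lemma count3E n (l : 'I_n -> 'I_n -> int) (lt : nat -> nat -> trit) :
 (forall k i : 'I_n, (l k i)%:~R = trit_val (lt k i)) -> (forall k : 'I_n, lt k k = None) ->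
 count3 l = BinNat.N.to_nat (rel_count n lt).
move=> lE l0; rewrite /count3 (card_pairs (@relF n l)).
pose G (z : seq 'F_3) := (#|[pred y : n.-tuple 'F_3 | relF l (insubd [tuple of nseq n (0%R : 'F_3)] z) y]| ^ 2)%N.
rewrite (eq_bigr (fun x : n.-tuple 'F_3 => G x)) => [|x _]; last by rewrite /G valKd.
rewrite sum_trit_seqs /rel_count; have := @size_trit_seqs n.
elim: (trit_seqs n) => [|s r IH] h; first by rewrite big_nil.
rewrite big_cons /= Nnat.N2Nat.inj_add IH => [|t tr]; last by apply: h; rewrite inE tr orbT.
congr (_ + _)%N; rewrite pow9E /G -kernel_dimE; congr (_ ^ 2)%N; apply: eq_card => y; rewrite !inE.
by apply: relF_rows => //; rewrite insubdK // -topredE /= size_map h ?mem_head.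
Qed.

End Counting.

(** * The number of triples is an invariant of the ring *)

Section Reduction.
Variables (R : realType).

Section Products.
Variables (n : nat) (a : forms R n).
Hypotheses (n1 : (1 < n)%N) (ca : is_cfg a).
Let X := complement (loci a).

Lemma pi_cocycle_mulz (c : cocycle R X 1) (m : int) :
 coh1 R X (c *~ m) = (coh1 R X c) *~ m.
have p0 : coh1 R X (0 : cocycle R X 1) = 0 by apply: pi_cocycle0; exact: in_coboundary0.
have H (k : nat) : coh1 R X (c *+ k) = (coh1 R X c) *+ k.
 by elim: k => [|k IH]; rewrite ?mulr0n // !mulrS pi_cocycleD IH.
case: m => k; first exact: H.
rewrite !NegzE !mulrNz; apply: (@addIr _ (coh1 R X (c *~ k.+1))).
by rewrite -pi_cocycleD addNr p0 -[c *~ k.+1]/(c *+ k.+1) H addNr.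
Qed.

Lemma E1_sum x : E1 a x = \sum_i e1 a i *~ x i.
have p0 : coh1 R X (0 : cocycle R X 1) = 0 by apply: pi_cocycle0; exact: in_coboundary0.
rewrite /E1 /comb (big_morph (coh1 R X) (@pi_cocycleD R X 1) p0).
by apply: eq_bigr => i _; rewrite pi_cocycle_mulz /e1 (cclsE (@cmod_form_arg R n a i)).
Qed.

Lemma rel3P x y : rel3 a x y <-> exists z, cup (E1 a x) (E1 a y) = z *+ 3.
split; last exact: cup_rel3.
rewrite !E1_sum => h.
apply: (@comb_product _ _ (@cup R X 1 1) _ _ _ n (link a) (e1 a) (Ordinal (ltnW n1))) => //.
- exact: cupDl.
- exact: cupDr.
- exact: cupC.
- exact: link_sym.
- by move=> i; rewrite /link eqxx.
- exact: link_sq.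
- exact: triple_relation.
Qed.
End Products.

Definition mod3 n (x : 'I_n -> int) : n.-tuple 'F_3 := [tuple (x i)%:~R | i < n].

Definition lift3 n (x : n.-tuple 'F_3) (i : 'I_n) : int := (val (tnth x i))%:Z.

Lemma lift3K n (x : n.-tuple 'F_3) : mod3 (lift3 x) = x.
by apply: eq_from_tnth => i; rewrite tnth_mktuple /lift3 -pmulrn natr_Zp. Qed.

Lemma int_mod3 (m : int) : reflect (exists q, m = q * 3) (m%:~R == 0 :> 'F_3).
have H (k : nat) : reflect (exists q, k%:Z = q * 3) (k%:R == 0 :> 'F_3).
 rewrite -(dvdn_pcharf (pchar_Fp (isT : prime 3))); apply: (iffP dvdnP) => [[q ->]|[q e]].
  by exists q%:Z; rewrite PoszM.
 by exists `|q|%N; rewrite -[3%N]/`|3%:Z|%N -abszM -e.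
case: m => k; first exact: H.
rewrite NegzE mulrNz oppr_eq0; apply: (iffP (H k.+1)) => -[q e]; exists (- q).
 by rewrite mulNr -e.
by rewrite mulNr -e opprK.
Qed.

Lemma rel3_mod3 n (a : forms R n) x y : rel3 a x y <-> relF (link a) (mod3 x) (mod3 y).
have E k : (x k * (\sum_i link a k i * y i) - y k * (\sum_i link a k i * x i))%:~R =
  tnth (mod3 x) k * (\sum_i (link a k i)%:~R * tnth (mod3 y) i) - tnth (mod3 y) k * (\sum_i (link a k i)%:~R * tnth (mod3 x) i) :> 'F_3.
 rewrite intrD rmorphN /= !intrM !rmorph_sum !tnth_mktuple /=.
 by congr (_ * _ - _ * _); apply: eq_bigr => i _; rewrite intrM tnth_mktuple.
split=> [h|/forallP h k]; last by apply/int_mod3; rewrite E subr_eq0.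
by apply/forallP => k; rewrite -subr_eq0 -E; apply/int_mod3.
Qed.

Lemma additive_relation (U V : zmodType) (f : {additive U -> V}) x x' w y y' v : injective f ->
 f x = y -> f x' = y' -> f w = v -> y = y' + (v + v + v) -> x = x' + (w + w + w).
by move=> fI <- <- <- e; apply: fI; rewrite !raddfD. Qed.

Lemma additive_triple (U V : zmodType) (f : {additive U -> V}) x : f (x *+ 3) = f x *+ 3.
exact: raddfMn. Qed.

(** The isomorphism acts on H^1 modulo 3, written through integer lifts. It is injective there since
    multiples of 3 can be pulled back, and it preserves divisibility of products. *)
Lemma ring_iso_count_le n (a a' : forms R n) : (1 < n)%N -> is_cfg a -> is_cfg a' ->
 graded_ring_iso R (complement (loci a)) (complement (loci a')) -> (count3 (link a) <= count3 (link a'))%N.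
move=> n1 ca ca' [phi [bij _ cupE]].
have [psi psiE] := choice (fun x => E1_surj n1 ca' (phi 1%N (E1 a x))).
have [g gK Kg] := bij 1%N; have [g2 g2K Kg2] := bij 2%N.
pose f (x : n.-tuple 'F_3) : n.-tuple 'F_3 := mod3 (psi (lift3 x)).
have fI : injective f.
 move=> x x' /(congr1 (fun t => tnth t)) e; rewrite -[x]lift3K -[x']lift3K.
 have [v vE] : exists v, forall i, psi (lift3 x) i = psi (lift3 x') i + (v i + v i + v i).
  have h i : exists q, psi (lift3 x) i - psi (lift3 x') i = q * 3.
   by apply/int_mod3; have := congr1 (@^~ i) e; rewrite /= !tnth_mktuple intrD rmorphN /= => ->; rewrite subrr.
  by have [v vE] := choice h; exists v => i; rewrite -[LHS](subrK (psi (lift3 x') i)) vE; ring.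
 have [w wE] := E1_surj n1 ca (g (E1 a' v)).
 have EE : E1 a' (psi (lift3 x)) = E1 a' (psi (lift3 x')) + (E1 a' v + E1 a' v + E1 a' v).
  by rewrite -!E1D; congr (E1 _ _); apply/funext => i; rewrite vE.
 have Ew : phi 1%N (E1 a w) = E1 a' v by rewrite -wE; exact: Kg.
 have : E1 a (lift3 x) = E1 a (fun i => lift3 x' i + (w i + w i + w i)).
  by rewrite !E1D; exact: (additive_relation (can_inj gK) (psiE _) (psiE _) Ew EE).
 move=> /(E1_inj n1 ca) xE; apply: eq_from_tnth => i; rewrite !tnth_mktuple xE !intrD.
 have t3 : (3 : 'F_3) = 0 by apply/eqP. by rewrite (_ : _ + _ + _ = 3 * (w i)%:~R); [rewrite t3 mul0r addr0|ring].
have fR x y : relF (link a) x y -> relF (link a') (f x) (f y).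
 rewrite -{1}[x]lift3K -{1}[y]lift3K => /rel3_mod3/(rel3P n1 ca)[z zE].
 apply/rel3_mod3/(rel3P n1 ca'); exists (phi 2%N z); rewrite -!psiE.
 exact: etrans (esym (cupE 1%N 1%N _ _)) (etrans (congr1 (phi 2%N) zE) (additive_triple (phi 2%N) z)).
pose F (t : n.-tuple 'F_3 * (n.-tuple 'F_3 * n.-tuple 'F_3)) := (f t.1, (f t.2.1, f t.2.2)).
have FI : injective F.
 move=> [x [y z]] [x' [y' z']] e; have /= := congr1 fst e; have /= := congr1 (fun t => t.2.1) e.
 by have /= := congr1 (fun t => t.2.2) e; move=> /fI-> /fI-> /fI->.
rewrite /count3 -(fintype.card_image FI); apply: subset_leq_card; apply/fintype.subsetP => t.
by move=> /fintype.imageP[u]; rewrite !inE => /andP[h1 h2] ->; rewrite /= !fR.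
Qed.

Lemma ring_iso_count n (a a' : forms R n) : (1 < n)%N -> is_cfg a -> is_cfg a' ->
 graded_ring_iso R (complement (loci a)) (complement (loci a')) -> count3 (link a) = count3 (link a').
move=> n1 ca ca' h; apply/eqP; rewrite eqn_leq (ring_iso_count_le n1 ca ca' h).
exact: (ring_iso_count_le n1 ca' ca (graded_ring_iso_sym h)).
Qed.

End Reduction.

(** * Signs up to renaming, change of coorientation and mirror image *)

Section Classification.

(* The negative pairs of a configuration, up to equivalence normalised so that no pair contains 0. *)
Definition reps (n : nat) : seq (seq (nat * nat)) :=
 match n with
 | 1 => [:: [::]]
 | 2 => [:: [::]]
 | 3 => [:: [:: (1, 2)]]
 | 4 => [:: [:: (1, 2); (1, 3); (2, 3)];
   [:: (1, 2)]]
 | 5 => [:: [:: (1, 2); (1, 3); (1, 4); (2, 3); (2, 4); (3, 4)];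
   [:: (1, 2); (1, 3); (2, 3)];
   [:: (1, 2); (3, 4)];
   [:: (1, 2); (1, 3); (3, 4)]]
 | 6 => [:: [:: (1, 2); (1, 3); (1, 4); (1, 5); (2, 3); (2, 4); (2, 5); (3, 4); (3, 5); (4, 5)];
   [:: (1, 2); (1, 3); (1, 4); (2, 3); (2, 4); (3, 4)];
   [:: (1, 2); (1, 3); (2, 3); (4, 5)];
   [:: (1, 2); (1, 3); (2, 3)];
   [:: (1, 4); (2, 3)];
   [:: (1, 2); (1, 3); (1, 5); (4, 5)];
   [:: (1, 2); (1, 3); (1, 4); (2, 3)];
   [:: (1, 3); (1, 4); (2, 3); (2, 4)];
   [:: (1, 3); (1, 5); (2, 3); (2, 4)];
   [:: (1, 4); (1, 5); (2, 3); (2, 5); (3, 4)]]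
 | _ => [::]
 end%N.

(* For each representative on n vertices and each way of joining a new vertex to it, an ordering of the
  vertices, and whether to complement, that bring the result back to a representative. *)
Definition normalisations (n : nat) : seq (seq nat * bool) := [seq (behead c, head 0 c == 1) | c <-
 match n with
 | 1 => [::
  [::0;0;1]]
 | 2 => [::
  [::1;0;1;2];[::0;0;1;2]]
 | 3 => [::
  [::0;0;1;2;3];[::1;0;1;3;2];[::1;0;2;3;1];[::0;0;1;2;3]]
 | 4 => [::
  [::0;0;1;2;3;4];[::0;4;0;3;1;2];[::0;4;0;2;1;3];[::0;1;0;2;3;4];[::0;4;0;1;2;3];[::0;2;0;1;3;4];[::0;3;0;1;2;4];
  [::0;0;1;2;3;4];[::1;1;0;3;4;2];[::0;0;1;2;3;4];[::1;2;0;3;1;4];[::1;0;1;4;3;2];[::1;1;0;3;2;4];[::0;0;1;2;4;3];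
  [::0;0;1;2;4;3];[::0;3;0;4;1;2]]
 | 5 => [::
  [::0;0;1;2;3;4;5];[::0;5;1;2;3;0;4];[::0;5;1;2;4;0;3];[::0;5;0;3;4;1;2];[::0;5;1;3;4;0;2];[::0;5;0;2;4;1;3];
  [::0;5;0;2;3;1;4];[::0;1;0;2;3;4;5];[::0;5;2;3;4;0;1];[::0;5;0;1;4;2;3];[::0;5;0;1;3;2;4];[::0;2;0;1;3;4;5];
  [::0;5;0;1;2;3;4];[::0;3;0;1;2;4;5];[::0;4;0;1;2;3;5];[::0;0;1;2;3;4;5];[::0;0;1;2;3;4;5];[::0;0;1;2;3;4;5];
  [::0;0;3;1;2;5;4];[::1;3;5;1;2;0;4];[::0;0;2;1;3;5;4];[::1;2;5;1;3;0;4];[::1;2;0;1;5;4;3];[::1;0;4;2;3;5;1];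
  [::0;0;1;2;3;5;4];[::1;1;5;2;3;0;4];[::1;1;0;2;5;4;3];[::1;0;4;1;3;5;2];[::1;1;0;3;5;4;2];[::1;0;4;1;2;5;3];
  [::0;0;1;2;3;5;4];[::0;4;1;2;3;0;5];[::0;0;1;3;4;2;5];[::1;1;0;3;5;4;2];[::1;1;0;4;5;3;2];[::0;0;3;4;5;1;2];
  [::0;1;2;3;4;0;5];[::0;0;2;4;5;3;1];[::0;0;2;3;5;4;1];[::1;1;0;3;4;2;5];[::0;2;1;3;4;0;5];[::0;0;1;4;5;3;2];
  [::0;0;1;3;5;4;2];[::1;2;0;3;4;1;5];[::0;0;1;2;5;3;4];[::1;3;0;1;2;4;5];[::1;4;0;1;2;3;5];[::1;0;1;2;3;4;5];
  [::0;2;1;0;5;3;4];[::0;0;1;4;3;5;2];[::0;0;3;4;5;2;1];[::1;2;0;4;5;1;3];[::0;0;2;3;1;4;5];[::1;0;1;2;3;5;4];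
  [::0;3;0;1;5;2;4];[::1;0;1;2;4;3;5];[::0;0;1;2;5;4;3];[::0;1;0;3;5;4;2];[::1;1;2;4;3;0;5];[::1;0;2;3;5;1;4];
  [::1;1;3;2;5;0;4];[::1;0;3;4;2;1;5];[::1;0;4;1;5;3;2];[::1;1;4;0;5;2;3]]
 | _ => [::]
 end]%N.

Definition neg_edge (L : seq (nat * nat)) (i j : nat) : bool := (minn i j, maxn i j) \in L.

(** The new vertex n is joined to the vertices 1, 2, ... by the signs [v], and positively to the
    vertex 0. *)
Definition extend (L : seq (nat * nat)) (n : nat) (v : bitseq) (i j : nat) : bool :=
 if maxn i j == n then nth false (false :: v) (minn i j) else neg_edge L i j.

(** The sign between two vertices other than the first after renaming, complementation if [mu], and
    switching coorientations so that all pairs with the new first vertex are positive. *)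
Definition switched (G : nat -> nat -> bool) (s : seq nat) (mu : bool) (i j : nat) : bool :=
 G (nth 0 s i) (nth 0 s j) (+) G (nth 0 s 0) (nth 0 s i) (+) G (nth 0 s 0) (nth 0 s j) (+) mu.

Definition normalises n (G : nat -> nat -> bool) (c : seq nat * bool) : bool :=
 [&& size c.1 == n.+1, uniq c.1, all (fun i => i < n.+1)%N c.1 &
  has (fun L => all (fun e => 0 < e.1)%N L &&
   all (fun i => all (fun j => (i < j)%N ==> (switched G c.1 c.2 i j == ((i, j) \in L))) (iota 1 n)) (iota 1 n))
   (reps n.+1)].

Fixpoint bitseqs (n : nat) : seq bitseq :=
 if n is m.+1 then [seq b :: v | b <- [:: false; true], v <- bitseqs m] else [:: [::]].

Lemma mem_bitseqs n v : size v = n -> v \in bitseqs n.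
elim: n v => [|n IH] [|b v] //= [sv]; rewrite cats0 mem_cat.
by case: b; rewrite (map_f _ (IH _ sv)) ?orbT.
Qed.

Lemma all2_has (S T : eqType) (r : S -> T -> bool) s t : all2 r s t -> forall x, x \in s -> exists y, r x y.
elim: s t => [|x s IH] [|y t] //= /andP[xy /IH h] z; rewrite inE => /predU1P[->|/h//]; by exists y.
Qed.

Lemma normalisations_ok n : (0 < n < 6)%N -> all2 (fun c => normalises n (extend c.1 n c.2))
 [seq (L, v) | L <- reps n, v <- bitseqs n.-1] (normalisations n).
by case: n => [|[|[|[|[|[|]]]]]] // _; vm_compute. Qed.

Variable R : realType.

Definition signs n (a : forms R n) (G : nat -> nat -> bool) : Prop :=
 forall i j : 'I_n, i != j -> (cross (a i) (a j) < 0) = G i j.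

Lemma moves_refl n (a : forms R n) : moves a a.
exists id, (fun=> 1%:M), 1%:M; split=> //; try by move=> *; rewrite det1 oner_neq0.
by apply/funext => i; rewrite mul1mx mulmx1.
Qed.

Lemma moves_trans n (a b c : forms R n) : moves a b -> moves b c -> moves a c.
move=> [s [P [g [sI dP dg ->]]]] [t [Q [h [tI dQ dh ->]]]].
exists (s \o t), (fun i => Q i *m P (t i)), (g *m h); split; first exact: inj_comp.
- by move=> i; rewrite det_mulmx mulf_neq0.
- by rewrite det_mulmx mulf_neq0.
by apply/funext => i; rewrite -!mulmxA.
Qed.

Definition flip k (c : bool) : 'M[R]_k.+1 := diag_mx (\row_i if i == ord0 then (-1) ^+ c else 1).

Lemma det_flip k c : \det (flip k c) = (-1) ^+ c.
rewrite det_diag (bigD1 ord0) //= mxE eqxx big1 ?mulr1 // => i /negPf i0; by rewrite mxE i0.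
Qed.

Lemma sign_flip (x : R) (c : bool) : x != 0 -> ((-1) ^+ c * x < 0) = (x < 0) (+) c.
case: c => x0; last by rewrite expr0 mul1r addbF.
by rewrite expr1 mulN1r oppr_lt0 addbT -leNgt le_eqVlt eq_sym (negPf x0).
Qed.

Lemma sign_switch n (a : forms R n) G (s : 'I_n -> 'I_n) (e : 'I_n -> bool) mu :
 is_cfg a -> signs a G -> injective s ->
 exists2 b, moves a b & forall i j, i != j -> (cross (b i) (b j) < 0) = G (s i) (s j) (+) e i (+) e j (+) mu.
move=> ca sa sI; exists (fun i => flip 1 (e i) *m (a (s i) *m flip 3 mu)).
 by exists s, (fun i => flip 1 (e i)), (flip 3 mu); split=> // *; rewrite det_flip signr_eq0.
move=> i j ij; have sij : s i != s j by rewrite (inj_eq sI).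
rewrite cross_mul cross_mulr !det_flip -mulrA mulrCA [_ * (-1) ^+ mu]mulrC.
have nz (c : bool) (x : R) : x != 0 -> (-1) ^+ c * x != 0 by move=> x0; rewrite mulf_neq0 // signr_eq0.
rewrite !sign_flip ?nz ?ca // (sa _ _ sij).
by case: (G _ _); case: (e i); case: (e j); case: mu.
Qed.

Lemma neg_edgeC L i j : neg_edge L i j = neg_edge L j i.
by rewrite /neg_edge minnC maxnC. Qed.

Lemma extendC L n v i j : extend L n v i j = extend L n v j i.
by rewrite /extend neg_edgeC minnC maxnC. Qed.

Lemma signs_lt n (a : forms R n) (G : nat -> nat -> bool) : (forall i j, G i j = G j i) ->
 (forall i j : 'I_n, (i < j)%N -> (cross (a i) (a j) < 0) = G i j) -> signs a G.
move=> GC h i j; rewrite -val_eqE neq_ltn => /orP[/h //|/h]; by rewrite cross_sym GC.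
Qed.

Lemma extension_signs m (a : forms R m.+2) (b : forms R m.+1) L : is_cfg a ->
 moves (fun i => a (lift ord_max i)) b -> signs b (neg_edge L) ->
 exists c v, [/\ moves a c, size v = m & signs c (extend L m.+1 v)].
move=> ca [s [P [g [sI dP dg bE]]]] sb; pose eps := cross (b ord0) (a ord_max *m g) < 0.
pose s' (i : 'I_m.+2) := if unlift ord_max i is Some k then lift ord_max (s k) else ord_max.
pose P' (i : 'I_m.+2) := if unlift ord_max i is Some k then P k else flip 1 eps.
pose c i := P' i *m (a (s' i) *m g).
have cl k : c (lift ord_max k) = b k by rewrite /c /P' /s' liftK bE.
have cm : c ord_max = flip 1 eps *m (a ord_max *m g) by rewrite /c /P' /s' unlift_none.
have tc : moves a c.
 exists s', P', g; split=> //.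
  move=> i j; rewrite /s'; case: unliftP => [k ->|->]; case: unliftP => [l ->|->] //.
  - by move=> /lift_inj/sI ->.
  - by move/eqP; rewrite eq_sym (negPf (neq_lift _ _)).
  - by move/eqP; rewrite (negPf (neq_lift _ _)).
 by move=> i; rewrite /P'; case: unliftP => [k _|_] //; rewrite det_flip signr_eq0.
have cc := moves_cfg ca tc.
have E : cross (c (lift ord_max ord0)) (c ord_max) = (-1) ^+ eps * cross (b ord0) (a ord_max *m g).
 by rewrite cl cm -{1}[b ord0]mul1mx cross_mul det1 mul1r det_flip.
have c0 : ~~ (cross (c (lift ord_max ord0)) (c ord_max) < 0).
 have := cc (lift ord_max ord0) ord_max; rewrite eq_sym neq_lift E => /(_ isT) h.
 by rewrite sign_flip ?addbb //; apply: contra_neq h => ->; rewrite mulr0.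
exists c, [seq cross (c (lift ord_max (inord k))) (c ord_max) < 0 | k <- iota 1 m]; split=> //.
 by rewrite size_map size_iota.
apply: signs_lt => [i j|i j ij]; first exact: extendC.
rewrite /extend (maxn_idPr (ltnW ij)) (minn_idPl (ltnW ij)).
case: (unliftP ord_max j) ij => [k ->|->].
 rewrite lift_max => ik; rewrite ltn_eqF ?ltn_ord //.
 case: (unliftP ord_max i) ik => [l ->|->]; last by rewrite ltnNge ltnW.
 rewrite lift_max => lk; rewrite !cl sb //; last by rewrite neq_ltn lk.
rewrite /= eqxx => im; have -> : i = lift ord_max (inord i) by apply: ord_inj; rewrite lift_max inordK.
rewrite lift_max inordK //; case: (val i) im => [|k] km /=.
 by apply/negbTE; rewrite (_ : inord 0 = ord0) //; apply: val_inj; rewrite /= inordK.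
by rewrite (nth_map 0%N) ?size_iota // nth_iota.
Qed.

Lemma classification m (a : forms R m.+1) : (m < 6)%N -> is_cfg a ->
 exists b L, [/\ moves a b, L \in reps m.+1 & signs b (neg_edge L)].
elim: m a => [|m IH] a m6 ca.
 by exists a, [::]; split=> // [|i j]; [exact: moves_refl|rewrite !ord1].
have [|b [L [ab rL sb]]] := IH (fun i => a (lift ord_max i)) (ltnW m6).
 by move=> i j ij; apply: ca; rewrite (inj_eq lift_inj).
have [c [v [ac sv sc]]] := extension_signs ca ab sb.
have h : (0 < m.+1 < 6)%N by rewrite m6.
have [[s mu]] := all2_has (normalisations_ok h) (allpairs_f pair rL (mem_bitseqs sv)).
move=> /and4P[/eqP ss us /allP bs /hasP[L2 rL2 /andP[/allP z2 /allP h2]]]; rewrite /= in ss us bs.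
pose G := extend L m.+1 v; pose t (i : 'I_m.+2) : 'I_m.+2 := inord (nth 0%N s i).
have tE i : t i = nth 0%N s i :> nat by rewrite /t inordK //; apply: bs; rewrite mem_nth ?ss.
have tI : injective t.
 move=> i j /(congr1 val) /= /eqP; rewrite !tE nth_uniq ?ss // => /eqP; exact: val_inj.
(* A mirror image also reverses the pairs with the first plane, so the switch of plane i has to
   include [mu] for these pairs to become positive. *)
have [d cd sd] := sign_switch (fun i => (i != ord0) && (G (t ord0) (t i) (+) mu)) mu (moves_cfg ca ac) sc tI.
exists d, L2; split=> //; first exact: moves_trans ac cd.
apply: signs_lt => [i j|i j ij]; first exact: neg_edgeC.
have ne : i != j by rewrite -val_eqE neq_ltn ij.
have j0 : j != ord0 by rewrite -val_eqE -lt0n (leq_ltn_trans _ ij).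
rewrite (sd _ _ ne) j0 /neg_edge (minn_idPl (ltnW ij)) (maxn_idPr (ltnW ij)) /=.
have [i0|i0] := eqVneq i ord0; rewrite /=.
 rewrite i0 -/G addbF; case e: ((_, _) \in L2); first by have := z2 _ e. by rewrite addbA addbb addFb addbb.
rewrite -val_eqE -lt0n in i0.
have := h2 i; rewrite mem_iota i0 add1n ltn_ord => /(_ isT)/allP/(_ j).
rewrite mem_iota (leq_trans i0 (ltnW ij)) add1n ltn_ord ij => /(_ isT)/eqP <-.
rewrite /switched /= -/G -(tE ord0) -!tE.
have xorE (x y z u : bool) : x (+) (y (+) u) (+) (z (+) u) (+) u = x (+) y (+) z (+) u by case: x y z u => [] [] [] [].
exact: xorE.
Qed.

End Classification.

(** * Equal counts give equal representatives, and these give homotopy equivalence *)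

Section Same.
Variable R : realType.

Definition link_trit (L : seq (nat * nat)) (i j : nat) : trit :=
 if i == j then None else Some (~~ neg_edge L i j).

Lemma count3_signs n (b : forms R n) L : is_cfg b -> signs b (neg_edge L) ->
 count3 (link b) = BinNat.N.to_nat (rel_count n (link_trit L)).
move=> cb sb; apply: count3E => [k i|k]; last by rewrite /link_trit eqxx.
rewrite /link /link_trit eq_sym val_eqE; case: (eqVneq k i) => [_|ki]; first by [].
rewrite -(sb _ _ ki); have := cb _ _ ki; rewrite -sgz_eq0.
by case: sgzP => // _ _; rewrite ?intrN.
Qed.

(** Here the invariant is seen to separate the classes, by evaluating all the eliminations. *)
Lemma rel_count_uniq n : (1 < n <= 6)%N ->
 uniq [seq rel_count n (link_trit L) | L <- reps n].
do 2![case: n => [//|n]]; do 5![case: n => [_|n]; first by vm_compute].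
by [].
Qed.

Lemma uniq_map_inj (S T : eqType) (f : S -> T) s : uniq (map f s) -> {in s &, injective f}.
elim: s => [|x s IH] //= /andP[xs us] y z; rewrite !inE => /predU1P[->|ys] /predU1P[->|zs] // e.
- by rewrite e map_f in xs.
- by rewrite -e map_f in xs.
- exact: IH.
Qed.

Lemma ring_iso_rep m (a a' b b' : forms R m.+2) L L' : (m.+2 <= 6)%N ->
 is_cfg a -> is_cfg a' -> moves a b -> moves a' b' ->
 L \in reps m.+2 -> L' \in reps m.+2 -> signs b (neg_edge L) -> signs b' (neg_edge L') ->
 graded_ring_iso R (complement (loci a)) (complement (loci a')) -> L = L'.
move=> m6 ca ca' ab ab' rL rL' sb sb' iso; have m2 : (1 < m.+2 <= 6)%N by rewrite m6.
have cb := moves_cfg ca ab; have cb' := moves_cfg ca' ab'.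
have step (c d : forms R m.+2) : is_cfg c -> is_cfg d -> moves c d ->
  count3 (link c) = count3 (link d).
 move=> cc cd ct; apply: (ring_iso_count (isT : (1 < m.+2)%N) cc cd).
 exact: heq_ring_iso (moves_heq ct).
apply: (uniq_map_inj (rel_count_uniq m2)) => //; apply: Nnat.N2Nat.inj.
rewrite -(count3_signs cb sb) -(count3_signs cb' sb') -(step _ _ ca cb ab) -(step _ _ ca' cb' ab').
exact: ring_iso_count (isT : (1 < m.+2)%N) ca ca' iso.
Qed.

Lemma pattern_signs neg L (b : forms R 6) : is_cfg b -> signs b (neg_edge L) ->
 all (fun e => (e \in neg) == neg_edge L (nth (0, 0)%N pairs6 e).1 (nth (0, 0)%N pairs6 e).2) (iota 0 15) ->
 pattern neg b.
move=> cb sb /allP h e e15; have ne := pair6_neq e15; rewrite /mvals e15.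
have := h e; rewrite mem_iota e15 => /(_ isT)/eqP; rewrite /sgp => ->.
have p6 : ((nth (0, 0)%N pairs6 e).1 < 6)%N && ((nth (0, 0)%N pairs6 e).2 < 6)%N.
 apply: (allP (isT : all (fun p => (p.1 < 6) && (p.2 < 6))%N pairs6)); exact: mem_nth.
have := sb _ _ ne; rewrite /i6 !inordK; [|by case/andP: p6..] => <-.
have := cb _ _ ne; rewrite /i6; move: (cross _ _) => x x0.
have [xn|xp|xE] := ltgtP x 0; last by rewrite xE eqxx in x0.
 by rewrite mulN1r oppr_gt0.
by rewrite mul1r.
Qed.

(** The threshold [k] splits the points into two classes; a threshold above all indices, such as 9,
    leaves a single class with all signs negative. *)
Lemma two_class_signs m k (a a' : forms R m.+2) L : is_cfg a -> is_cfg a' ->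
 signs a (neg_edge L) -> signs a' (neg_edge L) ->
 all (fun j => ~~ neg_edge L 0 j) (iota 1 m.+1) ->
 all (fun i => all (fun j => (i == j) || (neg_edge L i.+1 j.+1 == ((k < i)%N == (k < j)%N))) (iota 0 m.+1))
  (iota 0 m.+1) -> heq a a'.
move=> ca ca' sa sa' /allP h0 /allP h.
have ok (b : forms R m.+2) : is_cfg b -> signs b (neg_edge L) -> is_cfg b /\
  (forall j, 0 < cross (b ord0) (b (lift ord0 j))) /\
  (forall i j : 'I_m.+1, i != j -> if (k < i)%N == (k < j)%N then cross (b (lift ord0 i)) (b (lift ord0 j)) < 0
   else 0 < cross (b (lift ord0 i)) (b (lift ord0 j))).
 move=> cb sb; have pos (x y : 'I_m.+2) : x != y -> ~~ neg_edge L x y -> 0 < cross (b x) (b y).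
  by move=> xy; rewrite -(sb _ _ xy) -leNgt lt_neqAle eq_sym cb.
 split=> //; split=> [j|i j ij].
  apply: pos; first exact: neq_lift. by rewrite lift0; apply: h0; rewrite mem_iota add1n; exact: (ltn_ord j).
 have ij' : lift ord0 i != lift ord0 j by rewrite (inj_eq lift_inj).
 have := h i; rewrite mem_iota add0n ltn_ord => /(_ isT)/allP/(_ j).
 rewrite mem_iota add0n ltn_ord val_eqE (negPf ij) => /(_ isT)/eqP e.
 case: ifP => c; last by apply: pos; rewrite // !lift0 e c. by rewrite (sb _ _ ij') !lift0 e c.
apply: (two_class_heq (p := fun i : 'I_m.+1 => (k < i)%N)); exact: ok.
Qed.

Lemma same_signs_heq m (a a' b b' : forms R m.+2) L : (m.+2 <= 6)%N ->
 is_cfg a -> is_cfg a' -> moves a b -> moves a' b' -> L \in reps m.+2 ->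
 signs b (neg_edge L) -> signs b' (neg_edge L) -> ~ mazurovskii_pair (loci a) (loci a') -> heq a a'.
move=> m6 ca ca' ab ab' rL sb sb' nm; have cb := moves_cfg ca ab; have cb' := moves_cfg ca' ab'.
suff : heq b b' \/ heq a a'.
 case=> [h|h]; last exact: h. apply: heqT (moves_heq ab) _.
 exact: heqT h (heqC (moves_heq ab')).
have two k (all0 : all (fun j => ~~ neg_edge L 0 j) (iota 1 m.+1)) := two_class_signs (k := k) cb cb' sb sb' all0.
case: m a a' b b' m6 ca ca' ab ab' rL sb sb' nm cb cb' two =>
 [|[|[|[|[|//]]]]] a a' b b' _ ca ca' ab ab' rL sb sb' nm cb cb' two; move: rL; rewrite !inE.
- by move=> /eqP LE; left; subst L; apply: (two 9).
- by move=> /eqP LE; left; subst L; apply: (two 9).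
- by case/orP => /eqP LE; left; subst L; [apply: (two 9)|apply: (two 1)].
- case/or4P => /eqP LE; left; subst L; [by apply: (two 9)|by apply: (two 2)|by apply: (two 1)|].
 have pent (c : forms R 5) : is_cfg c -> signs c (neg_edge [:: (1, 2); (1, 3); (3, 4)]%N) -> pentagon c.
  move=> cc sc; split=> // i j ij; rewrite sc; last by rewrite -val_eqE neq_ltn ij.
  by rewrite /neg_edge (minn_idPl (ltnW ij)) (maxn_idPr (ltnW ij)).
 by apply: pentagon_heq; exact: pent.
have P neg : all (fun e => (e \in neg) == neg_edge L (nth (0, 0)%N pairs6 e).1 (nth (0, 0)%N pairs6 e).2) (iota 0 15) ->
  pattern neg b /\ pattern neg b'.
 by move=> h; split; apply: pattern_signs h.
do 9?[case/orP]; move=> /eqP LE; subst L.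
- by left; apply: (two 9).
- by left; apply: (two 3).
- by left; apply: (two 2).
- by left; have [|p p'] := P [:: 5; 6; 9]%N; [|exact: class4].
- by left; have [|p p'] := P [:: 7; 9]%N; [|exact: class5].
- by left; have [|p p'] := P [:: 5; 6; 8; 14]%N; [|exact: class6].
- by left; have [|p p'] := P [:: 5; 6; 7; 9]%N; [|exact: class7].
- by right; have [|p p'] := P neg8; [|exact: (class8 ca ca' ab ab' p p' nm)].
- by left; have [|p p'] := P neg9; [|exact: class9].
- by left; have [|p p'] := P neg10; [|exact: class10].
Qed.

(** One plane is treated apart: [is_cfg] speaks of pairs only, whereas an invertible matrix takes
    any form of full rank to any other. *)
Lemma plane_heq (f f' : forms R 1) : row_free (f 0) -> row_free (f' 0) -> heq f f'.
move=> ff ff'; pose g := pinvmx (f 0) *m f' 0.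
have fg : f 0 *m g = f' 0 by rewrite /g mulmxA mulmxVp // mul1mx.
have [h hu fh] : exists2 h : 'M[R]_4, h \in unitmx & f 0 *m g = f 0 *m h.
 by have [|h hu e] := @complete_unitmx R 2 4 (f 0) g;
  [rewrite fg (eqP (ff : \rank _ == _)) (eqP (ff' : \rank _ == _))|exists h].
have dh : \det h != 0 by rewrite -unitfE -unitmxE.
have := heq_gl f dh; rewrite (_ : (fun i => f i *m h) = f') //.
by apply/funext => i; rewrite ord1 -fh fg.
Qed.

End Same.

Theorem theorem6p8 (R : realType) (n : nat) (hn : (n <= 6)%N)
  (A A' : 'I_n -> subsp R)
  (hA : two_arrangement A) (hA' : two_arrangement A')
  (hAA' : ~ mazurovskii_pair A A') :
 graded_ring_iso R (complement A) (complement A') <->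
 homotopy_equivalent R (complement A) (complement A').
split; last exact: heq_ring_iso.
(* Without planes the two families coincide, and a single plane is covered by [plane_heq]; the forms
   of a configuration have full rank from two planes on. *)
case: n hn A A' hA hA' hAA' => [|[|m]] hn A A' hA hA' hAA' iso.
- rewrite (_ : A = A'); first exact: homotopy_eq_refl.
 by apply/funext => -[].
- have [f ff AE] := locus_of_plane (hA.1 0); have [f' ff' AE'] := locus_of_plane (hA'.1 0).
 have lE (B : 'I_1 -> subsp R) c : B 0 = zero_locus c -> B = loci (fun=> c).
  by move=> e; apply/funext => i; rewrite ord1.
 rewrite (lE _ _ AE) (lE _ _ AE'); exact: (plane_heq (f := fun=> f) (f' := fun=> f')).
have [a ca AE] := arrangement_loci hA; have [a' ca' AE'] := arrangement_loci hA'.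
rewrite AE AE' in hAA' iso *.
have [b [L [ab rL sb]]] := classification hn ca; have [b' [L' [ab' rL' sb']]] := classification hn ca'.
have LL := ring_iso_rep hn ca ca' ab ab' rL rL' sb sb' iso; rewrite -LL in sb'.
exact: same_signs_heq hn ca ca' ab ab' rL sb sb' hAA'.
Qed.
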